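(* Let $a\in\mathbb{C}$ and $f_a(z)=e^z+a$. Suppose that the singular value $a$ of $f_a$ satisfies one of the following conditions: (a) $a$ belongs to the Fatou set of $f_a$; (b) $a$ is on a hair; (c) $a$ is an endpoint. Then $\infty$ is an explosion point for the set $\tilde{E}(f_a)$ of escaping endpoints of $f_a$.
   Context: For $a\in\mathbb{C}$, $f_a\colon\mathbb{C}\to\mathbb{C}$, $f_a(z)=e^z+a$. The Fatou set is the set of points having a neighbourhood on which the iterates $(f_a^n)$ are equicontinuous with respect to the spherical metric; the Julia set is its complement. $I(f_a)=\{z\in\mathbb{C}: f_a^n(z)\to\infty\}$ is the escaping set. An arc is an injective continuous image of a compact interval (parametrised injectively). A point $z_0\in\mathbb{C}$ is on a hair if there is an arc $\gamma\colon[-1,1]\to I(f_a)$ with $\gamma(0)=z_0$. A point $z_0\in\mathbb{C}$ is an endpoint if $z_0$ is not on a hair and there is an arc $\gamma\colon[0,1]\to\mathbb{C}$ with $\gamma(0)=z_0$ and $\gamma(t)\in I(f_a)$ for all $t>0$. $E(f_a)$ is the set of endpoints, and $\tilde{E}(f_a)=E(f_a)\cap I(f_a)$ is the set of escaping endpoints. Two points $x,y$ of a topological space $X$ are separated in $X$ if there is an open and closed $U\subset X$ with $x\in U$, $y\notin U$; $X$ is totally separated if any two distinct points are separated in $X$. For $A\subset\mathbb{C}$, $\infty$ is an explosion point for $A$ if $A\cup\{\infty\}$ (as a subspace of the Riemann sphere) is connected and $A$ is totally separated. *)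

(* Defs.v *)
From HB Require Import structures.
From mathcomp Require Import all_boot all_order all_algebra.
From mathcomp Require Import all_classical all_reals all_analysis.
From mathcomp Require Export complex.

Set Implicit Arguments.
Unset Strict Implicit.
Unset Printing Implicit Defensive.

Import Order.TTheory GRing.Theory Num.Theory.
Import numFieldNormedType.Exports.

Local Open Scope classical_set_scope.
Local Open Scope ring_scope.
Local Open Scope complex_scope.

(* R[i] carries no topology by default: give it the one of its modulus, with
   which R[i]^o is equipped as a numFieldType. *)
HB.instance Definition _ (R : realType) := NormedModule.copy R[i] (R[i]^o).

Definition riemann_sphere (R : realType) : topologicalType :=
  one_point_compactification R[i].

Definition to_sphere (R : realType) (z : R[i]) : riemann_sphere R := Some z.
Definition infinity (R : realType) : riemann_sphere R := None.
Arguments infinity {R}.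

Definition cexp (R : realType) (z : R[i]) : R[i] :=
  let: x +i* y := z in (expR x * cos y) +i* (expR x * sin y).

Definition expmap (R : realType) (a z : R[i]) : R[i] := cexp z + a.

(* Great-circle distance on the unit sphere between the stereographic images
   of z and w, i.e. the distance induced by 2|dz| / (1 + |z|^2); the argument of
   asin is half the chordal distance. *)
Definition spherical_dist (R : realType) (z w : R[i]) : R :=
  2 * asin (Normc.normc (z - w) /
    Num.sqrt ((1 + Normc.normc z ^+ 2) * (1 + Normc.normc w ^+ 2))).

Definition spherically_equicontinuous_on (R : realType) (U : set R[i])
    (F : nat -> R[i] -> R[i]) : Prop :=
  forall w, U w -> forall eps : R, 0 < eps ->
    \forall w' \near w, U w' ->
      forall n, spherical_dist (F n w) (F n w') < eps.

Definition fatou_set (R : realType) (a : R[i]) : set R[i] :=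
  [set z | exists2 U, nbhs z U &
    spherically_equicontinuous_on U (fun n => iter n (expmap a))].

Definition escaping_set (R : realType) (a : R[i]) : set R[i] :=
  [set z | to_sphere (iter n (expmap a) z) @[n --> \oo] --> infinity].

Definition is_arc (R : realType) (u v : R) (gamma : R -> R[i]) : Prop :=
  {within `[u, v], continuous gamma} /\ set_inj `[u, v] gamma.

Definition on_hair (R : realType) (a z0 : R[i]) : Prop :=
  exists gamma : R -> R[i],
    [/\ is_arc (- 1) 1 gamma,
        forall t, t \in `[- 1, 1] -> escaping_set a (gamma t)
      & gamma 0 = z0].

Definition endpoints (R : realType) (a : R[i]) : set R[i] :=
  [set z0 | ~ on_hair a z0 /\
    exists gamma : R -> R[i],
      [/\ is_arc 0 1 gamma, gamma 0 = z0
        & forall t, t \in `]0, 1] -> escaping_set a (gamma t)]].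

Definition escaping_endpoints (R : realType) (a : R[i]) : set R[i] :=
  endpoints a `&` escaping_set a.

Definition separated_points (X : topologicalType) (x y : X) : Prop :=
  exists U : set X, [/\ clopen U, U x & ~ U y].

Definition totally_separated (X : topologicalType) : Prop :=
  forall x y : X, x <> y -> separated_points x y.

(* [set_type A] carries the topology induced from R[i], unlike [subspace A]. *)
Definition infinity_explosion_point (R : realType) (A : set R[i]) : Prop :=
  connected ((@to_sphere R @` A) `|` [set infinity]) /\
  totally_separated (set_type A).

(* Main.v *)
Require Import Defs.
From HB Require Import structures.
From mathcomp Require Import all_boot all_order all_algebra.
From mathcomp Require Import all_classical all_reals all_analysis.
From mathcomp Require Import ring lra zify.

(* An escaping point on a hair is, up to finitely many iterates, a point x with
   Re (f^n x) large for all n which is faster than some point with the same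
   address: the arc through it is obtained by pulling back points f^n x + t_n with
   suitable real t_n, and conversely escape is uniform along any arc of escaping points
   (Baire), so that speed is monotone along the arc.  Hence the escaping endpoints
   are the escaping points that are not on hairs, and this set is backward and
   forward invariant.
   Connectedness of A u {oo}: a bounded relatively clopen subset P of A is empty,
   since points of A accumulate on every hair (shadowing orbits whose addresses
   grow), and following the fastest points of P one leaves P.
   Total separation: given a path C from the singular value a to oo such that
   C \ {a} is disjoint from A, with a branch L of log (w - a) off C, the labels
   f^n z - L (f^(n+1) z) are locally constant on A; two points with the same labels
   have the same address eventually, or their orbits follow C, hence they
   coincide.  If a is on a hair or an endpoint, C is made of pieces of hairs.  If a is
   in the Fatou set, a disc D around a has no escaping point; a path without
   escaping points from a to some f^(n+1) a gives C by pulling back.  Without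
   such a path the inverse branches of f^n taking f^n a to a extend to discs that
   reach escaping points and have size comparable to those around f^n a for
   infinitely many n; by the distortion theorem they take the escaping points to a
   bounded set, on which f^n has bounded oscillation, which is absurd along a
   hair. *)

Set Implicit Arguments.
Unset Strict Implicit.
Unset Printing Implicit Defensive.

Import Order.TTheory GRing.Theory Num.Theory.
Import numFieldNormedType.Exports.

Local Open Scope classical_set_scope.
Local Open Scope ring_scope.
Local Open Scope complex_scope.

(** Everything rests on one contraction: where both images have real part at least 100 + |a|, the
    inverse of f on a strip of height pi contracts by 25. Hence two orbits with the same address
    that stay close coincide, and otherwise the real parts separate them: a lead of 1 becomes a lead
    of 100 and is never lost, so that speed is a total order on each address. The obstacle is that
    the points of an arc need not stay in a right half-plane from a common time on. Baire gives such
    a time only on a portion of the bad parameters. On a gap between them the path has to be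
    compared with the hairs of its ends, and there planar topology enters: a curve cannot cross the
    translate of a hair by 2 pi i without its image under f meeting the image of the hair. The
    planar facts, the inverse branches and the distortion theorem are all derived from continuous
    logarithms on compact star-shaped sets, in place of winding numbers and integrals. For
    connectedness the limit of the chosen points must itself be an escaping endpoint: growing
    addresses make it escape, and choosing nearly fastest points keeps it off the hairs. *)

Notation nm := Normc.normc.
Notation Rez := complex.Re.
Notation Imz := complex.Im.

(** * Modulus and topology of the complex plane *)

Section Modulus.
Variable R : realType.
Implicit Types (z w : R[i]) (x y t : R).

Lemma ReD z w : Rez (z + w) = Rez z + Rez w. Proof. by case: z w => ? ? [? ?]. Qed.
Lemma ImD z w : Imz (z + w) = Imz z + Imz w. Proof. by case: z w => ? ? [? ?]. Qed.
Lemma ReN z : Rez (- z) = - Rez z. Proof. by case: z. Qed.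
Lemma ImN z : Imz (- z) = - Imz z. Proof. by case: z. Qed.
Lemma ReB z w : Rez (z - w) = Rez z - Rez w. Proof. by rewrite ReD ReN. Qed.
Lemma ImB z w : Imz (z - w) = Imz z - Imz w. Proof. by rewrite ImD ImN. Qed.
Lemma ReM z w : Rez (z * w) = Rez z * Rez w - Imz z * Imz w.
Proof. by case: z w => ? ? [? ?]. Qed.
Lemma ImM z w : Imz (z * w) = Rez z * Imz w + Imz z * Rez w.
Proof. by case: z w => ? ? [? ?]. Qed.
Definition Cri := (ReD, ImD, ReN, ImN).

Lemma CP z w : Rez z = Rez w -> Imz z = Imz w -> z = w.
Proof. by case: z w => ? ? [? ?] /= -> ->. Qed.

Lemma nmE z : nm z = Num.sqrt (Rez z ^+ 2 + Imz z ^+ 2).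
Proof. by case: z. Qed.

Lemma nm_ge0 z : 0 <= nm z. Proof. by rewrite nmE sqrtr_ge0. Qed.

Lemma nm2 z : nm z ^+ 2 = Rez z ^+ 2 + Imz z ^+ 2.
Proof. by rewrite nmE sqr_sqrtr// addr_ge0 ?sqr_ge0. Qed.

Lemma nmD z w : nm (z + w) <= nm z + nm w. Proof. exact: le_normcD. Qed.
Lemma nmN z : nm (- z) = nm z. Proof. exact: normcN. Qed.
Lemma nmB z w : nm (z - w) = nm (w - z). Proof. by rewrite -nmN opprB. Qed.
Lemma nmM z w : nm (z * w) = nm z * nm w. Proof. exact: Normc.normcM. Qed.
Lemma nm_eq0 z : (nm z == 0) = (z == 0).
Proof.
by apply/eqP/eqP => [/Normc.eq0_normc//|->]; rewrite Normc.normc0.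
Qed.
Lemma nm0 : nm (0 : R[i]) = 0. Proof. exact: Normc.normc0. Qed.
Lemma nm1 : nm (1 : R[i]) = 1. Proof. exact: Normc.normc1. Qed.
Lemma nmV z : nm z^-1 = (nm z)^-1. Proof. exact: Normc.normcV. Qed.
Lemma nm_gt0 z : (0 < nm z) = (z != 0). Proof. by rewrite lt_def nm_ge0 nm_eq0 andbT. Qed.

Lemma nm_triB z u w : nm (z - w) <= nm (z - u) + nm (u - w).
Proof. by have := nmD (z - u) (u - w); rewrite addrA subrK. Qed.

Lemma nm_subl z w : nm z - nm w <= nm (z - w).
Proof. by rewrite lerBlDr; have := nmD (z - w) w; rewrite subrK. Qed.

Lemma nmBs z w : nm (z - w) <= nm z + nm w.
Proof. by rewrite -(nmN w); apply: nmD. Qed.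

Lemma Re_nm z : `|Rez z| <= nm z.
Proof.
rewrite -(ger0_norm (nm_ge0 z)) -ler_sqr ?nnegrE// !real_normK ?num_real// nm2.
by rewrite lerDl sqr_ge0.
Qed.
Lemma Im_nm z : `|Imz z| <= nm z.
Proof.
rewrite -(ger0_norm (nm_ge0 z)) -ler_sqr ?nnegrE// !real_normK ?num_real// nm2.
by rewrite lerDr sqr_ge0.
Qed.
Lemma Re_le z : Rez z <= nm z. Proof. exact: le_trans (ler_norm _) (Re_nm z). Qed.
Lemma Im_le z : Imz z <= nm z. Proof. exact: le_trans (ler_norm _) (Im_nm z). Qed.
Lemma Re_ge z : - nm z <= Rez z.
Proof. by have := Re_nm z; rewrite ler_norml => /andP[]. Qed.
Lemma Im_ge z : - nm z <= Imz z.
Proof. by have := Im_nm z; rewrite ler_norml => /andP[]. Qed.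

Lemma nm_ReIm z : nm z <= `|Rez z| + `|Imz z|.
Proof.
rewrite -ler_sqr ?nnegrE ?nm_ge0 ?addr_ge0 ?normr_ge0// nm2 sqrrD.
rewrite !real_normK ?num_real// -addrA [leRHS]addrA addrAC lerDl.
by rewrite mulrn_wge0 ?mulr_ge0.
Qed.

Lemma nmR x : nm (x +i* 0) = `|x|.
Proof. by rewrite nmE /= expr0n /= addr0 sqrtr_sqr. Qed.

Lemma cnormE z : `|z| = (nm z)%:C :> R[i].
Proof. by rewrite normc_def nmE. Qed.

End Modulus.

Section Topology.
Variable R : realType.
Implicit Types (z w : R[i]) (U : set R[i]).

Lemma nbhs_nmP z U : nbhs z U <-> exists2 e : R, 0 < e & forall w, nm (w - z) < e -> U w.
Proof.
split.
  move=> /nbhs_ballP[e /= e0 eU]; exists (Rez e).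
    by move: e0; rewrite ltcE /= => /andP[].
  move=> w wz; apply: eU; rewrite -ball_normE /= distrC cnormE.
  move: e0; rewrite !ltcE /= => /andP[/eqP Ie _].
  by rewrite Ie eqxx.
move=> [e e0 eU]; apply/nbhs_ballP; exists (e%:C) => /=.
  by rewrite ltcR.
by move=> w; rewrite -ball_normE /= cnormE ltcR nmB => /eU.
Qed.

End Topology.

(** * Exponential, logarithm and modulus *)

Section RealBounds.
Variable R : realType.
Implicit Types x y t : R.

Lemma expR_gap_ge x y : x <= y -> expR x * (y - x) <= expR y - expR x.
Proof.
move=> xy; have -> : expR y = expR x * expR (y - x) by rewrite -expRD subrKC.
have := expR_ge1Dx (y - x); have := expR_gt0 x; nra.
Qed.

Lemma expR_gap_le x y : expR y - expR x <= expR y * (y - x).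
Proof.
have -> : expR x = expR y * expR (x - y) by rewrite -expRD subrKC.
have := expR_ge1Dx (x - y); have := expR_gt0 y; nra.
Qed.

Lemma expRB1_le x : `|expR x - 1| <= expR `|x| * `|x|.
Proof.
have e0 := @expR0 R.
have [x0|x0] := leP 0 x.
  rewrite (ger0_norm x0) ger0_norm.
    by have := expR_gap_le 0 x; rewrite e0 subr0.
  by rewrite subr_ge0 -e0 ler_expR.
have h : expR x <= 1 by rewrite -e0 ler_expR ltW.
have h1 := expR_ge1Dx x; have h2 : 1 <= expR (- x) by have := expR_ge1Dx (- x); lra.
rewrite (ltr0_norm x0) ler0_norm ?subr_le0//; nra.
Qed.

Lemma sin_le_id x : 0 <= x -> sin x <= x.
Proof.
move=> x0.
have [|c _] := @MVT_segment R sin cos 0 x x0 (fun z _ => is_derive_sin z).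
- by apply: continuous_subspaceT => z; exact: continuous_sin.
- by rewrite sin0 !subr0 => ->; rewrite ler_piMl// cos_le1.
Qed.

Lemma sin_norm_le x : `|sin x| <= `|x|.
Proof.
have [x0|x0] := leP 0 x.
  rewrite (ger0_norm x0) ler_norml sin_le_id// andbT.
  have [x1|x1] := leP x 1.
    rewrite (@le_trans _ _ 0) ?oppr_le0// sin_ge0_pi// x0 /=.
    by have := pi_ge2 R; lra.
  by have := sin_geN1 x; lra.
have x1 : 0 <= - x by lra.
rewrite (ltr0_norm x0) -normrN -sinN ler_norml sin_le_id// andbT.
have [y1|y1] := leP (- x) 1.
  rewrite (@le_trans _ _ 0) ?oppr_le0// sin_ge0_pi// x1 /=.
  by have := pi_ge2 R; lra.
by have := sin_geN1 (- x); lra.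
Qed.

Lemma cosE_half x : cos x = 1 - 2 * sin (x / 2) ^+ 2.
Proof.
rewrite [in LHS](_ : x = (x / 2) *+ 2); last by rewrite -mulr_natr divfK ?pnatr_eq0.
rewrite cos_mulr2n cos2sin2 -mulr_natr; ring.
Qed.

Lemma cos_ge_quad x : 1 - x ^+ 2 / 2 <= cos x.
Proof.
rewrite cosE_half; have := sin_norm_le (x / 2) => h.
have : sin (x / 2) ^+ 2 <= (x / 2) ^+ 2.
  by rewrite -(real_normK (num_real (sin _))) -[leRHS]real_normK ?num_real// ler_sqr ?nnegrE.
by rewrite expr_div_n => h2; lra.
Qed.

Lemma sin_ge_lin t : 0 <= t <= pi / 2 -> t / 4 <= sin t.
Proof.
move=> /andP[t0 t1].
(* On [0, 1] the cosine is at least 1/2; beyond 1 the sine has passed 1/2, which is at least t / 4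
   because pi / 2 < 2. *)
have key (s : R) : 0 <= s <= 1 -> s / 2 <= sin s.
  move=> /andP[s0 s1].
  have [|c] := @MVT_segment R sin cos 0 s s0 (fun z _ => is_derive_sin z).
  - by apply: continuous_subspaceT => z; exact: continuous_sin.
  - rewrite in_itv /= => /andP[c0 cs]; rewrite sin0 !subr0 => ->.
    by have := cos_ge_quad c; nra.
have [t2|t2] := leP t 1; first by have := key t; rewrite t0 t2 => /(_ isT); lra.
have : sin 1 <= sin t.
  rewrite ltW// ltr_sin// ?in_itv /=; have := pihalf_ge1 R; lra.
have := key 1; rewrite lexx ler01 => /(_ isT).
by have := pihalf_lt2 R; lra.
Qed.

Lemma sin_norm_ge t : `|t| <= pi / 2 -> `|t| / 4 <= `|sin t|.
Proof.
move=> t1; have := @sin_ge_lin `|t|; rewrite normr_ge0 t1 => /(_ isT) h.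
apply: (le_trans h); case: (leP 0 t) => t0.
  by rewrite ger0_norm// ler_norm.
by rewrite ltr0_norm// sinN -normrN ler_norm.
Qed.

Lemma cos_eq1 t : `|t| < pi *+ 2 -> cos t = 1 -> t = 0.
Proof.
rewrite mulr2n => t1; rewrite cosE_half => h.
have s0 : sin (t / 2) = 0.
  by apply/eqP; rewrite -sqrf_eq0; apply/eqP; lra.
have [tp|tn|//] := ltgtP 0 t.
  have /lt0r_neq0 : 0 < sin (t / 2).
    by apply: sin_gt0_pi; move: t1; rewrite gtr0_norm//; lra.
  by rewrite s0 eqxx.
have /lt0r_neq0 : 0 < sin (- (t / 2)).
  by apply: sin_gt0_pi; move: t1; rewrite ltr0_norm//; lra.
by rewrite sinN s0 oppr0 eqxx.
Qed.

End RealBounds.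

Section ComplexExp.
Variable R : realType.
Implicit Types z w u v : R[i].

Lemma Re_cexp z : Rez (cexp z) = expR (Rez z) * cos (Imz z). Proof. by case: z. Qed.
Lemma Im_cexp z : Imz (cexp z) = expR (Rez z) * sin (Imz z). Proof. by case: z. Qed.

Lemma cexpD z w : cexp (z + w) = cexp z * cexp w.
Proof.
case: z w => a b [c d]; apply: CP; rewrite ?ReM ?ImM /= expRD ?cosD ?sinD; ring.
Qed.

Lemma cexp0 : cexp (0 : R[i]) = 1.
Proof. by apply: CP; rewrite ?Re_cexp ?Im_cexp /= expR0 ?cos0 ?sin0; ring. Qed.

Lemma nm_cexp z : nm (cexp z) = expR (Rez z).
Proof.
rewrite nmE Re_cexp Im_cexp !exprMn -mulrDr cos2Dsin2 mulr1 sqrtr_sqr.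
by rewrite gtr0_norm ?expR_gt0.
Qed.

Lemma cexp_neq0 z : cexp z != 0.
Proof. by rewrite -nm_gt0 nm_cexp expR_gt0. Qed.

Lemma cexpN z : cexp (- z) = (cexp z)^-1.
Proof.
by apply: (mulIf (cexp_neq0 z)); rewrite -cexpD addNr cexp0 mulVf ?cexp_neq0.
Qed.

Lemma cexpB z w : cexp (z - w) = cexp z / cexp w.
Proof. by rewrite cexpD cexpN. Qed.

Lemma cexp_eq1 z : `|Imz z| < pi *+ 2 -> cexp z = 1 -> z = 0.
Proof.
move=> iz h; have r0 : Rez z = 0.
  by apply: (@expR_inj R); rewrite -nm_cexp h nm1 expR0.
apply: CP => //; apply: cos_eq1 => //.
by have := congr1 (@complex.Re R) h; rewrite Re_cexp r0 expR0 mul1r.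
Qed.

Lemma cexp_inj z w : `|Imz z - Imz w| < pi *+ 2 -> cexp z = cexp w -> z = w.
Proof.
move=> h e; apply/eqP; rewrite -subr_eq0; apply/eqP/cexp_eq1; first by rewrite ImB.
by rewrite cexpB e divff ?cexp_neq0.
Qed.

Definition tpi (k : R) : R[i] := 0 +i* (pi *+ 2 * k).

Lemma cexp_tpi (n : nat) : cexp (tpi n%:R) = 1.
Proof.
elim: n => [|n IH].
  by rewrite (_ : tpi _ = 0) ?cexp0//; apply: CP => //=; rewrite mulr0.
have -> : tpi n.+1%:R = tpi n%:R + tpi 1.
  by apply: CP; rewrite !Cri /= ?addr0// -mulrDr -natr1.
rewrite cexpD IH mul1r.
by apply: CP; rewrite ?Re_cexp ?Im_cexp /= mulr1 expR0 mul1r ?cos2pi ?sin2pi.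
Qed.

Lemma cexp_tpiN (n : nat) : cexp (tpi (- n%:R)) = 1.
Proof.
rewrite (_ : tpi _ = - tpi n%:R) ?cexpN ?cexp_tpi ?invr1//.
by apply: CP; rewrite ?Cri /= ?oppr0// mulrN.
Qed.

Lemma cexp_tpiz (k : int) : cexp (tpi k%:~R) = 1.
Proof.
case: k => n; first exact: cexp_tpi.
by rewrite NegzE mulrNz; exact: cexp_tpiN.
Qed.

(** The radial and the angular part are separated, so that the upper and the lower bound below
    reduce to two real estimates each. *)
Lemma cexpB1_sqr z : nm (cexp z - 1) ^+ 2 =
  (expR (Rez z) - 1) ^+ 2 + 4 * expR (Rez z) * sin (Imz z / 2) ^+ 2.
Proof.
rewrite nm2 !Cri Re_cexp Im_cexp /= oppr0 addr0 exprMn.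
rewrite (sin2cos2 (Imz z)) (cosE_half (Imz z)); ring.
Qed.

Lemma cexpB1_le z : nm (cexp z - 1) <= expR `|Rez z| * nm z.
Proof.
rewrite -ler_sqr ?nnegrE ?nm_ge0 ?mulr_ge0 ?nm_ge0 ?expR_ge0//.
rewrite cexpB1_sqr exprMn nm2 mulrDr lerD//.
  rewrite -exprMn -(real_normK (num_real (_ - 1))) -[leRHS]real_normK ?num_real//.
  rewrite ler_sqr ?nnegrE// normrM (gtr0_norm (expR_gt0 _)); exact: expRB1_le.
have h := sin_norm_le (Imz z / 2).
have {}h : sin (Imz z / 2) ^+ 2 <= Imz z ^+ 2 / 4.
  have -> : Imz z ^+ 2 / 4 = (Imz z / 2) ^+ 2 by rewrite expr_div_n; field.
  by rewrite -(real_normK (num_real (sin _))) -[leRHS]real_normK ?num_real// ler_sqr ?nnegrE.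
have e1 : expR (Rez z) <= expR `|Rez z| ^+ 2.
  rewrite expr2 -expRD ler_expR (le_trans (ler_norm _))//.
  by rewrite lerDl.
have := expR_gt0 (Rez z); have := sqr_ge0 (Imz z); nra.
Qed.

Lemma cexpB1_ge z : `|Imz z| <= pi -> Num.min 1 (expR (Rez z)) * nm z / 4 <= nm (cexp z - 1).
Proof.
move=> iz; set m := Num.min _ _.
have m0 : 0 < m by rewrite lt_min ltr01 expR_gt0.
have m1 : m <= 1 by rewrite ge_min lexx.
have me : m <= expR (Rez z) by rewrite ge_min lexx orbT.
rewrite -ler_sqr ?nnegrE ?nm_ge0 ?divr_ge0 ?mulr_ge0 ?nm_ge0 ?(ltW m0)//.
rewrite cexpB1_sqr !exprMn nm2.
have h1 : (m * Rez z) ^+ 2 <= (expR (Rez z) - 1) ^+ 2.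
  rewrite -(real_normK (num_real (m * _))) -[leRHS]real_normK ?num_real//.
  rewrite ler_sqr ?nnegrE// normrM gtr0_norm//.
  have e0 := @expR0 R.
  have [x0|x0] := leP 0 (Rez z).
    have := expR_gap_ge x0; rewrite e0 subr0 mul1r.
    rewrite (ger0_norm x0) => h; apply: le_trans (ler_norm _); nra.
  have := expR_gap_ge (ltW x0); rewrite e0 sub0r.
  rewrite (ltr0_norm x0) -(normrN (expR _ - 1)) opprB => h; apply: le_trans (ler_norm _); nra.
have h2 : `|Imz z / 2| / 4 <= `|sin (Imz z / 2)|.
  by apply: sin_norm_ge; rewrite normrM [X in _ * X]ger0_norm ?invr_ge0//; lra.
have {}h2 : Imz z ^+ 2 / 64 <= sin (Imz z / 2) ^+ 2.
  have -> : Imz z ^+ 2 / 64 = (`|Imz z / 2| / 4) ^+ 2.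
    by rewrite expr_div_n real_normK ?num_real// expr_div_n; field.
  rewrite -[leRHS]real_normK ?num_real// ler_sqr ?nnegrE// divr_ge0//.
have h3 : m ^+ 2 <= expR (Rez z) by nra.
have h4 : m ^+ 2 * Imz z ^+ 2 / 16 <= 4 * expR (Rez z) * sin (Imz z / 2) ^+ 2.
  have := sqr_ge0 (Imz z); have := sqr_ge0 (sin (Imz z / 2)); have := sqr_ge0 m; nra.
move: h1; rewrite exprMn => h1; have e4 : 4^-1 ^+ 2 = 16^-1 :> R by field.
by have := sqr_ge0 (m * Rez z); rewrite exprMn e4; lra.
Qed.

(** Factor out exp w and apply [cexpB1_ge] to z - w. Read backwards, this is the contraction of
    logarithms on strips of height pi. *)
Lemma cexp_expand z w : `|Imz z - Imz w| <= pi ->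
  Num.min (expR (Rez z)) (expR (Rez w)) * nm (z - w) / 4 <= nm (cexp z - cexp w).
Proof.
move=> h.
have -> : cexp z - cexp w = cexp w * (cexp (z - w) - 1).
  by rewrite cexpB mulrBr mulr1 mulrC divfK ?cexp_neq0.
rewrite nmM nm_cexp; have := @cexpB1_ge (z - w); rewrite ImB => /(_ h).
rewrite ReB => {}h; have e0 := expR_gt0 (Rez w).
have -> : Num.min (expR (Rez z)) (expR (Rez w)) =
    expR (Rez w) * Num.min 1 (expR (Rez z - Rez w)).
  rewrite minr_pMr ?ltW// mulr1 -expRD subrKC minC.
  by [].
by rewrite -!mulrA ler_pM2l// mulrA.
Qed.

Definition parg z : R :=
  if 0 <= Imz z then acos (Rez z / nm z) else - acos (Rez z / nm z).
Definition plog z : R[i] := ln (nm z) +i* parg z.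

Lemma Re_div_nm z : -1 <= Rez z / nm z <= 1.
Proof.
have [->|z0] := eqVneq z 0; first by rewrite nm0 invr0 mulr0 lerN10 ler01.
rewrite -nm_gt0 in z0.
by rewrite -ler_norml normrM normfV (gtr0_norm z0) ler_pdivrMr// mul1r Re_nm.
Qed.

Lemma plogK z : z != 0 -> cexp (plog z) = z.
Proof.
move=> z0; have n0 := z0; rewrite -nm_gt0 in n0.
have c : cos (parg z) = Rez z / nm z.
  by rewrite /parg; case: ifP => _; rewrite ?cosN acosK// in_itv /= Re_div_nm.
have s : sin (parg z) = Imz z / nm z.
  have sq : Num.sqrt (1 - (Rez z / nm z) ^+ 2) = `|Imz z| / nm z.
    have -> : 1 - (Rez z / nm z) ^+ 2 = (Imz z / nm z) ^+ 2.
      by rewrite !expr_div_n nm2; field; rewrite -nm2 expf_neq0 ?gt_eqF.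
    by rewrite sqrtr_sqr normrM normfV (gtr0_norm n0).
  rewrite /parg; case: ifP => i0; rewrite ?sinN sin_acos ?Re_div_nm// sq.
    by rewrite ger0_norm.
  by rewrite ltr0_norm ?mulNr ?opprK// ltNge i0.
apply: CP; rewrite ?Re_cexp ?Im_cexp /= lnK ?posrE// ?c ?s mulrC divfK ?gt_eqF//.
Qed.

Lemma Re_plog z : Rez (plog z) = ln (nm z). Proof. by []. Qed.

Lemma parg_le z : `|Imz (plog z)| <= pi.
Proof.
rewrite /= /parg; have h := Re_div_nm z; have := acos_ge0 h; have := acos_lepi h => h1 h2.
by case: ifP => _; rewrite ?normrN ger0_norm.
Qed.

Lemma parg_lt z : 0 < Rez z -> `|Imz (plog z)| < pi / 2.
Proof.
move=> r0; have z0 : z != 0 by apply: contraTneq r0 => ->; rewrite ltxx.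
have := congr1 (@complex.Re R) (plogK z0); rewrite Re_cexp => h.
have := parg_le z; set t := Imz (plog z) in h * => tp.
have c0 : 0 < cos t by move: r0; rewrite -h; have := expR_gt0 (Rez (plog z)); nra.
rewrite ltNge; apply/negP => tge; move: c0; apply/negP; rewrite -leNgt.
rewrite -(cos_norm t) -(cos_pihalf R); have [<-//|ne] := eqVneq (pi / 2) `|t|.
rewrite ltW// ltr_cos ?in_itv /= ?lt_neqAle ?ne//; have := pi_gt0 R; lra.
Qed.

Lemma plog1 : plog 1 = 0.
Proof.
by rewrite /plog /parg nm1 ln1 /= lexx divr1 acos1.
Qed.

Lemma plog_cexp z : `|Imz z| < pi -> plog (cexp z) = z.
Proof.
move=> h; apply: cexp_inj; last by rewrite plogK ?cexp_neq0.
by have := ler_normB (Imz (plog (cexp z))) (Imz z); have := parg_le (cexp z); rewrite mulr2n; lra.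
Qed.

End ComplexExp.

(** * Paths and the escaping set *)

Section TopologyBridge.
Variable R : realType.
Implicit Types (z w : R[i]) (x y t u v : R).

Lemma nm_cst_continuous z : continuous (fun w : R[i] => nm (w - z)).
Proof.
move=> w U /nbhs_ballP [e /= e0 eU]; apply/nbhs_nmP; exists e => // w' h; apply: eU.
rewrite -ball_normE /=; apply: le_lt_trans h; rewrite ler_norml.
have h1 := nm_triB w w' z; have h2 := nm_triB w' w z; rewrite (nmB w w') in h1; lra.
Qed.

Lemma pair_cvg x y : (fun p : R * R => p.1 +i* p.2 : R[i]) @ (x, y) --> (x +i* y : R[i]).
Proof.
move=> U /nbhs_nmP [e e0 eU]; rewrite nbhs_simpl /=.
have h : 0 < e / 2 by lra.
exists (ball x (e / 2), ball y (e / 2)); first by split; exact: nbhsx_ballx.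
move=> [x' y'] [/= h1 h2]; apply: eU; rewrite -ball_normE /= in h1; rewrite -ball_normE /= in h2.
apply: le_lt_trans (nm_ReIm _) _; rewrite !Cri /= -(distrC x) -(distrC y); lra.
Qed.

Lemma compact_cball (r : R) : compact [set z : R[i] | nm z <= r].
Proof.
pose sq := `[- r, r]%classic `*` `[- r, r]%classic.
have csq : compact sq by apply: compact_setX; exact: segment_compact.
have cim : compact ((fun p : R * R => p.1 +i* p.2 : R[i]) @` sq).
  apply: continuous_compact csq; apply: continuous_subspaceT.
  by move=> [x y]; exact: pair_cvg.
apply: subclosed_compact cim _.
  rewrite (_ : [set _ | _] = (fun w : R[i] => nm (w - 0)) @^-1` [set x | x <= r]).
    apply: closed_comp; last exact: closed_le.
    by move=> w _; exact: nm_cst_continuous.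
  by apply/seteqP; split => w /=; rewrite subr0.
move=> [x y] /= h; exists (x, y) => //; split => /=; rewrite in_itv /=.
  by rewrite -ler_norml (le_trans (Re_nm (x +i* y))).
by rewrite -ler_norml (le_trans (Im_nm (x +i* y))).
Qed.

Lemma closed_cball (r : R) : closed [set z : R[i] | nm z <= r].
Proof.
rewrite (_ : [set _ | _] = (fun w : R[i] => nm (w - 0)) @^-1` [set x | x <= r]).
  apply: closed_comp; last exact: closed_le.
  by move=> w _; exact: nm_cst_continuous.
by apply/seteqP; split => w /=; rewrite subr0.
Qed.

Lemma compact_nm_bounded (K : set R[i]) : compact K -> exists r, forall z, K z -> nm z <= r.
Proof.
move=> cK.
have c2 : compact ((fun w : R[i] => nm (w - 0)) @` K).
  by apply: continuous_compact cK; apply: continuous_subspaceT => w; exact: nm_cst_continuous.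
have [M [Mr h]] := compact_bounded c2; exists (M + 1) => z Kz.
have := h (M + 1); rewrite ltrDl ltr01 => /(_ isT (nm z)) /=.
by rewrite ger0_norm ?nm_ge0//; apply; exists z => //=; rewrite subr0.
Qed.

Lemma cbolzano (u : nat -> R[i]) (r : R) : (forall n, nm (u n) <= r) ->
  exists z, forall e, 0 < e -> forall N, exists2 n, (N <= n)%N & nm (u n - z) < e.
Proof.
move=> ur.
have [|z [_ cz]] := @compact_cball r (u @ \oo) _.
  by exists 0%N => // n _ /=; exact: ur.
exists z => e e0 N.
have [||w [[n Nn /= <-] h]] := cz (u @` [set n | (N <= n)%N]) [set w | nm (w - z) < e].
- by exists N => // n /= Nn; exists n.
- by apply/nbhs_nmP; exists e.
- by exists n.
Qed.

(** Explicit epsilon-delta continuity of a total function on [u, v], convenient for restricting,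
    reparametrising and concatenating paths. *)
Definition pcont u v (g : R -> R[i]) := forall t, u <= t <= v -> forall e, 0 < e ->
  exists2 d, 0 < d & forall t', u <= t' <= v -> `|t' - t| < d -> nm (g t' - g t) < e.

Lemma pcontP u v g : {within `[u, v], continuous g} <-> pcont u v g.
Proof.
rewrite subspace_continuousP; split.
  move=> h t tuv e e0; have /h : `[u, v]%classic t by rewrite /= in_itv.
  move=> /(_ [set w | nm (w - g t) < e]) []; first by apply/nbhs_nmP; exists e.
  move=> d /= d0 H; exists d => // t' t'uv h'; apply: H => //=.
    by rewrite distrC.
move=> h t; rewrite /= in_itv /= => tuv U /nbhs_nmP [e e0 eU].
have [d d0 H] := h t tuv e e0; exists d => //= t' h' t'uv; apply: eU; apply: H.
  by move: t'uv; rewrite /= in_itv.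
by rewrite distrC.
Qed.

End TopologyBridge.

Section Dynamics.
Variables (R : realType) (a : R[i]).
Implicit Types (z w x y : R[i]).

Notation f := (expmap a).
Definition orb (n : nat) z := iter n f z.

Lemma orb0 z : orb 0 z = z. Proof. by []. Qed.
Lemma orbS n z : orb n.+1 z = f (orb n z). Proof. by []. Qed.
Lemma orbSr n z : orb n.+1 z = orb n (f z). Proof. by rewrite /orb iterSr. Qed.
Lemma orbD m n z : orb (m + n) z = orb m (orb n z). Proof. by rewrite /orb iterD. Qed.

Lemma expmapE z : f z = cexp z + a. Proof. by []. Qed.
Lemma expmapB z : f z - a = cexp z. Proof. by rewrite expmapE addrK. Qed.
Lemma nm_expmapB z : nm (f z - a) = expR (Rez z). Proof. by rewrite expmapB nm_cexp. Qed.
Lemma expmap_neq z : f z != a. Proof. by rewrite -subr_eq0 expmapB cexp_neq0. Qed.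
Lemma expmap_diff z w : f z - f w = cexp z - cexp w. Proof. by rewrite !expmapE; ring. Qed.
Lemma expmap_tpi z (k : int) : f (z + tpi k%:~R) = f z.
Proof. by rewrite !expmapE cexpD cexp_tpiz mulr1. Qed.

Definition esc z := forall M : R, exists N, forall n, (N <= n)%N -> M <= Rez (orb n z).

(** As |f z - a| = exp (Re z), the orbit tends to infinity exactly when its real parts tend to
    +oo. *)
Lemma escP z : escaping_set a z <-> esc z.
Proof.
split.
  move=> h M.
  pose r := expR M + nm a.
  have [] := h ([set to_sphere w | w in ~` [set w : R[i] | nm w <= r]] `|` [set infinity]).
    exists [set w : R[i] | nm w <= r]; last by [].
    by split; [exact: compact_cball | exact: closed_cball].
  move=> N _ H; exists N => n Nn.
  have /= := H n.+1 (leqW Nn); case => // -[w /= nw [wE]].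
  rewrite -(@ler_expR R) -nm_expmapB -[f _]/(orb n.+1 z) -[orb _ _]wE.
  have := nm_subl w a; move/negP: nw; rewrite -ltNge /r; lra.
move=> h U [K [cK _] KU].
have [r Kr] := compact_nm_bounded cK.
have [N H] := h (r + 1); exists N => // n /= Nn; apply: KU; left.
exists (orb n z) => // /Kr; have := H n Nn; have := Re_le (orb n z); lra.
Qed.

Lemma esc_orb n z : esc (orb n z) <-> esc z.
Proof.
split=> h M; have [N H] := h M.
  exists (N + n)%N => k kN; have := H (k - n)%N.
  rewrite -orbD subnK; first by apply; rewrite leq_subRL 1?addnC//; exact: leq_trans (leq_addl _ _) kN.
  exact: leq_trans (leq_addl _ _) kN.
by exists N => k kN; rewrite -orbD; apply: H; exact: leq_trans kN (leq_addr _ _).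
Qed.

End Dynamics.

Section Segments.
Variable R : realType.
Implicit Types (z w : R[i]) (s t u v : R) (g : R -> R[i]).

(** Compactness of a segment as an induction principle: the supremum of the x with Q u x is attained
    and cannot be less than v. It takes the place of finite subcovers throughout. *)
Lemma seg_ind u v (Q : R -> R -> Prop) : u <= v ->
  (forall t, u <= t <= v -> exists2 d, 0 < d &
     forall s s', u <= s -> s <= t -> t <= s' -> s' <= v -> t - d < s -> s' < t + d -> Q s s') ->
  (forall s m s', u <= s -> s <= m -> m <= s' -> s' <= v -> Q s m -> Q m s' -> Q s s') ->
  Q u v.
Proof.
move=> uv loc add.
pose S := [set x | u <= x <= v /\ Q u x].
have Su : S u.
  split; first by rewrite lexx.
  have [|d d0 H] := loc u; first by rewrite lexx uv.
  by apply: H => //; lra.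
have Sub : has_sup S by split; [exists u | exists v => x [/andP[]]].
have us : u <= sup S by apply: sup_upper_bound.
have sv : sup S <= v by apply: sup_le_ub; [exists u | move=> x [/andP[]]].
have [|d d0 H] := loc (sup S); first by rewrite us sv.
have [x [/andP[ux xv] Qx] xs] := sup_adherent d0 Sub.
have xsup : x <= sup S by apply: sup_upper_bound => //; split => //; rewrite ux xv.
have Qs : Q u (sup S).
  by apply: (add u x (sup S)) => //; apply: H => //; lra.
have [sveq|svlt] := eqVneq (sup S) v; first by rewrite -sveq.
have {}svlt : sup S < v by rewrite lt_neqAle svlt.
pose s' := Num.min v (sup S + d / 2).
have s'v : s' <= v by rewrite ge_min lexx.
have s's : sup S < s' by rewrite lt_min svlt; lra.
have s'd : s' < sup S + d by rewrite gt_min; apply/orP; right; lra.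
have : S s'.
  split; first by rewrite s'v andbT (le_trans us) ?ltW.
  apply: (add u (sup S) s') => //; first exact: ltW.
  by apply: H => //; [exact: ltW | lra].
by move=> /(sup_upper_bound Sub); rewrite leNgt s's.
Qed.

Lemma seg_near u v s s' t d x : u <= s -> s' <= v -> t - d < s -> s' < t + d -> s <= x -> x <= s' ->
  u <= x <= v /\ `|x - t| < d.
Proof.
by move=> us s'v h1 h2 sx xs'; rewrite ltr_norml; split; apply/andP; split; lra.
Qed.

Lemma mid_near (x m x' d : R) : x <= m -> m <= x' -> `|x - x'| < d -> `|x - m| < d /\ `|x' - m| < d.
Proof.
move=> xm mx'; rewrite ltr_norml => /andP[h1 h2].
by rewrite !ltr_norml; split; apply/andP; split; lra.
Qed.

Lemma pcont_sub u v u' v' g : u <= u' -> v' <= v -> pcont u v g -> pcont u' v' g.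
Proof.
move=> uu vv h t /andP[t1 t2] e e0; have [|d d0 H] := h t _ e e0.
  by rewrite (le_trans uu) ?(le_trans t2).
exists d => // t' /andP[t1' t2']; apply: H.
by rewrite (le_trans uu) ?(le_trans t2').
Qed.

Lemma pcont_bounded u v g : u <= v -> pcont u v g ->
  exists B, forall t, u <= t <= v -> nm (g t) <= B.
Proof.
move=> uv h; pose Q s s' := exists B, forall t, s <= t <= s' -> nm (g t) <= B.
apply: (@seg_ind u v Q uv).
  move=> t tuv; have [d d0 H] := h t tuv 1 ltr01; exists d => // s s' us st ts s'v h1 h2.
  exists (nm (g t) + 1) => x /andP[sx xs'].
  have := nm_triB (g x) (g t) 0; rewrite !subr0.
  have : nm (g x - g t) < 1.
    by have [? ?] := seg_near us s'v h1 h2 sx xs'; exact: H.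
  lra.
move=> s m s' _ _ _ _ [B1 H1] [B2 H2]; exists (Num.max B1 B2) => t /andP[t1 t2].
by rewrite le_max; case: (leP t m) => tm; [rewrite H1 ?t1 ?tm|rewrite H2 ?orbT ?t2 ?ltW].
Qed.

Lemma pcont_gap u v g w : u <= v -> pcont u v g -> (forall t, u <= t <= v -> g t != w) ->
  exists2 m, 0 < m & forall t, u <= t <= v -> m <= nm (g t - w).
Proof.
move=> uv h nz; pose Q s s' := exists2 m : R, 0 < m & forall t, s <= t <= s' -> m <= nm (g t - w).
apply: (@seg_ind u v Q uv).
  move=> t tuv; have n0 : 0 < nm (g t - w) / 2 by rewrite divr_gt0// nm_gt0 subr_eq0 nz.
  have [d d0 H] := h t tuv _ n0; exists d => // s s' us st ts s'v h1 h2.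
  exists (nm (g t - w) / 2) => // x /andP[sx xs'].
  have := nm_triB (g t) (g x) w; rewrite (nmB (g t) (g x)).
  have : nm (g x - g t) < nm (g t - w) / 2.
    by have [? ?] := seg_near us s'v h1 h2 sx xs'; exact: H.
  lra.
move=> s m s' _ _ _ _ [B1 p1 H1] [B2 p2 H2]; exists (Num.min B1 B2).
  by rewrite lt_min p1.
move=> t /andP[t1 t2]; rewrite ge_min.
by case: (leP t m) => tm; [rewrite H1 ?t1 ?tm|rewrite H2 ?orbT ?t2 ?ltW].
Qed.

(** Any 1-Lipschitz phi is allowed, so that one lemma serves Re, Im, - Im and |Im|. *)
Lemma pcont_ivt u v g (phi : R[i] -> R) c : u <= v -> pcont u v g ->
  (forall z w, `|phi z - phi w| <= nm (z - w)) ->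
  phi (g u) <= c -> c <= phi (g v) -> exists2 t, u <= t <= v & phi (g t) = c.
Proof.
move=> uv h lip c1 c2; apply: contrapT => no.
have ne t : u <= t <= v -> phi (g t) != c by move=> tuv; apply/eqP => e; apply: no; exists t.
pose Q s s' := phi (g s) < c -> phi (g s') < c.
suff : Q u v.
  have nu : phi (g u) < c by rewrite lt_neqAle c1 andbT ne// lexx.
by move=> /(_ nu); rewrite ltNge c2.
apply: (@seg_ind u v Q uv); last by move=> s m s' _ _ _ _ q1 q2 /q1/q2.
move=> t tuv; have n0 : 0 < `|phi (g t) - c| by rewrite normr_gt0 subr_eq0 ne.
have [d d0 H] := h t tuv _ n0; exists d => // s s' us st ts s'v h1 h2.
have K x : s <= x -> x <= s' -> (phi (g x) < c) = (phi (g t) < c).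
  move=> sx xs'; have : nm (g x - g t) < `|phi (g t) - c|.
    by have [? ?] := seg_near us s'v h1 h2 sx xs'; exact: H.
  move=> /(le_lt_trans (lip _ _)) l.
  have [lt|ge] := ltP (phi (g t)) c.
    rewrite [X in _ < X]ltr0_norm in l; last lra.
    by move: l; rewrite ltr_norml => /andP[_ l]; lra.
  rewrite [X in _ < X]ger0_norm in l; last lra.
  by move: l; rewrite ltr_norml => /andP[l _]; apply/negbTE; rewrite -leNgt; lra.
by rewrite /Q !K//; lra.
Qed.

Lemma Re_lip z w : `|Rez z - Rez w| <= nm (z - w).
Proof. by rewrite -ReB Re_nm. Qed.
Lemma Im_lip z w : `|Imz z - Imz w| <= nm (z - w).
Proof. by rewrite -ImB Im_nm. Qed.

Lemma geom_lim (w : nat -> R[i]) c : (forall k, nm (w k.+1 - w k) <= c / 2 ^+ k) ->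
  exists z, forall k, nm (z - w k) <= 2 * c / 2 ^+ k.
Proof.
move=> h.
have p k : 0 < (2 : R) ^+ k by rewrite exprn_gt0.
have c0 : 0 <= c by have := h 0%N; rewrite expr0 divr1; apply: le_trans; exact: nm_ge0.
have q k : (2 ^+ k.+1)^-1 = (2 ^+ k)^-1 / 2 :> R by rewrite exprS invfM mulrC.
have step k n : nm (w (k + n)%N - w k) <= 2 * c / 2 ^+ k - 2 * c / 2 ^+ (k + n).
  elim: n => [|n IH]; first by rewrite addn0 !subrr nm0.
  rewrite addnS; apply: le_trans (nm_triB _ (w (k + n)%N) _) _.
  apply: le_trans (lerD (h _) IH) _; rewrite q; lra.
have bd n : nm (w n) <= nm (w 0%N) + 2 * c.
  have := step 0%N n; rewrite add0n expr0 divr1.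
  have : 0 <= 2 * c / 2 ^+ n by apply: divr_ge0; [apply: mulr_ge0|apply: ltW].
  have := nm_triB (w n) (w 0%N) 0; rewrite !subr0; lra.
have [z hz] := cbolzano bd; exists z => k; rewrite leNgt; apply/negP => lt.
have e0 : 0 < nm (z - w k) - 2 * c / 2 ^+ k by rewrite subr_gt0.
have [n kn hn] := hz _ e0 k; have := step k (n - k)%N; rewrite subnKC// => hs.
have : 0 <= 2 * c / 2 ^+ n by apply: divr_ge0; [apply: mulr_ge0|apply: ltW].
have := nm_triB z (w n) (w k); rewrite (nmB z (w n)); lra.
Qed.

End Segments.

Section ExpContinuity.
Variables (R : realType) (a : R[i]).
Implicit Types (z w : R[i]).

Lemma cexp_lip z w : nm (w - z) <= 1 -> nm (cexp w - cexp z) <= expR (Rez z + 1) * nm (w - z).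
Proof.
move=> h; have -> : cexp w - cexp z = cexp z * (cexp (w - z) - 1).
  by rewrite cexpB mulrBr mulr1 mulrC divfK ?cexp_neq0.
rewrite nmM nm_cexp expRD -mulrA ler_pM2l ?expR_gt0//.
apply: le_trans (cexpB1_le _) _; rewrite ler_wpM2r ?nm_ge0// ler_expR.
exact: le_trans (Re_nm _) h.
Qed.

Lemma cexp_cts z e : 0 < e -> exists2 d, 0 < d & forall w, nm (w - z) < d -> nm (cexp w - cexp z) < e.
Proof.
move=> e0; have p := expR_gt0 (Rez z + 1).
exists (Num.min 1 (e / expR (Rez z + 1))); first by rewrite lt_min ltr01 divr_gt0.
move=> w; rewrite lt_min => /andP[h1 h2].
apply: le_lt_trans (cexp_lip (ltW h1)) _.
by rewrite mulrC -ltr_pdivlMr.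
Qed.

Lemma expmap_cts z e : 0 < e -> exists2 d, 0 < d &
  forall w, nm (w - z) < d -> nm (expmap a w - expmap a z) < e.
Proof. by move=> /(cexp_cts z)[d d0 H]; exists d => // w; rewrite expmap_diff; exact: H. Qed.

Lemma orb_cts n z e : 0 < e -> exists2 d, 0 < d &
  forall w, nm (w - z) < d -> nm (orb a n w - orb a n z) < e.
Proof.
elim: n e => [|n IH] e e0; first by exists e.
have [d d0 H] := expmap_cts (orb a n z) e0; have [d' d'0 H'] := IH d d0.
by exists d' => // w /H'/H.
Qed.

Lemma pcont_orb u v (g : R -> R[i]) n : pcont u v g -> pcont u v (fun t => orb a n (g t)).
Proof.
move=> h t tuv e e0; have [d d0 H] := orb_cts n (g t) e0; have [d' d'0 H'] := h t tuv d d0.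
by exists d' => // t' h1 h2; apply: H; apply: H'.
Qed.

End ExpContinuity.

(** * Hairs *)

Section Growth.
Variables (R : realType) (a : R[i]).
Implicit Types (z w x y u v : R[i]).
Notation f := (expmap a).

Lemma pi_le4 : pi <= 4 :> R.
Proof. by have := pihalf_lt2 R; lra. Qed.

Lemma fRe_ge x (c : R) : c + nm a <= Rez (f x) -> c <= expR (Rez x).
Proof.
rewrite -(nm_expmapB a) => h; have := Re_le (f x - a); rewrite ReB; have := Re_le a; lra.
Qed.

(** An image with real part at least 100 + |a| comes from a point with exp (Re x) >= 100, and the
    divisor 4 of [cexp_expand] leaves 25. *)
Lemma contraction x y : 100 + nm a <= Rez (f x) -> 100 + nm a <= Rez (f y) ->
  `|Imz x - Imz y| <= pi -> nm (x - y) <= nm (f x - f y) / 25.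
Proof.
move=> /fRe_ge hx /fRe_ge hy h; rewrite expmap_diff; have := cexp_expand h.
have : 100 <= Num.min (expR (Rez x)) (expR (Rez y)) by rewrite le_min hx.
by have := nm_ge0 (x - y); nra.
Qed.

(** The inverse branch of f on the half-plane Re u > |a| that takes f x back to x. *)
Definition Lst x u := x + (plog (u - a) - plog (f x - a)).

Lemma Re_pos_subl u : nm a < Rez u -> 0 < Rez (u - a).
Proof. by move=> h; rewrite ReB; have := Re_le a; lra. Qed.

Lemma sub_neq0 u : nm a < Rez u -> u - a != 0.
Proof. by move=> /Re_pos_subl; apply: contraTneq => ->; rewrite /= ltxx. Qed.

Lemma LstK x u : nm a < Rez u -> f (Lst x u) = u.
Proof.
move=> hu; rewrite expmapE /Lst cexpD cexpB expmapB !plogK ?cexp_neq0 ?(sub_neq0 hu)//.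
by rewrite mulrC divfK ?cexp_neq0// subrK.
Qed.

Lemma Lst_id x : Lst x (f x) = x.
Proof. by rewrite /Lst subrr addr0. Qed.

Lemma Lst_Im2 x u v : nm a < Rez u -> nm a < Rez v -> `|Imz (Lst x u) - Imz (Lst x v)| < pi.
Proof.
move=> /Re_pos_subl/parg_lt hu /Re_pos_subl/parg_lt hv; rewrite !Cri.
rewrite (_ : _ - _ = Imz (plog (u - a)) - Imz (plog (v - a))); last by ring.
by apply: le_lt_trans (ler_normB _ _) _; lra.
Qed.

Lemma Lst_contract x u v : 100 + nm a <= Rez u -> 100 + nm a <= Rez v ->
  nm (Lst x u - Lst x v) <= nm (u - v) / 25.
Proof.
move=> hu hv; have nu : nm a < Rez u by lra. have nv : nm a < Rez v by lra.
rewrite -{2}(LstK x nu) -{2}(LstK x nv); apply: contraction; rewrite ?LstK//.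
exact/ltW/Lst_Im2.
Qed.

Lemma Re_Lst x u : Rez (Lst x u) = ln (nm (u - a)).
Proof. by rewrite /Lst !Cri /= nm_expmapB expRK; lra. Qed.

(** With X = f x - a and Y = f y - a, the lead of Re y gives |X| <= |Y| / 2. The squares of the
    imaginary parts differ by at most B (|X| + |Y|), little against |Y|^2, so the squares of the
    real parts differ by most of |Y|^2. *)
Lemma growth (B : R) x y : 1 <= B -> 100 * B + nm a <= Rez (f x) -> 100 * B + nm a <= Rez (f y) ->
  `|Imz (f x) - Imz (f y)| <= B -> Rez x + 1 <= Rez y ->
  Rez (f x) + expR (Rez y) / 4 <= Rez (f y).
Proof.
move=> B1 hx hy hi hr; have := fRe_ge hy.
have : expR (Rez x) <= expR (Rez y) / 2.
  rewrite ler_pdivlMr//; have -> : expR (Rez y) = expR (Rez x) * expR (Rez y - Rez x).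
    by rewrite -expRD subrKC.
  by rewrite ler_pM2l ?expR_gt0//; have := expR_ge1Dx (Rez y - Rez x); lra.
rewrite -(nm_expmapB a x) -(nm_expmapB a y).
have -> : Rez (f x) = Rez (f x - a) + Rez a by rewrite ReB subrK.
have -> : Rez (f y) = Rez (f y - a) + Rez a by rewrite ReB subrK.
have {hi} : `|Imz (f x - a) - Imz (f y - a)| <= B by rewrite !ImB; move: hi; congr (`|_| <= _); ring.
have : 0 < Rez (f x - a) by apply: Re_pos_subl; have := nm_ge0 a; lra.
have : 0 < Rez (f y - a) by apply: Re_pos_subl; have := nm_ge0 a; lra.
move: (f x - a) (f y - a) => X Y; clear -B1.
move=> rY rX hi h b; have nX := nm2 X; have nY := nm2 Y.
have iX := Im_nm X; have iY := Im_nm Y; have RX := Re_le X; have RY := Re_le Y.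
have nX0 := nm_ge0 X.
set x := nm X in nX iX RX nX0 h *; set y := nm Y in nY iY RY h b *.
move: (Rez X) (Imz X) (Rez Y) (Imz Y) nX nY iX iY RX RY rX rY hi => p q r s nX nY iX iY RX RY rX rY hi.
have d : `|s ^+ 2 - q ^+ 2| <= B * (y + x).
  rewrite subr_sqr normrM distrC ler_pM//; apply: le_trans (ler_normD _ _) _; lra.
have {}d : s ^+ 2 - q ^+ 2 <= B * (y + x) by apply: le_trans (ler_norm _) d.
clear hi iX iY.
have xx : x * x <= y * y / 4 by nra.
have By : B * y <= y * y / 100 by nra.
have Bx : B * x <= B * y by nra.
have e1 : 7 / 10 * (y * y) <= (r - p) * (r + p).
  rewrite !expr2 in nX nY d; clear -nX nY d xx By Bx b B1; nra.
have yp : 0 < y by lra.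
have e2 : 0 < r - p by clear -e1 rX rY yp; nra.
have e3 : (r - p) * (r + p) <= (r - p) * (3 / 2 * y) by apply: ler_wpM2l; lra.
have e4 : 7 / 10 * y <= (r - p) * (3 / 2) by rewrite -(ler_pM2r yp); lra.
lra.
Qed.

End Growth.

Section Hair.
Variables (R : realType) (a : R[i]) (M : R).
Hypothesis hM : 100 * 20 + nm a <= M.
Implicit Types (z w x y u v : R[i]) (t h : R).
Notation f := (expmap a).
Notation orb := (orb a).

Definition inJ (K : R) z := forall n, K <= Rez (orb n z).

Lemma inJ_orb K n z : inJ K z -> inJ K (orb n z).
Proof. by move=> h k; rewrite -orbD. Qed.

Lemma inJ_le K K' z : K' <= K -> inJ K z -> inJ K' z.
Proof. by move=> le h n; exact: le_trans (h n). Qed.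

(* Heights chosen so that hpt x n t = orb n x + hs x n t satisfies
   |hpt x n.+1 t - a| = exp (Re (hpt x n t)); pulling hpt x (n + k) t back to level
   n along the orbit of x then converges to the point hair x n t. *)
Fixpoint hs x (n : nat) t : R := match n with
  | 0 => t
  | n'.+1 => Num.sqrt (expR (Rez (orb n' x) + hs x n' t) ^+ 2 - Imz (cexp (orb n' x)) ^+ 2)
             - Rez (cexp (orb n' x))
  end.

Lemma hs_start x t : hs x 0 t = t. Proof. by []. Qed.

Lemma hsS x n t : hs x n.+1 t =
  Num.sqrt (expR (Rez (orb n x) + hs x n t) ^+ 2 - Imz (cexp (orb n x)) ^+ 2) - Rez (cexp (orb n x)).
Proof. by []. Qed.

(** Every level stays in the half-plane where inverse branches contract. A valid negative t says
    that the hair continues beyond x towards slower points. *)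
Definition valid x t := forall n, M <= Rez (orb n x) + hs x n t.

Definition hpt x n t : R[i] := orb n x + hs x n t +i* 0.

Lemma Re_hpt x n t : Rez (hpt x n t) = Rez (orb n x) + hs x n t.
Proof. by rewrite /hpt Cri. Qed.
Lemma Im_hpt x n t : Imz (hpt x n t) = Imz (orb n x).
Proof. by rewrite /hpt Cri /= addr0. Qed.

Lemma Re_subl_pos u : M <= Rez u -> 0 < Rez (u - a).
Proof. by move=> h; apply: Re_pos_subl; have := hM; lra. Qed.

Lemma Re_cexp_pos x n : inJ M x -> 0 < Rez (cexp (orb n x)).
Proof. by move=> /(_ n.+1)/Re_subl_pos; rewrite orbS expmapB. Qed.

(** A negative radicand would make [Num.sqrt] 0 by convention, and the real part of level n + 1
    would be Re a, against validity. *)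
Lemma hs_rad_ge0 x n t : inJ M x -> valid x t ->
  Imz (cexp (orb n x)) ^+ 2 <= expR (Rez (orb n x) + hs x n t) ^+ 2.
Proof.
move=> xJ v; rewrite leNgt -subr_lt0; apply/negP => h.
have {}h : Num.sqrt (expR (Rez (orb n x) + hs x n t) ^+ 2 - Imz (cexp (orb n x)) ^+ 2) = 0.
  by apply: ler0_sqrtr; apply: ltW.
have := v n.+1; rewrite /= h -(expmapB a) ReB.
have := hM; have := Re_le a; have := nm_ge0 a; lra.
Qed.

Lemma nm_hpt x n t : inJ M x -> valid x t -> nm (hpt x n.+1 t - a) = expR (Rez (orb n x) + hs x n t).
Proof.
move=> xJ v; set e := expR _.
have rE : Rez (hpt x n.+1 t - a) = Num.sqrt (e ^+ 2 - Imz (cexp (orb n x)) ^+ 2).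
  rewrite ReB Re_hpt /= -(expmapB a) ReB -/e; ring.
have iE : Imz (hpt x n.+1 t - a) = Imz (cexp (orb n x)).
  by rewrite ImB Im_hpt orbS -(expmapB a) ImB.
apply/eqP; rewrite -(@eqrXn2 _ 2) ?nm_ge0 ?expR_ge0// nm2 rE iE sqr_sqrtr ?subrK//.
by rewrite subr_ge0 hs_rad_ge0.
Qed.

(** The heights are chosen so that both real parts agree exactly; only the arguments contribute, by
    at most pi. *)
Lemma hpt_step x n t : inJ M x -> valid x t -> nm (Lst a (orb n x) (hpt x n.+1 t) - hpt x n t) <= 4.
Proof.
move=> xJ v; have v1 := v n.+1; rewrite -Re_hpt in v1.
have re : Rez (Lst a (orb n x) (hpt x n.+1 t) - hpt x n t) = 0.
  by rewrite ReB Re_Lst nm_hpt// expRK Re_hpt subrr.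
apply: le_trans (nm_ReIm _) _; rewrite re normr0 add0r ImB Im_hpt.
apply: le_trans (pi_le4 R); rewrite -[in leLHS](Lst_id a (orb n x)) {1}Lst_id; apply/ltW.
apply: Lst_Im2; have := hM; have := xJ n.+1; have := nm_ge0 a; rewrite ?orbS; lra.
Qed.

Fixpoint pb x t (k n : nat) : R[i] := match k with
  | 0 => hpt x n t
  | k'.+1 => Lst a (orb n x) (pb x t k' n.+1)
  end.

Lemma Lst_near x u v : M <= Rez u -> M - 20 <= Rez v -> nm (Lst a x u - Lst a x v) <= nm (u - v) / 25.
Proof. by move=> h1 h2; apply: Lst_contract; have := hM; lra. Qed.

Lemma Re_near u v (c : R) : nm (u - v) <= c -> Rez v - c <= Rez u.
Proof. by have := Re_ge (u - v); rewrite ReB; lra. Qed.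

(** The error 4 of one step plus the contracted error 5 / 25 of the following levels is again at
    most 5. *)
Lemma pb_near x t k n : inJ M x -> valid x t -> nm (pb x t k n - hpt x n t) <= 5.
Proof.
move=> xJ v; elim: k n => [|k IH] n; first by rewrite subrr nm0.
have v1 := v n.+1; rewrite -Re_hpt in v1; have h := IH n.+1.
apply: le_trans (nm_triB _ (Lst a (orb n x) (hpt x n.+1 t)) _) _.
have := hpt_step n xJ v; have : nm (pb x t k.+1 n - Lst a (orb n x) (hpt x n.+1 t)) <= 1; last by lra.
rewrite nmB /=; apply: le_trans (Lst_near _ v1 _) _; last by rewrite nmB; lra.
have := Re_near h; lra.
Qed.

Lemma pb_step x t k n : inJ M x -> valid x t -> nm (pb x t k.+1 n - pb x t k n) <= 5 / 2 ^+ k.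
Proof.
move=> xJ v; elim: k n => [|k IH] n.
  by rewrite expr0 divr1; exact: (pb_near 1).
have v1 := v n.+1; rewrite -Re_hpt in v1.
have h1 := Re_near (pb_near k n.+1 xJ v); have h2 := Re_near (pb_near k.+1 n.+1 xJ v).
rewrite [pb x t k.+2 n]/= [pb x t k.+1 n]/=.
apply: le_trans (Lst_contract _ _ _) _; try by have := hM; rewrite /= in h2 *; lra.
apply: le_trans (_ : nm (pb x t k.+1 n.+1 - pb x t k n.+1) / 2 <= _).
  by rewrite ler_wpM2l ?nm_ge0// lef_pV2 ?posrE//; lra.
by rewrite exprS invfM [_^-1 * _]mulrC mulrA ler_wpM2r// ?invr_ge0.
Qed.

(** The limit of [pb x t k n] in k, at level n, so that f maps level n to level n + 1. It is
    meaningful only for x in [inJ M] and valid t; elsewhere the set may be empty and [get]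
    arbitrary. *)
Definition hair x n t : R[i] := get [set z | forall k, nm (z - pb x t k n) <= 10 / 2 ^+ k].

Lemma hair_pb x n t k : inJ M x -> valid x t -> nm (hair x n t - pb x t k n) <= 10 / 2 ^+ k.
Proof.
move=> xJ v; rewrite /hair; case: xgetP => [z _ /= h|no] //.
have [z hz] := geom_lim (fun k => pb_step k n xJ v); exfalso; apply: (no z) => j /=.
by apply: le_trans (hz j) _; rewrite ler_wpM2r ?invr_ge0 ?exprn_ge0//; lra.
Qed.

Lemma hair_near x n t : inJ M x -> valid x t -> nm (hair x n t - hpt x n t) <= 10.
Proof. by move=> xJ v; have := hair_pb n 0 xJ v; rewrite expr0 divr1. Qed.

Lemma half_pow_lt (c e : R) : 0 < e -> exists k, c / 2 ^+ k < e.
Proof.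
move=> e0; have [n hn] : exists n : nat, c / e < n%:R.
  by exists (Num.truncn (c / e)).+1; exact: truncnS_gt.
exists n; rewrite ltr_pdivrMr ?exprn_gt0// mulrC -ltr_pdivrMr//; apply: lt_le_trans hn _.
by rewrite -natrX ler_nat ltnW// ltn_expl.
Qed.

Lemma le0_half_pow (c d : R) : (forall k, d <= c / 2 ^+ k) -> d <= 0.
Proof.
move=> h; rewrite leNgt; apply/negP => d0; have [k hk] := half_pow_lt c d0.
by have := h k; rewrite leNgt hk.
Qed.

Lemma hair_Lst x n t : inJ M x -> valid x t -> hair x n t = Lst a (orb n x) (hair x n.+1 t).
Proof.
move=> xJ v; apply/eqP; rewrite -subr_eq0 -nm_eq0 eq_le nm_ge0 andbT.
apply: (@le0_half_pow 20) => k.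
apply: le_trans (nm_triB _ (pb x t k.+1 n) _) _.
have v1 := v n.+1; rewrite -Re_hpt in v1.
have h1 := Re_near (pb_near k n.+1 xJ v); have h2 := Re_near (hair_near n.+1 xJ v).
have h3 : nm (Lst a (orb n x) (pb x t k n.+1) - Lst a (orb n x) (hair x n.+1 t))
   <= nm (pb x t k n.+1 - hair x n.+1 t) / 25.
  by apply: Lst_contract; have := hM; lra.
have := hair_pb n.+1 k xJ v; have := hair_pb n k.+1 xJ v; rewrite exprS invfM.
rewrite (nmB (hair _ _ _) (pb x t k n.+1)) /= in h3 *.
by have : 0 < (2 ^+ k : R)^-1; [rewrite invr_gt0 exprn_gt0|lra].
Qed.

Lemma Re_hair x n t : inJ M x -> valid x t -> Rez (orb n x) + hs x n t - 10 <= Rez (hair x n t).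
Proof. by move=> xJ v; have := Re_near (hair_near n xJ v); rewrite Re_hpt. Qed.

Lemma Re_hair_le x n t : inJ M x -> valid x t -> Rez (hair x n t) <= Rez (orb n x) + hs x n t + 10.
Proof.
by move=> xJ v; have := hair_near n xJ v; rewrite nmB => /Re_near; rewrite Re_hpt; lra.
Qed.

Lemma Re_hair_ge x n t : inJ M x -> valid x t -> M - 10 <= Rez (hair x n t).
Proof. by move=> xJ v; have := Re_hair n xJ v; have := v n; lra. Qed.

Lemma hairS x n t : inJ M x -> valid x t -> f (hair x n t) = hair x n.+1 t.
Proof.
move=> xJ v; rewrite hair_Lst// LstK//; have := Re_hair_ge n.+1 xJ v; have := hM; have := nm_ge0 a; lra.
Qed.

Lemma hair_orb x n t : inJ M x -> valid x t -> orb n (hair x 0 t) = hair x n t.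
Proof. by move=> xJ v; elim: n => // n IH; rewrite orbS IH hairS. Qed.

Lemma hair_Im x n t t' : inJ M x -> valid x t -> valid x t' -> `|Imz (hair x n t) - Imz (hair x n t')| < pi.
Proof.
move=> xJ v v'; rewrite (hair_Lst n xJ v) (hair_Lst n xJ v').
apply: Lst_Im2; [have := Re_hair_ge n.+1 xJ v|have := Re_hair_ge n.+1 xJ v']; have := hM; lra.
Qed.

Lemma hs0 x n : inJ M x -> hs x n 0 = 0.
Proof.
move=> xJ; elim: n => //= n ->; rewrite addr0 -nm_cexp nm2 addrK sqrtr_sqr gtr0_norm ?subrr//.
exact: Re_cexp_pos.
Qed.

Lemma valid0 x : inJ M x -> valid x 0.
Proof. by move=> xJ n; rewrite hs0// addr0. Qed.

Lemma hair0 x n : inJ M x -> hair x n 0 = orb n x.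
Proof.
move=> xJ; have pbE k m : pb x 0 k m = orb m x.
  elim: k m => [|k IH] m /=; last by rewrite IH orbS Lst_id.
  by rewrite /hpt hs0//; apply: CP; rewrite !Cri /= addr0.
apply/eqP; rewrite -subr_eq0 -nm_eq0 eq_le nm_ge0 andbT.
by apply: (@le0_half_pow 10) => k; have := hair_pb n k xJ (valid0 xJ); rewrite pbE.
Qed.

(** The difference of the squares is unchanged by subtracting c^2, while the sum S' + S of the roots
    is at most A' + A. *)
Lemma sqrt_gap (A A' c : R) : 0 <= A -> A <= A' -> c ^+ 2 <= A ^+ 2 ->
  A' - A <= Num.sqrt (A' ^+ 2 - c ^+ 2) - Num.sqrt (A ^+ 2 - c ^+ 2).
Proof.
move=> A0 AA cA.
have AA2 : A ^+ 2 <= A' ^+ 2 by rewrite ler_sqr ?nnegrE//; lra.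
have c2 := sqr_ge0 c.
have s1 : Num.sqrt (A ^+ 2 - c ^+ 2) ^+ 2 = A ^+ 2 - c ^+ 2 by rewrite sqr_sqrtr//; lra.
have s2 : Num.sqrt (A' ^+ 2 - c ^+ 2) ^+ 2 = A' ^+ 2 - c ^+ 2 by rewrite sqr_sqrtr//; lra.
have p1 := sqrtr_ge0 (A ^+ 2 - c ^+ 2); have p2 := sqrtr_ge0 (A' ^+ 2 - c ^+ 2).
set S := Num.sqrt (A ^+ 2 - _) in s1 p1 *; set S' := Num.sqrt (A' ^+ 2 - _) in s2 p2 *.
have l1 : S <= A by rewrite -ler_sqr ?nnegrE//; lra.
have l2 : S' <= A' by rewrite -ler_sqr ?nnegrE//; lra.
have e : (S' - S) * (S' + S) = (A' - A) * (A' + A) by rewrite -!subr_sqr s1 s2; ring.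
rewrite leNgt; apply/negP => lt.
have ge : S <= S' by rewrite -ler_sqr ?nnegrE//; lra.
nra.
Qed.

(** Exponentiating multiplies a gap of heights by at least 2 and [sqrt_gap] does not lose any of it.
    This divergence gives escape along the hair and injectivity in t. *)
Lemma hs_gap x n t t' : inJ M x -> valid x t -> t <= t' -> 2 ^+ n * (t' - t) <= hs x n t' - hs x n t.
Proof.
move=> xJ v tt; elim: n => [|n IH]; first by rewrite expr0 mul1r.
have g0 : 0 <= hs x n t' - hs x n t by apply: le_trans IH; rewrite mulr_ge0 ?exprn_ge0 ?subr_ge0.
have := @sqrt_gap (expR (Rez (orb n x) + hs x n t)) (expR (Rez (orb n x) + hs x n t'))
  (Imz (cexp (orb n x))); rewrite expR_ge0 ler_expR hs_rad_ge0//= => /(_ isT).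
have le : Rez (orb n x) + hs x n t <= Rez (orb n x) + hs x n t' by lra.
move=> /(_ le isT); have := expR_gap_ge le.
have : 2 <= expR (Rez (orb n x) + hs x n t).
  by have := expR_ge1Dx (Rez (orb n x) + hs x n t); have := v n; have := hM; have := nm_ge0 a; lra.
move: (expR _) IH g0 => e IH g0 e2.
rewrite (_ : _ - (Rez (orb n x) + hs x n t) = hs x n t' - hs x n t); last by ring.
set d := hs x n t' - _ in IH g0 * => h1 h2.
have -> : 2 ^+ n.+1 * (t' - t) = 2 * (2 ^+ n * (t' - t)) by rewrite exprS mulrA.
have : 2 * d <= e * d by rewrite ler_wpM2r.
lra.
Qed.

Lemma valid_le x t t' : inJ M x -> valid x t -> t <= t' -> valid x t'.
Proof.
move=> xJ v tt n; have := v n; have := hs_gap n xJ v tt.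
have : 0 <= 2 ^+ n * (t' - t) by rewrite mulr_ge0 ?exprn_ge0 ?subr_ge0.
lra.
Qed.

Lemma valid_ge0 x t : inJ M x -> 0 <= t -> valid x t.
Proof. by move=> xJ; apply: valid_le => //; exact: valid0. Qed.

Lemma Re_hair_gap x n t t' : inJ M x -> valid x t -> t <= t' ->
  Rez (hair x n t) + 2 ^+ n * (t' - t) - 20 <= Rez (hair x n t').
Proof.
move=> xJ v tt; have := hs_gap n xJ v tt; have := Re_hair_le n xJ v.
have := Re_hair n xJ (valid_le xJ v tt); lra.
Qed.

Lemma pow2_ge (c d : R) : 0 < d -> exists N, forall n, (N <= n)%N -> c <= 2 ^+ n * d.
Proof.
move=> d0; have [N hN] := half_pow_lt c d0; exists N => n Nn.
have : c <= 2 ^+ N * d by rewrite mulrC -ler_pdivrMr ?exprn_gt0// ltW.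
move/le_trans; apply; rewrite ler_pM2r// ler_weXn2l//; lra.
Qed.

Lemma hair_esc x t t' : inJ M x -> valid x t -> t < t' -> esc a (hair x 0 t').
Proof.
move=> xJ v tt c; have tt' := tt; rewrite -subr_gt0 in tt'.
have [N h] := pow2_ge (c - M + 30) tt'; exists N => n /h.
rewrite hair_orb//; last by apply: valid_le v _ => //; exact: ltW.
have := Re_hair_gap n xJ v (ltW tt); have := Re_hair_ge n xJ v; lra.
Qed.

Lemma hair_inj x n t t' : inJ M x -> valid x t -> valid x t' -> hair x n t = hair x n t' -> t = t'.
Proof.
move=> xJ v v'.
have W s s' : valid x s -> valid x s' -> s < s' -> hair x n s <> hair x n s'.
  move=> u u' lt e; have lt' := lt; rewrite -subr_gt0 in lt'.
  have [N h] := pow2_ge (21 : R) lt'; have := h (N + n)%N (leq_addr _ _).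
  have := Re_hair_gap (N + n) xJ u (ltW lt).
  have -> : hair x (N + n) s = hair x (N + n) s'.
    by rewrite -(hair_orb _ xJ u) -(hair_orb _ xJ u') !orbD !(hair_orb n)// e.
  lra.
case: (ltgtP t t') => // lt e; first by have := W t t' v v' lt.
by have := W t' t v' v lt; rewrite e.
Qed.

Lemma hair_contract x n t t' : inJ M x -> valid x t -> valid x t' ->
  nm (hair x 0 t - hair x 0 t') <= nm (hair x n t - hair x n t') / 2 ^+ n.
Proof.
move=> xJ v v'; elim: n => [|n IH]; first by rewrite expr0 divr1.
apply: le_trans IH _; rewrite exprS invfM mulrA ler_wpM2r ?invr_ge0 ?exprn_ge0//.
have h1 := Re_hair_ge n.+1 xJ v; have h2 := Re_hair_ge n.+1 xJ v'.
apply: le_trans (_ : nm (hair x n.+1 t - hair x n.+1 t') / 25 <= _).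
  rewrite -!hairS//; apply: contraction; rewrite ?hairS//; try by have := hM; lra.
  exact/ltW/hair_Im.
by rewrite ler_wpM2l ?nm_ge0// lef_pV2 ?posrE//; lra.
Qed.

Lemma hs_cts x n : continuous (hs x n).
Proof.
elim: n => [|n IH] t; first exact: cvg_id.
rewrite /=; apply: cvgB; last exact: cvg_cst.
apply: continuous_comp; last exact: sqrt_continuous.
apply: cvgB; last exact: cvg_cst.
apply: cvgM; (apply: continuous_comp; last exact: continuous_expR);
  by apply: cvgD; [exact: cvg_cst|exact: IH].
Qed.

Lemma hair_pcont0 x (u v : R) : inJ M x -> valid x u -> pcont u v (hair x 0).
Proof.
move=> xJ vu t /andP[ut tv] e e0.
(* At level n the two points are within 10 + 1 + 10: each is within 10 of its [hpt], and the heights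
   differ by less than 1. Then pull back n times. *)
have [n hn] := half_pow_lt 21 e0.
have vt := valid_le xJ vu ut.
have : \forall s \near t, `|hs x n t - hs x n s| < 1.
  by have /cvgrPdist_lt := @hs_cts x n t; apply.
move=> /nbhs_ballP[d /= d0 H]; exists d => // t' /andP[ut' _] tt.
have vt' := valid_le xJ vu ut'.
apply: le_lt_trans (hair_contract n xJ vt' vt) _; apply: le_lt_trans hn.
rewrite ler_wpM2r ?invr_ge0 ?exprn_ge0//.
have := H t'; rewrite /ball /= distrC => /(_ tt) hh.
have := nm_triB (hair x n t') (hpt x n t') (hair x n t).
have := nm_triB (hpt x n t') (hpt x n t) (hair x n t).
have := hair_near n xJ vt; have := hair_near n xJ vt'; rewrite (nmB (hair x n t)).
have : nm (hpt x n t' - hpt x n t) < 1.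
  rewrite /hpt (_ : _ - _ = (hs x n t' - hs x n t) +i* 0) ?nmR 1?distrC//.
  by apply: CP; rewrite !Cri /=; ring.
lra.
Qed.

Lemma hair_pcont x n (u v : R) : inJ M x -> valid x u -> pcont u v (hair x n).
Proof.
move=> xJ vu t tuv e e0; have [d d0 H] := pcont_orb a n (hair_pcont0 (v:=v) xJ vu) tuv e0.
have /andP[ut _] := tuv.
exists d => // t' t'uv tt; have /andP[ut' _] := t'uv; have := H t' t'uv tt.
by rewrite !hair_orb//; exact: valid_le vu _.
Qed.

(** The levels of height -1/2 stay 1/4 to the right of the orbit of y: a gap of 1/4 multiplies the
    modulus by 5/4, which absorbs a difference of 20 in the imaginary parts because the moduli are
    at least 2000. *)
Lemma valid_slower x y : inJ M x -> inJ M y -> (forall n, `|Imz (orb n x) - Imz (orb n y)| <= 20) ->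
  Rez y + 1 <= Rez x -> valid x (- 1 / 2).
Proof.
move=> xJ yJ hI h0; suff S n : Rez (orb n y) + 1 / 4 <= Rez (orb n x) + hs x n (- 1 / 2).
  by move=> n; have := S n; have := yJ n; lra.
elim: n => [|n IH]; first by rewrite !orb0 /=; lra.
set A := expR (Rez (orb n x) + hs x n (- 1 / 2)).
have hA : 5 / 4 * expR (Rez (orb n y)) <= A.
  apply: le_trans (_ : expR (Rez (orb n y) + 1 / 4) <= _); last by rewrite ler_expR.
  rewrite expRD mulrC ler_pM2l ?expR_gt0//; have := expR_ge1Dx (1 / 4 : R); lra.
have hY : 100 * 20 <= expR (Rez (orb n y)).
  by apply: (@fRe_ge _ a); rewrite -orbS; have := yJ n.+1; have := hM; lra.
rewrite [hs _ _ _]/= -/A orbS -[f _]/(cexp (orb n y) + a) orbS -[f (orb n x)]/(cexp (orb n x) + a).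
rewrite !ReD.
have := hI n.+1; rewrite !orbS !expmapE !ImD.
set X := cexp (orb n x); rewrite -nm_cexp in hA hY; set Y := cexp (orb n y) in hA hY *.
move=> hXY; have {}hXY : `|Imz X - Imz Y| <= 20 by move: hXY; congr (`|_| <= _); ring.
suff : Rez Y + 1 / 4 <= Num.sqrt (A ^+ 2 - Imz X ^+ 2) by lra.
apply: le_trans (ler_norm _) _; rewrite -sqrtr_sqr ler_wsqrtr//.
have hiX : Imz X ^+ 2 <= (`|Imz Y| + 20) ^+ 2.
  rewrite -(real_normK (num_real (Imz X))) ler_sqr ?nnegrE ?addr_ge0//.
  by have := ler_normD (Imz X - Imz Y) (Imz Y); rewrite subrK; lra.
have nY := nm2 Y; have iY := Im_nm Y; have rY := Re_le Y.
have iY2 : `|Imz Y| ^+ 2 = Imz Y ^+ 2 by rewrite real_normK ?num_real.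
have A2 : 25 / 16 * nm Y ^+ 2 <= A ^+ 2.
  have -> : 25 / 16 * nm Y ^+ 2 = (5 / 4 * nm Y) ^+ 2 by field.
  by rewrite ler_sqr ?nnegrE//; have := nm_ge0 Y; lra.
rewrite !expr2 in hiX nY iY2 A2 *; clear -hiX nY iY rY iY2 A2 hY.
set q := `|_| in hiX iY iY2; set r := Rez _ in nY rY *; set m := nm Y in nY iY rY A2 hY.
have n2 : 100 * 20 * m <= m * m by rewrite ler_wpM2r//; lra.
nra.
Qed.

End Hair.

(** * Comparing speeds of escape *)

Section Monotone.
Variables (R : realType) (u v : R) (T : Type) (g : R -> T) (P : R -> R -> Prop).
Implicit Types s t x y : R.
Notation I t := (u <= t <= v).
Hypothesis Popen : forall s t, I s -> I t -> P s t -> exists2 d : R, 0 < d &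
  forall s' t', I s' -> I t' -> `|s' - s| < d -> `|t' - t| < d -> P s' t'.
Hypothesis Ptot : forall s t, I s -> I t -> g s <> g t -> P s t \/ P t s.
Hypothesis Ptrans : forall r s t, I r -> I s -> I t -> P r s -> P s t -> P r t.
Hypothesis Pasym : forall s t, I s -> I t -> P s t -> ~ P t s.
Hypothesis linj : forall t, I t -> exists2 d : R, 0 < d &
  forall s s', I s -> I s' -> `|s - t| < d -> `|s' - t| < d -> g s = g s' -> s = s'.

Lemma in_seg s t x : I s -> I t -> s <= x -> x <= t -> I x.
Proof. by move=> /andP[us _] /andP[_ tv] sx xt; rewrite (le_trans us)// (le_trans xt). Qed.

(** Intermediate values for the order P: the parameters before c and those after c form disjoint
    open sets, which cannot cover a segment that meets both. *)
Lemma rel_ivt c s t : I c -> I s -> I t -> s <= t ->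
  (P s c /\ P c t) \/ (P c s /\ P t c) -> exists2 q, s <= q <= t & g q = g c.
Proof.
move=> ic is_ it st h; apply: contrapT => no.
have ne q : s <= q <= t -> P q c \/ P c q.
  move=> /andP[sq qt]; apply: Ptot => //; first exact: in_seg sq qt.
  by move=> e; apply: no; exists q => //; rewrite sq.
have Q1 : P s c -> P t c.
  apply: (@seg_ind _ s t (fun x y => P x c -> P y c) st); last by auto.
  move=> q sqt; have /andP[sq qt] := sqt; have iq := in_seg is_ it sq qt.
  have [h1|h1] := ne q sqt;
    [have [d d0 H] := Popen iq ic h1|have [d d0 H] := Popen ic iq h1]; exists d => // x y sx xq qy yt dx dy.
    move=> _; apply: H => //; rewrite ?subrr ?normr0//.
      by apply: in_seg is_ it _ yt; lra.
    by rewrite ltr_norml; apply/andP; split; lra.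
  have ix : I x by apply: in_seg is_ it sx _; lra.
  move=> Pxc; exfalso; apply: (Pasym ix ic Pxc).
  apply: H => //; rewrite ?subrr ?normr0//.
  by rewrite ltr_norml; apply/andP; split; lra.
have Q2 : P c s -> P c t.
  apply: (@seg_ind _ s t (fun x y => P c x -> P c y) st); last by auto.
  move=> q sqt; have /andP[sq qt] := sqt; have iq := in_seg is_ it sq qt.
  have [h1|h1] := ne q sqt;
    [have [d d0 H] := Popen iq ic h1|have [d d0 H] := Popen ic iq h1]; exists d => // x y sx xq qy yt dx dy.
    have ix : I x by apply: in_seg is_ it sx _; lra.
    move=> Pxc; exfalso; apply: (Pasym ic ix Pxc).
    apply: H => //; rewrite ?subrr ?normr0//.
    by rewrite ltr_norml; apply/andP; split; lra.
  move=> _; apply: H => //; rewrite ?subrr ?normr0//.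
    by apply: in_seg is_ it _ yt; lra.
  by rewrite ltr_norml; apply/andP; split; lra.
by case: h => -[h1 h2]; [exact: (Pasym it ic (Q1 h1))|exact: (Pasym ic it (Q2 h1))].
Qed.

Definition ginj s t := forall x y, s <= x <= t -> s <= y <= t -> g x = g y -> x = y.

(** In any other order of the three points, [rel_ivt] makes g take the value g r on [s, t] or the
    value g s on [t, r]. *)
Lemma inj_tri s t r : I s -> I r -> s < t -> t < r -> ginj s r ->
  (P s t -> P t r) /\ (P t s -> P r t).
Proof.
move=> is_ ir st tr inj; have it : I t by apply: in_seg is_ ir _ _; exact: ltW.
have h1 : s <= s <= r by lra. have h2 : s <= t <= r by lra. have h3 : s <= r <= r by lra.
have n1 : g t <> g r by move=> /(inj _ _ h2 h3) e; lra.
have n2 : g s <> g r by move=> /(inj _ _ h1 h3) e; lra.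
have K1 : (P s r /\ P r t) \/ (P r s /\ P t r) -> False.
  move=> h; have [q /andP[sq qt] e] := rel_ivt ir is_ it (ltW st) h.
  by have h4 : s <= q <= r by [lra]; have := inj _ _ h4 h3 e; lra.
have K2 : (P t s /\ P s r) \/ (P s t /\ P r s) -> False.
  move=> h; have [q /andP[tq qr] e] := rel_ivt is_ it ir (ltW tr) h.
  by have h4 : s <= q <= r by [lra]; have := inj _ _ h4 h1 e; lra.
split=> h.
  have [//|h'] := Ptot it ir n1; have [h''|h''] := Ptot is_ ir n2; exfalso.
    by apply: K1; left.
  by apply: K2; right.
have [h'|//] := Ptot it ir n1; have [h''|h''] := Ptot is_ ir n2; exfalso.
  by apply: K2; left.
by apply: K1; right.
Qed.

Lemma inj_ends s r x y : I s -> I r -> s <= x -> x < y -> y <= r -> ginj s r ->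
  (P x y -> P s r) /\ (P y x -> P r s).
Proof.
move=> is_ ir sx xy yr inj.
have ix : I x by apply: in_seg is_ ir _ _; lra.
have iy : I y by apply: in_seg is_ ir _ _; lra.
have inj1 : ginj s y by move=> p q h1 h2; apply: inj; lra.
have inj2 : ginj x r by move=> p q h1 h2; apply: inj; lra.
have nsx : s <> x -> g s <> g x by move=> n e; apply: n; apply: inj e; lra.
split=> h.
  have h1 : P x r.
    have [->//|yr'] := eqVneq r y; have {}yr : y < r by rewrite lt_neqAle eq_sym yr'.
    by apply: (Ptrans ix iy ir h); exact: (inj_tri ix ir xy yr inj2).1.
  have [<-//|sx'] := eqVneq x s; have {}sx : s < x by rewrite lt_neqAle eq_sym sx'.
  apply: (Ptrans is_ ix ir _ h1); have [//|h2] : P s x \/ P x s.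
    by apply: Ptot => //; apply: nsx => e; move: sx; rewrite e ltxx.
  by case: (Pasym ix iy h); exact: (inj_tri is_ iy sx xy inj1).2.
have h1 : P r x.
  have [->//|yr'] := eqVneq r y; have {}yr : y < r by rewrite lt_neqAle eq_sym yr'.
  by apply: (Ptrans ir iy ix _ h); exact: (inj_tri ix ir xy yr inj2).2.
have [<-//|sx'] := eqVneq x s; have {}sx : s < x by rewrite lt_neqAle eq_sym sx'.
apply: (Ptrans ir ix is_ h1); have [h2|//] : P s x \/ P x s.
  by apply: Ptot => //; apply: nsx => e; move: sx; rewrite e ltxx.
by case: (Pasym iy ix h); exact: (inj_tri is_ iy sx xy inj1).1.
Qed.

Lemma ginj_neq s r x y : ginj s r -> s <= x -> x < y -> y <= r -> g x <> g y.
Proof.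
move=> inj sx xy yr e; have ix : s <= x <= r by rewrite sx (le_trans (ltW xy)).
have iy : s <= y <= r by rewrite yr (le_trans sx (ltW xy)).
by move: xy; rewrite (inj x y ix iy e) ltxx.
Qed.

Lemma span_lt (x x' y y' t d : R) : `|x - t| < d / 2 -> `|y - t| < d / 2 -> `|x' - t| < d / 2 ->
  `|y' - t| < d / 2 -> Num.max y y' - Num.min x x' < d.
Proof.
rewrite !ltr_norml => /andP[? ?] /andP[? ?] /andP[? ?] /andP[? ?].
by case: (leP x x') => _; case: (leP y y') => _; lra.
Qed.

Lemma dist_in_seg (s r p q d : R) : s <= p -> p <= r -> s <= q -> q <= r -> r - s < d -> `|p - q| < d.
Proof. by move=> ? ? ? ? ?; rewrite ltr_norml; lra. Qed.

Lemma two_near (l r q d : R) : l <= q <= r -> l < r -> 0 < d ->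
  exists p p', [/\ l <= p <= r, l <= p' <= r, p < p', `|p - q| < d / 4 & `|p' - q| < d / 4].
Proof.
move=> /andP[lq qr] lr d0; have [rq|qr'] := leP r q.
  exists (Num.max l (q - d / 8)), q.
  have l1 : l <= Num.max l (q - d / 8) by rewrite le_max lexx.
  have l2 : Num.max l (q - d / 8) < q by rewrite gt_max; lra.
  have l3 : q - d / 8 <= Num.max l (q - d / 8) by rewrite le_max lexx orbT.
  by rewrite subrr normr0 !ltr_norml; split; lra.
exists q, (Num.min r (q + d / 8)).
have l1 : Num.min r (q + d / 8) <= r by rewrite ge_min lexx.
have l2 : q < Num.min r (q + d / 8) by rewrite lt_min; lra.
have l3 : Num.min r (q + d / 8) <= q + d / 8 by rewrite ge_min lexx orbT.
by rewrite subrr normr0 !ltr_norml; split; lra.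
Qed.

Lemma near_tri (z r q d : R) : `|r - q| < d / 8 -> `|z - q| < d / 4 -> `|z - r| < d / 2.
Proof. by rewrite !ltr_norml => /andP[? ?] /andP[? ?]; lra. Qed.

Lemma unif_linj : u <= v -> exists2 d : R, 0 < d & forall s t, I s -> I t -> `|s - t| < d -> g s = g t -> s = t.
Proof.
move=> uv; pose Q s s' := exists2 d : R, 0 < d & forall t t', s <= t <= s' -> s <= t' <= s' -> `|t - t'| < d ->
    g t = g t' -> t = t'.
apply: (@seg_ind _ u v Q uv).
  move=> t tuv; have [d d0 H] := linj tuv; exists d => // s s' us st ts s'v h1 h2.
  exists 1 => // x x' /andP[sx xs'] /andP[sx' xs'x] _.
  have [? ?] := seg_near us s'v h1 h2 sx xs'; have [? ?] := seg_near us s'v h1 h2 sx' xs'x; exact: H.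
move=> s m s' us sm ms' s'v [d1 p1 H1] [d2 p2 H2].
have muv : u <= m <= v by rewrite (le_trans us sm) (le_trans ms' s'v).
have [d d0 H] := linj muv.
exists (Num.min d (Num.min d1 d2)); first by rewrite !lt_min d0 p1.
have W x x' : x <= x' -> s <= x <= s' -> s <= x' <= s' -> `|x - x'| < Num.min d (Num.min d1 d2) ->
    g x = g x' -> x = x'.
  rewrite !lt_min => xx' /andP[sx xs'] /andP[sx' xs'x] /and3P[l0 l1 l2].
  have [x'm|mx'] := leP x' m; first by apply: H1; rewrite // ?sx ?sx' ?x'm ?(le_trans xx' x'm).
  have [mx|xm] := leP m x; first by apply: H2; rewrite // ?mx ?xs' ?xs'x ?(ltW mx').
  have [n1 n2] := mid_near (ltW xm) (ltW mx') l0.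
  apply: H => //; first by rewrite (le_trans us sx) (le_trans xs' s'v).
  by rewrite (le_trans us sx') (le_trans xs'x s'v).
move=> x x' xs xs' xx e; have [le|lt] := leP x x'; first exact: W.
by symmetry; apply: W => //; [exact: ltW | rewrite distrC].
Qed.

(** Iterates of an arc are only locally injective. On intervals shorter than d one pair decides the
    direction, overlapping intervals share a pair, and transitivity extends the direction to the
    whole segment. *)
Lemma linj_monotone : (forall s t, I s -> I t -> s < t -> P s t) \/
  (forall s t, I s -> I t -> s < t -> P t s).
Proof.
have [vu|uv] := leP v u; first by left => s t; lra.
have [d d0 D] := unif_linj (ltW uv).
pose up t := forall x y, I x -> I y -> `|x - t| < d / 2 -> `|y - t| < d / 2 -> x < y -> P x y.
have updn t x y : ~ up t -> I x -> I y -> `|x - t| < d / 2 -> `|y - t| < d / 2 -> x < y -> P y x.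
  move=> nu ix iy dx dy xy.
  have [x' [y' [ix' [iy' [dx' [dy' [xy' nP]]]]]]] : exists x' y', I x' /\ I y' /\ `|x' - t| < d / 2 /\
      `|y' - t| < d / 2 /\ x' < y' /\ ~ P x' y'.
    apply: contrapT => no; apply: nu => x' y' ix' iy' dx' dy' xy'; apply: contrapT => nP.
    by apply: no; exists x', y'.
  pose s := Num.min x x'; pose r := Num.max y y'.
  have is_ : I s by rewrite /s; case: (leP x x').
  have ir : I r by rewrite /r; case: (leP y y').
  have sx : s <= x by rewrite ge_min lexx.
  have sx' : s <= x' by rewrite ge_min lexx orbT.
  have yr : y <= r by rewrite le_max lexx.
  have yr' : y' <= r by rewrite le_max lexx orbT.
  have sr : r - s < d.
    exact: (span_lt dx dy dx' dy').
  have inj : ginj s r.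
    move=> p q /andP[p1 p2] /andP[q1 q2]; apply: D; [exact: in_seg is_ ir p1 p2|exact: in_seg is_ ir q1 q2|].
    exact: (dist_in_seg p1 p2 q1 q2 sr).
  have E1 := inj_ends is_ ir sx xy yr inj; have E2 := inj_ends is_ ir sx' xy' yr' inj.
  have n1 : g x' <> g y' by exact: (ginj_neq inj sx' xy' yr').
  have n2 : g x <> g y by exact: (ginj_neq inj sx xy yr).
  have [//|h] := Ptot ix' iy' n1; have [h'|//] := Ptot ix iy n2.
  by case: (Pasym is_ ir (E1.1 h')); exact: E2.2.
have const : forall s t, I s -> I t -> s <= t -> (up s <-> up t).
  move=> s t is_ it st; apply: (@seg_ind _ s t (fun x y => up x <-> up y) st); last first.
    by move=> x m y _ _ _ _ [h1 h1'] [h2 h2']; split=> h; [exact: h2 (h1 h)|exact: h1' (h2' h)].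
  move=> q /andP[sq qt]; have iq := in_seg is_ it sq qt; exists (d / 8); first lra.
  move=> x y sx xq qy yt dx dy.
  have [p [p' [ip ip' pp' np np']]] := two_near iq uv d0.
  have [_ dx'] := seg_near (lexx x) (lexx y) dx dy (lexx x) (le_trans xq qy).
  have [_ dy'] := seg_near (lexx x) (lexx y) dx dy (le_trans xq qy) (lexx y).
  have sub z r : `|r - q| < d / 8 -> `|z - q| < d / 4 -> `|z - r| < d / 2 by exact: near_tri.
  split=> h; apply: contrapT => nu.
    apply: (Pasym ip ip' (h p p' ip ip' (sub _ _ dx' np) (sub _ _ dx' np') pp')).
    exact: updn nu ip ip' (sub _ _ dy' np) (sub _ _ dy' np') pp'.
  apply: (Pasym ip ip' (h p p' ip ip' (sub _ _ dy' np) (sub _ _ dy' np') pp')).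
  exact: updn nu ip ip' (sub _ _ dx' np) (sub _ _ dx' np') pp'.
have iu : I u by lra.
have [uu|nuu] := pselect (up u); [left|right] => s t is_ it st.
  apply: (@seg_ind _ s t (fun x y => x < y -> P x y) (ltW st)) st.
    move=> q /andP[sq qt]; have iq := in_seg is_ it sq qt; exists (d / 2); first lra.
    move=> x y sx xq qy yt dx dy xy.
    have : up q by apply: (const u q iu iq _).1 uu; have /andP[] := iq.
    have [? ?] := seg_near (lexx x) (lexx y) dx dy (lexx x) (le_trans xq qy).
    have [? ?] := seg_near (lexx x) (lexx y) dx dy (le_trans xq qy) (lexx y).
    by apply=> //; apply: in_seg is_ it _ _ => //; [apply: le_trans xq (le_trans qy yt)|apply: le_trans sx (le_trans xq qy)].
  move=> x m y sx xm my yt h1 h2 xy.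
  have im : I m := in_seg is_ it (le_trans sx xm) (le_trans my yt).
  have ix : I x := in_seg is_ it sx (le_trans xm (le_trans my yt)).
  have iy : I y := in_seg is_ it (le_trans sx (le_trans xm my)) yt.
  have [e|n] := eqVneq x m; first by rewrite e; apply: h2; rewrite -e.
  have [e|n'] := eqVneq m y; first by rewrite -e; apply: h1; rewrite e.
  by apply: (Ptrans ix im iy); [apply: h1|apply: h2]; rewrite lt_neqAle ?n ?n'.
apply: (@seg_ind _ s t (fun x y => x < y -> P y x) (ltW st)) st.
  move=> q /andP[sq qt]; have iq := in_seg is_ it sq qt; exists (d / 2); first lra.
  move=> x y sx xq qy yt dx dy xy.
  have nu : ~ up q by move=> h; apply: nuu; apply: (const u q iu iq _).2 h; have /andP[] := iq.
  have [? ?] := seg_near (lexx x) (lexx y) dx dy (lexx x) (le_trans xq qy).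
  have [? ?] := seg_near (lexx x) (lexx y) dx dy (le_trans xq qy) (lexx y).
  by apply: updn nu _ _ _ _ xy => //; apply: in_seg is_ it _ _ => //; [apply: le_trans xq (le_trans qy yt)|apply: le_trans sx (le_trans xq qy)].
move=> x m y sx xm my yt h1 h2 xy.
have im : I m := in_seg is_ it (le_trans sx xm) (le_trans my yt).
have ix : I x := in_seg is_ it sx (le_trans xm (le_trans my yt)).
have iy : I y := in_seg is_ it (le_trans sx (le_trans xm my)) yt.
have [e|n] := eqVneq x m; first by rewrite e; apply: h2; rewrite -e.
have [e|n'] := eqVneq m y; first by rewrite -e; apply: h1; rewrite e.
by apply: (Ptrans iy im ix); [apply: h2|apply: h1]; rewrite lt_neqAle ?n ?n'.
Qed.

End Monotone.

Section Speed.
Variables (R : realType) (a : R[i]) (M : R).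
Hypothesis hM : 100 * 20 + nm a <= M.
Implicit Types (z w x y : R[i]) (t h : R).
Notation f := (expmap a).
Notation orb := (orb a).

Definition nearI (B : R) x y := forall n, `|Imz (orb n x) - Imz (orb n y)| <= B.

Lemma nearI_sym B x y : nearI B x y -> nearI B y x.
Proof. by move=> h n; rewrite distrC. Qed.

Lemma nearI_le B B' x y : B <= B' -> nearI B x y -> nearI B' x y.
Proof. by move=> h h' n; exact: le_trans (h' n) h. Qed.

(** One lead of 1 at one time is enough: by [speed_step] it turns into a lead of 100 at all later
    times when the orbits stay to the right of M and their imaginary parts are close. *)
Definition slower x y := exists n, Rez (orb n x) + 1 <= Rez (orb n y).

Lemma speed_step n x y : M <= Rez (orb n.+1 x) -> M <= Rez (orb n.+1 y) ->
  `|Imz (orb n.+1 x) - Imz (orb n.+1 y)| <= 20 -> Rez (orb n x) + 1 <= Rez (orb n y) ->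
  Rez (orb n.+1 x) + 100 <= Rez (orb n.+1 y).
Proof.
move=> hx hy hi hr; have := @growth _ a 20 (orb n x) (orb n y).
rewrite -!orbS => /(_ _ _ _ hi hr) h.
have : 100 * 20 <= expR (Rez (orb n y)).
  by apply: (@fRe_ge _ a); rewrite -orbS; have := hM; lra.
by have := hM; have := h _ _ _; rewrite ?ler1n//; lra.
Qed.

Lemma slower_later m n x y : inJ a M x -> inJ a M y -> nearI 20 x y -> (n <= m)%N ->
  Rez (orb n x) + 1 <= Rez (orb n y) -> Rez (orb m x) + 1 <= Rez (orb m y).
Proof.
move=> xJ yJ hI /subnK <-; elim: (m - n)%N => // k IH h; rewrite addSn.
have := speed_step (xJ _) (yJ _) (hI (k + n).+1) (IH h); lra.
Qed.

Lemma slower_gap x y : inJ a M x -> inJ a M y -> nearI 20 x y -> slower x y ->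
  exists N, forall n, (N <= n)%N -> Rez (orb n x) + 100 <= Rez (orb n y).
Proof.
move=> xJ yJ hI [N h]; exists N.+1 => -[//|n] Nn.
exact: speed_step (xJ n.+1) (yJ n.+1) (hI n.+1) (slower_later xJ yJ hI (Nn : (N <= n)%N) h).
Qed.

Lemma slower_Re k x y : inJ a M x -> inJ a M y -> nearI 20 x y -> slower x y ->
  Rez (orb k x) - 1 < Rez (orb k y).
Proof.
move=> xJ yJ hI s; rewrite ltNge; apply/negP => h.
have h' : Rez (orb k y) + 1 <= Rez (orb k x) by lra.
have [N H] := slower_gap xJ yJ hI s.
have := slower_later yJ xJ (nearI_sym hI) (leq_maxr N k) h'.
have := H _ (leq_maxl N k); lra.
Qed.

Lemma slower_asym x y : inJ a M x -> inJ a M y -> nearI 20 x y -> slower x y -> ~ slower y x.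
Proof.
by move=> xJ yJ hI s [k h]; have := slower_Re k xJ yJ hI s; lra.
Qed.

Lemma slower_trans x y z : inJ a M x -> inJ a M y -> inJ a M z -> nearI 20 x y -> nearI 20 y z ->
  slower x y -> slower y z -> slower x z.
Proof.
move=> xJ yJ zJ h1 h2 /(slower_gap xJ yJ h1)[N1 H1] /(slower_gap yJ zJ h2)[N2 H2].
exists (maxn N1 N2); have := H1 _ (leq_maxl N1 N2); have := H2 _ (leq_maxr N1 N2); lra.
Qed.

Lemma slower_open x y : inJ a M x -> inJ a M y -> nearI 20 x y -> slower x y ->
  exists2 e, 0 < e & forall x' y', nm (x' - x) < e -> nm (y' - y) < e -> slower x' y'.
Proof.
move=> xJ yJ hI /(slower_gap xJ yJ hI)[N /(_ N (leqnn N)) h].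
have [e1 p1 H1] := orb_cts a N x (ltr01 : 0 < 1 :> R).
have [e2 p2 H2] := orb_cts a N y (ltr01 : 0 < 1 :> R).
exists (Num.min e1 e2); first by rewrite lt_min p1.
move=> x' y'; rewrite !lt_min => /andP[h1 _] /andP[_ h2]; exists N.
have := H1 _ h1; have := H2 _ h2.
have := Re_le (orb N x' - orb N x); have := Re_ge (orb N y' - orb N y); rewrite !ReB; lra.
Qed.

(** A distance that stays bounded under expansion by a factor above 1 is 0. *)
Lemma close_eq (c : R) x y : inJ a M x -> inJ a M y -> nearI pi x y ->
  (forall n, `|Rez (orb n x) - Rez (orb n y)| <= c) -> x = y.
Proof.
move=> xJ yJ hI hR.
have step n k : nm (orb k x - orb k y) <= nm (orb (n + k) x - orb (n + k) y) / 2 ^+ n.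
  elim: n => [|n IH]; first by rewrite expr0 divr1.
  apply: le_trans IH _; rewrite exprS invfM mulrA ler_wpM2r ?invr_ge0 ?exprn_ge0//.
  apply: le_trans (_ : nm (orb (n.+1 + k) x - orb (n.+1 + k) y) / 25 <= _).
    by apply: contraction (hI _); have := hM; have := xJ (n + k).+1; have := yJ (n + k).+1; rewrite orbS; lra.
  by rewrite ler_wpM2l ?nm_ge0// lef_pV2 ?posrE//; lra.
apply/eqP; rewrite -subr_eq0 -nm_eq0 eq_le nm_ge0 andbT.
apply: (@le0_half_pow _ (c + pi)) => n; apply: le_trans (step n 0%N) _.
rewrite addn0 ler_wpM2r ?invr_ge0 ?exprn_ge0//; apply: le_trans (nm_ReIm _) _.
by rewrite ReB ImB lerD// hI.
Qed.

Lemma slower_total x y : inJ a M x -> inJ a M y -> nearI pi x y -> x <> y -> slower x y \/ slower y x.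
Proof.
move=> xJ yJ hI ne; apply: contrapT => /not_orP[n1 n2]; apply: ne.
apply: (@close_eq 1) => // n; rewrite ler_norml; apply/andP; split; rewrite leNgt; apply/negP => h.
  by apply: n1; exists n; lra.
by apply: n2; exists n; lra.
Qed.

(** If the imaginary part varied by more than pi, it would take two values m and m + pi, at which
    the cosine has opposite signs. *)
Lemma path_strip (u v : R) (g : R -> R[i]) : u <= v -> pcont u v g ->
  (forall t, u <= t <= v -> 0 < Rez (cexp (g t))) ->
  forall s t, u <= s <= v -> u <= t <= v -> `|Imz (g s) - Imz (g t)| <= pi.
Proof.
move=> uv gc pos.
have W s t : u <= s -> s <= t -> t <= v -> `|Imz (g s) - Imz (g t)| <= pi.
  move=> us st tv; rewrite leNgt; apply/negP => h.
  have gc' : pcont s t g by apply: pcont_sub gc.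
  have key c : Num.min (Imz (g s)) (Imz (g t)) <= c -> c <= Num.max (Imz (g s)) (Imz (g t)) ->
      exists2 q, u <= q <= v & Imz (g q) = c.
    move=> c1 c2; have [le|lt] := leP (Imz (g s)) (Imz (g t)).
      move: c1 c2; rewrite min_l// max_r// => c1 c2.
      have [q q1 q2] := pcont_ivt st gc' (@Im_lip R) c1 c2; exists q => //; lra.
    move: c1 c2; rewrite min_r ?max_l ?(ltW lt)// => c1 c2.
    have [|||q q1 /oppr_inj q2] := @pcont_ivt _ s t g (fun z => - Imz z) (- c) st gc'.
    - by move=> z w; rewrite -opprD normrN -ImB Im_nm.
    - by rewrite lerN2.
    - by rewrite lerN2.
    - by exists q => //; lra.
  pose m := Num.min (Imz (g s)) (Imz (g t)).
  have mM : m + pi <= Num.max (Imz (g s)) (Imz (g t)).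
    rewrite /m; move: h; case: (leP (Imz (g s)) (Imz (g t))) => l.
      by rewrite ler0_norm; lra.
    by rewrite gtr0_norm; lra.
  have mp : m <= m + pi by rewrite lerDl pi_ge0.
  have [q0 i0 e0] := key m (lexx _) (le_trans mp mM).
  have [q1 i1 e1] := key (m + pi) mp mM.
  have := pos _ i0; have := pos _ i1; rewrite !Re_cexp e0 e1 cosDpi.
  have := expR_gt0 (Rez (g q0)); have := expR_gt0 (Rez (g q1)); nra.
move=> s t /andP[us sv] /andP[ut tv]; have [st|ts] := leP s t; first exact: W.
by rewrite distrC; apply: W => //; exact: ltW.
Qed.

Lemma path_nearI (u v : R) (g : R -> R[i]) : u <= v -> pcont u v g ->
  (forall t, u <= t <= v -> inJ a M (g t)) ->
  forall s t, u <= s <= v -> u <= t <= v -> nearI pi (g s) (g t).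
Proof.
move=> uv gc gJ s t is_ it n; apply: (path_strip uv (pcont_orb a n gc)) => // q iq.
rewrite -(expmapB a); exact: (Re_subl_pos hM (gJ q iq n.+1)).
Qed.

Definition loc_inj (u v : R) (g : R -> R[i]) := forall t, u <= t <= v -> exists2 d : R, 0 < d &
  forall s s', u <= s <= v -> u <= s' <= v -> `|s - t| < d -> `|s' - t| < d -> g s = g s' -> s = s'.

Lemma nearI_pi20 x y : nearI pi x y -> nearI 20 x y.
Proof. by apply: nearI_le; have := pi_le4 R; lra. Qed.

Lemma path_monotone (u v : R) (g : R -> R[i]) : pcont u v g ->
  (forall t, u <= t <= v -> inJ a M (g t)) -> loc_inj u v g ->
  (forall s t, u <= s <= v -> u <= t <= v -> s < t -> slower (g s) (g t)) \/
  (forall s t, u <= s <= v -> u <= t <= v -> s < t -> slower (g t) (g s)).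
Proof.
move=> gc gJ li; have [vu|uv] := ltP v u; first by left => s t; lra.
have nI s t is_ it := nearI_pi20 (@path_nearI u v g uv gc gJ s t is_ it).
apply: (@linj_monotone R u v _ g (fun s t => slower (g s) (g t))) => //.
- move=> s t is_ it /(slower_open (gJ s is_) (gJ t it) (nI _ _ is_ it))[e e0 H].
  have [d1 p1 H1] := gc s is_ e e0; have [d2 p2 H2] := gc t it e e0.
  exists (Num.min d1 d2); first by rewrite lt_min p1.
  by move=> s' t' is' it'; rewrite !lt_min => /andP[h1 _] /andP[_ h2]; apply: H; [exact: H1|exact: H2].
- move=> s t is_ it; apply: slower_total; [exact: gJ|exact: gJ|exact: path_nearI gc gJ _ _ is_ it].
- move=> r s t ir is_ it; apply: slower_trans; by [exact: gJ|exact: nI].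
- move=> s t is_ it; apply: slower_asym; by [exact: gJ|exact: nI].
Qed.

End Speed.

(** * Continuous logarithms *)

Section ContinuousLog.
Variable R : realType.
Implicit Types (z w p q : R[i]) (s t u v : R) (D : R[i] -> Prop) (F L : R[i] -> R[i]).

Definition ccont D F := forall p, D p -> forall e : R, 0 < e -> exists2 d : R, 0 < d &
  forall q, D q -> nm (q - p) < d -> nm (F q - F p) < e.

Definition cclosed D := forall z, (forall e : R, 0 < e -> exists2 w, D w & nm (w - z) < e) -> D z.

Lemma cbolzano_in D (r : R) (un : nat -> R[i]) : (forall z, D z -> nm z <= r) -> cclosed D ->
  (forall n, D (un n)) -> exists2 z, D z & forall e : R, 0 < e -> forall N, exists2 n, (N <= n)%N & nm (un n - z) < e.
Proof.
move=> bD cD Du; have [z hz] := @cbolzano _ un r (fun n => bD _ (Du n)).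
exists z => //; apply: cD => e e0; have [n _ hn] := hz e e0 0%N; by exists (un n).
Qed.

Lemma ccont_unif D (r : R) F : (forall z, D z -> nm z <= r) -> cclosed D -> ccont D F ->
  forall e : R, 0 < e -> exists2 d : R, 0 < d & forall p q, D p -> D q -> nm (p - q) < d -> nm (F p - F q) < e.
Proof.
move=> bD cD cF e e0; apply: contrapT => no.
have ex (n : nat) : exists pq : R[i] * R[i], [/\ D pq.1, D pq.2, nm (pq.1 - pq.2) < n.+1%:R^-1 & e <= nm (F pq.1 - F pq.2)].
  apply: contrapT => no'; apply: no; exists n.+1%:R^-1; first by rewrite invr_gt0.
  move=> p q Dp Dq pq; rewrite ltNge; apply/negP => le; apply: no'; by exists (p, q).
have [pq hpq] := choice ex.
have [z Dz hz] := @cbolzano_in D r (fun n => (pq n).1) bD cD (fun n => let: And4 h _ _ _ := hpq n in h).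
have e2 : 0 < e / 2 by lra.
have [d d0 H] := cF z Dz _ e2.
have d2 : 0 < d / 2 by lra.
have [N hN] : exists N : nat, (2 / d) < N%:R by exists (Num.truncn (2 / d)).+1; exact: truncnS_gt.
have [n Nn hn] := hz _ d2 N; have [D1 D2 h12 hF] := hpq n.
have nd : n.+1%:R^-1 <= d / 2.
  rewrite -[leRHS]invrK lef_pV2 ?posrE ?invr_gt0// invf_div ltW//; apply: lt_trans hN _.
  by rewrite ltr_nat.
have h1 := H _ D1; have h2 := H _ D2; have h3 := lt_le_trans h12 nd.
have l1 : nm ((pq n).1 - z) < d by lra.
have l2 : nm ((pq n).2 - z) < d.
  by apply: le_lt_trans (nm_triB _ (pq n).1 _) _; rewrite (nmB (pq n).2); lra.
have := nm_triB (F (pq n).1) (F z) (F (pq n).2); rewrite (nmB (F z)).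
by have := h1 l1; have := h2 l2; lra.
Qed.

Lemma ccont_gap D (r : R) F : (forall z, D z -> nm z <= r) -> cclosed D -> ccont D F ->
  (forall z, D z -> F z != 0) -> exists2 m : R, 0 < m & forall z, D z -> m <= nm (F z).
Proof.
move=> bD cD cF F0; apply: contrapT => no.
have ex (n : nat) : exists p : R[i], D p /\ nm (F p) < n.+1%:R^-1.
  apply: contrapT => no'; apply: no; exists n.+1%:R^-1; first by rewrite invr_gt0.
  by move=> p Dp; rewrite leNgt; apply/negP => le; apply: no'; exists p.
have [un hu] := choice ex.
have [z Dz hz] := @cbolzano_in D r un bD cD (fun n => (hu n).1).
have n0 : 0 < nm (F z) / 2 by rewrite divr_gt0// nm_gt0 F0.
have [d d0 H] := cF z Dz _ n0.
have [N hN] : exists N : nat, (nm (F z) / 2)^-1 < N%:R by exists (Num.truncn (nm (F z) / 2)^-1).+1; exact: truncnS_gt.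
have [n Nn hn] := hz _ d0 N; have := H _ (hu n).1 hn; have : nm (F (un n)) < nm (F z) / 2.
  apply: lt_le_trans (hu n).2 _.
  by rewrite -[leRHS]invrK lef_pV2 ?posrE ?invr_gt0// ltW//; apply: lt_trans hN _; rewrite ltr_nat.
have := nm_subl (F z) (F (un n)); rewrite nmB; lra.
Qed.

Lemma plog_lip z w : nm (z - 1) <= 1 / 2 -> nm (w - 1) <= 1 / 2 ->
  nm (plog z - plog w) <= 8 * nm (z - w).
Proof.
move=> hz hw.
have rz : 0 < Rez z by have := Re_ge (z - 1); rewrite ReB /=; lra.
have rw : 0 < Rez w by have := Re_ge (w - 1); rewrite ReB /=; lra.
have z0 : z != 0 by apply: contraTneq rz => ->; rewrite ltxx.
have w0 : w != 0 by apply: contraTneq rw => ->; rewrite ltxx.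
have hI : `|Imz (plog z) - Imz (plog w)| <= pi.
  by apply: le_trans (ler_normB _ _) _; have := parg_lt rz; have := parg_lt rw; lra.
have := cexp_expand hI; rewrite -!nm_cexp !plogK//.
have : 1 / 2 <= Num.min (nm z) (nm w).
  by rewrite le_min; have := nm_subl 1 z; have := nm_subl 1 w; rewrite nm1 !(nmB 1); lra.
have := nm_ge0 (plog z - plog w); nra.
Qed.

(** Cut the ray from 0 to z so finely that successive values of F have quotients within 1/2 of 1.
    The sum of the principal logarithms of these quotients telescopes, and it is continuous in z. *)
Lemma starlog D (r : R) F : (forall z, D z -> nm z <= r) -> cclosed D -> D 0 ->
  (forall z s, D z -> 0 <= s <= 1 -> D (s%:C * z)) -> ccont D F -> (forall z, D z -> F z != 0) ->
  exists2 L, ccont D L & forall z, D z -> cexp (L z) = F z.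
Proof.
move=> bD cD D0 sD cF F0.
have [m m0 hm] := ccont_gap bD cD cF F0.
have m2 : 0 < m / 2 by lra.
have [d d0 hd] := ccont_unif bD cD cF m2.
have [n hn] : exists n : nat, `|r| / d < n.+1%:R by exists (Num.truncn (`|r| / d)); exact: truncnS_gt.
pose pt (k : nat) z : R[i] := (k%:R / n.+1%:R)%:C * z.
have Dpt k z : (k <= n.+1)%N -> D z -> D (pt k z).
  move=> kn Dz; apply: sD => //; rewrite divr_ge0//= ler_pdivrMr ?ltr0n// mul1r ler_nat//.
pose q k z := F (pt k.+1 z) / F (pt k z).
have qn k z : (k <= n)%N -> D z -> nm (q k z - 1) <= 1 / 2.
  move=> kn Dz; have D1 := Dpt k z (leqW kn) Dz; have D2 := Dpt k.+1 z kn Dz.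
  have n0 := F0 _ D1; have -> : q k z - 1 = (F (pt k.+1 z) - F (pt k z)) / F (pt k z).
    by rewrite mulrBl divff.
  rewrite nmM nmV ler_pdivrMr ?nm_gt0//; have := hm _ D1.
  have := hd _ _ D2 D1; have : nm (pt k.+1 z - pt k z) < d; last by move=> h /(_ h); lra.
  have -> : pt k.+1 z - pt k z = (n.+1%:R^-1)%:C * z.
    by rewrite /pt -mulrBl -rmorphB -mulrBl /= -natr1 addrAC subrr add0r mul1r.
  rewrite nmM nmR ger0_norm ?invr_ge0// mulrC ltr_pdivrMr//.
  apply: le_lt_trans (bD z Dz) _; apply: le_lt_trans (ler_norm _) _.
  by rewrite mulrC -ltr_pdivrMr.
pose LS := fix LS (k : nat) z : R[i] := match k with 0 => plog (F 0) | k'.+1 => LS k' z + plog (q k' z) end.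
have cpt k : (k <= n.+1)%N -> ccont D (fun z => F (pt k z)).
  move=> kn z Dz e e0; have [d' p' H] := cF _ (Dpt k z kn Dz) e e0; exists d' => // w Dw h.
  apply: H; first exact: Dpt.
  rewrite /pt -mulrBr nmM nmR; apply: le_lt_trans h; rewrite ler_piMl ?nm_ge0//.
  rewrite ger0_norm ?divr_ge0// ler_pdivrMr ?ltr0n// mul1r ler_nat//.
have cq k : (k <= n)%N -> ccont D (q k).
  move=> kn z Dz e e0.
  have D1 := Dpt k z (leqW kn) Dz; have D2 := Dpt k.+1 z kn Dz.
  pose A := nm (F (pt k z)); pose B := nm (F (pt k.+1 z)).
  have A0 : 0 < A by rewrite nm_gt0 F0.
  have B0 : 0 <= B := nm_ge0 _.
  have ee : 0 < e * (m * A) / (2 * (A + B + 1)) by rewrite divr_gt0 ?mulr_gt0//; lra.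
  have [d1 p1 H1] := cpt k (leqW kn) z Dz _ ee; have [d2 p2 H2] := cpt k.+1 kn z Dz _ ee.
  exists (Num.min d1 d2); first by rewrite lt_min p1.
  move=> w Dw; rewrite lt_min => /andP[/(H1 w Dw) h1 /(H2 w Dw) h2].
  have E1 := Dpt k w (leqW kn) Dw; have E2 := Dpt k.+1 w kn Dw.
  have -> : q k w - q k z = ((F (pt k.+1 w) - F (pt k.+1 z)) * F (pt k z) - F (pt k.+1 z) * (F (pt k w) - F (pt k z)))
     / (F (pt k w) * F (pt k z)).
    rewrite /q; field; by rewrite !F0.
  rewrite nmM nmV nmM -/A ltr_pdivrMr ?mulr_gt0// ?nm_gt0 ?F0//.
  apply: le_lt_trans (nmBs _ _) _; rewrite !nmM -/A -/B.
  set ep := e * (m * A) / _ in h1 h2 ee.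
  have hh : ep * A + B * ep < e * (m * A).
    have : ep * (2 * (A + B + 1)) = e * (m * A) by rewrite /ep divfK// gt_eqF//; lra.
    nra.
  have h3 : nm (F (pt k.+1 w) - F (pt k.+1 z)) * A <= ep * A by rewrite ler_wpM2r// ltW.
  have h4 : B * nm (F (pt k w) - F (pt k z)) <= B * ep by rewrite ler_wpM2l// ltW.
  have h5 : e * (m * A) <= e * (nm (F (pt k w)) * A).
    by rewrite ler_pM2l// ler_pM2r// hm.
  lra.
have key k : (k <= n.+1)%N -> ccont D (LS k) /\ forall z, D z -> cexp (LS k z) = F (pt k z).
  elim: k => [|k IH] kn.
    split=> [z Dz e e0|z Dz]; first by exists 1 => // w _ _; rewrite subrr nm0.
    have -> : pt 0%N z = 0 by rewrite /pt mul0r mul0r.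
    by rewrite [LS _ _]/= plogK ?F0.
  have [c1 c2] := IH (ltnW kn); split=> [z Dz e e0|z Dz].
    have e2 : 0 < e / 2 by lra. have e16 : 0 < e / 16 by lra.
    have [d1 p1 H1] := c1 z Dz _ e2; have [d2 p2 H2] := cq k kn z Dz _ e16.
    exists (Num.min d1 d2); first by rewrite lt_min p1.
    move=> w Dw; rewrite lt_min => /andP[/(H1 w Dw) h1 /(H2 w Dw) h2] /=.
    rewrite opprD addrACA; apply: le_lt_trans (nmD _ _) _.
    have := @plog_lip (q k w) (q k z) (qn _ _ kn Dw) (qn _ _ kn Dz); lra.
  rewrite /= cexpD c2// plogK; last first.
    by rewrite mulf_neq0 ?invr_neq0 ?F0//; apply: Dpt => //; exact: ltnW.
  by rewrite /q mulrCA mulfV ?mulr1// F0//; apply: Dpt => //; exact: ltnW.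
exists (LS n.+1); first exact: (key n.+1 (leqnn _)).1.
by move=> z Dz; rewrite (key n.+1 (leqnn _)).2// /pt divff ?mul1r// pnatr_eq0.
Qed.

Lemma pcont_log u v (g : R -> R[i]) : u <= v -> pcont u v g -> (forall t, u <= t <= v -> g t != 0) ->
  exists2 L : R -> R[i], pcont u v L & forall t, u <= t <= v -> cexp (L t) = g t.
Proof.
move=> uv gc g0.
have [<-|ne] := eqVneq u v.
  exists (fun _ => plog (g u)) => [t tuv e e0|t tuv].
    by exists 1 => // t' _ _; rewrite subrr nm0.
  have -> : t = u by lra.
  by rewrite plogK// g0// lexx.
have lt : 0 < v - u by rewrite subr_gt0 lt_neqAle ne.
pose D z := 0 <= Rez z <= 1 /\ Imz z = 0.
pose F z := g (u + (v - u) * Rez z).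
have DI z : D z -> u <= u + (v - u) * Rez z <= v by move=> [/andP[h1 h2] _]; nra.
have [||||||L cL hL] := @starlog D 1 F.
- by move=> z [/andP[h1 h2] h3]; apply: le_trans (nm_ReIm _) _; rewrite h3 normr0 addr0 ger0_norm.
- move=> z h; split.
    apply/andP; split; rewrite leNgt; apply/negP => l.
      have [|w [/andP[w1 w2] _] hw] := h (- Rez z); first lra.
      by have := Re_le (w - z); rewrite ReB; lra.
    have [|w [/andP[w1 w2] _] hw] := h (Rez z - 1); first lra.
    by have := Re_ge (w - z); rewrite ReB; lra.
  apply/eqP; rewrite -normr_eq0 eq_le normr_ge0 andbT leNgt; apply/negP => l.
  have [w [_ w0] hw] := h _ l; have := Im_nm (w - z); rewrite ImB w0 sub0r normrN; lra.
- by split; rewrite /= ?lexx ?ler01.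
- move=> z s [/andP[h1 h2] h3] /andP[s0 s1]; split; last by rewrite ImM /= h3; ring.
  rewrite ReM /= h3; nra.
- move=> z Dz e e0; have [d d0 H] := gc _ (DI z Dz) e e0.
  exists (d / (v - u)); first by rewrite divr_gt0.
  move=> w Dw h; apply: H; first exact: DI.
  rewrite (_ : _ - _ = (v - u) * Rez (w - z)); last by rewrite ReB; ring.
  rewrite normrM gtr0_norm// mulrC -ltr_pdivlMr//; exact: le_lt_trans (Re_nm _) h.
- by move=> z Dz; apply: g0; exact: DI.
pose c (t : R) : R[i] := ((t - u) / (v - u)) +i* 0.
have Dc t : u <= t <= v -> D (c t).
  move=> tuv; split => //=; rewrite divr_ge0 ?ler_pdivrMr//; lra.
have Fc t : F (c t) = g t by rewrite /F /c /= mulrC divfK ?gt_eqF// subrKC.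
exists (L \o c).
  move=> t tuv e e0; have [d d0 H] := cL _ (Dc t tuv) e e0.
  exists (d * (v - u)); first by rewrite mulr_gt0.
  move=> t' t'uv h; apply: H; first exact: Dc.
  rewrite /c (_ : _ - _ = ((t' - t) / (v - u)) +i* 0); last by apply: CP; rewrite ?Cri /=; ring.
  by rewrite nmR normrM normfV (gtr0_norm lt) ltr_pdivrMr.
by move=> t tuv; rewrite /= hL ?Fc//; exact: Dc.
Qed.

Lemma pcont_log_from u v (g : R -> R[i]) l : u <= v -> pcont u v g -> (forall t, u <= t <= v -> g t != 0) ->
  cexp l = g u ->
  exists L : R -> R[i], [/\ pcont u v L, forall t, u <= t <= v -> cexp (L t) = g t & L u = l].
Proof.
move=> uv gc g0 le; have [L cL hL] := pcont_log uv gc g0; exists (fun t => L t + (l - L u)); split.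
- move=> t tuv e e0; have [d d0 H] := cL t tuv e e0; exists d => // t' t'uv h.
  by rewrite opprD addrACA subrr addr0; exact: H.
- move=> t tuv; rewrite cexpD cexpB le !hL// ?lexx//.
  by rewrite divff ?mulr1// g0// lexx.
- by rewrite subrKC.
Qed.

(** The difference is a multiple of 2 pi i, hence locally constant. *)
Lemma log_unique u v (L L' : R -> R[i]) : u <= v -> pcont u v L -> pcont u v L' ->
  (forall t, u <= t <= v -> cexp (L t) = cexp (L' t)) -> L u = L' u -> L v = L' v.
Proof.
move=> uv c c' e; apply: (@seg_ind _ u v (fun x y => L x = L' x -> L y = L' y) uv); last by auto.
move=> t tuv; have [d d0 H] := c t tuv 1 ltr01; have [d' d'0 H'] := c' t tuv 1 ltr01.
exists (Num.min d d'); first by rewrite lt_min d0.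
move=> s s' us st ts s'v h1 h2 E.
have K x : u <= x <= v -> `|x - t| < Num.min d d' -> `|Imz (L x - L' x) - Imz (L t - L' t)| < 2.
  move=> xuv; rewrite lt_min => /andP[/(H x xuv) k1 /(H' x xuv) k2].
  have := Im_nm (L x - L t); have := Im_nm (L' x - L' t); rewrite !ImB => i1 i2.
  rewrite (_ : _ - _ = (Imz (L x) - Imz (L t)) - (Imz (L' x) - Imz (L' t))); last by ring.
  by apply: le_lt_trans (ler_normB _ _) _; lra.
have k1 : `|Imz (L s - L' s) - Imz (L t - L' t)| < 2 by apply: K; rewrite ?ltr_norml; lra.
have k2 : `|Imz (L s' - L' s') - Imz (L t - L' t)| < 2 by apply: K; rewrite ?ltr_norml; lra.
rewrite E subrr /= sub0r normrN in k1.
apply: cexp_inj; last by apply: e; lra.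
rewrite -ImB; have := ler_normD (Imz (L s' - L' s') - Imz (L t - L' t)) (Imz (L t - L' t)).
by rewrite subrK; have := pi_ge2 R; rewrite mulr2n; lra.
Qed.

(** The plane without the nonpositive real axis, where the principal argument has modulus less than
    pi. *)
Definition slit z := 0 < Rez z \/ Imz z <> 0.

Lemma slit_neq0 z : slit z -> z != 0.
Proof. by move=> h; apply/eqP => e; case: h; rewrite e /= ?ltxx. Qed.

Lemma slit_arg z : slit z -> `|Imz (plog z)| < pi.
Proof.
move=> h; rewrite lt_neqAle parg_le andbT; apply/eqP => e.
have c := plogK (slit_neq0 h); have cs : cos (Imz (plog z)) = -1 by rewrite -cos_norm e cospi.
have sn : sin (Imz (plog z)) = 0.
  apply/eqP; rewrite -sqrf_eq0 sin2cos2 cs; apply/eqP; ring.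
case: h; rewrite -c ?Re_cexp ?Im_cexp ?cs ?sn ?mulr0//.
by rewrite mulrN1 oppr_gt0 ltNge expR_ge0.
Qed.

(** Translate L so that it starts at the principal value; its imaginary part cannot reach pi or -pi,
    where the exponential is negative real, so it remains principal. *)
Lemma slit_turn u v (L : R -> R[i]) : u <= v -> pcont u v L ->
  (forall t, u <= t <= v -> slit (cexp (L t))) ->
  L v - L u = plog (cexp (L v)) - plog (cexp (L u)).
Proof.
move=> uv c sl; pose k := plog (cexp (L u)) - L u; pose L' t := L t + k.
have iu : u <= u <= v by lra. have iv : u <= v <= v by lra.
have e t : u <= t <= v -> cexp (L' t) = cexp (L t).
  by move=> tuv; rewrite /L' /k cexpD cexpB plogK ?cexp_neq0// divff ?cexp_neq0// mulr1.
have L'u : L' u = plog (cexp (L u)) by rewrite /L' /k subrKC.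
have c' : pcont u v L'.
  move=> t tuv ee ee0; have [d d0 H] := c t tuv ee ee0; exists d => // t' t'uv h.
  by rewrite /L' opprD addrACA subrr addr0; exact: H.
have no t : u <= t <= v -> `|Imz (L' t)| = pi -> False.
  move=> tuv E; have := sl t tuv; rewrite -e// => h.
  have cs : cos (Imz (L' t)) = -1 by rewrite -cos_norm E cospi.
  have sn : sin (Imz (L' t)) = 0 by apply/eqP; rewrite -sqrf_eq0 sin2cos2 cs; apply/eqP; ring.
  case: h; rewrite ?Re_cexp ?Im_cexp ?cs ?sn ?mulr0//.
  by rewrite mulrN1 oppr_gt0 ltNge expR_ge0.
have i0 : `|Imz (L' u)| < pi by rewrite L'u; apply: slit_arg; exact: sl.
suff i1 : `|Imz (L' v)| < pi.
  have : L' v = plog (cexp (L v)) by rewrite -(e v iv) plog_cexp.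
  by rewrite -L'u /L' => <-; ring.
rewrite ltNge; apply/negP => ge.
have [t tuv] := @pcont_ivt _ u v L' (fun z => `|Imz z|) pi uv c'
  (fun z w => le_trans (ler_dist_dist _ _) (Im_lip z w)) (ltW i0) ge.
exact: no.
Qed.

Definition ci : R[i] := 0 +i* 1.

Lemma Re_ciM z : Rez (ci * z) = - Imz z. Proof. by case: z => x y /=; ring. Qed.
Lemma cexp_pi2 : cexp (0 +i* (pi / 2)) = ci.
Proof. by rewrite /cexp expR0 cos_pihalf sin_pihalf; apply: CP => /=; ring. Qed.
Lemma cexp_piN2 : cexp (0 +i* (- (pi / 2))) = - ci.
Proof. by rewrite /cexp expR0 cosN sinN cos_pihalf sin_pihalf; apply: CP => /=; ring. Qed.

Lemma plog_ciM z : 0 < Rez z -> plog (ci * z) = plog z + 0 +i* (pi / 2).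
Proof.
move=> h; have := parg_lt h => hp; have z0 : z != 0 by apply: slit_neq0; left.
rewrite -{1}(plogK z0) -cexp_pi2 -cexpD plog_cexp; first by rewrite addrC.
move: hp; rewrite !Cri /= !ltr_norml => /andP[? ?]; have := pi_gt0 R; lra.
Qed.

Lemma plog_NciM z : 0 < Rez z -> plog (- (ci * z)) = plog z - 0 +i* (pi / 2).
Proof.
move=> h; have := parg_lt h => hp; have z0 : z != 0 by apply: slit_neq0; left.
rewrite -mulNr -{1}(plogK z0) -cexp_piN2 -cexpD plog_cexp.
  by rewrite addrC; congr (_ + _); apply: CP; rewrite ?Cri /= ?oppr0.
move: hp; rewrite !Cri /= !ltr_norml => /andP[? ?]; have := pi_gt0 R; lra.
Qed.

Lemma slit_turn_rot c u v (L : R -> R[i]) : u <= v -> pcont u v L -> c != 0 ->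
  (forall t, u <= t <= v -> slit (c * cexp (L t))) ->
  L v - L u = plog (c * cexp (L v)) - plog (c * cexp (L u)).
Proof.
move=> uv cL c0 sl; have e t : cexp (plog c + L t) = c * cexp (L t) by rewrite cexpD plogK.
have := @slit_turn u v (fun t => plog c + L t) uv; rewrite /= !e => <-; first by ring.
  move=> t tuv ee ee0; have [d d0 H] := cL t tuv ee ee0; exists d => // t' t'uv h.
  by rewrite opprD addrACA subrr add0r; exact: H.
by move=> t tuv; rewrite e; exact: sl.
Qed.

End ContinuousLog.

(** * Planar topology through turns of logarithms on a square *)

Section Planar.
Variable R : realType.
Implicit Types (z w p q : R[i]) (s t u v : R).

Definition usq z := 0 <= Rez z <= 1 /\ 0 <= Imz z <= 1.

Lemma usq_bd z : usq z -> nm z <= 2.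
Proof.
move=> [/andP[? ?] /andP[? ?]]; apply: le_trans (nm_ReIm z) _; rewrite !ger0_norm//; lra.
Qed.

Lemma usq_closed : cclosed usq.
Proof.
move=> z h; split; apply/andP; split; rewrite leNgt; apply/negP => l.
- have [|w [/andP[w1 w2] _] hw] := h (- Rez z); first lra.
  by have := Re_le (w - z); rewrite ReB; lra.
- have [|w [/andP[w1 w2] _] hw] := h (Rez z - 1); first lra.
  by have := Re_ge (w - z); rewrite ReB; lra.
- have [|w [_ /andP[w1 w2]] hw] := h (- Imz z); first lra.
  by have := Im_le (w - z); rewrite ImB; lra.
- have [|w [_ /andP[w1 w2]] hw] := h (Imz z - 1); first lra.
  by have := Im_ge (w - z); rewrite ImB; lra.
Qed.

Lemma usq_star z s : usq z -> 0 <= s <= 1 -> usq (s%:C * z).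
Proof.
move=> [/andP[? ?] /andP[? ?]] /andP[? ?]; split.
  by rewrite ReM /=; apply/andP; split; nra.
by rewrite ImM /=; apply/andP; split; nra.
Qed.

Lemma pcont_reparam u v (g : R -> R[i]) : u <= v -> pcont u v g -> pcont 0 1 (fun t => g (u + (v - u) * t)).
Proof.
move=> uv gc t /andP[t0 t1] e e0; have [|d d0 H] := gc (u + (v - u) * t) _ e e0; first by nra.
exists (d / (v - u + 1)); first by rewrite divr_gt0//; lra.
move=> t' /andP[t'0 t'1]; rewrite ltr_pdivlMr; last lra.
move=> h; apply: H; first by nra.
rewrite (_ : _ - _ = (v - u) * (t' - t)); last by ring.
rewrite normrM ger0_norm; last lra.
by have := normr_ge0 (t' - t); nra.
Qed.

(** If g1 never meets g2 + c, the total turn of g1 s - g2 t - c around the square is 0.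
    Intersections are obtained below by computing a nonzero turn. *)
Lemma usq_log (g1 g2 : R -> R[i]) c : pcont 0 1 g1 -> pcont 0 1 g2 ->
  (forall s t, 0 <= s <= 1 -> 0 <= t <= 1 -> g1 s - g2 t != c) ->
  exists2 L : R[i] -> R[i], ccont usq L & forall s t, 0 <= s <= 1 -> 0 <= t <= 1 ->
    cexp (L (s +i* t)) = g1 s - g2 t - c.
Proof.
move=> c1 c2 ne; pose F z := g1 (Rez z) - g2 (Imz z) - c.
have [||||||L cL hL] := @starlog R usq 2 F.
- exact: usq_bd.
- exact: usq_closed.
- by split; rewrite /= lexx ler01.
- exact: usq_star.
- move=> z [z1 z2] e e0; have e2 : 0 < e / 2 by lra.
  have [d1 p1 H1] := c1 _ z1 _ e2; have [d2 p2 H2] := c2 _ z2 _ e2.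
  exists (Num.min d1 d2); first by rewrite lt_min p1.
  move=> w [w1 w2]; rewrite lt_min => /andP[h1 h2].
  rewrite /F (_ : _ - _ = (g1 (Rez w) - g1 (Rez z)) - (g2 (Imz w) - g2 (Imz z))); last by ring.
  apply: le_lt_trans (nmBs _ _) _.
  have := H1 _ w1 (le_lt_trans (Re_lip w z) h1); have := H2 _ w2 (le_lt_trans (Im_lip w z) h2); lra.
- by move=> z [z1 z2]; rewrite subr_eq0; exact: ne.
by exists L => // s t s1 t1; rewrite hL.
Qed.

Lemma pcont_edge (L : R[i] -> R[i]) (b c : R[i]) : ccont usq L ->
  (forall t, 0 <= t <= 1 -> usq (b + t%:C * c)) -> pcont 0 1 (fun t => L (b + t%:C * c)).
Proof.
move=> cL h t t01 e e0; have [d d0 H] := cL _ (h t t01) e e0.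
exists (d / (nm c + 1)); first by rewrite divr_gt0//; have := nm_ge0 c; lra.
move=> t' t'01 ht; apply: H; first exact: h.
rewrite (_ : _ - _ = (t' - t)%:C * c); last by rewrite rmorphB /=; ring.
rewrite nmM nmR; move: ht; rewrite ltr_pdivlMr; last by have := nm_ge0 c; lra.
have := nm_ge0 c; have := normr_ge0 (t' - t); nra.
Qed.

Lemma plog_pos_im (y : R) : 0 < y -> Imz (plog (0 +i* y)) = pi / 2.
Proof. by move=> y0; rewrite /plog /parg /= ltW// mul0r acos0. Qed.
Lemma plog_neg_im (y : R) : y < 0 -> Imz (plog (0 +i* y)) = - (pi / 2).
Proof. by move=> y0; rewrite /plog /parg /= leNgt y0 /= mul0r acos0. Qed.

Lemma Re0_slit z : 0 <= Rez z -> z != 0 -> slit z.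
Proof.
move=> h z0; have [e|n] := eqVneq (Rez z) 0; last by left; rewrite lt_neqAle eq_sym n.
by right=> i0; move/eqP: z0; apply; exact: CP.
Qed.

Lemma edge_turn c (L : R[i] -> R[i]) (b d : R[i]) : ccont usq L -> c != 0 ->
  (forall t, 0 <= t <= 1 -> usq (b + t%:C * d)) ->
  (forall t, 0 <= t <= 1 -> slit (c * cexp (L (b + t%:C * d)))) ->
  L (b + d) - L b = plog (c * cexp (L (b + d))) - plog (c * cexp (L b)).
Proof.
move=> cL c0 h sl.
have := @slit_turn_rot R c 0 1 (fun t => L (b + t%:C * d)) ler01 (pcont_edge cL h) c0 sl.
by rewrite mul0r addr0 mul1r.
Qed.

Lemma translate_meet_aux (g : R -> R[i]) (X : R) : pcont 0 1 g ->
  (forall t, 0 <= t <= 1 -> Rez (g t) <= X) -> Rez (g 0) = X -> Rez (g 1) = X ->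
  pi *+ 2 < Imz (g 1) - Imz (g 0) ->
  exists s t, [/\ 0 <= s <= 1, 0 <= t <= 1 & g s - g t = tpi 1].
Proof.
move=> gc gX g0 g1 hI; apply: contrapT => no.
have tpE : tpi 1 = 0 +i* (pi *+ 2) :> R[i] by rewrite /tpi mulr1.
have [|L cL hL] := usq_log (c := tpi 1) gc gc.
  by move=> s t s01 t01; apply/eqP => e; apply: no; exists s, t.
have i0 : 0 <= (0 : R) <= 1 by rewrite ?lexx ?ler01.
have i1 : 0 <= (1 : R) <= 1 by rewrite ?lexx ?ler01.
have eq0 : L 0 = L (0 +i* 0) by congr L.
have pi0 := pi_gt0 R; rewrite mulr2n in hI.
have E00 : cexp (L 0) = 0 +i* (- (pi *+ 2)).
  by rewrite eq0 hL// tpE; apply: CP; rewrite !Cri /=; ring.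
have E1 : cexp (L 1) = 0 +i* (Imz (g 1) - Imz (g 0) - pi *+ 2).
  rewrite (_ : 1 = 1 +i* 0)// hL// tpE; apply: CP; rewrite !Cri /= ?g0 ?g1; ring.
have E11 : cexp (L (1 +i* 1)) = 0 +i* (- (pi *+ 2)).
  by rewrite hL// tpE; apply: CP; rewrite !Cri /=; ring.
have M1 z : -1 * z = - z :> R[i] by rewrite mulN1r.
(* On the edge t = 0 the function stays in the left half-plane, on s = 1 in the right one, and on
   the diagonal it is constant. The turns would be - pi, - pi and 0, although the first two must add
   up to the third. *)
have T1 : L (0 + 1) - L 0 = plog (-1 * cexp (L (0 + 1))) - plog (-1 * cexp (L 0)).
  apply: edge_turn cL _ _ _; first by rewrite oppr_eq0 oner_eq0.
    by move=> t t01; rewrite add0r mulr1; split => //=; rewrite lexx ler01.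
  move=> t t01; apply: Re0_slit; last by rewrite mulf_neq0 ?cexp_neq0// oppr_eq0 oner_eq0.
  rewrite add0r mulr1 M1 ReN (_ : t%:C = t +i* 0)// hL// !ReB /= g0.
  by have := gX t t01; lra.
have T2 : L (1 + ci R) - L 1 = plog (1 * cexp (L (1 + ci R))) - plog (1 * cexp (L 1)).
  have eqt t : 1 + t%:C * ci R = 1 +i* t by apply: CP => /=; ring.
  apply: edge_turn cL _ _ _; first by rewrite oner_eq0.
    by move=> t t01; rewrite eqt; split => //=; rewrite lexx ler01.
  move=> t t01; apply: Re0_slit; last by rewrite mulf_neq0 ?cexp_neq0// oner_eq0.
  by rewrite eqt mul1r hL// !ReB /= g1; have := gX t t01; lra.
have T3 : L (0 + (1 +i* 1)) - L 0 = plog (1 * cexp (L (0 + (1 +i* 1)))) - plog (1 * cexp (L 0)).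
  have eqt t : 0 + t%:C * (1 +i* 1) = t +i* t :> R[i] by apply: CP => /=; ring.
  apply: edge_turn cL _ _ _; first by rewrite oner_eq0.
    by move=> t t01; rewrite eqt.
  move=> t t01; right; rewrite mul1r eqt hL// tpE !Cri /=; move: pi0; rewrite mulr2n; lra.
rewrite !add0r in T1 T3; have e11 : 1 + ci R = 1 +i* 1 by apply: CP; rewrite !Cri /=; ring.
rewrite e11 in T2; rewrite !mul1r in T2 T3.
rewrite !M1 in T1; rewrite E00 E11 E1 in T1 T2 T3.
have N1 (y : R) : - (0 +i* y) = 0 +i* (- y) :> R[i] by apply: CP; rewrite !Cri /= ?oppr0.
rewrite !N1 opprK in T1.
have {}T1 := congr1 (@complex.Im R) T1; have {}T2 := congr1 (@complex.Im R) T2; have {}T3 := congr1 (@complex.Im R) T3.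
rewrite !ImB in T1 T2 T3.
have Y1 : 0 < Imz (g 1) - Imz (g 0) - pi *+ 2 by rewrite mulr2n; lra.
have Y2 : 0 < (pi : R) *+ 2 by rewrite mulr2n; lra.
rewrite (plog_neg_im (y := - _)) ?oppr_lt0// (plog_pos_im Y2) in T1.
rewrite (plog_neg_im (y := - _)) ?oppr_lt0// (plog_pos_im Y1) in T2.
rewrite subrr in T3; lra.
Qed.

Lemma pcont_rev (g : R -> R[i]) : pcont 0 1 g -> pcont 0 1 (fun t => g (1 - t)).
Proof.
move=> gc t t01 e e0; have [|d d0 H] := gc (1 - t) _ e e0; first by lra.
exists d => // t' t'01 h; apply: H; first by lra.
by rewrite (_ : _ - _ = t - t') 1?distrC//; ring.
Qed.

(* Otherwise the difference of two points of the curve, minus 2 pi i, has a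
   continuous logarithm on the unit square, whose turns along the edges do not add up. *)
Lemma translate_meet u v (g : R -> R[i]) (X : R) : u <= v -> pcont u v g ->
  (forall t, u <= t <= v -> Rez (g t) <= X) -> Rez (g u) = X -> Rez (g v) = X ->
  pi *+ 2 < `|Imz (g v) - Imz (g u)| ->
  exists s t, [/\ u <= s <= v, u <= t <= v & g s - g t = tpi 1].
Proof.
move=> uv gc gX gu gv hI; pose h t := g (u + (v - u) * t).
have hc : pcont 0 1 h := pcont_reparam uv gc.
have iuv t : 0 <= t <= 1 -> u <= u + (v - u) * t <= v by move=> /andP[? ?]; nra.
have h0 : h 0 = g u by rewrite /h mulr0 addr0.
have h1 : h 1 = g v by rewrite /h mulr1 subrKC.
have [le|lt] := leP 0 (Imz (g v) - Imz (g u)).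
  have [||||s [t [s1 t1 e]]] := translate_meet_aux (X := X) hc; rewrite ?h0 ?h1//.
  - by move=> t t01; apply: gX; exact: iuv.
  - by move: hI; rewrite ger0_norm.
  - by exists (u + (v - u) * s), (u + (v - u) * t); split => //; exact: iuv.
have [||||s [t [s1 t1 e]]] := translate_meet_aux (X := X) (pcont_rev hc); rewrite ?subrr ?subr0 ?h0 ?h1//.
- by move=> t t01; apply: gX; apply: iuv; lra.
- by move: hI; rewrite ltr0_norm//; lra.
- by exists (u + (v - u) * (1 - s)), (u + (v - u) * (1 - t)); split => //; apply: iuv; lra.
Qed.

(** The four edges of the square are mapped to the right, upper, left and lower half-planes, so the
    boundary turns once around 0. *)
Lemma barrier_aux (k g : R -> R[i]) c : pcont 0 1 k -> pcont 0 1 g ->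
  (forall s t, 0 <= s <= 1 -> 0 <= t <= 1 -> k s - g t != c) ->
  (forall s, 0 <= s <= 1 -> 0 < Rez (k s - g 0 - c) /\ Rez (k s - g 1 - c) < 0) ->
  (forall t, 0 <= t <= 1 -> Imz (k 0 - g t - c) < 0) ->
  ~ (forall t, 0 <= t <= 1 -> 0 < Imz (k 1 - g t - c)).
Proof.
move=> kc gc ne hR h0 h1.
have [L cL hL] := usq_log kc gc ne.
have i0 : 0 <= (0 : R) <= 1 by rewrite ?lexx ?ler01.
have i1 : 0 <= (1 : R) <= 1 by rewrite ?lexx ?ler01.
have M1 z : -1 * z = - z :> R[i] by rewrite mulN1r.
have ci0 : ci R != 0 by rewrite eq_complex /= oner_eq0 andbF.
have e0 : 0 = 0 +i* 0 :> R[i] by []. have e1 : 1 = 1 +i* 0 :> R[i] by [].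
have eci : ci R = 0 +i* 1 by [].
have e11 : 1 + ci R = 1 +i* 1 by apply: CP; rewrite !Cri /=; ring.
have e11' : ci R + 1 = 1 +i* 1 by apply: CP; rewrite !Cri /=; ring.
have T1 : L (0 + 1) - L 0 = plog (1 * cexp (L (0 + 1))) - plog (1 * cexp (L 0)).
  have eqt t : 0 + t%:C * 1 = t +i* 0 :> R[i] by apply: CP => /=; ring.
  apply: edge_turn cL _ _ _; first by rewrite oner_eq0.
    by move=> t t01; rewrite eqt; split => //=; rewrite lexx ler01.
  by move=> t t01; left; rewrite eqt mul1r hL//; exact: (hR t t01).1.
have T2 : L (ci R + 1) - L (ci R) = plog (-1 * cexp (L (ci R + 1))) - plog (-1 * cexp (L (ci R))).
  have eqt t : ci R + t%:C * 1 = t +i* 1 by apply: CP => /=; ring.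
  apply: edge_turn cL _ _ _; first by rewrite oppr_eq0 oner_eq0.
    by move=> t t01; rewrite eqt; split => //=; rewrite lexx ler01.
  by move=> t t01; left; rewrite eqt M1 ReN hL//; have := (hR t t01).2; lra.
have T3 : L (0 + ci R) - L 0 = plog (ci R * cexp (L (0 + ci R))) - plog (ci R * cexp (L 0)).
  have eqt t : 0 + t%:C * ci R = 0 +i* t by apply: CP => /=; ring.
  apply: edge_turn cL ci0 _ _.
    by move=> t t01; rewrite eqt; split => //=; rewrite lexx ler01.
  by move=> t t01; left; rewrite eqt Re_ciM hL//; have := h0 t t01; lra.
have T4 : L (1 + ci R) - L 1 = plog (- ci R * cexp (L (1 + ci R))) - plog (- ci R * cexp (L 1)).
  have eqt t : 1 + t%:C * ci R = 1 +i* t by apply: CP => /=; ring.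
  apply: edge_turn cL _ _ _; first by rewrite oppr_eq0.
    by move=> t t01; rewrite eqt; split => //=; rewrite lexx ler01.
  by move=> t t01; left; rewrite eqt mulNr ReN Re_ciM hL//; have := h1 t t01; lra.
rewrite !add0r !M1 !mul1r !e11' !e11 in T1 T2 T3 T4; rewrite !mulNr in T4.
have r0 : 0 < Rez (cexp (L 0)) by rewrite e0 hL//; exact: (hR 0 i0).1.
have r1 : 0 < Rez (cexp (L 1)) by rewrite e1 hL//; exact: (hR 1 i1).1.
have rc : 0 < Rez (- cexp (L (ci R))) by rewrite eci hL// ReN; have := (hR 0 i0).2; lra.
have r11 : 0 < Rez (- cexp (L (1 +i* 1))) by rewrite hL// ReN; have := (hR 1 i1).2; lra.
rewrite (plog_ciM r0) -[ci R * cexp (L (ci R))]opprK -mulrN (plog_NciM rc) in T3.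
rewrite (plog_NciM r1) -mulrN (plog_ciM r11) in T4.
have {}T1 := congr1 (@complex.Im R) T1; have {}T2 := congr1 (@complex.Im R) T2.
have {}T3 := congr1 (@complex.Im R) T3; have {}T4 := congr1 (@complex.Im R) T4.
rewrite !ImB in T1 T2 T3 T4; rewrite !Cri in T3 T4; have := pi_gt0 R.
have iE : Imz (0 +i* (pi / 2) : R[i]) = pi / 2 by [].
rewrite iE in T3 T4; move: T1 T2 T3 T4.
move: (Imz (plog _)) (Imz (plog (cexp (L 0)))) (Imz (plog (- cexp (L (ci R))))) (Imz (plog (- cexp (L (1 +i* 1))))).
by move=> x1 x2 x3 x4 ? ? ? ?; lra.
Qed.

End Planar.

(** * Following hairs *)

Section PathTools.
Variables (R : realType) (a : R[i]).
Implicit Types (z w x y : R[i]) (s t u v : R) (g : R -> R[i]).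
Notation f := (expmap a).
Notation orb := (orb a).

Lemma pcont_first_hit u v g (phi : R[i] -> R) c : u <= v -> pcont u v g ->
  (forall z w, `|phi z - phi w| <= nm (z - w)) -> phi (g u) < c -> c <= phi (g v) ->
  exists t, [/\ u <= t <= v, phi (g t) = c & forall s, u <= s -> s < t -> phi (g s) < c].
Proof.
move=> uv gc lip c1 c2.
pose S := [set x | u <= x <= v /\ forall s, u <= s <= x -> phi (g s) < c].
have iu : u <= u <= v by rewrite lexx.
have Su : S u by split => // s us; have -> : s = u by lra.
have Sub : has_sup S by split; [exists u | exists v => x [/andP[]]].
have us : u <= sup S by apply: sup_upper_bound.
have sv : sup S <= v by apply: sup_le_ub; [exists u | move=> x [/andP[]]].
have is_ : u <= sup S <= v by rewrite us.
have lt s : u <= s -> s < sup S -> phi (g s) < c.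
  move=> us' ss; have d0 : 0 < sup S - s by rewrite subr_gt0.
  have [x [_ Sx] xs] := sup_adherent d0 Sub; apply: Sx; rewrite us' /=; lra.
exists (sup S); split => //; apply/eqP; rewrite eq_le; apply/andP; split; rewrite leNgt; apply/negP => h.
  have e0 : 0 < phi (g (sup S)) - c by rewrite subr_gt0.
  have [d d0 H] := gc _ is_ _ e0.
  have us2 : u < sup S by rewrite lt_neqAle us andbT; apply: contraTneq h => <-; rewrite -leNgt ltW.
  pose s := Num.max u (sup S - d / 2).
  have s1 : u <= s by rewrite le_max lexx.
  have s2 : s < sup S by rewrite gt_max us2; lra.
  have s3 : sup S - d / 2 <= s by rewrite le_max lexx orbT.
  have := lt _ s1 s2.
  have sd : `|s - sup S| < d by rewrite ltr_norml; apply/andP; split; lra.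
  have suv : u <= s <= v by rewrite s1 /=; lra.
  have := le_lt_trans (lip _ _) (H s suv sd).
  by rewrite ltr_norml => /andP[]; lra.
have e0 : 0 < c - phi (g (sup S)) by rewrite subr_gt0.
have [d d0 H] := gc _ is_ _ e0.
have sv2 : sup S < v by rewrite lt_neqAle sv andbT; apply: contraTneq h => ->; rewrite -leNgt.
pose s := Num.min v (sup S + d / 2).
have s1 : s <= v by rewrite ge_min lexx.
have s2 : sup S < s by rewrite lt_min sv2; lra.
have s3 : s <= sup S + d / 2 by rewrite ge_min lexx orbT.
have : S s.
  split; first by rewrite s1 andbT; lra.
  move=> r /andP[r1 r2]; have [rs|sr] := ltP r (sup S); first exact: lt.
  have sd : `|r - sup S| < d by rewrite ltr_norml; apply/andP; split; lra.
  have ruv : u <= r <= v by rewrite r1 /=; lra.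
  have := le_lt_trans (lip _ _) (H r ruv sd).
  by rewrite ltr_norml => /andP[]; lra.
by move=> /(sup_upper_bound Sub); rewrite leNgt s2.
Qed.

Lemma pcont_cat u m v g : pcont u m g -> pcont m v g -> pcont u v g.
Proof.
move=> h1 h2 t /andP[ut tv] e e0; case: (ltgtP t m) => tm.
- have [|d d0 H] := h1 t _ e e0; first by rewrite ut ltW.
  exists (Num.min d (m - t)); first by rewrite lt_min d0 subr_gt0.
  move=> t' /andP[ut' _]; rewrite lt_min => /andP[h /ltr_normlP[_ h']]; apply: H => //.
  by rewrite ut' /=; lra.
- have [|d d0 H] := h2 t _ e e0; first by rewrite tv ltW.
  exists (Num.min d (t - m)); first by rewrite lt_min d0 subr_gt0.
  move=> t' /andP[_ tv']; rewrite lt_min => /andP[h /ltr_normlP[h' _]]; apply: H => //.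
  by rewrite tv' andbT; lra.
- have [|d d0 H] := h1 t _ e e0; first by rewrite ut tm lexx.
  have [|d' d'0 H'] := h2 t _ e e0; first by rewrite tv tm lexx.
  exists (Num.min d d'); first by rewrite lt_min d0.
  move=> t' /andP[ut' tv']; rewrite lt_min => /andP[k1 k2].
  by have [le|lt] := leP t' m; [apply: H; rewrite ?ut'|apply: H' => //; rewrite tv' ltW].
Qed.

Lemma pcont_eq u v g g' : (forall t, u <= t <= v -> g t = g' t) -> pcont u v g -> pcont u v g'.
Proof.
move=> e h t tuv ee e0; have [d d0 H] := h t tuv ee e0; exists d => // t' t'uv h'.
by rewrite -!e//; exact: H.
Qed.

Lemma pcont_shift u v g c : pcont u v g -> pcont (u + c) (v + c) (fun t => g (t - c)).
Proof.
move=> h t tuv e e0; have [|d d0 H] := h (t - c) _ e e0; first by lra.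
exists d => // t' t'uv h'; apply: H; first by lra.
by rewrite (_ : _ - _ = t' - t)//; ring.
Qed.

Lemma pcont_opp u v g : pcont u v g -> pcont (- v) (- u) (fun t => g (- t)).
Proof.
move=> h t tuv e e0; have [|d d0 H] := h (- t) _ e e0; first by lra.
exists d => // t' t'uv h'; apply: H; first by lra.
by rewrite (_ : _ - _ = t - t') 1?distrC//; ring.
Qed.

(** f is injective on strips of height less than 2 pi, but the image of an arc may return to itself;
    this is why only local injectivity is carried along. *)
Lemma loc_inj_expmap u v g : pcont u v g -> loc_inj u v g -> loc_inj u v (fun t => f (g t)).
Proof.
move=> gc li t tuv; have [d d0 H] := li t tuv; have [d' d'0 H'] := gc t tuv 1 ltr01.
exists (Num.min d d'); first by rewrite lt_min d0.
move=> s s' is_ is'; rewrite !lt_min => /andP[h1 h2] /andP[h3 h4] /eqP.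
rewrite -subr_eq0 expmap_diff subr_eq0 => /eqP e; apply: H => //; apply: cexp_inj => //.
have := le_lt_trans (Im_lip _ _) (H' _ is_ h2); have := le_lt_trans (Im_lip _ _) (H' _ is' h4) => k1 k2.
rewrite (_ : _ - _ = (Imz (g s) - Imz (g t)) - (Imz (g s') - Imz (g t))); last by ring.
by apply: le_lt_trans (ler_normB _ _) _; have := pi_ge2 R; rewrite mulr2n; lra.
Qed.

Lemma loc_inj_orb u v g n : pcont u v g -> loc_inj u v g -> loc_inj u v (fun t => orb n (g t)).
Proof. by move=> gc li; elim: n => // n IH; apply: loc_inj_expmap IH; exact: pcont_orb. Qed.

Lemma loc_inj_sub u v u' v' g : u <= u' -> v' <= v -> loc_inj u v g -> loc_inj u' v' g.
Proof.
move=> uu vv h t /andP[t1 t2]; have [|d d0 H] := h t; first by rewrite (le_trans uu) ?(le_trans t2).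
exists d => // s s' /andP[s1 s2] /andP[s3 s4]; apply: H.
  by rewrite (le_trans uu) ?(le_trans s2).
by rewrite (le_trans uu) ?(le_trans s4).
Qed.

Lemma loc_inj_opp u v g : loc_inj u v g -> loc_inj (- v) (- u) (fun t => g (- t)).
Proof.
move=> h t tuv; have [|d d0 H] := h (- t); first by lra.
exists d => // s s' is_ is' h1 h2 e; apply: oppr_inj; apply: H => //; try lra.
  by rewrite (_ : _ - _ = t - s) 1?distrC//; ring.
by rewrite (_ : _ - _ = t - s') 1?distrC//; ring.
Qed.

Lemma Re_of_image (c : R) x : expR c + nm a <= Rez (f x) -> c <= Rez x.
Proof. by move=> /fRe_ge; rewrite ler_expR. Qed.

Lemma inJS (c : R) x : c <= Rez x -> inJ a c (f x) -> inJ a c x.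
Proof. by move=> h h' [//|n]; rewrite orbSr. Qed.

End PathTools.

(** * Bringing a late lower bound on the real parts back to time 0 *)

Section Uniform.
Variables (R : realType) (a : R[i]) (T M : R).
Hypothesis hT : 100 * 20 + nm a <= T.
Hypothesis hM : expR T + nm a + 30 <= M.
Implicit Types (z w x y e : R[i]) (s t u v p q r : R) (g : R -> R[i]).
Notation f := (expmap a).
Notation orb := (orb a).
Notation slower := (slower a).

Lemma T_le_M : T + 30 <= M.
Proof. by have := hM; have := expR_ge1Dx T; have := nm_ge0 a; lra. Qed.

(** By induction on n: the image path is in [inJ a (M - 1)], which by the choice of M puts the path
    itself in [inJ a T]. If it fell below M - 1 at some time, the point e, never below M, would lead
    by 1 and keep its lead, against the last hypothesis. *)
Lemma uniform_pull n s t g : s <= t -> pcont s t g ->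
  (forall r, s <= r <= t -> inJ a T (orb n (g r))) ->
  (forall r, s <= r <= t -> exists e, [/\ inJ a M e,
     (exists2 q, s <= q <= t & e = g q) \/ (forall k, `|Imz (orb k e) - Imz (orb k (g t))| <= 16)
     & ~ slower (orb n (g r)) (orb n e)]) ->
  forall r, s <= r <= t -> inJ a (M - 1) (g r).
Proof.
move=> st; elim: n g => [|n IH] g gc gJ he r ir.
  have it : s <= t <= t by lra.
  have [e [eJ en ns]] := he r ir => k; rewrite leNgt; apply/negP => lt; apply: ns.
  have := path_nearI hT st gc gJ; have pi4 := pi_le4 R => nI; exists k.
  have := eJ k; rewrite orb0; lra.
have gc' : pcont s t (fun t => f (g t)) := pcont_orb a 1 gc.
have J1 : forall r, s <= r <= t -> inJ a (M - 1) (f (g r)).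
  apply: IH => // [q iq|q iq]; first by rewrite -orbSr; exact: gJ.
  have [e [eJ en ns]] := he q iq; exists (f e); split.
  - by move=> k; rewrite -orbSr; exact: eJ.
  - case: en => [[q' iq' ->]|en]; first by left; exists q'.
    by right => k; rewrite -!orbSr; exact: en.
  - by rewrite -!orbSr.
have J0 q : s <= q <= t -> inJ a T (g q).
  move=> iq; have h := J1 q iq; have TM := T_le_M; apply: inJS; last by apply: inJ_le h; lra.
  by apply: (@Re_of_image _ a); have := h 0%N; rewrite orb0; have := hM; lra.
have nI := path_nearI hT st gc J0; have pi4 := pi_le4 R.
have it : s <= t <= t by lra.
have [e [eJ en ns]] := he r ir => k; rewrite leNgt; apply/negP => lt; apply: ns.
have eT : inJ a T e by apply: inJ_le eJ; have := T_le_M; lra.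
have near : nearI a 20 (g r) e.
  case: en => [[q iq ->]|en]; first exact: nearI_pi20 (nI _ _ ir iq).
  move=> j; have := nI r t ir it j; have := en j; rewrite (distrC (Imz (orb j e))).
  have := ler_normD (Imz (orb j (g r)) - Imz (orb j (g t))) (Imz (orb j (g t)) - Imz (orb j e)).
  by rewrite addrA subrK; lra.
have lt' : Rez (orb k (g r)) + 1 <= Rez (orb k e) by have := eJ k; lra.
exists k; rewrite -!orbD; apply: (slower_later hT (J0 r ir) eT near _ lt').
exact: leq_addr.
Qed.

(** By monotonicity of speed one of the two ends is the slowest point; it serves as e in
    [uniform_pull]. *)
Lemma uniform_two_ends n s t g : s <= t -> pcont s t g -> loc_inj s t g ->
  (forall r, s <= r <= t -> inJ a T (orb n (g r))) -> inJ a M (g s) -> inJ a M (g t) ->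
  forall r, s <= r <= t -> inJ a (M - 1) (g r).
Proof.
move=> st gc li gJ Js Jt; apply: (@uniform_pull n) => // r ir.
have is_ : s <= s <= t by lra. have it : s <= t <= t by lra.
have gcn := pcont_orb a n gc; have nI := path_nearI hT st gcn gJ.
have as_ (x y : R) : s <= x <= t -> s <= y <= t -> slower (orb n (g x)) (orb n (g y)) -> ~ slower (orb n (g y)) (orb n (g x)).
  by move=> ix iy; apply: (slower_asym hT); [exact: gJ|exact: gJ|exact: nearI_pi20 (nI _ _ ix iy)].
have irr (x : R) : s <= x <= t -> ~ slower (orb n (g x)) (orb n (g x)) by move=> ix h; exact: (as_ x x ix ix h).
case: (path_monotone hT gcn gJ (loc_inj_orb a n gc li)) => mono.
  exists (g s); split => //; first by left; exists s.
  have [->|rs] := eqVneq r s; first exact: irr.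
  by apply: as_ => //; apply: mono => //; rewrite lt_neqAle eq_sym rs; have /andP[->] := ir.
exists (g t); split => //; first by left; exists t.
have [->|rt] := eqVneq r t; first exact: irr.
by apply: as_ => //; apply: mono => //; rewrite lt_neqAle rt; have /andP[_ ->] := ir.
Qed.

End Uniform.

Opaque orb expmap cexp plog hair hs pb.

Section BarrierHair.
Variables (R : realType) (a : R[i]) (T : R).
Hypothesis hT : 100 * 20 + nm a <= T.
Implicit Types (z w x y e : R[i]) (s t u v p q r h : R) (g : R -> R[i]).
Notation f := (expmap a).
Notation orb := (orb a).

Lemma tpiN1 : tpi (-1) = - tpi 1 :> R[i].
Proof. by apply: CP; rewrite !Cri /= ?oppr0// mulr1 mulrN1. Qed.

(** Between the vertical lines through the ends of g, a path that starts on g cannot get above the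
    translate of g by 2 pi i without meeting it; heights along g vary by less than pi, whence 3
    pi. *)
Lemma barrier_up p q u v (k g : R -> R[i]) : p <= q -> u <= v -> pcont p q k -> pcont u v g ->
  (forall s t, p <= s <= q -> u <= t <= v -> k s - g t != tpi 1) ->
  (forall s, p <= s <= q -> Rez (g u) < Rez (k s) < Rez (g v)) ->
  (forall t t', u <= t <= v -> u <= t' <= v -> `|Imz (g t) - Imz (g t')| < pi) ->
  (exists2 t, u <= t <= v & k p = g t) ->
  forall t, u <= t <= v -> Imz (k q) - Imz (g t) < pi *+ 2 + pi.
Proof.
move=> pq uv kc gc ne hR hI [t0 it0 kp] t it; rewrite ltNge; apply/negP => ge.
have sub (x y : R) : x <= y -> forall l, 0 <= l <= 1 -> x <= x + (y - x) * l <= y by move=> xy l /andP[? ?]; nra.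
have pi0 := pi_gt0 R; have e2 : (pi : R) *+ 2 = pi + pi by rewrite mulr2n.
have tE : Rez (tpi 1 : R[i]) = 0 /\ Imz (tpi 1 : R[i]) = pi + pi by rewrite /tpi /= mulr1 e2.
apply: (@barrier_aux R (fun s => k (p + (q - p) * s)) (fun t => g (u + (v - u) * t)) (tpi 1)).
- exact: pcont_reparam.
- exact: pcont_reparam.
- by move=> s s' is_ is'; apply: ne; exact: sub.
- move=> s is_; have /andP[h1 h2] := hR _ (sub _ _ pq s is_).
  by rewrite !ReB tE.1 mulr0 addr0 mulr1 subrKC; split; lra.
- move=> s is_; rewrite !ImB tE.2 mulr0 addr0 kp.
  have := hI _ _ it0 (sub _ _ uv s is_); rewrite ltr_norml => /andP[_]; lra.
- move=> s is_; rewrite !ImB tE.2 mulr1 subrKC.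
  have := hI _ _ it (sub _ _ uv s is_); rewrite ltr_norml e2 in ge * => /andP[]; lra.
Qed.

(** Reflection turns the barrier above g into the one below. *)
Definition conj_ (z : R[i]) : R[i] := Rez z -i* Imz z.

Lemma pcont_conj u v g : pcont u v g -> pcont u v (fun t => conj_ (g t)).
Proof.
move=> h t tuv e e0; have [d d0 H] := h t tuv e e0; exists d => // t' t'uv h'.
apply: le_lt_trans (H t' t'uv h'); rewrite le_eqVlt; apply/orP; left; apply/eqP.
by rewrite !nmE !Cri /=; congr Num.sqrt; ring.
Qed.

Lemma barrier_both p q u v (k g : R -> R[i]) : p <= q -> u <= v -> pcont p q k -> pcont u v g ->
  (forall s t, p <= s <= q -> u <= t <= v -> k s - g t != tpi 1 /\ k s - g t != tpi (-1)) ->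
  (forall s, p <= s <= q -> Rez (g u) < Rez (k s) < Rez (g v)) ->
  (forall t t', u <= t <= v -> u <= t' <= v -> `|Imz (g t) - Imz (g t')| < pi) ->
  (exists2 t, u <= t <= v & k p = g t) ->
  forall t, u <= t <= v -> `|Imz (k q) - Imz (g t)| < pi *+ 2 + pi.
Proof.
move=> pq uv kc gc ne hR hI [t0 it0 kp] t it.
have h1 := @barrier_up p q u v k g pq uv kc gc (fun s t is_ it => (ne s t is_ it).1) hR hI (ex_intro2 _ _ t0 it0 kp) t it.
have := @barrier_up p q u v (fun s => conj_ (k s)) (fun s => conj_ (g s)) pq uv (pcont_conj kc) (pcont_conj gc).
move=> /(_ _ hR _ _ t it) => h2; rewrite ltr_norml h1 andbT.
have : - Imz (k q) - - Imz (g t) < pi *+ 2 + pi; last by lra.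
apply: h2.
- move=> s s' is_ is'; apply/eqP => e; have /eqP := (ne s s' is_ is').2; apply.
  rewrite tpiN1; apply: CP; [have := congr1 (@complex.Re R) e|have := congr1 (@complex.Im R) e]; rewrite !Cri /=; lra.
- by move=> s s' is_ is' /=; rewrite -opprD normrN; exact: hI.
- by exists t0 => //; rewrite kp.
Qed.

End BarrierHair.

Section FollowHair.
Variables (R : realType) (a : R[i]) (T : R).
Hypothesis hT : 100 * 20 + nm a <= T.
Implicit Types (z w x y e : R[i]) (s t h : R).
Notation f := (expmap a).
Notation orb := (orb a).
Variables (p q u v h0 : R) (k : R -> R[i]) (g : nat -> R -> R[i]).
Hypotheses (pq : p < q) (uh : u < h0) (hv : h0 < v) (kc : pcont p q k) (kp : k p = g 0 h0).
Hypothesis gc : forall n, pcont u v (g n).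
Hypothesis gS : forall n h, u <= h <= v -> f (g n h) = g n.+1 h.
Hypothesis gT : forall n h, u <= h <= v -> T <= Rez (g n h).
Hypothesis gI : forall n h h', u <= h <= v -> u <= h' <= v -> `|Imz (g n h) - Imz (g n h')| < pi.
Hypothesis gR : forall n h h', u <= h -> h <= h' -> h' <= v ->
  Rez (g n h) + 2 ^+ n * (h' - h) - 20 <= Rez (g n h').
Hypothesis ncr : forall n s h, p <= s <= q -> u <= h <= v ->
  orb n (k s) - g n h != tpi 1 /\ orb n (k s) - g n h != tpi (-1).

Let iu : u <= u <= v. Proof. by rewrite lexx ltW// (lt_trans uh hv). Qed.
Let iv : u <= v <= v. Proof. by rewrite lexx andbT ltW// (lt_trans uh hv). Qed.
Let ih : u <= h0 <= v. Proof. by rewrite !ltW. Qed.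
Let uv : u <= v. Proof. by rewrite ltW// (lt_trans uh hv). Qed.

Lemma seg_orb n h : u <= h <= v -> orb n (g 0%N h) = g n h.
Proof. by move=> i; elim: n => // n IH; rewrite orbS IH gS. Qed.

Lemma seg_inj h : u <= h <= v -> h != h0 -> g 0%N h != g 0%N h0.
Proof.
move=> i ne; apply/eqP => e; have i0 := ih.
have E n : g n h = g n h0 by rewrite -(seg_orb n i) -(seg_orb n ih) e.
have [lt|gt|eq] := ltgtP h h0; last by rewrite eq eqxx in ne.
  have d0 : 0 < h0 - h by rewrite subr_gt0.
  have [N H] := pow2_ge (21 : R) d0; have := H N (leqnn _).
  by have := @gR N h h0; rewrite E; lra.
have d0 : 0 < h - h0 by rewrite subr_gt0.
have [N H] := pow2_ge (21 : R) d0; have := H N (leqnn _).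
by have := @gR N h0 h; rewrite E; lra.
Qed.

Lemma half_pow20 m : 20 / 2 ^+ m <= 20 :> R.
Proof. by rewrite ler_pdivrMr ?exprn_gt0// ler_peMr// exprn_ege1// ler1n. Qed.

(** Both paths start at the same point and their images at level j + 1 stay right of a, so one
    inverse branch serves along the whole of k up to t. *)
Lemma seg_Lst j t s z : p <= s <= t -> t <= q ->
  (forall s', p <= s' <= t -> T - 20 <= Rez (orb j.+1 (k s'))) ->
  orb j (k s) = Lst a (g j h0) (orb j.+1 (k s)).
Proof.
move=> is_ tq Rs; have pt : p <= t by case/andP: is_; exact: le_trans.
have st : forall s', p <= s' <= t -> 0 < Rez (cexp (orb j (k s'))).
  move=> s' i'; rewrite -(expmapB a) -orbS; apply: Re_pos_subl.
  have := Rs s' i'; have := hT; have := nm_ge0 a; lra.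
have ptk : pcont p t (fun s => orb j (k s)) by apply: pcont_orb; apply: pcont_sub kc.
have ipt : p <= p <= t by rewrite lexx.
have I1 := path_strip pt ptk st is_ ipt.
rewrite kp (seg_orb j ih) in I1.
have Rk : nm a < Rez (orb j.+1 (k s)) by have := Rs s is_; have := hT; have := nm_ge0 a; lra.
have LI : `|Imz (Lst a (g j h0) (orb j.+1 (k s))) - Imz (g j h0)| < pi.
  rewrite -[X in _ - Imz X](Lst_id a (g j h0)); apply: Lst_Im2 => //.
  by rewrite gS ?ih//; have := gT j.+1 ih; have := hT; have := nm_ge0 a; lra.
apply: cexp_inj; last by apply: (addIr a); rewrite -!expmapE LstK// orbS.
rewrite (_ : _ - _ = (Imz (orb j (k s)) - Imz (g j h0)) - (Imz (Lst a (g j h0) (orb j.+1 (k s))) - Imz (g j h0))); last by ring.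
by apply: le_lt_trans (ler_normB _ _) _; rewrite mulr2n; apply: ler_ltD.
Qed.

Lemma seg_Lst2 j h : u <= h <= v -> g j h = Lst a (g j h0) (g j.+1 h).
Proof.
move=> i; have Rg : nm a < Rez (g j.+1 h) by have := gT j.+1 i; have := hT; have := nm_ge0 a; lra.
have LI : `|Imz (Lst a (g j h0) (g j.+1 h)) - Imz (g j h0)| < pi.
  rewrite -[X in _ - Imz X](Lst_id a (g j h0)); apply: Lst_Im2 => //.
  by rewrite gS ?ih//; have := gT j.+1 ih; have := hT; have := nm_ge0 a; lra.
apply: cexp_inj; last by apply: (addIr a); rewrite -!expmapE LstK// gS.
rewrite (_ : _ - _ = (Imz (g j h) - Imz (g j h0)) - (Imz (Lst a (g j h0) (g j.+1 h)) - Imz (g j h0))); last by ring.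
by apply: le_lt_trans (ler_normB _ _) _; rewrite mulr2n; apply: ltrD LI; exact: gI.
Qed.

(** Closeness at level n is needed for all s up to t: at each pullback it keeps the path in the
    half-plane that determines the branch. *)
Lemma seg_pull n t : p <= t -> t <= q ->
  (forall s, p <= s <= t -> exists2 h, u <= h <= v & nm (orb n (k s) - g n h) <= 20) ->
  forall h, u <= h <= v -> nm (orb n (k t) - g n h) <= 20 -> nm (k t - g 0%N h) <= 20 / 2 ^+ n.
Proof.
move=> pt tq H h ih' hh.
have [hs hsP] : exists hs : R -> R, forall s, p <= s <= t -> u <= hs s <= v /\ nm (orb n (k s) - g n (hs s)) <= 20.
  have ex s : exists h, p <= s <= t -> u <= h <= v /\ nm (orb n (k s) - g n h) <= 20.
    have [is_|nis] := boolP (p <= s <= t); last by exists 0.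
    by have [h' i1 i2] := H s is_; exists h'.
  by have [hs hs'] := choice ex; exists hs.
pose hs' s := if s == t then h else hs s.
have hs'P s : p <= s <= t -> u <= hs' s <= v /\ nm (orb n (k s) - g n (hs' s)) <= 20.
  by rewrite /hs'; case: eqP => [->|_] //; exact: hsP.
have step m : (m <= n)%N -> forall s, p <= s <= t -> nm (orb (n - m) (k s) - g (n - m)%N (hs' s)) <= 20 / 2 ^+ m.
  elim: m => [|m IH] mn s is_; first by rewrite subn0 expr0 divr1; exact: (hs'P s is_).2.
  have nS : (n - m = (n - m.+1).+1)%N by rewrite subnSK.
  have {}IH := IH (ltnW mn); rewrite nS in IH; move: (n - m.+1)%N IH => j IH.
  have Rs s' : p <= s' <= t -> T - 20 <= Rez (orb j.+1 (k s')).
    move=> i'; have := Re_near (IH s' i'); have := gT j.+1 (hs'P s' i').1.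
    by have := half_pow20 m; lra.
  have ihs := (hs'P s is_).1.
  rewrite (seg_Lst 0 is_ tq Rs) (seg_Lst2 j ihs); apply: le_trans (Lst_contract _ _ _) _.
  - by have := Rs s is_; have := hT; lra.
  - by have := gT j.+1 ihs; have := hT; lra.
  rewrite exprS invfM [2^-1 * _]mulrC mulrA; apply: le_trans (_ : (20 / 2 ^+ m) / 25 <= _).
    by rewrite ler_wpM2r ?invr_ge0//; exact: IH.
  by rewrite ler_wpM2l ?divr_ge0 ?exprn_ge0// lef_pV2 ?posrE// ler_nat.
have itt : p <= t <= t by rewrite pt lexx.
by have := step n (leqnn n) t itt; rewrite subnn /hs' eqxx.
Qed.

Lemma seg_barrier n s h : p <= s <= q ->
  (forall s', p <= s' <= s -> Rez (g n u) < Rez (orb n (k s')) < Rez (g n v)) ->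
  u <= h <= v -> `|Imz (orb n (k s)) - Imz (g n h)| < pi *+ 2 + pi.
Proof.
move=> /andP[ps sq] ins ih'.
apply: (@barrier_both _ p s u v (fun s => orb n (k s)) (g n)) => //.
- by apply: pcont_orb; apply: pcont_sub kc.
- by move=> s' h' /andP[i1 i2] ih''; apply: ncr => //; rewrite i1 (le_trans i2).
- exact: gI.
- by exists h0; [exact: ih|rewrite kp seg_orb// ih].
Qed.

Lemma strip_lip (b c : R) z w :
  `|Num.max (Rez z - c) (b - Rez z) - Num.max (Rez w - c) (b - Rez w)| <= nm (z - w).
Proof.
have := Re_nm (z - w); rewrite ReB; move: (nm _) (Rez z) (Rez w) => n x y hzw.
rewrite ler_norml in hzw; have /andP[? ?] := hzw.
by rewrite ler_norml; case: (leP (x - c) (b - x)) => ?; case: (leP (y - c) (b - y)) => ?; lra.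
Qed.

Lemma pcont_closed_le (c : R) (k' : R -> R[i]) (x t t1 : R) : x < t1 -> t1 <= t -> pcont x t k' ->
  (forall s, x <= s -> s < t1 -> `|Imz (k' s)| <= c) -> `|Imz (k' t1)| <= c.
Proof.
move=> xt tt kc' H; rewrite leNgt; apply/negP => h20.
have ee : 0 < `|Imz (k' t1)| - c by rewrite subr_gt0.
have i1 : x <= t1 <= t by rewrite tt andbT ltW.
have [d' d'0 H'] := kc' t1 i1 _ ee.
pose s' := Num.max x (t1 - d' / 2).
have l1 : x <= s' by rewrite le_max lexx.
have l2 : s' < t1 by rewrite gt_max xt; lra.
have l3 : t1 - d' / 2 <= s' by rewrite le_max lexx orbT.
have l4 : x <= s' <= t by rewrite l1 (le_trans (ltW l2)).
have l5 : `|s' - t1| < d' by rewrite ltr_norml; lra.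
have := le_lt_trans (Im_lip _ _) (H' s' l4 l5); have := H s' l1 l2.
have := ler_normD (Imz (k' t1) - Imz (k' s')) (Imz (k' s')); rewrite subrK distrC; lra.
Qed.

(** Consider the first t1 at which level n leaves the vertical strip between the ends of g n. By the
    barriers the path is then within 20 of an end, so k t1 is within 20 / 2^n of g 0 u or g 0 v,
    while k t1 is still near g 0 h0. *)
Lemma seg_inside : exists q' N, p < q' <= q /\ forall n t, (N <= n)%N -> p <= t <= q' ->
  Rez (g n u) < Rez (orb n (k t)) < Rez (g n v).
Proof.
have pi4 := pi_le4 R.
pose D := Num.min (nm (g 0%N u - g 0%N h0)) (nm (g 0%N v - g 0%N h0)).
have Du : D <= nm (g 0%N u - g 0%N h0) by rewrite ge_min lexx.
have Dv : D <= nm (g 0%N v - g 0%N h0) by rewrite ge_min lexx orbT.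
have D0 : 0 < D.
  by rewrite lt_min !nm_gt0 !subr_eq0 !seg_inj ?iu ?iv//; [rewrite gt_eqF|rewrite lt_eqF].
move: D Du Dv D0 => D Du Dv D0.
have e0 : 0 < D / 2 by rewrite divr_gt0.
have ipp : p <= p <= q by rewrite lexx ltW.
have [d d0 Hd] := kc ipp e0.
have [q' pq' [q'q q'd]] : exists2 q', p < q' & q' <= q /\ q' <= p + d / 2.
  exists (Num.min q (p + d / 2)); first by rewrite lt_min pq; lra.
  by rewrite !ge_min !lexx orbT.
have near t : p <= t <= q' -> nm (k t - g 0%N h0) < D / 2.
  move=> /andP[it1 it2]; rewrite -kp; apply: Hd; first by rewrite it1 (le_trans it2).
  by rewrite ltr_norml; lra.
have dk : 0 < Num.min (h0 - u) (v - h0) by rewrite lt_min !subr_gt0 uh.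
have [N HN] := pow2_ge (21 : R) dk.
have [N2 HN2] := half_pow_lt 20 e0.
exists q', (maxn N N2); split; first by rewrite pq'.
move=> n t; rewrite geq_max => /andP[Nn N2n] it.
have R0 : Rez (g n u) < Rez (orb n (k p)) < Rez (g n v).
  rewrite kp seg_orb ?ih//.
  have m1 : 2 ^+ n * Num.min (h0 - u) (v - h0) <= 2 ^+ n * (h0 - u) by rewrite ler_pM2l ?exprn_gt0// ge_min lexx.
  have m2 : 2 ^+ n * Num.min (h0 - u) (v - h0) <= 2 ^+ n * (v - h0) by rewrite ler_pM2l ?exprn_gt0// ge_min lexx orbT.
  have k1 := gR n (lexx u) (ltW uh) (ltW hv); have k2 := gR n (ltW uh) (ltW hv) (lexx v).
  by have := HN n Nn; lra.
have small : 20 / 2 ^+ n < D / 2.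
  apply: le_lt_trans HN2; apply: ler_wpM2l => //; rewrite lef_pV2 ?posrE ?exprn_gt0//.
  by apply: ler_weXn2l => //; rewrite ler1n.
apply: contrapT => no.
pose phi z := Num.max (Rez z - Rez (g n v)) (Rez (g n u) - Rez z).
have lip z w : `|phi z - phi w| <= nm (z - w) by exact: strip_lip.
have /andP[pt tq] := it.
have ptk : pcont p t (fun s => orb n (k s)) by apply: pcont_orb; apply: pcont_sub kc => //; exact: le_trans q'q.
have ph0 : phi (orb n (k p)) < 0 by rewrite /phi gt_max !subr_lt0; case/andP: R0 => -> ->.
have ph1 : 0 <= phi (orb n (k t)).
  by rewrite leNgt; apply/negP; rewrite /phi gt_max !subr_lt0 => /andP[l1 l2]; apply: no; rewrite l1 l2.
have [t1 [/andP[pt1 t1t] ph1' first_]] := pcont_first_hit pt ptk lip ph0 ph1.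
have ins s : p <= s -> s < t1 -> Rez (g n u) < Rez (orb n (k s)) < Rez (g n v).
  by move=> ps st1; have := first_ s ps st1; rewrite /phi gt_max !subr_lt0 => /andP[-> ->].
have t1q' : t1 <= q' := le_trans t1t tq.
have t1q : t1 <= q := le_trans t1q' q'q.
have Ims s h : p <= s -> s < t1 -> u <= h <= v -> `|Imz (orb n (k s)) - Imz (g n h)| < pi *+ 2 + pi.
  move=> ps st1 ih'; apply: seg_barrier => //; first by rewrite ps (le_trans (ltW st1)).
  by move=> s' /andP[h1 h2]; apply: ins => //; exact: le_lt_trans st1.
have pt1' : p < t1.
  by rewrite lt_neqAle pt1 andbT; apply/eqP => e; move: ph0; rewrite e ph1' ltxx.
have bound13 : (pi : R) *+ 2 + pi <= 20 by rewrite mulr2n; lra.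
have close s : p <= s <= t1 -> forall h, u <= h <= v -> Rez (orb n (k s)) = Rez (g n h) -> nm (orb n (k s) - g n h) <= 20.
  move=> /andP[ps st1] h ih' e; apply: le_trans (nm_ReIm _) _; rewrite ReB e subrr normr0 add0r ImB.
  move: st1; rewrite le_eqVlt => /orP[/eqP ->|lt]; last by apply: le_trans (ltW (Ims s h ps lt ih')) _.
  have c0 : pcont p t (fun s => orb n (k s) - g n h).
    move=> x ix ee ee0; have [d' d'0 H'] := ptk x ix ee ee0; exists d' => // x' ix' hx.
    by rewrite opprB addrA subrK; exact: H'.
  have := @pcont_closed_le 20 _ p t t1 pt1' t1t c0; rewrite ImB; apply=> s' ps' st1.
  by rewrite ImB; apply: le_trans (ltW (Ims s' h ps' st1 ih')) _.
have bnd s : p <= s <= t1 -> Rez (g n u) <= Rez (orb n (k s)) <= Rez (g n v).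
  move=> /andP[ps st1]; move: st1; rewrite le_eqVlt => /orP[/eqP ->|lt].
    have : phi (orb n (k t1)) <= 0 by rewrite ph1'.
    by rewrite /phi ge_max !subr_le0 => /andP[-> ->].
  by have /andP[b1 b2] := ins s ps lt; rewrite !ltW.
have H s : p <= s <= t1 -> exists2 h, u <= h <= v & nm (orb n (k s) - g n h) <= 20.
  move=> is_; have /andP[b1 b2] := bnd s is_.
  have [h ih' e] := pcont_ivt uv (gc n) (@Re_lip R) b1 b2.
  by exists h => //; apply: close.
have it1 : p <= t1 <= t1 by rewrite pt1 lexx. have it1' : p <= t1 <= q' by rewrite pt1.
have nt1 := near t1 it1'.
have [e|e] : Rez (orb n (k t1)) = Rez (g n v) \/ Rez (orb n (k t1)) = Rez (g n u).
- move: ph1'; rewrite /phi; case: (leP (Rez (orb n (k t1)) - Rez (g n v)) (Rez (g n u) - Rez (orb n (k t1)))) => _ /eqP.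
    by rewrite subr_eq0 => /eqP ->; right.
  by rewrite subr_eq0 => /eqP ->; left.
- have hh := seg_pull pt1 t1q H iv (close t1 it1 v iv e).
  have := nm_triB (g 0%N v) (k t1) (g 0%N h0); rewrite (nmB (g 0%N v) (k t1)).
  by lra.
- have hh := seg_pull pt1 t1q H iu (close t1 it1 u iu e).
  have := nm_triB (g 0%N u) (k t1) (g 0%N h0); rewrite (nmB (g 0%N u) (k t1)).
  by lra.
Qed.

(* The translates of the segment g n by 2 pi i and -2 pi i confine orb n (k t) to
   a strip around it, and pulling back contracts. *)
Lemma follow_hair : exists2 q', p < q' <= q &
  forall t, p <= t <= q' -> exists2 h, u <= h <= v & k t = g 0%N h.
Proof.
have [q' [N [/andP[pq' q'q] ins]]] := seg_inside; exists q'; first by rewrite pq'.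
move=> t /andP[pt tq']; apply: contrapT => no.
have [|m m0 hm] := @pcont_gap _ u v (g 0%N) (k t) uv (gc 0%N).
  by move=> h ih'; apply/eqP => e; apply: no; exists h.
have [N3 HN3] := half_pow_lt 20 m0.
have [n nN nN3] : exists2 n, (N <= n)%N & (N3 <= n)%N.
  by exists (maxn N N3); rewrite ?leq_maxl ?leq_maxr.
have tq : t <= q := le_trans tq' q'q.
have close s : p <= s <= t -> exists2 h, u <= h <= v & nm (orb n (k s) - g n h) <= 20.
  move=> /andP[ps st]; have isq : p <= s <= q' by rewrite ps (le_trans st).
  have /andP[b1 b2] := ins n s nN isq.
  have [h ih' e] := pcont_ivt uv (gc n) (@Re_lip R) (ltW b1) (ltW b2).
  exists h => //; apply: le_trans (nm_ReIm _) _; rewrite ReB e subrr normr0 add0r ImB.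
  have : `|Imz (orb n (k s)) - Imz (g n h)| < pi *+ 2 + pi; last first.
    by have := pi_le4 R; rewrite mulr2n; lra.
  apply: seg_barrier => //; first by rewrite ps (le_trans st).
  by move=> s' /andP[i1 i2]; apply: ins => //; rewrite i1 (le_trans i2) ?(le_trans st).
have itt : p <= t <= t by rewrite pt lexx.
have [h ih' hh] := close t itt.
have := seg_pull pt tq close ih' hh; have := hm h ih'; rewrite nmB.
have : 20 / 2 ^+ n <= 20 / 2 ^+ N3 :> R.
  apply: ler_wpM2l => //; rewrite lef_pV2 ?posrE ?exprn_gt0//.
  by apply: ler_weXn2l => //; rewrite ler1n.
by lra.
Qed.

End FollowHair.

Section LateOrder.
Variables (R : realType) (a : R[i]) (T : R).
Hypothesis hT : 100 * 20 + nm a <= T.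
Implicit Types (z w x y e : R[i]) (s t h : R).
Notation f := (expmap a).
Notation orb := (orb a).

(** The order by speed up to finitely many iterates: it can be used before the orbits enter a
    half-plane, and it is unchanged when a point is replaced by one with the same later orbit. *)
Definition lslow x y := exists N, forall n, (N <= n)%N -> Rez (orb n x) + 100 <= Rez (orb n y).

Lemma lslow_asym x y : lslow x y -> ~ lslow y x.
Proof.
move=> [N h] [N' h']; have := h _ (leq_maxl N N'); have := h' _ (leq_maxr N N'); lra.
Qed.

Lemma lslow_trans x y z : lslow x y -> lslow y z -> lslow x z.
Proof.
move=> [N h] [N' h']; exists (maxn N N') => n; rewrite geq_max => /andP[/h h1 /h' h2]; lra.
Qed.

Lemma orb_eq_later j n x y : (j <= n)%N -> orb j x = orb j y -> orb n x = orb n y.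
Proof. by move=> /subnK <- e; rewrite !orbD e. Qed.

Lemma lslow_neq j x y : lslow x y -> orb j x <> orb j y.
Proof.
move=> [N h] e; have := h _ (leq_maxl N j); rewrite (orb_eq_later (leq_maxr N j) e); lra.
Qed.

Lemma lslow_orb j x y : lslow (orb j x) (orb j y) <-> lslow x y.
Proof.
split=> -[N h].
  exists (N + j)%N => n Nn; have jn : (j <= n)%N by exact: leq_trans (leq_addl _ _) Nn.
  by have := h (n - j)%N; rewrite -!orbD subnK//; apply; rewrite leq_subRL// addnC.
by exists N => n Nn; rewrite -!orbD; apply: h; exact: leq_trans Nn (leq_addr _ _).
Qed.

Lemma lslow_eql j x x' y : orb j x = orb j x' -> lslow x y -> lslow x' y.
Proof.
move=> e [N h]; exists (maxn N j) => n; rewrite geq_max => /andP[Nn jn].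
by rewrite -(orb_eq_later jn e); exact: h.
Qed.

Lemma lslow_eqr j x y y' : orb j y = orb j y' -> lslow x y -> lslow x y'.
Proof.
move=> e [N h]; exists (maxn N j) => n; rewrite geq_max => /andP[Nn jn].
by rewrite -(orb_eq_later jn e); exact: h.
Qed.

Lemma slower_lslow n x y : inJ a T (orb n x) -> inJ a T (orb n y) -> nearI a 20 (orb n x) (orb n y) ->
  slower a (orb n x) (orb n y) -> lslow x y.
Proof.
move=> h1 h2 h3 h4; apply/(lslow_orb n); have [N h] := slower_gap hT h1 h2 h3 h4.
by exists N.
Qed.

Lemma hair_lslow x t t' : inJ a T x -> valid a T x t -> t < t' -> lslow (hair a x 0 t) (hair a x 0 t').
Proof.
move=> xJ v tt; have d0 : 0 < t' - t by rewrite subr_gt0.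
have [N h] := pow2_ge (120 : R) d0; exists N => n /h.
have v' := valid_le hT xJ v (ltW tt).
rewrite !(hair_orb hT)//; have := Re_hair_gap hT n xJ v (ltW tt); lra.
Qed.

Lemma tpi_image z w : z - w = tpi 1 \/ z - w = tpi (-1) -> f z = f w.
Proof.
move=> [] /eqP; rewrite subr_eq => /eqP ->; rewrite addrC.
  by rewrite (_ : 1 = (1 : int)%:~R) ?expmap_tpi.
by rewrite (_ : -1 = (-1 : int)%:~R) ?expmap_tpi.
Qed.

Lemma tpi_Im z w : z - w = tpi 1 \/ z - w = tpi (-1) -> `|Imz z - Imz w| = pi *+ 2.
Proof.
by rewrite -ImB => -[] ->; rewrite /= ?mulr1 ?mulrN1 ?normrN ger0_norm// mulrn_wge0// pi_ge0.
Qed.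

End LateOrder.

(** * Extending uniform escape to the end of a gap *)

Section Gap.
Variables (R : realType) (a : R[i]) (T M : R).
Hypothesis hT : 100 * 20 + nm a <= T.
Hypothesis hM : expR T + nm a + 30 <= M.
Implicit Types (z w x y e : R[i]) (s t h : R).
Notation f := (expmap a).
Notation orb := (orb a).
Notation lslow := (lslow a).

Let TM : T + 30 <= M. Proof. exact: T_le_M hM. Qed.

Section OnePath.
Variables (p m : R) (g : R -> R[i]).
Hypotheses (pm : p < m) (gc : pcont p m g) (li : loc_inj p m g).
Hypotheses (wJ : inJ a M (g p)) (vJ : inJ a M (g m)).
Hypothesis ge : forall t, p <= t <= m -> esc a (g t).
Hypothesis lu : forall q, p < q <= m -> exists n, forall r, q <= r <= m -> inJ a T (orb n (g r)).

Lemma gap_near_end q : p < q <= m -> exists N, forall n r, (N <= n)%N -> q <= r <= m ->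
  inJ a T (orb n (g r)) /\ nearI a pi (orb n (g r)) (orb n (g m)).
Proof.
move=> /[dup] iq /lu[N h]; exists N => n r Nn ir; have /andP[pq qm] := iq.
have J r' : q <= r' <= m -> inJ a T (orb n (g r')).
  by move=> ir'; rewrite -(subnK Nn) orbD; apply: inJ_orb; exact: h.
split; first exact: J.
apply: (path_nearI hT qm _ J) => //; last by rewrite qm lexx.
by apply: pcont_orb; apply: pcont_sub gc => //; exact: ltW.
Qed.

Lemma gap_monotone : (forall s t, p < s -> s < t -> t <= m -> lslow (g s) (g t)) \/
  (forall s t, p < s -> s < t -> t <= m -> lslow (g t) (g s)).
Proof.
have K q : p < q -> q < m -> (forall s t, q <= s -> s < t -> t <= m -> lslow (g s) (g t)) \/
  (forall s t, q <= s -> s < t -> t <= m -> lslow (g t) (g s)).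
  move=> pq qm; have [|N h] := @gap_near_end q; first by rewrite pq ltW.
  have J r : q <= r <= m -> inJ a T (orb N (g r)) by move=> ir; exact: (h N r (leqnn N) ir).1.
  have gq : pcont q m g by apply: pcont_sub gc => //; exact: ltW.
  have lq : loc_inj q m g by apply: loc_inj_sub li => //; exact: ltW.
  have gqN := pcont_orb a N gq.
  have nI := path_nearI hT (ltW qm) gqN J.
  have [mo|mo] := path_monotone hT gqN J (loc_inj_orb a N gq lq); [left|right] => s t qs st tm;
    have is_ : q <= s <= m by [rewrite qs ltW// (lt_le_trans st)]; have it : q <= t <= m by rewrite tm ltW// (le_lt_trans qs).
    by apply: (slower_lslow hT (J s is_) (J t it) (nearI_pi20 (nI s t is_ it))); exact: mo.
  by apply: (slower_lslow hT (J t it) (J s is_) (nearI_pi20 (nI t s it is_))); exact: mo.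
pose q0 := (p + m) / 2.
have q0p : p < q0 by have := pm; rewrite /q0; lra.
have q0m : q0 < m by have := pm; rewrite /q0; lra.
have [h|h] := K q0 q0p q0m; [left|right] => s t ps st tm;
  have [sq|qs] := ltP s q0; try exact: h.
- have sm : s < m := lt_trans sq q0m.
  have [h'|h'] := K s ps sm; first exact: h'.
  by case: (lslow_asym (h q0 m (lexx _) q0m (lexx _))); exact: h' (ltW sq) q0m (lexx _).
- have sm : s < m := lt_trans sq q0m.
  have [h'|h'] := K s ps sm; last exact: h'.
  by case: (lslow_asym (h q0 m (lexx _) q0m (lexx _))); exact: h' (ltW sq) q0m (lexx _).
Qed.

Lemma gap_pull e : inJ a M e -> e = g m \/ (forall k, `|Imz (orb k e) - Imz (orb k (g m))| <= 16) ->
  (forall t, p < t <= m -> ~ lslow (g t) e) ->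
  forall r, p <= r <= m -> inJ a T (g r).
Proof.
move=> eJ en ns r /andP[]; rewrite le_eqVlt => /orP[/eqP <- _|pr rm].
  by apply: inJ_le wJ; have := TM; lra.
have [|N h] := @gap_near_end r; first by rewrite pr.
apply: (@inJ_le _ _ (M - 1)); first by have := TM; lra.
apply: (@uniform_pull _ a T M hT hM N r m g rm _ _ _ r); last by rewrite lexx.
- by apply: pcont_sub gc => //; exact: ltW.
- by move=> r' ir'; exact: (h N r' (leqnn _) ir').1.
move=> r' ir'; exists e; split => //.
  by case: en => [->|]; [left; exists m => //; rewrite rm lexx|right].
have /andP[rr' r'm] := ir'; move=> sl; apply: (ns r'); first by rewrite r'm (lt_le_trans pr).
have [J nI] := h N r' (leqnn _) ir'.
have eT : inJ a T (orb N e) by apply: inJ_orb; apply: inJ_le eJ; have := TM; lra.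
apply: (slower_lslow hT J eT _ sl); case: en => [->|en]; first exact: nearI_pi20.
move=> j; have := nI j; have := en (j + N)%N; rewrite !orbD distrC.
have := ler_normD (Imz (orb j (orb N (g r'))) - Imz (orb j (orb N (g m)))) (Imz (orb j (orb N (g m))) - Imz (orb j (orb N e))).
by rewrite addrA subrK; have := pi_le4 R; lra.
Qed.

(** The end m is then the slowest point and serves as e in [gap_pull]. *)
Lemma gap_dec : (forall s t, p < s -> s < t -> t <= m -> lslow (g t) (g s)) ->
  forall r, p <= r <= m -> inJ a T (g r).
Proof.
move=> dec; apply: (gap_pull vJ); first by left.
move=> t /andP[pt]; rewrite le_eqVlt => /orP[/eqP -> /[dup] /lslow_asym//|tm].
by apply: lslow_asym; apply: dec.
Qed.

Section Increasing.
Hypothesis inc : forall s t, p < s -> s < t -> t <= m -> lslow (g s) (g t).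

Let wT : inJ a T (g p). Proof. by apply: inJ_le wJ; have := TM; lra. Qed.
Let vT : inJ a T (g m). Proof. by apply: inJ_le vJ; have := TM; lra. Qed.
Let w10 : inJ a (T + 10) (g p). Proof. by apply: inJ_le wJ; have := TM; lra. Qed.
Let v10 : inJ a (T + 10) (g m). Proof. by apply: inJ_le vJ; have := TM; lra. Qed.
Let hT10 : 100 * 20 + nm a <= T + 10. Proof. by have := hT; lra. Qed.

Lemma hair_first_hit x k X : inJ a T x -> Rez (orb k x) < X ->
  exists2 h, 0 <= h & Rez (hair a x k h) = X /\ forall h', 0 <= h' <= h -> Rez (hair a x k h') <= X.
Proof.
move=> xJ xX; have v0 := valid0 hT xJ; pose H := X - Rez (orb k x) + 20.
have H0 : 0 <= H by rewrite /H; lra.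
have hc : pcont 0 H (hair a x k) := hair_pcont hT k xJ v0.
have [||h [/andP[h0 hH] e lt]] := @pcont_first_hit _ 0 H _ _ X H0 hc (@Re_lip R).
- by rewrite (hair0 hT k xJ).
- have := Re_hair_gap hT k xJ v0 H0; rewrite (hair0 hT k xJ) subr0.
  have : H <= 2 ^+ k * H by rewrite ler_peMl// exprn_ege1// ler1n.
  by rewrite /H; lra.
exists h => //; split=> // h' /andP[h'0]; rewrite le_eqVlt => /orP[/eqP ->|/lt h'']; first by rewrite e.
exact: ltW (h'' h'0).
Qed.

(** Level k of g, prolonged by the hairs of its two ends, so that both extremities reach an abscissa
    to the right of everything between them, as [translate_meet] requires. *)
Definition joined k t : R[i] :=
  if t <= p then hair a (g p) k (p - t) else if t <= m then orb k (g t) else hair a (g m) k (t - m).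

Lemma joined_orb k t : orb k (joined 0 t) = joined k t.
Proof.
rewrite /joined; case: leP => tp; first by rewrite (hair_orb hT)//; apply: (valid_ge0 hT wT); lra.
by case: leP => tm //; rewrite (hair_orb hT)//; apply: (valid_ge0 hT vT); lra.
Qed.

Lemma joined_pcont k u v : u <= p -> m <= v -> pcont u v (joined k).
Proof.
move=> up mv; apply: (@pcont_cat _ _ m); first apply: (@pcont_cat _ _ p).
- have h := hair_pcont hT (u := 0) (v := p - u) k wT (valid0 hT wT).
  have := pcont_shift (c := p) (pcont_opp h); rewrite oppr0 add0r.
  rewrite (_ : - (p - u) + p = u); last by ring.
  by apply: pcont_eq => t /andP[_ tp]; rewrite /joined tp; congr hair; ring.
- apply: pcont_eq (pcont_orb a k gc) => t /andP[pt tm]; rewrite /joined tm.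
  case: leP => // tp; have -> : t = p by lra.
  by rewrite subrr (hair0 hT)//.
- have h := hair_pcont hT (u := 0) (v := v - m) k vT (valid0 hT vT).
  have := pcont_shift (c := m) h; rewrite add0r subrK.
  apply: pcont_eq => t /andP[mt tv]; rewrite /joined.
  case: (leP t p) => tp; first by have := lt_le_trans pm mt; rewrite ltNge tp.
  case: (leP t m) => // tm; have -> : t = m by lra.
  by rewrite subrr (hair0 hT)//.
Qed.

Lemma joined_lslow s t : p < s -> s < t -> lslow (joined 0 s) (joined 0 t).
Proof.
move=> ps st; have pt := lt_trans ps st; rewrite /joined (leNgt s) (leNgt t) ps pt /=.
have vh r : 0 <= r -> valid a T (g m) r by move=> r0; exact (valid_ge0 hT vT r0).
have hm r : 0 < r -> lslow (g m) (hair a (g m) 0 r).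
  by move=> r0; have := hair_lslow hT vT (vh 0 (lexx 0)) r0; rewrite (hair0 hT).
have [sm|ms] := leP s m; have [tm|mt] := leP t m.
- exact: inc.
- have h : lslow (g m) (hair a (g m) 0 (t - m)) by apply: hm; rewrite subr_gt0.
  move: sm; rewrite le_eqVlt => /orP[/eqP ->//|sm]; apply: lslow_trans h.
  exact: inc.
- by have := lt_le_trans st tm; rewrite ltNge ltW.
- by apply: (hair_lslow hT vT (vh _ _)); rewrite ?ltrD2r// subr_ge0 ltW.
Qed.

Lemma joined_near_w k t : t <= p -> `|Imz (joined k t) - Imz (orb k (g p))| < pi.
Proof.
move=> tp; rewrite /joined tp -(hair0 hT k wT); apply: (hair_Im hT k wT) => //.
  by apply: (valid_ge0 hT wT); rewrite subr_ge0.
exact (valid0 hT wT).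
Qed.

Lemma joined_near_v t : p < t -> exists N, forall n, (N <= n)%N -> `|Imz (joined n t) - Imz (orb n (g m))| <= pi.
Proof.
move=> pt; have [tm|mt] := leP t m.
  have [|N h] := @gap_near_end t; first by rewrite pt.
  exists N => n Nn; have [|_ /(_ 0%N)] := h n t Nn; first by rewrite lexx.
  by rewrite /joined (leNgt t p) pt tm.
exists 0%N => n _; rewrite /joined (leNgt t p) pt (leNgt t m) mt /= -(hair0 hT n vT); apply/ltW/(hair_Im hT n vT).
  by apply: (valid_ge0 hT vT); rewrite subr_ge0 ltW.
exact (valid0 hT vT).
Qed.

(** A difference above 16 >= 4 pi at level k leaves more than 2 pi after both prolongations, so two
    points of the joined path differ by 2 pi i and have the same image. Two points on the hair of g
    p are too close for that, two points after p have different speeds; a point on the hair of g p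
    and one after p make the ends near from then on. *)
Lemma gap_eventually_near : exists N, forall n, (N <= n)%N -> `|Imz (orb n (g p)) - Imz (orb n (g m))| <= 16.
Proof.
have [all|] := pselect (forall n, `|Imz (orb n (g p)) - Imz (orb n (g m))| <= 16); first by exists 0%N.
move=> /existsNP[k /negP]; rewrite -ltNge => hk.
have [B hB] := pcont_bounded (ltW pm) (pcont_orb a k gc).
pose X := B + 1.
have XB t : p <= t <= m -> Rez (orb k (g t)) < X.
  by move=> it; have := hB t it; have := Re_le (orb k (g t)); rewrite /X; lra.
have ipp : p <= p <= m by rewrite lexx ltW. have imm : p <= m <= m by rewrite lexx ltW.
have [hw hw0 [ew lw]] := hair_first_hit wT (XB p ipp).
have [hv hv0 [ev lv]] := hair_first_hit vT (XB m imm).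
have up : p - hw <= p by rewrite gerBl. have mv : m <= m + hv by rewrite lerDl.
have ju : joined k (p - hw) = hair a (g p) k hw by rewrite /joined up; congr hair; ring.
have jv : `|Imz (joined k (m + hv)) - Imz (orb k (g m))| < pi /\ Rez (joined k (m + hv)) = X.
  rewrite /joined (leNgt _ p) (lt_le_trans pm mv) /=; case: (leP (m + hv) m) => mm.
    have e : hv = 0 by apply/eqP; rewrite eq_le hv0 andbT -(lerD2l m) addr0.
    by rewrite e addr0 subrr normr0 pi_gt0 -ev e (hair0 hT).
  rewrite (_ : m + hv - m = hv); last by ring.
  split=> //; rewrite -[X in _ - Imz X](hair0 hT k vT); apply: (hair_Im hT k vT).
    exact (valid_ge0 hT vT hv0).
  exact (valid0 hT vT).
have iw : `|Imz (joined k (p - hw)) - Imz (orb k (g p))| < pi by exact: joined_near_w.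
have uv : p - hw <= m + hv by apply: le_trans mv; apply: le_trans up (ltW pm).
have [||||s [t [is_ it st]]] := translate_meet (X := X) uv (joined_pcont k up mv).
- move=> t /andP[t1 t2]; rewrite /joined; case: (leP t p) => tp.
    by apply: lw; rewrite subr_ge0 tp /=; lra.
  case: (leP t m) => tm; first by apply/ltW/XB; rewrite tm ltW.
  by apply: lv; rewrite subr_ge0 (ltW tm) /=; lra.
- by rewrite ju.
- exact: jv.2.
- have := ler_normD (Imz (orb k (g p)) - Imz (joined k (p - hw)) + (Imz (joined k (p - hw)) - Imz (joined k (m + hv))))
      (Imz (joined k (m + hv)) - Imz (orb k (g m))).
  have := ler_normD (Imz (orb k (g p)) - Imz (joined k (p - hw))) (Imz (joined k (p - hw)) - Imz (joined k (m + hv))).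
  rewrite !addrA !subrK (distrC (Imz (orb k (g p)))) (distrC _ (Imz (joined k (m + hv)))) => l1 l2.
  by rewrite distrC in iw; have := jv.1; have := pi_le4 R; rewrite mulr2n; move: hk iw l1 l2; lra.
have Nst : joined k s - joined k t = tpi 1 \/ joined k s - joined k t = tpi (-1) by left.
have E : orb k.+1 (joined 0 s) = orb k.+1 (joined 0 t).
  by rewrite !orbS !joined_orb; exact: tpi_image Nst.
have Im2 := tpi_Im Nst.
have st_ne : s != t.
  by apply/eqP => e; move: Im2; rewrite e subrr normr0 => /esym/eqP; rewrite mulrn_eq0 /= gt_eqF// pi_gt0.
have key (x y : R) : x <= p -> p < y -> orb k.+1 (joined 0 x) = orb k.+1 (joined 0 y) ->
   exists N, forall n, (N <= n)%N -> `|Imz (orb n (g p)) - Imz (orb n (g m))| <= 16.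
  move=> xp py e; have [N h] := joined_near_v py; exists (maxn N k.+1) => n; rewrite geq_max => /andP[Nn kn].
  have := h n Nn; have := joined_near_w n xp; rewrite -(joined_orb n x) -(joined_orb n y) (orb_eq_later kn e) distrC.
  have := ler_normD (Imz (orb n (g p)) - Imz (orb n (joined 0 y))) (Imz (orb n (joined 0 y)) - Imz (orb n (g m))).
  by rewrite addrA subrK; have := pi_le4 R; lra.
have [sp|ps] := leP s p; have [tp|pt] := leP t p.
- have := joined_near_w k sp; have := joined_near_w k tp.
  have := ler_normB (Imz (joined k s) - Imz (orb k (g p))) (Imz (joined k t) - Imz (orb k (g p))).
  rewrite opprB addrA subrK Im2 mulr2n; lra.
- exact: key sp pt E.
- exact: key tp ps (esym E).
- case: (ltgtP s t) st_ne => // lt _.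
    by case: (lslow_neq (j := k.+1) (joined_lslow ps lt)).
  by case: (lslow_neq (j := k.+1) (joined_lslow pt lt)); rewrite E.
Qed.

Section Near.
Hypothesis nI : forall n, `|Imz (orb n (g p)) - Imz (orb n (g m))| <= 16.

Lemma gap_near_start q : p < q <= m -> exists N, forall n r, (N <= n)%N -> q <= r <= m ->
  inJ a T (orb n (g r)) /\ nearI a 20 (orb n (g p)) (orb n (g r)).
Proof.
move=> /gap_near_end[N h]; exists N => n r Nn ir; have [h1 h2] := h n r Nn ir; split=> // j.
have := h2 j; have := nI (j + n); rewrite !orbD => k1; rewrite distrC => k2.
have := ler_normD (Imz (orb j (orb n (g p))) - Imz (orb j (orb n (g m)))) (Imz (orb j (orb n (g m))) - Imz (orb j (orb n (g r)))).
by rewrite addrA subrK; have := pi_le4 R; lra.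
Qed.

(** As g t1 is slower than g p, the hair of the iterate W of g p continues below W by
    [valid_slower], and the path has to follow this hair near p. *)
Lemma gap_slow_start t1 : p < t1 <= m -> lslow (g t1) (g p) ->
  exists q N, p < q <= m /\ forall r, p <= r <= q -> inJ a T (orb N (g r)).
Proof.
move=> it1 sl; have /andP[pt1 t1m] := it1.
have [N1 h1] := gap_near_start it1.
have [N2 h2] := sl.
have it1' : p <= t1 <= m by rewrite t1m ltW.
have [N3 h3] := ge it1' (T + 10).
pose n2 := maxn N1 (maxn N2 N3).
have n21 : (N1 <= n2)%N by exact: leq_maxl.
have n22 : (N2 <= n2)%N by rewrite leq_max leq_maxl orbT.
have n23 : (N3 <= n2)%N by rewrite leq_max leq_maxr orbT.
have n2D k : (n2 <= k + n2)%N by exact: leq_addl.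
clearbody n2.
pose W := orb n2 (g p).
have WJ : inJ a (T + 10) W by apply: inJ_orb.
have WT : inJ a T W by apply: inJ_orb.
have yJ : inJ a (T + 10) (orb n2 (g t1)).
  by move=> k; rewrite -orbD; apply: h3; exact: leq_trans (n2D k).
have near1 : nearI a 20 W (orb n2 (g t1)) by apply: (h1 n2 t1 n21 _).2; rewrite lexx.
have vW : valid a (T + 10) W (- 1 / 2).
  apply: (valid_slower hT10 WJ yJ) => //.
  by have := h2 n2 n22; rewrite /W; lra.
have vWh h : - 1 / 2 <= h -> valid a (T + 10) W h by move=> hh; exact (valid_le hT10 WJ vW hh).
pose k t := orb n2 (g t).
have kW : k p = hair a W 0 0 by rewrite (hair0 hT10).
have lsW t : p < t <= t1 -> lslow (k t) W.
  move=> /andP[pt tt1]; apply/lslow_orb; move: tt1; rewrite le_eqVlt => /orP[/eqP ->//|lt].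
  by apply: lslow_trans sl; exact: inc.
have kinc s t : p < s -> s < t -> t <= t1 -> lslow (k s) (k t).
  by move=> ps st tt1; apply/lslow_orb; apply: inc => //; exact: le_trans t1m.
have kc : pcont p t1 k by apply: pcont_orb; apply: pcont_sub gc.
have Horb n h : - 1 / 2 <= h -> orb n (hair a W 0 h) = hair a W n h by move=> hh; apply: (hair_orb hT10 n WJ); exact: vWh.
have HI n h h' : - 1 / 2 <= h -> - 1 / 2 <= h' -> `|Imz (hair a W n h) - Imz (hair a W n h')| < pi.
  by move=> hh hh'; apply: (hair_Im hT10 n WJ); exact: vWh.
pose Cross n t h := p <= t <= t1 /\ (orb n (k t) - hair a W n h = tpi 1 \/ orb n (k t) - hair a W n h = tpi (-1)).
have h00 : - 1 / 2 <= (0 : R) by rewrite mulNr oppr_le0.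
have ncr_p n h : - 1 / 2 <= h -> ~ Cross n p h.
  move=> hh [_ /tpi_Im]; rewrite kW (Horb n 0 h00).
  by move=> e; have := HI n 0 h h00 hh; rewrite e mulr2n; have := pi_gt0 R; lra.
have cross_img n t h : - 1 / 2 <= h -> Cross n t h -> orb n.+1 (k t) = orb n.+1 (hair a W 0 h).
  by move=> hh [_ /tpi_image]; rewrite !orbS Horb.
(* Without crossings of the translates from level N on, [follow_hair] puts orb N (k t) on level N of
   the hair of W for t near p, hence in a half-plane for ever. *)
have finish u N : - 1 / 2 <= u -> u < 0 -> (forall n t h, (N <= n)%N -> u <= h <= 1 -> ~ Cross n t h) ->
    exists q N, p < q <= m /\ forall r, p <= r <= q -> inJ a T (orb N (g r)).
  move=> u0 u1 nc.
  have vu h : u <= h -> valid a (T + 10) W h by move=> hh; apply: vWh; exact: le_trans hh.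
  have := @follow_hair _ a T hT p t1 u 1 0 (fun t => orb N (k t)) (fun n => hair a W (n + N)) pt1 u1 ltr01.
  case.
  - exact: pcont_orb.
  - by rewrite kW (Horb N 0 h00).
  - by move=> n; apply: (hair_pcont hT10 _ WJ); exact: vu.
  - by move=> n h /andP[h1' _]; apply: (hairS hT10 _ WJ); exact: vu.
  - by move=> n h /andP[h1' _]; have := Re_hair_ge hT10 (n + N) WJ (vu h h1'); rewrite addrK.
  - by move=> n h h' /andP[h1' _] /andP[h2' _]; apply: (hair_Im hT10 _ WJ); exact: vu.
  - move=> n h h' h1' hh' _; have := Re_hair_gap hT10 (n + N) WJ (vu h h1') hh'.
    have : 2 ^+ n * (h' - h) <= 2 ^+ (n + N) * (h' - h).
      by rewrite ler_wpM2r ?subr_ge0// ler_weXn2l ?ler1n// leq_addr.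
    lra.
  - move=> n s h is_ ih; rewrite -orbD; split; apply/eqP => e; apply: (nc (n + N)%N s h) => //; rewrite ?leq_addl//; split=> //; by [left|right].
  - move=> q' /andP[pq' q't1] H; exists q', (N + n2)%N; split; first by rewrite pq' (le_trans q't1).
    move=> r ir; have [h /andP[h1' _] e] := H r ir; rewrite orbD -/(k r) e add0n.
    by move=> j; rewrite -Horb ?(le_trans u0)// -orbD Horb ?(le_trans u0)//;
      have := Re_hair_ge hT10 (j + N) WJ (vu h h1'); rewrite addrK.
have [none|] := pselect (forall n t h, - 1 / 2 <= h <= 1 -> ~ Cross n t h).
  apply: (finish (- 1 / 2) 0%N) => // n t h _; exact: none.
(* A crossing identifies the later orbits of k t0 and of the hair point at h0, and speeds force h0 <
   0. Restrict the hair to [h0, 1] and to late levels: another crossing at t has t0 <= t by speeds,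
   and then the imaginary parts differ by less than pi + pi, not by 2 pi. *)
move=> /existsNP[n0 /existsNP[t0 /existsNP[h0 /not_implyP[ih0 /contrapT cr0]]]].
have /andP[h0u h0v] := ih0.
have pt0 : p < t0.
  have [/andP[pt0 _] _] := cr0; rewrite lt_neqAle pt0 andbT; apply/eqP => e.
  by apply: (ncr_p n0 h0) => //; rewrite e.
have it0 : p < t0 <= t1 by rewrite pt0; have [/andP[_ ->]] := cr0.
have e0 := cross_img n0 t0 h0 h0u cr0.
have h0n : h0 < 0.
  rewrite ltNge; apply/negP => h0p; have : lslow (hair a W 0 h0) W by apply: lslow_eql e0 (lsW t0 it0).
  have E0 : hair a W 0 0 = W by rewrite (hair0 hT10).
  move: h0p; rewrite le_eqVlt => /orP[/eqP <-|h0p].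
    by rewrite E0 => /[dup] /lslow_asym.
  apply: lslow_asym; rewrite -{1}E0; apply: (hair_lslow hT WT) h0p.
  exact (valid0 hT WT).
have [|N0 hN0] := @gap_near_start t0; first by rewrite pt0 (le_trans _ t1m)//; case/andP: it0.
apply: (finish h0 (maxn n0.+1 N0)) => // n t h; rewrite geq_max => /andP[n0n N0n] /andP[h0h h1'] cr.
have hh : - 1 / 2 <= h := le_trans h0u h0h.
have e := cross_img n t h hh cr.
have pt : p < t.
  have [/andP[pt _] _] := cr; rewrite lt_neqAle pt andbT; apply/eqP => e'.
  by apply: (ncr_p n h) => //; rewrite e'.
have [/andP[_ tt1] crI] := cr.
have t0t1 : t0 <= t1 by case/andP: it0.
have e0n : orb n (k t0) = hair a W n h0 by rewrite -Horb//; exact: orb_eq_later n0n e0.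
have t0t : t0 <= t.
  rewrite leNgt; apply/negP => lt; have l1 := kinc t t0 pt lt t0t1.
  have l2 : lslow (hair a W 0 h) (hair a W 0 h0) by apply: lslow_eql e _; apply: lslow_eqr e0 l1.
  move: h0h; rewrite le_eqVlt => /orP[/eqP e'|h0h]; first by move: l2; rewrite e' => /[dup] /lslow_asym.
  apply: (lslow_asym l2); apply: (hair_lslow (T := T + 10) hT10 WJ _ h0h); exact: vWh.
have J r : t0 <= r <= t1 -> inJ a T (orb n (k r)).
  by move=> /andP[r1 r2]; rewrite /k -orbD; apply: (hN0 _ r _ _).1; [exact: leq_trans N0n (leq_addr _ _)|rewrite r1 (le_trans r2)].
have := @path_nearI _ a T hT t0 t1 (fun r => orb n (k r)) t0t1 _ J t t0.
have c' : pcont t0 t1 (fun r => orb n (k r)) by apply: pcont_orb; apply: pcont_sub kc => //; exact: ltW.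
move=> /(_ c'); rewrite t0t tt1 t0t1 lexx => /(_ isT isT 0%N).
rewrite !orb0 e0n; have := HI n h0 h h0u hh; have := tpi_Im crI.
have := ler_normD (Imz (orb n (k t)) - Imz (hair a W n h0)) (Imz (hair a W n h0) - Imz (hair a W n h)).
by rewrite addrA subrK => l0 e2; rewrite e2 mulr2n in l0; lra.
Qed.

End Near.
End Increasing.
End OnePath.
End Gap.

(** * Escape is uniform along arcs *)

Section UniformEscape.
Variables (R : realType) (a : R[i]) (T M : R).
Hypothesis hT : 100 * 20 + nm a <= T.
Hypothesis hM : expR T + nm a + 30 <= M.
Implicit Types (z w : R[i]) (s t h p q m x y : R) (g : R -> R[i]).
Notation f := (expmap a).
Notation orb := (orb a).

Let TM : T + 30 <= M. Proof. exact: T_le_M hM. Qed.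

Lemma gap_uniform_aux p m g : p < m -> pcont p m g -> loc_inj p m g -> inJ a M (g p) -> inJ a M (g m) ->
  (forall t, p <= t <= m -> esc a (g t)) ->
  (forall q, p < q <= m -> exists n, forall r, q <= r <= m -> inJ a T (orb n (g r))) ->
  (forall n, `|Imz (orb n (g p)) - Imz (orb n (g m))| <= 16) ->
  exists n, forall r, p <= r <= m -> inJ a T (orb n (g r)).
Proof.
move=> pm gc li wJ vJ ge lu nI.
have [inc|dec] := gap_monotone hT pm gc li lu; last first.
  by exists 0%N; exact: (gap_dec hT hM gc wJ vJ lu dec).
have [fast|] := pselect (forall t, p < t <= m -> ~ lslow a (g t) (g p)).
  exists 0%N => r ir; apply: (gap_pull hT hM gc wJ lu wJ _ fast) => //.
  by right.
move=> /existsNP[t1 /not_implyP[it1 /contrapT sl]].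
have [q [N [/andP[pq qm] H]]] := gap_slow_start hT hM gc wJ ge lu inc nI it1 sl.
have [|N' H'] := lu q; first by rewrite pq.
exists (maxn N N') => r /andP[pr rm]; have [rq|qr] := leP r q.
  by rewrite -(subnK (leq_maxl N N')) orbD; apply: inJ_orb; apply: H; rewrite pr.
by rewrite -(subnK (leq_maxr N N')) orbD; apply: inJ_orb; apply: H'; rewrite ltW.
Qed.

Lemma shift_lu j p m g : (forall q, p < q <= m -> exists n, forall r, q <= r <= m -> inJ a T (orb n (g r))) ->
  forall q, p < q <= m -> exists n, forall r, q <= r <= m -> inJ a T (orb n (orb j (g r))).
Proof.
move=> lu q iq; have [n H] := lu q iq; exists n => r ir.
by rewrite -orbD addnC orbD; apply: inJ_orb; exact: H.
Qed.

Lemma shift_esc j p m g : (forall t, p <= t <= m -> esc a (g t)) -> forall t, p <= t <= m -> esc a (orb j (g t)).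
Proof. by move=> h t it; apply/esc_orb; exact: h. Qed.

(** First n0 iterates bring g m into [inJ a M]; when speed increases along the path, N more make the
    two ends near as in [gap_eventually_near]. *)
Lemma gap_uniform p m g : p < m -> pcont p m g -> loc_inj p m g -> inJ a M (g p) ->
  (forall t, p <= t <= m -> esc a (g t)) ->
  (forall q, p < q <= m -> exists n, forall r, q <= r <= m -> inJ a T (orb n (g r))) ->
  exists n, forall r, p <= r <= m -> inJ a T (orb n (g r)).
Proof.
move=> pm; pose P g j := exists n, forall r, p <= r <= m -> inJ a T (orb n (orb j (g r))).
have unshift g' j : P g' j -> exists n, forall r, p <= r <= m -> inJ a T (orb n (g' r)).
  by move=> [n H]; exists (n + j)%N => r ir; rewrite orbD; exact: H.
have main g' : pcont p m g' -> loc_inj p m g' -> inJ a M (g' p) -> inJ a M (g' m) ->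
    (forall t, p <= t <= m -> esc a (g' t)) ->
    (forall q, p < q <= m -> exists n, forall r, q <= r <= m -> inJ a T (orb n (g' r))) ->
    exists n, forall r, p <= r <= m -> inJ a T (orb n (g' r)).
  move=> gc li wJ vJ ge lu; have [inc|dec] := gap_monotone hT pm gc li lu; last first.
    by exists 0%N; exact: (gap_dec hT hM gc wJ vJ lu dec).
  have [N nI] := gap_eventually_near hT hM pm gc wJ vJ lu inc.
  apply: (unshift g' N); apply: gap_uniform_aux => //.
  - exact: pcont_orb.
  - exact: loc_inj_orb.
  - exact: inJ_orb.
  - exact: inJ_orb.
  - exact: shift_esc.
  - exact: shift_lu.
  - by move=> n; rewrite -!orbD; apply: nI; exact: leq_addl.
move=> gc li wJ ge lu; have imm : p <= m <= m by rewrite lexx ltW.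
have [n0 vE] := ge m imm M.
apply: (unshift g n0); apply: main.
- exact: pcont_orb.
- exact: loc_inj_orb.
- exact: inJ_orb.
- by move=> k; rewrite -orbD; apply: vE; exact: leq_addl.
- exact: shift_esc.
- exact: shift_lu.
Qed.

Definition loc_unif u v g t := exists d : R, exists n, 0 < d /\
  forall s, u <= s <= v -> `|s - t| < d -> inJ a T (orb n (g s)).

Lemma loc_unif_seg u v g s t : u <= s -> t <= v -> s <= t -> (forall r, s <= r <= t -> loc_unif u v g r) ->
  exists n, forall r, s <= r <= t -> inJ a T (orb n (g r)).
Proof.
move=> us tv st lu.
apply: (@seg_ind _ s t (fun x y => exists n, forall r, x <= r <= y -> inJ a T (orb n (g r))) st).
  move=> r ir; have [d [n [d0 H]]] := lu r ir; exists d => // x y sx xr ry yt dx dy.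
  exists n => q /andP[xq qy]; apply: H; first by rewrite (le_trans us) ?(le_trans sx)// (le_trans qy) ?(le_trans yt).
  by rewrite ltr_norml; apply/andP; split; move: dx dy xq qy; lra.
move=> x m y _ xm my _ [n1 H1] [n2 H2]; exists (maxn n1 n2) => r /andP[xr ry].
have [rm|mr] := leP r m.
  by rewrite -(subnK (leq_maxl n1 n2)) orbD; apply: inJ_orb; apply: H1; rewrite xr.
by rewrite -(subnK (leq_maxr n1 n2)) orbD; apply: inJ_orb; apply: H2; rewrite ltW.
Qed.

Lemma loc_unif_open u v g t : loc_unif u v g t -> exists2 d : R, 0 < d & forall s, u <= s <= v -> `|s - t| < d -> loc_unif u v g s.
Proof.
move=> [d [n [d0 H]]]; exists (d / 2); first by rewrite divr_gt0.
move=> s is_ sd; exists (d / 2), n; split; first by rewrite divr_gt0.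
move=> r ir rs; apply: H => //; have := ler_normD (r - s) (s - t); rewrite addrA subrK.
by move: rs sd; lra.
Qed.

Lemma loc_unif_opp u v g t : loc_unif u v g t <-> loc_unif (- v) (- u) (fun s => g (- s)) (- t).
Proof.
have E (x y : R) : - x - y = - (x - - y) by ring.
split=> -[d [n [d0 H]]]; exists d, n; split=> // s is_ sd.
  by apply: H; [move: is_; lra|rewrite E normrN].
by rewrite -(opprK s); apply: H; [move: is_; lra|rewrite -opprD normrN].
Qed.

(** The two halves escape uniformly from some time depending on the gap, but [uniform_two_ends]
    brings the bound back to time 0. This makes it common to infinitely many gaps. *)
Lemma two_ended_gap p s g : p < s -> pcont p s g -> loc_inj p s g -> inJ a M (g p) -> inJ a M (g s) ->
  (forall t, p <= t <= s -> esc a (g t)) -> (forall t, p < t < s -> loc_unif p s g t) ->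
  forall r, p <= r <= s -> inJ a T (g r).
Proof.
move=> ps gc li Jp Js ge lu.
pose m := (p + s) / 2.
have pm : p < m by rewrite /m; move: ps; lra. have ms : m < s by rewrite /m; move: ps; lra.
have [||||n1 H1] := @gap_uniform p m g pm _ _ Jp.
- by apply: pcont_sub gc => //; exact: ltW.
- by apply: loc_inj_sub li => //; exact: ltW.
- by move=> t /andP[pt tm]; apply: ge; rewrite pt (le_trans tm)// ltW.
- move=> q /andP[pq qm]; apply: (@loc_unif_seg p s); rewrite ?(ltW pq) ?(ltW ms)// => r /andP[qr rm].
  by apply: lu; rewrite (lt_le_trans pq)//= (le_lt_trans rm).
have sm : - s < - m by rewrite ltrN2.
have [|||||n2 H2] := @gap_uniform (- s) (- m) (fun t => g (- t)) sm.
- by apply: pcont_opp; apply: pcont_sub gc => //; exact: ltW.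
- by apply: loc_inj_opp; apply: loc_inj_sub li => //; exact: ltW.
- by rewrite opprK.
- by move=> t it; apply: ge; move: it pm; lra.
- move=> q iq; have [||||n H] := @loc_unif_seg p s g m (- q).
  + exact: ltW.
  + by move: iq; lra.
  + by move: iq; lra.
  + by move=> r /andP[qr rm]; apply: lu; rewrite (lt_le_trans pm)//=; move: rm iq; lra.
  + by exists n => r ir; apply: H; move: ir; lra.
have J r : p <= r <= s -> inJ a T (orb (maxn n1 n2) (g r)).
  move=> /andP[pr rs]; have [rm|mr] := leP r m.
    by rewrite -(subnK (leq_maxl n1 n2)) orbD; apply: inJ_orb; apply: H1; rewrite pr.
  rewrite -(subnK (leq_maxr n1 n2)) orbD; apply: inJ_orb; rewrite -(opprK r); apply: H2.
  by move: rs mr; lra.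
move=> r ir; apply: (@inJ_le _ _ (M - 1)); first by move: TM; lra.
exact: (uniform_two_ends hT hM (ltW ps) gc li J Jp Js ir).
Qed.

Lemma last_point (K : R -> Prop) x s : x <= s -> K x ->
  (forall t, ~ K t -> x <= t <= s -> exists2 d : R, 0 < d & forall r, x <= r <= s -> `|r - t| < d -> ~ K r) ->
  exists p, [/\ x <= p <= s, K p & forall r, p < r -> r <= s -> ~ K r].
Proof.
move=> xs Kx op; pose S := [set r | x <= r <= s /\ K r].
have Sx : S x by split => //; rewrite lexx.
have Sub : has_sup S by split; [exists x | exists s => r [/andP[]]].
have xu : x <= sup S by apply: sup_upper_bound.
have us : sup S <= s by apply: sup_le_ub; [exists x | move=> r [/andP[]]].
have ius : x <= sup S <= s by rewrite xu.
exists (sup S); split => //; last first.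
  move=> r ur rs Kr; have : S r by split => //; rewrite rs (le_trans xu) ?ltW.
  by move=> /(sup_upper_bound Sub); rewrite leNgt ur.
apply: contrapT => nK; have [d d0 H] := op _ nK ius.
have [r [ir Kr] rs] := sup_adherent d0 Sub; have rS : r <= sup S by apply: sup_upper_bound.
by apply: (H r ir _ Kr); rewrite ltr_norml; move: rs rS d0; lra.
Qed.

Section Nonuniform.
Variables (u v : R).

(** Either a gap starts at x, and [gap_uniform] applies; or bad parameters y accumulate at x from
    the right, and each parameter up to one such y is bad itself or in a gap with two bad ends,
    where [two_ended_gap] applies. *)
Lemma right_side g N x d : pcont u v g -> loc_inj u v g -> (forall t, u <= t <= v -> esc a (g t)) ->
  u <= x <= v -> ~ loc_unif u v g x -> 0 < d ->
  (forall y, u <= y <= v -> ~ loc_unif u v g y -> `|y - x| < d -> inJ a M (orb N (g y))) ->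
  exists n, exists2 d', 0 < d' & forall s, u <= s <= v -> x <= s -> s < x + d' -> inJ a T (orb n (g s)).
Proof.
move=> gc li ge /[dup] ix /andP[ux xv] nx d0 H.
have xJ : inJ a M (orb N (g x)) by apply: H => //; rewrite subrr normr0.
move: xv; rewrite le_eqVlt => /orP[/eqP xv|xv].
  exists N, 1 => // s /andP[us sv] xs _; have -> : s = x by apply/eqP; rewrite eq_le xs {1}xv sv.
  by apply: inJ_le xJ; move: TM; lra.
pose k t := orb N (g t).
have kc : pcont u v k := pcont_orb a N gc.
have kli : loc_inj u v k := loc_inj_orb a N gc li.
have lu_shift s t r : u <= s -> t <= v -> loc_unif u v g r -> loc_unif s t k r.
  move=> us tv [e [n [e0 h]]]; exists e, n; split=> // q /andP[sq qt] qr.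
  by rewrite /k -orbD addnC orbD; apply: inJ_orb; apply: h => //; rewrite (le_trans us)// (le_trans qt).
have [[d'' d''0 free]|acc] := pselect (exists2 d'' : R, 0 < d'' & forall s, x < s -> s < x + d'' -> s <= v -> loc_unif u v g s).
  have [m xm [mv md]] : exists2 m, x < m & m <= v /\ m < x + d''.
    exists (Num.min v (x + d'' / 2)).
      by rewrite lt_min xv; move: d''0; lra.
    split; first by rewrite ge_min lexx.
    by rewrite gt_min; apply/orP; right; move: d''0; lra.
  have [||||n Hn] := @gap_uniform x m k xm _ _ xJ.
  - exact: pcont_sub kc.
  - exact: loc_inj_sub kli.
  - by move=> t /andP[xt tm]; apply/esc_orb; apply: ge; rewrite (le_trans ux) ?(le_trans tm).
  - move=> q /andP[xq qm]; apply: (@loc_unif_seg x m k q m (ltW xq) (lexx _) qm) => r /andP[qr rm].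
    apply: lu_shift => //; apply: free; first exact: lt_le_trans qr.
      exact: le_lt_trans md.
    exact: le_trans mv.
  exists (n + N)%N, (m - x); first by rewrite subr_gt0.
  by move=> s _ xs sm; rewrite orbD; apply: Hn; rewrite xs /=; move: sm; lra.
have [y [xy yd yv ny]] : exists y, [/\ x < y, y < x + d, y <= v & ~ loc_unif u v g y].
  apply: contrapT => no; apply: acc; exists d => // s xs sd sv; apply: contrapT => ns.
  by apply: no; exists s.
have KJ s : x <= s -> s <= y -> ~ loc_unif u v g s -> inJ a M (k s).
  move=> xs sy ns; apply: H => //; first by rewrite (le_trans ux xs) (le_trans sy).
  by rewrite ger0_norm ?subr_ge0//; move: sy yd; lra.
have lo t : ~ ~ loc_unif u v g t -> exists2 d : R, 0 < d & forall r, u <= r <= v -> `|r - t| < d -> ~ ~ loc_unif u v g r.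
  by move=> /contrapT /loc_unif_open[e e0 h]; exists e => // r ir rt; apply; exact: h.
exists N, (y - x); first by rewrite subr_gt0.
move=> s isv xs sd; have {sd}sy : s < y by move: sd; lra.
have [us|ns] := pselect (loc_unif u v g s); last first.
  by apply: (@inJ_le _ _ M); [move: TM; lra|apply: KJ => //; exact: ltW].
have sub t : x <= t -> t <= y -> u <= t <= v by move=> xt ty; rewrite (le_trans ux xt) (le_trans ty yv).
have [|p [/andP[xp ps] Kp pfree]] := @last_point (fun r => ~ loc_unif u v g r) x s xs nx.
  move=> t /lo[e e0 h] it; exists e => // r /andP[xr rs]; apply: h.
  by apply: sub => //; rewrite (le_trans rs)// ltW.
(* The first bad parameter after s is the last one before - s for the reflected path. *)
have ys' : - y <= - s by rewrite lerN2 ltW.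
have Ky : ~ loc_unif u v g (- (- y)) by rewrite opprK.
have [|q [/andP[yq qs] Kq qfree]] := @last_point (fun r => ~ loc_unif u v g (- r)) (- y) (- s) ys' Ky.
  move=> t /lo[e e0 h] it; exists e => // r /andP[yr rs] rt; apply: h.
    by apply: sub; [rewrite (le_trans xs)// lerNr|rewrite lerNl].
  by rewrite -opprD normrN.
have ne r : ~ loc_unif u v g r -> r != s by move=> nr; apply/eqP => e; apply: nr; rewrite e.
have ps' : p < s by rewrite lt_neqAle ps ne.
have sq : s < - q by rewrite lt_neqAle eq_sym ne//= lerNr.
have pq : p < - q := lt_trans ps' sq.
have qy : - q <= y by rewrite lerNl.
apply: (@two_ended_gap p (- q) k pq).
- by apply: pcont_sub kc; [exact: le_trans ux xp|exact: le_trans qy yv].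
- by apply: loc_inj_sub kli; [exact: le_trans ux xp|exact: le_trans qy yv].
- by apply: KJ => //; exact: le_trans (ltW pq) qy.
- by apply: KJ => //; exact: le_trans xp (ltW pq).
- by move=> t /andP[pt tq]; apply/esc_orb; apply: ge; apply: sub; [exact: le_trans pt|exact: le_trans qy].
- move=> t /andP[pt tq]; apply: lu_shift; [exact: le_trans ux xp|exact: le_trans qy yv|].
  apply: contrapT => nt; have [ts|st] := leP t s; first exact: (pfree t pt ts nt).
  apply: (qfree (- t)); rewrite ?opprK//; first by rewrite ltrNr.
  by rewrite lerN2 ltW.
- by rewrite (ltW ps') (ltW sq).
Qed.

(** Otherwise nested intervals with centres in K avoid A 0, A 1, ... in turn, and their common point
    is in the closed set K but in no A n. *)
Lemma baire_seg (K : R -> Prop) (A : nat -> R -> Prop) x0 :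
  u <= x0 <= v -> K x0 ->
  (forall t, u <= t <= v -> ~ K t -> exists2 d : R, 0 < d & forall r, u <= r <= v -> `|r - t| < d -> ~ K r) ->
  (forall n t, u <= t <= v -> ~ A n t -> exists2 d : R, 0 < d & forall r, u <= r <= v -> `|r - t| < d -> ~ A n r) ->
  (forall t, u <= t <= v -> K t -> exists n, A n t) ->
  exists N x, exists2 d : R, 0 < d & u <= x <= v /\ K x /\ forall y, u <= y <= v -> K y -> `|y - x| < d -> A N y.
Proof.
move=> ix0 Kx0 oK oA cov; apply: contrapT => no.
pose good (cd : R * R) := [/\ u <= cd.1 <= v, K cd.1 & 0 < cd.2].
have step (a' : nat * (R * R)) : exists cd' : R * R, good a'.2 ->
   [/\ good cd', cd'.2 <= a'.2.2 / 2, `|cd'.1 - a'.2.1| + cd'.2 <= a'.2.2 &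
     forall r, u <= r <= v -> `|r - cd'.1| <= cd'.2 -> ~ A a'.1 r].
  case: a' => n [c d] /=; have [[/= ic Kc d0]|] := pselect (good (c, d)); last by exists (0, 0).
  have d2 : 0 < d / 2 by rewrite divr_gt0.
  have [y [iy Ky yc nA]] : exists y, [/\ u <= y <= v, K y, `|y - c| < d / 2 & ~ A n y].
    apply: contrapT => no'; apply: no; exists n, c, (d / 2) => //; split=> //; split=> // y iy Ky yc.
    by apply: contrapT => nA; apply: no'; exists y.
  have [e e0 he] := oA n y iy nA.
  have m0 : 0 < Num.min (d / 2) (e / 2) by rewrite lt_min d2 divr_gt0.
  have m1 : Num.min (d / 2) (e / 2) <= d / 2 by rewrite ge_min lexx.
  have m2 : Num.min (d / 2) (e / 2) <= e / 2 by rewrite ge_min lexx orbT.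
  exists (y, Num.min (d / 2) (e / 2)) => _; split => //=.
    by move: m1 yc; lra.
  by move=> r ir rc; apply: he => //; move: rc m2 e0; lra.
have [F FP] := choice step.
pose s := fix s (n : nat) : R * R := match n with 0 => (x0, 1) | n'.+1 => F (n', s n') end.
have sg n : good (s n).
  elim: n => [|n IH]; first by split => //=.
  by have [] := FP (n, s n) IH.
have sP n : [/\ (s n.+1).2 <= (s n).2 / 2, `|(s n.+1).1 - (s n).1| + (s n.+1).2 <= (s n).2 &
     forall r, u <= r <= v -> `|r - (s n.+1).1| <= (s n.+1).2 -> ~ A n r].
  by have [] := FP (n, s n) (sg n).
pose lo n := (s n).1 - (s n).2; pose hi n := (s n).1 + (s n).2.
have nest n : lo n <= lo n.+1 /\ hi n.+1 <= hi n.
  have [_ + _] := sP n; rewrite /lo /hi; move: (s n.+1) (s n) => [c' d'] [c d] /= h.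
  have := ler_norm (c' - c); have := ler_norm (- (c' - c)); rewrite normrN; move: h; lra.
have nestm (n m : nat) : lo n <= lo (m + n)%N /\ hi (m + n)%N <= hi n.
  elim: m => [|m [I1 I2]]; first by rewrite add0n.
  by have [h1 h2] := nest (m + n)%N; split; [exact: le_trans I1 h1|exact: le_trans h2 I2].
have lohi (n m : nat) : lo n <= hi m.
  have pos k : lo k <= hi k by have [_ _] := sg k; rewrite /lo /hi; move: (s k).1 (s k).2=> ? ?; lra.
  have [h1 _] := nestm n m; have [_ h2] := nestm m n; rewrite addnC in h2.
  exact: le_trans h1 (le_trans (pos _) h2).
pose S := range lo; pose x := sup S.
have Sub : has_sup S by split; [exists (lo 0%N); exists 0%N|exists (hi 0%N) => _ [k _ <-]; exact: lohi].
have xlo n : lo n <= x by apply: sup_upper_bound => //; exists n.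
have xhi n : x <= hi n by apply: sup_le_ub; [exists (lo 0%N); exists 0%N|move=> _ [k _ <-]; exact: lohi].
have xin n : `|x - (s n).1| <= (s n).2.
  by have := xlo n; have := xhi n; rewrite /lo /hi ler_norml; lra.
have dn n : (s n).2 <= 1 / 2 ^+ n.
  elim: n => [|n IH]; first by rewrite expr0 divr1.
  have [h _ _] := sP n; apply: le_trans h _; rewrite exprS invfM mulrCA; move: IH; set q := _ / _; move: (s n).2 q=> ? ?; lra.
have ix : u <= x <= v.
  apply/andP; split; rewrite leNgt; apply/negP => h.
    have e0 : 0 < u - x by rewrite subr_gt0.
    have [n hn] := half_pow_lt 1 e0; have [/andP[h1 _] _ _] := sg n; have := xin n; have := dn n.
    by rewrite ler_norml; move: hn h1; set q := 1 / _ => hn h1 h2 /andP[h3 h4]; lra.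
  have e0 : 0 < x - v by rewrite subr_gt0.
  have [n hn] := half_pow_lt 1 e0; have [/andP[_ h1] _ _] := sg n; have := xin n; have := dn n.
  by rewrite ler_norml; move: hn h1; set q := 1 / _ => hn h1 h2 /andP[h3 h4]; lra.
have Kx : K x.
  apply: contrapT => nK; have [e e0 he] := oK x ix nK; have [n hn] := half_pow_lt 1 e0.
  have [i1 K1 _] := sg n; apply: (he (s n).1 i1 _ K1); rewrite distrC.
  exact: le_lt_trans (xin n) (le_lt_trans (dn n) hn).
have [n An] := cov x ix Kx; have [_ _ h] := sP n; exact: (h x ix (xin n.+1) An).
Qed.

End Nonuniform.

(* Baire's theorem gives a portion of the closed set of non-uniform parameters
   on which escape is uniform; gap_uniform deals with its complementary gaps. *)
Theorem uniform_escape u v g : u <= v -> pcont u v g -> loc_inj u v g ->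
  (forall t, u <= t <= v -> esc a (g t)) ->
  exists n, forall t, u <= t <= v -> inJ a T (orb n (g t)).
Proof.
move=> uv gc li ge; apply: (@loc_unif_seg u v g u v (lexx _) (lexx _) uv) => t0 it0.
apply: contrapT => nt0.
have [|||N [x [d d0 [ix [nx H]]]]] := @baire_seg u v (fun t => ~ loc_unif u v g t)
   (fun n t => inJ a M (orb n (g t))) t0 it0 nt0.
- move=> t _ /contrapT /loc_unif_open[e e0 h]; exists e => // r ir rt; apply; exact: h.
- move=> n t it /existsNP[k /negP]; rewrite -ltNge => lt.
  have e0 : 0 < M - Rez (orb k (orb n (g t))) by rewrite subr_gt0.
  have [d d0 h] := pcont_orb a (k + n) gc it e0; exists d => // r ir rt J.
  have := h r ir rt; have := J k; rewrite !orbD => J' h'.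
  have := le_lt_trans (Re_le _) h'; rewrite ReB; move: J'; lra.
- by move=> t it _; have [n h] := ge t it M; exists n => k; rewrite -orbD; apply: h; exact: leq_addl.
have [n1 [d1 p1 H1]] := right_side gc li ge ix nx d0 H.
have ixo : - v <= - x <= - u by rewrite !lerN2 andbC.
have [|||n2 [d2 p2 H2]] := @right_side (- v) (- u) (fun s => g (- s)) N (- x) d (pcont_opp gc) (loc_inj_opp li) _ ixo _ d0.
- by move=> t it; apply: ge; rewrite lerNr lerNl andbC.
- by move=> h; apply: nx; exact: (loc_unif_opp u v g x).2 h.
- move=> y iy ny yd; apply: H; first by rewrite lerNr lerNl andbC.
    by move=> /(loc_unif_opp u v g (- y)).1; rewrite opprK.
  by rewrite -normrN opprB opprK addrC -(opprK x).
apply: nx; exists (Num.min d1 d2), (maxn n1 n2); split; first by rewrite lt_min p1.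
move=> s is_; rewrite lt_min => /andP[s1 s2]; have [xs|sx] := leP x s.
  rewrite -(subnK (leq_maxl n1 n2)) orbD; apply: inJ_orb; apply: H1 => //.
  by move: s1; rewrite ger0_norm ?subr_ge0//; lra.
rewrite -(subnK (leq_maxr n1 n2)) orbD; apply: inJ_orb; rewrite -(opprK s); apply: H2.
- by rewrite !lerN2 andbC.
- by rewrite lerN2 ltW.
- by move: s2; rewrite ltr0_norm ?subr_lt0//; lra.
Qed.

End UniformEscape.

(** * Points on hairs *)

Section OnHair.
Variables (R : realType) (a : R[i]).
Implicit Types (z w x y : R[i]) (s t h p q u v : R) (g : R -> R[i]).
Notation f := (expmap a).
Notation orb := (orb a).

(** 100 B + |a| is the threshold of [growth] for imaginary gaps B = 20. A point whose image has real
    part at least exp T0 + |a| has real part at least T0; the 30 in [M0] is slack. *)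
Definition T0 : R := 100 * 20 + nm a.
Definition M0 : R := expR T0 + nm a + 30.
Lemma T0_ge : 100 * 20 + nm a <= T0. Proof. exact: lexx. Qed.
Let hT := T0_ge.
Let hM : expR T0 + nm a + 30 <= M0. Proof. exact: lexx. Qed.
Opaque T0 M0.

Lemma arcP u v g : is_arc u v g <-> pcont u v g /\ forall s t, u <= s <= v -> u <= t <= v -> g s = g t -> s = t.
Proof.
split=> -[/pcontP h1 h2]; split=> //.
  by move=> s t is_ it; apply: h2; rewrite inE /= in_itv.
by move=> s t; rewrite !inE /= !in_itv /= => is_ it; exact: h2.
Qed.

Lemma inj_loc_inj u v g : (forall s t, u <= s <= v -> u <= t <= v -> g s = g t -> s = t) -> loc_inj u v g.
Proof. by move=> h t it; exists 1 => // s s' is_ is' _ _; exact: h. Qed.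

Lemma esc_inJ z c : esc a z -> exists N, forall n, (N <= n)%N -> inJ a c (orb n z).
Proof.
by move=> h; have [N H] := h c; exists N => n Nn k; rewrite -orbD; apply: H; exact: leq_trans Nn (leq_addl _ _).
Qed.

Lemma on_hairE z : on_hair a z <-> exists g, [/\ pcont (- 1) 1 g, forall s t, - 1 <= s <= 1 -> - 1 <= t <= 1 -> g s = g t -> s = t,
  forall t, - 1 <= t <= 1 -> esc a (g t) & g 0 = z].
Proof.
split=> -[g [h1 h2 h3]].
  have [c i] := (arcP _ _ _).1 h1; exists g; split => // t it; apply/escP; apply: h2.
  by rewrite in_itv.
by move=> h4; exists g; split => //; [exact/arcP|move=> t; rewrite in_itv /= => it; apply/escP; exact: h3].
Qed.

Lemma slower_valid x y n : inJ a T0 x -> inJ a T0 y -> nearI a 20 x y -> Rez (orb n y) + 1 <= Rez (orb n x) ->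
  valid a T0 (orb n x) (- 1 / 2).
Proof.
move=> xJ yJ nI h; apply: (valid_slower hT (inJ_orb n xJ) (inJ_orb n yJ)) => // k.
by rewrite -!orbD; exact: nI.
Qed.

(** Speed is monotone along the arc, so one of its two ends is slower than the middle point, and
    [slower_valid] makes the height -1/2 valid. *)
Lemma on_hair_fast z : on_hair a z -> exists N, forall n, (N <= n)%N ->
  inJ a T0 (orb n z) /\ valid a T0 (orb n z) (- 1 / 2).
Proof.
move=> /on_hairE[g [gc gi ge g0]].
have li := inj_loc_inj gi.
have N11 : - 1 <= 1 :> R by apply: le_trans (lerN10 R) ler01.
have [n J] := uniform_escape hT hM N11 gc li ge.
have gcn := pcont_orb a n gc; have lin := loc_inj_orb a n gc li.
have nI s t is_ it := nearI_pi20 (@path_nearI _ a T0 hT (- 1) 1 _ N11 gcn J s t is_ it).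
have i0 : - 1 <= (0 : R) <= 1 by rewrite lerN10 ler01.
have iN : - 1 <= (- 1 : R) <= 1 by rewrite lexx N11.
have i1 : - 1 <= (1 : R) <= 1 by rewrite lexx N11.
have [y [iy [j hj]]] : exists y : R, - 1 <= y <= 1 /\ slower a (orb n (g y)) (orb n (g 0)).
  have [mo|mo] := path_monotone hT gcn J lin.
    by exists (- 1); split => //; apply: mo => //; rewrite ltrN10.
  by exists 1; split => //; apply: mo.
exists (j + n)%N => m jm; rewrite -g0.
have := slower_later hT (J y iy) (J 0 i0) (nI _ _ iy i0) _ hj => late.
have -> : orb m (g 0) = orb (m - n) (orb n (g 0)) by rewrite -orbD subnK// (leq_trans _ jm)// leq_addl.
split; first by apply: inJ_orb; exact: J.
apply: (slower_valid (J 0 i0) (J y iy) (nearI_sym (nI _ _ iy i0))); apply: late.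
by rewrite leq_subRL 1?addnC// (leq_trans _ jm)// leq_addl.
Qed.

Lemma pcont_scale u v u' v' g c : 0 < c -> (forall t, u' <= t <= v' -> u <= c * t <= v) -> pcont u v g ->
  pcont u' v' (fun t => g (c * t)).
Proof.
move=> c0 K gc t it e e0; have [e' e'0 H] := gc (c * t) (K t it) e e0.
exists (e' / c); first by rewrite divr_gt0.
move=> t' it' tt; apply: H; first exact: K.
by rewrite -mulrBr normrM gtr0_norm// mulrC -ltr_pdivlMr.
Qed.

Lemma hair_on_hair x t h : inJ a T0 x -> valid a T0 x t -> t < h -> on_hair a (hair a x 0 h).
Proof.
move=> xJ v th; apply/on_hairE; pose c := (h - t) / 2.
have c0 : 0 < c by rewrite /c divr_gt0// subr_gt0.
have vs r : - 1 <= r <= 1 -> t < h + c * r by move=> /andP[s1 s2]; rewrite /c; nra.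
have vv r : - 1 <= r <= 1 -> valid a T0 x (h + c * r) by move=> /vs/ltW; exact: valid_le.
have P : pcont (- c) c (fun r => hair a x 0 (h + r)).
  have v1 : valid a T0 x (h - c) by rewrite -[- c]mulrN1; apply: vv; apply/andP; split; lra.
  have := pcont_shift (c := - h) (hair_pcont0 hT (v := h + c) xJ v1).
  have -> : h - c - h = - c by ring.
  have -> : h + c - h = c by ring.
  by apply: pcont_eq => r _; rewrite opprK addrC.
exists (fun r => hair a x 0 (h + c * r)); split.
- apply: (pcont_scale c0 _ P) => r /andP[r1 r2]; apply/andP; split; nra.
- move=> r r' ir ir' e; apply: (mulfI (lt0r_neq0 c0)); apply: (addrI h).
  exact: (hair_inj hT xJ (vv r ir) (vv r' ir') e).
- by move=> r ir; apply: (hair_esc hT xJ v); exact: vs.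
- by rewrite mulr0 addr0.
Qed.

Lemma fast_on_hair x t : inJ a T0 x -> t < 0 -> valid a T0 x t -> on_hair a x.
Proof. by move=> xJ t0 v; rewrite -[x](hair0 hT 0 xJ); exact: hair_on_hair xJ v t0. Qed.

(** g t0 = f w differs from a, so g - a has a continuous logarithm near t0. A short lift is enough,
    as the arcs of [on_hair] may be shrunk. *)
Lemma lift_near w u v g (t0 : R) : u <= t0 <= v -> u < v -> pcont u v g -> g t0 = f w ->
  exists u' v', [/\ u <= u', u' <= t0 <= v', v' <= v & (u < t0 -> u' < t0) /\ (t0 < v -> t0 < v')] /\
  exists L, [/\ pcont u' v' L, forall t, u' <= t <= v' -> f (L t) = g t & L t0 = w].
Proof.
move=> it uv gc ge; have n0 : 0 < nm (f w - a) by rewrite nm_expmapB expR_gt0.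
have [d d0 H] := gc t0 it _ n0; have /andP[ut tv] := it.
pose u' := Num.max u (t0 - d / 2); pose v' := Num.min v (t0 + d / 2).
have h1 : u <= u' by rewrite le_max lexx.
have h2 : u' <= t0 by rewrite ge_max ut /=; lra.
have h3 : t0 <= v' by rewrite le_min tv /=; lra.
have h4 : v' <= v by rewrite ge_min lexx.
have h5 : t0 - d / 2 <= u' by rewrite le_max lexx orbT.
have h6 : v' <= t0 + d / 2 by rewrite ge_min lexx orbT.
exists u', v'; split.
  split => //; first by rewrite h2.
  by split=> l; [rewrite gt_max l|rewrite lt_min l] => /=; lra.
clearbody u' v'.
have gc' : pcont u' v' (fun t => g t - a).
  move=> t /andP[t1 t2] e e0; have [|e' e'0 K] := gc t _ e e0; first by rewrite (le_trans h1) ?(le_trans t2).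
  exists e' => // t' /andP[t1' t2'] tt; rewrite opprB addrA subrK; apply: K => //.
  by rewrite (le_trans h1) ?(le_trans t2').
have [|L cL hL] := pcont_log (le_trans h2 h3) gc'.
  move=> t /andP[t1 t2]; rewrite subr_eq0; apply/eqP => e.
  have : nm (g t - g t0) < nm (f w - a).
    by apply: H; [rewrite (le_trans h1) ?(le_trans t2)|rewrite ltr_norml; lra].
  by rewrite e ge nmB ltxx.
have it' : u' <= t0 <= v' by rewrite h2.
exists (fun t => L t + (w - L t0)); split.
- move=> t t' e e0; have [e' e'0 K] := cL t t' e e0; exists e' => // s is_ st.
  by rewrite opprD addrACA subrr addr0; exact: K.
- move=> t it''; by rewrite expmapE cexpD cexpB !hL// ge expmapB divff ?cexp_neq0// mulr1 subrK.
- by rewrite subrKC.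
Qed.

Lemma on_hair_pull w : on_hair a (f w) -> on_hair a w.
Proof.
move=> /on_hairE[g [gc gi ge g0]].
have N11 : - 1 < 1 :> R by apply: lt_trans (ltrN10 R) ltr01.
have i0 : - 1 <= (0 : R) <= 1 by rewrite lerN10 ler01.
have [u [v [[h1 h2 h3 [h4 h5]] [L [cL fL L0]]]]] := lift_near i0 N11 gc g0.
have {h4}u0 := h4 (ltrN10 R). have {h5}v0 := h5 ltr01.
pose c := Num.min (- u) v.
have c0 : 0 < c by rewrite lt_min oppr_gt0 u0.
have cu : c <= - u by rewrite ge_min lexx. have cv : c <= v by rewrite ge_min lexx orbT.
have K t : - 1 <= t <= 1 -> u <= c * t <= v by move=> /andP[? ?]; nra.
have K' t : - 1 <= t <= 1 -> - 1 <= c * t <= 1 by move=> /K; lra.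
apply/on_hairE; exists (fun t => L (c * t)); split.
- exact: pcont_scale c0 K cL.
- move=> s t is_ it e; apply: (mulfI (lt0r_neq0 c0)); apply: gi; [exact: K'|exact: K'|].
  by rewrite -!fL ?e//; exact: K.
- move=> t it; apply/(esc_orb a 1); rewrite orbS orb0 fL; last exact: K.
  by apply: ge; exact: K'.
- by rewrite mulr0.
Qed.

Lemma on_hair_pull_orb n w : on_hair a (orb n w) -> on_hair a w.
Proof. by elim: n => // n IH; rewrite orbS => /on_hair_pull. Qed.

(** The image of an arc need not be an arc, so forward invariance goes through speed: a later
    iterate has a valid negative height, and its hair is pulled back. *)
Lemma on_hair_orb n w : on_hair a (orb n w) <-> on_hair a w.
Proof.
split=> [|h]; first exact: on_hair_pull_orb.
have [N H] := on_hair_fast h; apply: (@on_hair_pull_orb N).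
have [J v] := H (N + n)%N (leq_addr _ _); rewrite -orbD; apply: (fast_on_hair J _ v).
lra.
Qed.

Definition escend z := esc a z /\ ~ on_hair a z.

Lemma escend_orb n z : escend (orb n z) <-> escend z.
Proof. by rewrite /escend esc_orb on_hair_orb. Qed.

Lemma slower_on_hair x y : inJ a T0 x -> inJ a T0 y -> nearI a 20 x y -> slower a y x -> on_hair a x.
Proof.
move=> xJ yJ nI [n h]; apply: (@on_hair_pull_orb n).
apply: (fast_on_hair (inJ_orb n xJ) _ (slower_valid xJ yJ nI h)); lra.
Qed.

Lemma escend_not_faster x y n : escend x -> inJ a T0 (orb n x) -> inJ a T0 (orb n y) ->
  nearI a 20 (orb n x) (orb n y) -> ~ slower a (orb n y) (orb n x).
Proof. by move=> /(escend_orb n)[_ nh] xJ yJ nI s; apply: nh; exact: slower_on_hair xJ yJ nI s. Qed.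

Definition half_arc z := exists g, [/\ pcont 0 1 g, forall s t, 0 <= s <= 1 -> 0 <= t <= 1 -> g s = g t -> s = t,
  forall t, 0 < t <= 1 -> esc a (g t) & g 0 = z].

Lemma half_arc_pull w : half_arc (f w) -> half_arc w.
Proof.
move=> [g [gc gi ge g0]].
have i0 : 0 <= (0 : R) <= 1 by rewrite lexx ler01.
have [u [v [[h1 /andP[h2 h2'] h3 [_ h5]] [L [cL fL L0]]]]] := lift_near i0 ltr01 gc g0.
have {h5}v0 := h5 ltr01.
have K t : 0 <= t <= 1 -> u <= v * t <= v by move=> /andP[? ?]; nra.
have K' t : 0 <= t <= 1 -> 0 <= v * t <= 1 by move=> /andP[? ?]; nra.
exists (fun t => L (v * t)); split.
- exact: pcont_scale v0 K cL.
- move=> s t is_ it e; apply: (mulfI (lt0r_neq0 v0)); apply: gi; [exact: K'|exact: K'|].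
  by rewrite -!fL ?e//; exact: K.
- move=> t /andP[t0 t1]; apply/(esc_orb a 1); rewrite orbS orb0 fL; last by apply: K; rewrite ltW.
  have /andP[_ vt1] : 0 <= v * t <= 1 by apply: K'; rewrite ltW.
  by apply: ge; rewrite mulr_gt0.
- by rewrite mulr0.
Qed.

Lemma inJ_half_arc x : inJ a T0 x -> half_arc x.
Proof.
move=> xJ; have v0 := valid0 hT xJ; exists (hair a x 0); split.
- exact (hair_pcont hT 0 xJ v0).
- move=> s t /andP[s0 _] /andP[t0 _]; apply: (hair_inj hT xJ); exact: valid_ge0.
- by move=> t /andP[t0 _]; exact (hair_esc hT xJ v0 t0).
- by rewrite (hair0 hT).
Qed.

(** An iterate of an escaping point stays far to the right and carries its own hair; pulled back,
    this is the arc that the definition of an endpoint asks for. *)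
Lemma escaping_endpointsE : escaping_endpoints a = [set z | escend z].
Proof.
apply/seteqP; split=> z; first by move=> [[nh _] /escP].
move=> [ez nh]; split; last exact/escP.
split=> //.
have [N HN] := esc_inJ T0 ez.
have : half_arc (orb N z) := inJ_half_arc (HN N (leqnn _)).
have {HN} : forall n, half_arc (orb n z) -> half_arc z.
  by elim=> // n IH; rewrite orbS => /half_arc_pull.
move=> /[apply] -[g [gc gi ge g0]]; exists g; split => //; first by apply/arcP.
by move=> t; rewrite in_itv /= => it; apply/escP; exact: ge.
Qed.

End OnHair.

(** * External addresses and shadowing *)

Section Address.
Variables (R : realType) (a : R[i]).
Implicit Types (z w x y : R[i]) (s t h : R).
Notation f := (expmap a).
Notation orb := (orb a).
Notation T := (T0 a).
Let hT : 100 * 20 + nm a <= T. Proof. exact: T0_ge. Qed.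

Definition addr z : int := Num.floor ((Imz z + pi) / (pi *+ 2)).

Lemma pi2_gt0 : 0 < (pi : R) *+ 2. Proof. by rewrite pmulrn_lgt0 ?pi_gt0. Qed.

Lemma addr_bound z : - pi <= Imz z - pi *+ 2 * (addr z)%:~R < pi.
Proof.
have p2 := pi2_gt0.
have := @Num.Theory.floor_itv R ((Imz z + pi) / (pi *+ 2)); rewrite -/(addr z).
rewrite ler_pdivlMr// ltr_pdivrMr// intrD mulrDl mul1r mulr2n => /andP[h1 h2].
by apply/andP; split; lra.
Qed.

Lemma addr_uniq z (k : int) : `|Imz z - pi *+ 2 * k%:~R| < pi -> addr z = k.
Proof.
move=> h; have p2 := pi2_gt0; apply: Num.Theory.floor_def.
rewrite ler_pdivlMr// ltr_pdivrMr// intrD mulrDl mul1r.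
by move: h; rewrite ltr_norml mulr2n => /andP[h1 h2]; apply/andP; split; lra.
Qed.

(** cos (Im z) > 0 halves the strip. Hence for such points equal addresses and imaginary parts
    within pi mean the same. *)
Lemma addr_strip z : 0 < Rez (cexp z) -> `|Imz z - pi *+ 2 * (addr z)%:~R| < pi / 2.
Proof.
move=> h; pose z' : R[i] := z - tpi (addr z)%:~R.
have e : cexp z' = cexp z by rewrite /z' cexpB cexp_tpiz divr1.
have iz : Imz z' = Imz z - pi *+ 2 * (addr z)%:~R by rewrite /z' ImB.
rewrite -iz.
have bd : - pi <= Imz z' < pi by rewrite iz addr_bound.
have c0 : 0 < cos (Imz z').
  by move: h; rewrite -e Re_cexp pmulr_rgt0 ?expR_gt0.
rewrite ltNge; apply/negP => tge; move: c0; apply/negP; rewrite -leNgt.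
rewrite -(cos_norm (Imz z')) -(cos_pihalf R); have [<-//|ne] := eqVneq (pi / 2) `|Imz z'|.
have le : `|Imz z'| <= pi by rewrite ler_norml; have /andP[b1 b2] := bd; rewrite b1 ltW.
have pi0 := pi_gt0 R.
rewrite ltW// ltr_cos ?in_itv /= ?lt_neqAle ?ne ?normr_ge0//; lra.
Qed.

Lemma addr_cexp_pos x n : inJ a T x -> 0 < Rez (cexp (orb n x)).
Proof. by move=> xJ; exact: (Re_cexp_pos hT). Qed.

Lemma addr_near z w : 0 < Rez (cexp z) -> 0 < Rez (cexp w) -> addr z = addr w -> `|Imz z - Imz w| <= pi.
Proof.
move=> /addr_strip h1 /addr_strip h2 e; rewrite e in h1.
rewrite (_ : _ - _ = (Imz z - pi *+ 2 * (addr w)%:~R) - (Imz w - pi *+ 2 * (addr w)%:~R)); last by ring.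
by apply: le_trans (ler_normB _ _) _; lra.
Qed.

Lemma near_addr z w : 0 < Rez (cexp z) -> 0 < Rez (cexp w) -> `|Imz z - Imz w| < pi -> addr z = addr w.
Proof.
move=> /addr_strip h1 /addr_strip h2 h.
have h3 : `|pi *+ 2 * (addr z)%:~R - pi *+ 2 * (addr w)%:~R| < pi *+ 2 :> R.
  rewrite (_ : _ - _ = (Imz w - pi *+ 2 * (addr w)%:~R) - (Imz z - pi *+ 2 * (addr z)%:~R) + (Imz z - Imz w)); last by ring.
  apply: le_lt_trans (ler_normD _ _) _; rewrite mulr2n; apply: ler_ltD h.
  by apply: le_trans (ler_normB _ _) _; lra.
move: h3; rewrite -mulrBr normrM (gtr0_norm pi2_gt0) -ltr_pdivlMl ?pi2_gt0// mulVf ?gt_eqF ?pi2_gt0//.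
rewrite -intrB -intr_norm -[1]/(1%:~R) ltr_int => h3; apply/eqP; rewrite -subr_eq0 -normr_eq0.
by rewrite eq_le normr_ge0 andbT -ltzD1 add0r.
Qed.

(** The inverse branch of f with values of address k. *)
Definition Lam (k : int) u : R[i] := plog (u - a) + tpi k%:~R.

Lemma LamK k u : nm a < Rez u -> f (Lam k u) = u.
Proof. by move=> h; rewrite expmapE /Lam cexpD plogK ?sub_neq0// cexp_tpiz mulr1 subrK. Qed.

Lemma Im_Lam k u : Imz (Lam k u) = Imz (plog (u - a)) + pi *+ 2 * k%:~R.
Proof. by rewrite /Lam ImD. Qed.

Lemma Re_Lam k u : Rez (Lam k u) = ln (nm (u - a)).
Proof. by rewrite /Lam ReD /= addr0. Qed.

Lemma addr_Lam k u : nm a < Rez u -> addr (Lam k u) = k.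
Proof.
move=> /Re_pos_subl/parg_lt h; apply: addr_uniq; rewrite Im_Lam addrK.
by apply: lt_trans h _; have := pi_gt0 R; lra.
Qed.

Lemma Lam_contract k u v : 100 + nm a <= Rez u -> 100 + nm a <= Rez v -> nm (Lam k u - Lam k v) <= nm (u - v) / 25.
Proof.
move=> hu hv; have -> : Lam k u - Lam k v = Lst a 0 u - Lst a 0 v by rewrite /Lam /Lst; ring.
exact: Lst_contract.
Qed.

Lemma Lam_addr x : nm a < Rez (f x) -> Lam (addr x) (f x) = x.
Proof.
move=> h; apply: cexp_inj; last by apply: (addIr a); rewrite -!expmapE LamK.
have h1 := parg_lt (Re_pos_subl h); have := Re_pos_subl h; rewrite expmapB => /addr_strip h2.
rewrite expmapB in h1.
rewrite Im_Lam expmapB (_ : _ - _ = Imz (plog (cexp x)) - (Imz x - pi *+ 2 * (addr x)%:~R)); last by ring.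
by apply: le_lt_trans (ler_normB _ _) _; rewrite mulr2n; have := pi_gt0 R; lra.
Qed.

Section Shadow.
Variables (p : nat -> R[i]) (s : nat -> int).
Hypothesis pT : forall k, T <= Rez (p k).
Hypothesis ps : forall k, nm (Lam (s k) (p k.+1) - p k) <= 5.

Fixpoint sh (k n : nat) : R[i] := match k with 0 => p n | k'.+1 => Lam (s n) (sh k' n.+1) end.

Lemma T_bound (c : R) z : c <= 100 -> T - c <= Rez z -> 100 + nm a <= Rez z.
Proof. by have := hT; lra. Qed.

Lemma Lam_near k u v : nm (u - v) <= 20 -> T <= Rez v -> nm (Lam k u - Lam k v) <= nm (u - v) / 25.
Proof.
move=> h hv; apply: Lam_contract.
  by apply: (@T_bound 20) => //; have := Re_near h; lra.
by apply: (@T_bound 0) => //; rewrite subr0.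
Qed.

Lemma sh_near k n : nm (sh k n - p n) <= 6.
Proof.
elim: k n => [|k IH] n; first by rewrite subrr nm0.
apply: le_trans (nm_triB _ (Lam (s n) (p n.+1)) _) _.
have h := IH n.+1; have := ps n; have := @Lam_near (s n) (sh k n.+1) (p n.+1) _ (pT n.+1).
by move=> /=; have h20 : nm (sh k n.+1 - p n.+1) <= 20 by [lra]; move=> /(_ h20); lra.
Qed.

Lemma sh_step k n : nm (sh k.+1 n - sh k n) <= 6 / 2 ^+ k.
Proof.
elim: k n => [|k IH] n; first by rewrite expr0 divr1; exact: (sh_near 1).
have h1 := Re_near (sh_near k n.+1); have h2 := Re_near (sh_near k.+1 n.+1); have h3 := pT n.+1.
rewrite [sh k.+2 n]/= [sh k.+1 n]/=; apply: le_trans (Lam_contract _ _ _) _.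
- by apply: (@T_bound 6) => //; move: h2 h3; rewrite /=; lra.
- by apply: (@T_bound 6) => //; lra.
apply: le_trans (_ : nm (sh k.+1 n.+1 - sh k n.+1) / 2 <= _).
  by rewrite ler_wpM2l ?nm_ge0// lef_pV2 ?posrE// ler_nat.
by rewrite exprS invfM [_^-1 * _]mulrC mulrA ler_wpM2r// ?invr_ge0.
Qed.

(** A backward pseudo-orbit with errors at most 5 is shadowed because the branches [Lam] contract:
    pull p (n + k) back to level n and let k grow. *)
Lemma shadow : exists x, forall k, nm (orb k x - p k) <= 12 /\ addr (orb k x) = s k /\
  orb k x = Lam (s k) (orb k.+1 x).
Proof.
have ex n : exists z, forall k, nm (z - sh k n) <= 12 / 2 ^+ k.
  have [z hz] := geom_lim (fun k => sh_step k n); exists z => k; apply: le_trans (hz k) _.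
  by rewrite ler_wpM2r ?invr_ge0 ?exprn_ge0//; lra.
have [X XP] := choice ex.
have Xp n : nm (X n - p n) <= 12 by have := XP n 0%N; rewrite expr0 divr1.
have XL n : X n = Lam (s n) (X n.+1).
  apply/eqP; rewrite -subr_eq0 -nm_eq0 eq_le nm_ge0 andbT.
  apply: (@le0_half_pow _ 24) => k.
  apply: le_trans (nm_triB _ (sh k.+1 n) _) _.
  have h1 := Re_near (sh_near k n.+1); have h2 := Re_near (Xp n.+1); have h0 := pT n.+1.
  have h3 : nm (Lam (s n) (sh k n.+1) - Lam (s n) (X n.+1)) <= nm (sh k n.+1 - X n.+1) / 25.
    by apply: Lam_contract; apply: (@T_bound 12) => //; lra.
  have := XP n.+1 k; have := XP n k.+1; rewrite exprS invfM.
  rewrite (nmB (X n.+1) (sh k n.+1)) /= in h3 *.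
  by have : 0 < (2 ^+ k : R)^-1; [rewrite invr_gt0 exprn_gt0|lra].
have XR n : nm a < Rez (X n).
  have := Re_near (Xp n); have := pT n; have := hT; have := nm_ge0 a; lra.
have XO n : orb n (X 0%N) = X n.
  by elim: n => // n IH; rewrite orbS IH [in LHS]XL LamK.
exists (X 0%N) => k; rewrite !XO; split=> //; split; last exact: XL.
by rewrite XL addr_Lam.
Qed.

End Shadow.

(** A criterion for endpoints: an orbit whose real parts stay below every multiple of 2^n has no
    valid negative height. *)
Lemma fast_lower x t n : inJ a T x -> valid a T x t -> t <= 0 -> T + 2 ^+ n * (- t) <= Rez (orb n x).
Proof.
move=> xJ v t0; have := hs_gap hT n xJ v t0; rewrite (hs0 hT n xJ) sub0r.
have := v n; lra.
Qed.

Lemma pow2_gt_linear (A B : R) : 0 <= A -> 0 <= B -> exists N, forall n, (N <= n)%N -> A + B * n%:R < 2 ^+ n.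
Proof.
move=> A0 B0; pose N := (Num.truncn (A + 2 * B)).+1.
have hN : A + 2 * B < N%:R by exact: truncnS_gt.
exists (2 * N + 1)%N => n Nn.
have sq k : (k.+1 ^ 2 <= 2 ^ (2 * k))%N.
  by rewrite expnM -[(2 ^ 2)%N]/4%N -[4%N]/(2 ^ 2)%N -expnM mulnC expnM leq_exp2r// ltn_expl.
have h2 : (n./2.+1 ^ 2 <= 2 ^ n)%N.
  apply: leq_trans (sq n./2) _; rewrite leq_exp2l// mul2n -[leqRHS]odd_double_half leq_addl//.
have nk : (n <= 2 * n./2 + 1)%N by rewrite mul2n -{1}[n]odd_double_half addnC leq_add2l leq_b1.
have Nk : (N <= n./2)%N.
  have : (2 * N + 1 <= 2 * n./2 + 1)%N by exact: leq_trans Nn nk.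
  by rewrite leq_add2r leq_mul2l.
have h2R : (n./2.+1%:R : R) ^+ 2 <= 2 ^+ n by rewrite -natrX -(natrX _ 2) ler_nat.
have nkR : (n%:R : R) <= 2 * (n./2)%:R + 1.
  have : (n%:R : R) <= (2 * n./2 + 1)%N%:R by rewrite ler_nat.
  by rewrite natrD natrM.
have NkR : (N%:R : R) <= (n./2)%:R by rewrite ler_nat.
move: h2R nkR NkR; rewrite -[n./2.+1]addn1 natrD; move: (n%:R : R) ((n./2)%:R : R) (2 ^+ n : R) => x k q.
rewrite expr2 mulr1n => k1 k2 k3.
have Bx : B * x <= B * (2 * k + 1) by apply: ler_wpM2l.
have k0 : A + 2 * B < k by lra.
nra.
Qed.

End Address.

(** * Escaping endpoints near a given hair *)

Section Special.
Variables (R : realType) (a : R[i]).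
Implicit Types (z w x y e : R[i]) (h : R).
Notation f := (expmap a).
Notation orb := (orb a).
Notation T := (T0 a).
Let hT : 100 * 20 + nm a <= T. Proof. exact: T0_ge. Qed.
Let hT10 : 100 * 20 + nm a <= T + 10. Proof. by have := hT; lra. Qed.

Lemma ln_le8 (y : R) : 0 < y -> ln y <= y / 8 + 7.
Proof.
move=> y0; have y8 : 0 < y / 8 by rewrite divr_gt0.
have e : y = 8 * (y / 8) by rewrite mulrCA divff ?mulr1// pnatr_eq0.
rewrite {1}e lnM ?posrE//.
have l8 : ln 8 <= 8 - 1 :> R.
  by rewrite -ler_expR lnK ?posrE//; have := expR_ge1Dx (8 - 1 : R); lra.
have l1 : ln (y / 8) <= y / 8 - 1.
  by rewrite -ler_expR lnK ?posrE//; have := expR_ge1Dx (y / 8 - 1); lra.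
lra.
Qed.

Lemma ln_ratio (u v : R) : 0 < u -> 0 < v -> u <= 2 * v -> v <= 2 * u -> `|ln u - ln v| <= 1.
Proof.
move=> u0 v0 h1 h2.
have l2 : ln 2 <= 2 - 1 :> R.
  by rewrite -ler_expR lnK ?posrE//; have := expR_ge1Dx (2 - 1 : R); lra.
have k1 : ln u <= ln 2 + ln v by rewrite -lnM ?posrE// ler_ln ?posrE// mulr_gt0.
have k2 : ln v <= ln 2 + ln u by rewrite -lnM ?posrE// ler_ln ?posrE// mulr_gt0.
by rewrite ler_norml; lra.
Qed.

Lemma addr_Im_ge z (n : nat) : (n <= `|addr z|)%N -> pi *+ 2 * n%:R - pi <= `|Imz z| :> R.
Proof.
move=> h; have /andP[b1 b2] := addr_bound z; have p2 := pi2_gt0 R.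
have n1 : (n%:R : R) <= `|(addr z)%:~R|.
  by rewrite -intr_norm -abszE -pmulrn ler_nat.
have n2 : pi *+ 2 * n%:R <= `|pi *+ 2 * (addr z)%:~R| :> R.
  by rewrite normrM (gtr0_norm p2) ler_pM2l.
have : `|pi *+ 2 * (addr z)%:~R| <= `|Imz z| + pi :> R.
  have := ler_normB (Imz z) (Imz z - pi *+ 2 * (addr z)%:~R); rewrite subKr.
  have : `|Imz z - pi *+ 2 * (addr z)%:~R| <= pi by rewrite ler_norml b1 ltW.
  lra.
lra.
Qed.

Lemma addr_expR x (n : nat) : (n <= `|addr (f x)|)%N -> pi *+ 2 * n%:R - pi - nm a <= expR (Rez x).
Proof.
move=> /addr_Im_ge h; rewrite -(nm_expmapB a x); have := nm_subl (f x) a; have := Im_nm (f x); lra.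
Qed.

(** A large address at time n + 1 means a large modulus, hence a large real part at time n. *)
Lemma growing_esc x (N : nat) : (forall k, (N <= k)%N -> (k <= `|addr (orb k x)|)%N) -> esc a x.
Proof.
move=> h C; have pi2 := pi_ge2 R.
pose N' := (Num.truncn (expR C + nm a)).+1.
have hN : expR C + nm a < N'%:R by exact: truncnS_gt.
exists (maxn N N') => n; rewrite geq_max => /andP[Nn N'n].
have Nn1 : (N <= n.+1)%N := leqW Nn.
have := h n.+1 Nn1; rewrite orbS => /addr_expR l; rewrite -(@ler_expR R); apply: le_trans l.
have : (N'%:R : R) <= n%:R by rewrite ler_nat.
have : (0 : R) <= n%:R by rewrite ler0n.
have pi4 := pi_le4 R.
rewrite mulr2n -[n.+1]addn1 natrD mulr1n; move: hN; move: (n%:R : R) (N'%:R : R) (expR C) (nm a) => ? ? ? ? ? ? ?; nra.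
Qed.

Section Build.
Variables (e : R[i]) (h : R) (j' L : nat).
Hypothesis eJ : inJ a (T + 10) e.
Hypothesis h0 : 0 < h.
Notation j := j'.+1.
Hypothesis jbig : expR T + nm a + 100 * 4 + 4 * nm a + 16 * (j + L)%:R <= 2 ^+ j' * h.

Let G k := hair a e k h.
Let vh : valid a (T + 10) e h. Proof. exact (valid_ge0 hT10 eJ (ltW h0)). Qed.
Let X : R := nm (G j - a).
Let K : nat := Num.truncn (X / (pi *+ 2)).

Lemma sp_X : X = expR (Rez (G j')).
Proof. by rewrite /X /G -(hairS hT10 j' eJ vh) nm_expmapB. Qed.

Lemma sp_ReG : Rez (orb j' e) + 2 ^+ j' * h - 20 <= Rez (G j').
Proof.
by have := Re_hair_gap hT10 j' eJ (valid0 hT10 eJ) (ltW h0); rewrite (hair0 hT10 _ eJ) subr0.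
Qed.

Lemma sp_Xbig : expR T + nm a + 100 * 2 + 4 * nm a + 16 * (j + L)%:R <= X.
Proof.
rewrite sp_X; have := expR_ge1Dx (Rez (G j')); have := sp_ReG; have := eJ j'; have := jbig; have := hT; have := nm_ge0 a; lra.
Qed.

Lemma sp_K : pi *+ 2 * K%:R <= X < pi *+ 2 * K.+1%:R.
Proof.
have X0 : 0 <= X / (pi *+ 2) by rewrite divr_ge0 ?nm_ge0// ltW// pi2_gt0.
have /andP[h1 h2] := truncn_itv X0; rewrite -/K in h1 h2.
by rewrite mulrC -ler_pdivlMr ?pi2_gt0// h1 /= mulrC -ltr_pdivrMr ?pi2_gt0.
Qed.

Lemma sp_K_ge : (j + L <= K)%N.
Proof.
rewrite leqNgt; apply/negP => lt; have /andP[_ k1] := sp_K; have := sp_Xbig.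
have : (K.+1%:R : R) <= (j + L)%:R by rewrite ler_nat.
have pi4 := pi_le4 R; have pi2 := pi_ge2 R; have := expR_ge0 T; have := nm_ge0 a.
have : pi *+ 2 * K.+1%:R <= 8 * K.+1%:R :> R by rewrite ler_wpM2r// mulr2n; lra.
have : (0 : R) <= K.+1%:R by rewrite ler0n.
by move: k1; lra.
Qed.

(** Up to time j - 1 the pseudo-orbit follows the hair of e at height h; from time j on it has
    addresses K, K + 1, and so on. As 2 pi K is about |G j - a|, replacing G j hardly changes the
    real part of the preimage, which depends on the modulus only; the abscissa ln (2 pi t (k + 1))
    anticipates the next modulus in the same way. *)
Let t (k : nat) : nat := (K + (k - j))%N.
Let p (k : nat) : R[i] := if (k < j)%N then G k else (ln (pi *+ 2 * (t k.+1)%:R)) +i* (pi *+ 2 * (t k)%:R).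
Let s (k : nat) : int := if (k < j)%N then addr (orb k e) else Posz (t k).

Lemma sp_tS k : (j <= k)%N -> t k.+1 = (t k).+1.
Proof. by move=> jk; rewrite /t subSn// addnS. Qed.

Lemma sp_Y k : (j <= k)%N -> X - pi *+ 2 <= pi *+ 2 * (t k)%:R.
Proof.
move=> jk; have /andP[_ k1] := sp_K; have : pi *+ 2 * (K%:R : R) <= pi *+ 2 * (t k)%:R.
  by rewrite ler_pM2l ?pi2_gt0// ler_nat leq_addr.
by move: k1; rewrite -[K.+1]addn1 natrD mulrDr mulr1; lra.
Qed.

Lemma sp_ratio k : (j <= k)%N -> let Y := pi *+ 2 * (t k)%:R in
  nm (p k - a) <= 2 * Y - pi *+ 2 /\ Y <= 2 * nm (p k - a) - pi *+ 2 /\ 100 <= Y.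
Proof.
move=> jk Y; have kj : (k < j)%N = false by rewrite ltnNge jk.
have Yb := sp_Y jk; have Xb := sp_Xbig; rewrite -/Y in Yb.
have pi4 := pi_le4 R; have pi2 := pi_ge2 R; have n0 := nm_ge0 a; have eT := expR_ge0 T.
have J0 : (0 : R) <= (j + L)%:R by rewrite ler0n.
have l1 : ln (pi *+ 2 * (t k.+1)%:R) <= (Y + pi *+ 2) / 8 + 7.
  rewrite sp_tS//; have -> : pi *+ 2 * (t k).+1%:R = Y + pi *+ 2 :> R.
    by rewrite /Y -[(t k).+1]addn1 natrD mulrDr mulr1.
  by apply: ln_le8; move: Yb; rewrite mulr2n; lra.
have l0 : 0 <= ln (pi *+ 2 * (t k.+1)%:R : R).
  have Y1 : 1 <= pi *+ 2 * (t k.+1)%:R :> R.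
    by have := sp_Y (leqW jk); move: Xb; rewrite mulr2n; lra.
  by rewrite -ln1 ler_ln ?posrE//; exact: lt_le_trans Y1.
have u1 : nm (p k) <= (Y + pi *+ 2) / 8 + 7 + Y.
  rewrite /p kj; apply: le_trans (nm_ReIm _) _; rewrite /= (ger0_norm l0).
  by rewrite ger0_norm ?mulr_ge0 ?ler0n ?(ltW (pi2_gt0 R))//; rewrite -/Y; lra.
have u2 : Y <= nm (p k) by apply: le_trans (Im_le _); rewrite /p kj.
have := nm_subl (p k) a; have := nmBs (p k) a.
by move: u1 u2 Yb; rewrite mulr2n; split; [|split]; lra.
Qed.

Lemma sp_pT k : T <= Rez (p k).
Proof.
rewrite /p; case: ltnP => kj.
  have := Re_hair_ge hT10 k eJ vh; rewrite /G; lra.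
rewrite /= -(@ler_expR R) lnK ?posrE.
  have := sp_Y (leqW kj); have := sp_Xbig; have := pi_le4 R; have := nm_ge0 a.
  have : (0 : R) <= (j + L)%:R by rewrite ler0n.
  by rewrite mulr2n; lra.
have [_ [_ h1]] := sp_ratio (leqW kj); lra.
Qed.

Lemma sp_addrG k : addr (G k) = addr (orb k e).
Proof.
have e0 := hair0 hT10 k eJ; have pos z : T <= Rez (f z) -> 0 < Rez (cexp z).
  by move=> hz; rewrite -(expmapB a); exact: (Re_subl_pos hT).
apply: near_addr.
- apply: pos; rewrite /G (hairS hT10)//; have := Re_hair_ge hT10 k.+1 eJ vh; lra.
- by apply: pos; rewrite -orbS; have := eJ k.+1; lra.
- by rewrite -e0; apply: (hair_Im hT10 k eJ vh); exact (valid0 hT10 eJ).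
Qed.

Lemma sp_LamG k : Lam a (addr (orb k e)) (G k.+1) = G k.
Proof.
rewrite -sp_addrG /G -(hairS hT10 k eJ vh) Lam_addr// (hairS hT10 k eJ vh).
by have := Re_hair_ge hT10 k.+1 eJ vh; have := hT; have := nm_ge0 a; lra.
Qed.

Lemma sp_step k : nm (Lam a (s k) (p k.+1) - p k) <= 5.
Proof.
have pi4 := pi_le4 R; have pi2 := pi_ge2 R.
have posp m : nm a < Rez (p m) by have := sp_pT m; have := hT; have := nm_ge0 a; lra.
rewrite /s [p k]/p; case: ltnP => kj.
  rewrite -(sp_LamG k) /Lam.
  have [kj1|jk1] := ltnP k.+1 j; first by rewrite /p kj1 subrr nm0.
  have {kj jk1} ek : k.+1 = j by apply/eqP; rewrite eqn_leq kj.
  rewrite ek opprD addrACA subrr addr0.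
  have [r1 [r2 r3]] := sp_ratio (leqnn j).
  have tj : t j = K by rewrite /t subnn addn0.
  have /andP[k1 k2] := sp_K; rewrite tj in r1 r2 r3.
  have k3 : X < pi *+ 2 * K%:R + pi *+ 2.
    by move: k2; rewrite -[K.+1]addn1 natrD mulrDr mulr1.
  have GJ : nm a < Rez (G j) by have := Re_hair_ge hT10 j eJ vh; have := hT; have := nm_ge0 a; rewrite /G; lra.
  have a1 := parg_lt (Re_pos_subl (posp j)); have a2 := parg_lt (Re_pos_subl GJ).
  have X0 : 0 < X by rewrite sp_X expR_gt0.
  have P0 : 0 < nm (p j - a) by move: r2 r3; rewrite mulr2n; lra.
  have := @ln_ratio (nm (p j - a)) X P0 X0 _ _.
  have q1 : nm (p j - a) <= 2 * X by move: r1; rewrite mulr2n; lra.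
  have q2 : X <= 2 * nm (p j - a) by move: r2 k3; rewrite mulr2n; lra.
  move=> /(_ q1 q2) l; apply: le_trans (nm_ReIm _) _; rewrite ReB ImB !Re_plog -/X.
  have := ler_normB (Imz (plog (p j - a))) (Imz (plog (G j - a))); lra.
have jk1 : (j <= k.+1)%N := leqW kj.
have [r1 [r2 r3]] := sp_ratio jk1.
have a1 := parg_lt (Re_pos_subl (posp k.+1)).
apply: le_trans (nm_ReIm _) _; rewrite ReB ImB Re_Lam Im_Lam [Rez (_ +i* _)]/= [Imz (_ +i* _)]/=.
have -> : ((Posz (t k))%:~R : R) = (t k)%:R by [].
rewrite addrK.
have P0 : 0 < nm (p k.+1 - a) by move: r2 r3; rewrite mulr2n; lra.
have Y0 : 0 < pi *+ 2 * (t k.+1)%:R :> R by lra.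
have q1 : nm (p k.+1 - a) <= 2 * (pi *+ 2 * (t k.+1)%:R) by move: r1; rewrite mulr2n; lra.
have q2 : pi *+ 2 * (t k.+1)%:R <= 2 * nm (p k.+1 - a) by move: r2; rewrite mulr2n; lra.
have := ln_ratio P0 Y0 q1 q2; lra.
Qed.

(** The last clause says that whoever has the address of x at time j was faster than e at time j -
    1: a modulus of about 2 pi K requires a real part close to that of G j', which is far beyond
    e. *)
Lemma special_build : exists x, [/\ nm (x - hair a e 0 h) <= 12 / 2 ^+ j',
  forall k, (k < j)%N -> addr (orb k x) = addr (orb k e) /\ nm (orb k x - hair a e k h) <= 12,
  forall k, (j <= k)%N -> (k + L <= `|addr (orb k x)|)%N, escend a x &
  forall w, addr (f w) = addr (orb j x) -> Rez (orb j' e) + 1 <= Rez w].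
Proof.
have [x hx] := shadow sp_pT sp_step.
have pG k : (k < j)%N -> p k = G k by rewrite /p => ->.
have adx k : (j <= k)%N -> addr (orb k x) = Posz (t k).
  by move=> jk; rewrite (hx k).2.1 /s ltnNge jk.
have grow k : (j <= k)%N -> (k + L <= `|addr (orb k x)|)%N.
  by move=> jk; rewrite adx// absz_nat /t; have := sp_K_ge; lia.
have pi4 := pi_le4 R; have pi2 := pi_ge2 R.
exists x; split => //.
- have step m : (m <= j')%N -> nm (orb (j' - m) x - G (j' - m)) <= 12 / 2 ^+ m.
    elim: m => [|m IH] mj; first by rewrite subn0 expr0 divr1 -(pG j')//; exact: (hx j').1.
    have nS : (j' - m = (j' - m.+1).+1)%N by rewrite subnSK.
    have lt : (j' - m.+1 < j)%N by rewrite ltnS leq_subr.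
    have lt' : ((j' - m.+1).+1 < j)%N by rewrite -nS ltnS leq_subr.
    have {}IH := IH (ltnW mj); rewrite nS in IH; move: (j' - m.+1)%N IH lt lt' => i IH lt lt'.
    rewrite -(sp_LamG i) (hx i).2.2 /s lt; apply: le_trans (Lam_contract _ _ _) _.
    + apply: (@T_bound _ a 12) => //; first by lra.
      by have := Re_near (hx i.+1).1; have := sp_pT i.+1; lra.
    + by apply: (@T_bound _ a 0) => //; rewrite -(pG _ lt') subr0; exact: sp_pT.
    rewrite exprS invfM [2^-1 * _]mulrC mulrA; apply: le_trans (_ : (12 / 2 ^+ m) / 25 <= _).
      by rewrite ler_wpM2r ?invr_ge0.
    by rewrite ler_wpM2l ?divr_ge0 ?exprn_ge0// lef_pV2 ?posrE// ler_nat.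
  by have := step j' (leqnn _); rewrite subnn.
- move=> k kj; have [h1 [h2 _]] := hx k; rewrite h2 /s kj; split=> //.
  by rewrite -[hair a e k h]/(G k) -(pG k kj).
- split; first by apply: (@growing_esc x j) => k /grow; exact: leq_trans (leq_addr _ _).
  move=> /on_hair_fast[N HN].
  (* The real parts of x are of the order of ln (2 pi t k), so they grow at most linearly, whereas
     on a hair they would grow like 2^m. *)
  have [N1 hN1] := @pow2_gt_linear R (2 * (K + N + 100)%:R) 2 (ltac:(by rewrite mulr_ge0)) (ltac:(by [])).
  pose m := maxn N1 j.
  have mN1 : (N1 <= m)%N by exact: leq_maxl. have jm : (j <= m)%N by exact: leq_maxr.
  have [J v] := HN N (leqnn N).
  have l1 := fast_lower m J v (ltac:(by rewrite mulNr oppr_le0)).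
  have jk : (j <= m + N)%N by exact: leq_trans (leq_addr _ _).
  have l2 : Rez (orb (m + N) x) <= (t (m + N).+1)%:R + 19.
    have := (hx (m + N)%N).1; rewrite nmB => /Re_near; rewrite {1}/p ltnNge jk /=.
    have [_ [_ Y0]] := sp_ratio (leqW jk).
    have := @ln_le8 (pi *+ 2 * (t (m + N).+1)%:R) (ltac:(lra)).
    have : (0 : R) <= (t (m + N).+1)%:R by rewrite ler0n.
    by rewrite mulr2n; move: (_%:R : R) => y; nra.
  have l3 : ((t (m + N).+1)%:R : R) <= (K + N + 100)%:R + m%:R - 19.
    rewrite -natrD lerBrDr -natrD ler_nat /t; apply: leq_trans (_ : (K + (m + N).+1 + 19 <= _)%N).
      by rewrite leq_add2r leq_add2l leq_subr.
    by rewrite -!addnA leq_add2l addSn -addnS -addnA addnCA leq_add2l addnC leq_add2r.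
  rewrite orbD in l2; have := hN1 m mN1; have := hT; have := nm_ge0 a; move: l1 l2 l3; rewrite mulNr opprK.
  move: ((K + N + 100)%:R : R) (m%:R : R) (2 ^+ m : R) => ? ? ?; lra.
- move=> w; rewrite (adx j (leqnn _)) => ey.
  have l1 : (K <= `|addr (f w)|)%N by rewrite ey absz_nat /t subnn addn0.
  have := addr_expR l1; have /andP[_ k2] := sp_K; have Xb := sp_Xbig; have := sp_ReG => r1 r2.
  have J0 : (0 : R) <= (j + L)%:R by rewrite ler0n.
  have half : X / 2 <= expR (Rez w).
    move: k2 r2; rewrite -[K.+1]addn1 natrD mulrDr mulr1 mulr2n; have := expR_ge0 T; have := nm_ge0 a; lra.
  have : Rez (G j') - 1 <= Rez w.
    rewrite -(@ler_expR R); apply: le_trans half; rewrite sp_X expRD ler_wpM2l ?expR_ge0//.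
    rewrite expRN lef_pV2 ?posrE ?expR_gt0//; have := expR_ge1Dx (1 : R); lra.
  have := jbig; have := expR_ge0 T; have := nm_ge0 a; lra.
Qed.

End Build.

(** Escaping endpoints accumulate on the hair of e; they leave it at a time j' that may be taken as
    late as desired. *)
Lemma special e h (L : nat) (eps : R) : inJ a (T + 10) e -> 0 < h -> 0 < eps ->
  exists J0, forall j', (J0 <= j')%N -> exists x, [/\ nm (x - hair a e 0 h) < eps,
  forall k, (k < j'.+1)%N -> addr (orb k x) = addr (orb k e) /\ nm (orb k x - hair a e k h) <= 12,
  forall k, (j'.+1 <= k)%N -> (k + L <= `|addr (orb k x)|)%N, escend a x &
  forall w, addr (f w) = addr (orb j'.+1 x) -> Rez (orb j' e) + 1 <= Rez w].
Proof.
move=> eJ h0 e0.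
pose A := (expR T + nm a + 100 * 4 + 4 * nm a + 16 * L.+1%:R) / h.
have A0 : 0 <= A.
  rewrite divr_ge0 ?(ltW h0)//; have := expR_ge0 T; have := nm_ge0 a; have : (0 : R) <= L.+1%:R by rewrite ler0n.
  lra.
have B0 : 0 <= 16 / h by rewrite divr_ge0 ?(ltW h0).
have [N HN] := pow2_gt_linear A0 B0.
have [N2 HN2] := half_pow_lt 12 e0.
exists (maxn N N2) => j'; rewrite geq_max => /andP[Nj N2j].
have jb : expR T + nm a + 100 * 4 + 4 * nm a + 16 * (j'.+1 + L)%:R <= 2 ^+ j' * h.
  have := HN j' Nj; rewrite /A mulrAC -mulrDl ltr_pdivrMr// => /ltW; apply: le_trans.
  by rewrite addSnnS addnC natrD; lra.
have [x [h1 h2 h3 h4 h5]] := special_build eJ h0 jb.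
exists x; split => //; apply: le_lt_trans h1 _; apply: le_lt_trans HN2.
by rewrite ler_wpM2l// lef_pV2 ?posrE ?exprn_gt0// ler_weXn2l ?ler1n.
Qed.

End Special.

(** * Connectedness *)

Section OpenMap.
Variables (R : realType) (a : R[i]).
Implicit Types (z w x y e : R[i]).
Notation f := (expmap a).
Notation orb := (orb a).

Lemma expmap_open z (e : R) : 0 < e -> exists2 d : R, 0 < d & forall w', nm (w' - f z) < d ->
  exists2 w, nm (w - z) < e & f w = w'.
Proof.
move=> e0; have E0 := expR_gt0 (Rez z).
exists (expR (Rez z) * Num.min (1 / 2) (e / 8)); first by rewrite mulr_gt0// lt_min !divr_gt0.
move=> w' h; pose q := (w' - a) / cexp z.
have hq : nm (q - 1) < Num.min (1 / 2) (e / 8).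
  have -> : q - 1 = (w' - f z) / cexp z.
    by rewrite /q expmapE -{1}(divff (cexp_neq0 z)) -mulrBl; congr (_ / _); ring.
  by rewrite nmM nmV nm_cexp ltr_pdivrMr// mulrC.
have [q1 q2] : nm (q - 1) < 1 / 2 /\ nm (q - 1) < e / 8 by move: hq; rewrite lt_min => /andP[].
have q0 : q != 0.
  by apply: contraTneq q1 => ->; rewrite sub0r nmN nm1 -leNgt; lra.
exists (z + plog q).
  rewrite addrC addKr.
  have := @plog_lip _ q 1 (ltW q1); rewrite subrr nm0 plog1 subr0 => /(_ (ltac:(by rewrite divr_ge0))); lra.
by rewrite expmapE cexpD plogK// /q mulrC divfK ?cexp_neq0// subrK.
Qed.

Lemma orb_open n z (e : R) : 0 < e -> exists2 d : R, 0 < d & forall w', nm (w' - orb n z) < d ->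
  exists2 w, nm (w - z) < e & orb n w = w'.
Proof.
elim: n e => [|n IH] e e0; first by exists e => // w' h; exists w'.
have [d d0 H] := IH e e0; have [d' d'0 H'] := expmap_open (orb n z) d0.
exists d' => // w'; rewrite orbS => /H'[w1 /H[w h1 h2] h3]; exists w => //.
by rewrite orbS h2.
Qed.

Lemma orb_bounded n (r : R) : exists B, forall z, nm z <= r -> nm (orb n z) <= B.
Proof.
elim: n => [|n [B H]]; first by exists r.
exists (expR B + nm a) => z /H h; rewrite orbS expmapE; apply: le_trans (nmD _ _) _.
by rewrite lerD2r nm_cexp ler_expR; apply: le_trans (Re_le _) h.
Qed.

End OpenMap.

Section Connected.
Variables (R : realType) (a : R[i]).
Implicit Types (z w x y e : R[i]).
Notation f := (expmap a).
Notation orb := (orb a).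
Notation T := (T0 a).
Let hT : 100 * 20 + nm a <= T. Proof. exact: T0_ge. Qed.
Let hT10 : 100 * 20 + nm a <= T + 10. Proof. by have := hT; lra. Qed.

Definition bclopen (P : R[i] -> Prop) := [/\ forall z, P z -> escend a z,
  exists r, forall z, P z -> nm z <= r,
  forall z, P z -> exists2 d : R, 0 < d & forall w, escend a w -> nm (w - z) < d -> P w &
  forall z, escend a z -> (forall d : R, 0 < d -> exists2 w, P w & nm (w - z) < d) -> P z].

Lemma bclopen_orb P n : bclopen P -> bclopen (fun X => exists2 x, P x & orb n x = X).
Proof.
move=> [Pe [r Pr] Po Pc]; split.
- by move=> _ [x Px <-]; apply/escend_orb; exact: Pe.
- by have [B hB] := orb_bounded a n r; exists B => _ [x /Pr/hB h <-].
- move=> _ [x Px <-]; have [d d0 H] := Po x Px; have [d' d'0 H'] := orb_open a n x d0.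
  exists d' => // w ew /H'[w1 h1 e1]; exists w1 => //; apply: H => //.
  by apply: (escend_orb a n w1).1; rewrite e1.
- move=> z ez H.
  have ex (k : nat) : exists x, P x /\ nm (orb n x - z) < k.+1%:R^-1.
    by have [|_ [x Px <-] h] := H k.+1%:R^-1; [rewrite invr_gt0|exists x].
  have [xs hxs] := choice ex.
  have [y hy] := cbolzano (fun k => Pr _ (hxs k).1).
  have oy : orb n y = z.
    apply/eqP; rewrite -subr_eq0 -nm_eq0 eq_le nm_ge0 andbT leNgt; apply/negP => lt.
    have e2 : 0 < nm (orb n y - z) / 2 by rewrite divr_gt0.
    have [d d0 Hd] := orb_cts a n y e2.
    have [N hN] : exists N : nat, (nm (orb n y - z) / 2)^-1 < N%:R.
      by exists (Num.truncn (nm (orb n y - z) / 2)^-1).+1; exact: truncnS_gt.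
    have [k kN hk] := hy d d0 N.
    have l1 := Hd _ hk; have l2 := (hxs k).2.
    have l3 : k.+1%:R^-1 <= nm (orb n y - z) / 2.
      by rewrite -[leRHS]invrK lef_pV2 ?posrE ?invr_gt0// ltW//; apply: lt_trans hN _; rewrite ltr_nat.
    have := nm_triB (orb n y) (orb n (xs k)) z; rewrite (nmB (orb n y) (orb n (xs k))); have := lt_le_trans l2 l3; lra.
  exists y => //; apply: Pc; first by apply: (escend_orb a n y).1; rewrite oy.
  by move=> d d0; have [k _ hk] := hy d d0 0%N; exists (xs k) => //; exact: (hxs k).1.
Qed.

Lemma hair_small e (d : R) : inJ a (T + 10) e -> 0 < d -> exists2 h : R, 0 < h & nm (hair a e 0 h - e) < d.
Proof.
move=> eJ d0; have hc := hair_pcont hT10 (u := 0) (v := 1) 0 eJ (valid0 hT10 eJ).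
have [|d' d'0 H] := hc 0 _ d d0; first by rewrite lexx ler01.
have m0 : 0 < Num.min 1 (d' / 2) by rewrite lt_min ltr01 divr_gt0.
have m1 : Num.min 1 (d' / 2) <= 1 by rewrite ge_min lexx.
have m2 : Num.min 1 (d' / 2) <= d' / 2 by rewrite ge_min lexx orbT.
exists (Num.min 1 (d' / 2)) => //.
have := H (Num.min 1 (d' / 2)); rewrite (hair0 hT10 0 eJ) orb0; apply; first by rewrite m1 ltW.
by rewrite subr0 gtr0_norm//; lra.
Qed.

(** The finite-time form of [slower_later], for points that share addresses only up to time j. *)
Lemma persist i j x y : inJ a T x -> inJ a T y -> (i <= j)%N ->
  (forall k, (i < k)%N -> (k <= j)%N -> `|Imz (orb k x) - Imz (orb k y)| <= 20) ->
  Rez (orb i x) + 1 <= Rez (orb i y) -> Rez (orb j x) + 1 <= Rez (orb j y).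
Proof.
move=> xJ yJ; elim: j => [|j IH]; first by rewrite leqn0 => /eqP ->.
rewrite leq_eqVlt => /orP[/eqP -> //|ij] hI h0.
have h1 : Rez (orb j x) + 1 <= Rez (orb j y).
  by apply: IH => // k ik kj; apply: hI => //; exact: leqW.
have := speed_step hT (xJ j.+1) (yJ j.+1) (hI j.+1 ij (leqnn _)) h1; lra.
Qed.

Lemma addr_near20 x y k l : inJ a T x -> inJ a T y -> addr (orb k x) = addr (orb l y) ->
  `|Imz (orb k x) - Imz (orb l y)| <= 20.
Proof.
move=> xJ yJ e; have := addr_near (addr_cexp_pos k xJ) (addr_cexp_pos l yJ) e.
have := pi_le4 R; lra.
Qed.

Section Growing.
Variable L : nat.
Hypothesis hL : expR (T + 10) + nm a <= L%:R.

Definition growing x := forall k, (k + L <= `|addr (orb k x)|)%N.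

Lemma growing_inJ x : growing x -> inJ a (T + 10) x.
Proof.
move=> g k; have h : (L.+1 <= `|addr (orb k.+1 x)|)%N.
  by apply: leq_trans (g k.+1); rewrite addSn ltnS leq_addl.
rewrite orbS in h; have := addr_expR h; rewrite -(@ler_expR R); apply: le_trans.
have pi2 := pi_ge2 R; have pi4 := pi_le4 R; have := hL; have : (0 : R) <= L%:R by rewrite ler0n.
by rewrite mulr2n -[L.+1]addn1 natrD mulr1n; move: (L%:R : R) (expR _) (nm a) => ? ? ?; nra.
Qed.

Lemma growing_inJT x : growing x -> inJ a T x.
Proof. by move=> /growing_inJ; apply: inJ_le; lra. Qed.

Variables (P : R[i] -> Prop) (e0 : R[i]).
Hypotheses (hP : bclopen P) (Pe0 : P e0) (ge0 : growing e0).

Definition Q x' m x := [/\ P x, growing x & forall k, (k <= m)%N -> addr (orb k x) = addr (orb k x')].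

(** P is bounded, so the real parts at time m have a supremum, which e misses by less than 1. *)
Lemma Q_max x' m x0 : Q x' m x0 -> exists2 e, Q x' m e & forall x, Q x' m x -> Rez (orb m x) <= Rez (orb m e) + 1.
Proof.
move=> Q0; have [_ [r Pr] _ _] := hP; have [B hB] := orb_bounded a m r.
pose S := [set Rez (orb m x) | x in Q x' m].
have Sub : has_sup S.
  split; first by exists (Rez (orb m x0)); exists x0.
  by exists B => _ [x [/Pr/hB h _ _] <-]; exact: le_trans (Re_le _) h.
have [_ [e Qe <-] he] := sup_adherent ltr01 Sub.
exists e => // x Qx; have : Rez (orb m x) <= sup S by apply: sup_upper_bound => //; exists x.
lra.
Qed.

Definition state := (R[i] * nat * R[i])%type.
Definition inv (s : state) := Q s.1.1 s.1.2 s.2 /\ forall x, Q s.1.1 s.1.2 x -> Rez (orb s.1.2 x) <= Rez (orb s.1.2 s.2) + 1.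
(** The new address at time m' is so large that every point having it was faster than the old e at
    time m' - 1. *)
Definition rel (s s' : state) := [/\ (s.1.2 < s'.1.2)%N,
  forall k, (k < s'.1.2)%N -> addr (orb k s'.1.1) = addr (orb k s.2) &
  forall w, addr (f w) = addr (orb s'.1.2 s'.1.1) -> Rez (orb s'.1.2.-1 s.2) + 1 <= Rez w].

(** As P is open around e, it contains a special point x near a low point of the hair of e; e' is
    then nearly fastest among the points with the addresses of x. *)
Lemma inv_step s : exists s', inv s -> inv s' /\ rel s s'.
Proof.
have [i|] := pselect (inv s); last by exists s.
case: s i => [[x' m] e] [/= [Pe ge ae] emax].
have eJ := growing_inJ ge.
have [_ _ Po _] := hP; have [d d0 H] := Po e Pe.
have d2 : 0 < d / 2 by rewrite divr_gt0.
have [h h0 hh] := hair_small eJ d2.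
have [J0 HJ] := special L eJ h0 d2.
pose j' := maxn J0 m.
have [x [h1 h2 h3 h4 h5]] := HJ j' (leq_maxl _ _).
have Px : P x.
  apply: H => //; apply: le_lt_trans (nm_triB _ (hair a e 0 h) _) _; lra.
have gx : growing x.
  by move=> k; have [kj|jk] := ltnP k j'.+1; [rewrite (h2 k kj).1; exact: ge|exact: h3].
have [|e' Qe' e'max] := @Q_max x j'.+1 x; first by split.
exists (x, j'.+1, e') => _; split => //; split => //=; first by rewrite ltnS leq_maxr.
by move=> k /h2[].
Qed.

(** The nearly fastest points E n accumulate at a point z with all the prescribed addresses. It
    escapes and is not on a hair, so it is in P; but P then contains points near the hair of z that
    are faster than the maximality of E n allows. *)
Lemma connected_growing : False.
Proof.
have [st hst] := choice inv_step.
have [|e1 Qe1 e1max] := @Q_max e0 0 e0; first by split.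
pose s := fix s (n : nat) : state := match n with 0 => (e0, 0%N, e1) | n'.+1 => st (s n') end.
have is_ n : inv (s n).
  by elim: n => [|n IH] /=; [split|exact: (hst _ IH).1].
have rs n : rel (s n) (s n.+1) := (hst _ (is_ n)).2.
pose X n := (s n).1.1; pose m n := (s n).1.2; pose E n := (s n).2.
have mlt n : (m n < m n.+1)%N by have [] := rs n.
have mge n : (n <= m n)%N by elim: n => // n IH; exact: leq_ltn_trans IH (mlt n).
have adX n k : (k < m n.+1)%N -> addr (orb k (X n.+1)) = addr (orb k (E n)) by have [_ h _] := rs n; exact: h.
have QE n : Q (X n) (m n) (E n) by have [] := is_ n.
have Qmax n x : Q (X n) (m n) x -> Rez (orb (m n) x) <= Rez (orb (m n) (E n)) + 1 by have [_] := is_ n; apply.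
have Qnest n x : Q (X n.+1) (m n.+1) x -> Q (X n) (m n) x.
  move=> [h1 h2 h3]; split => // k kn; have [_ _ h4] := QE n.
  have kn' : (k < m n.+1)%N := leq_ltn_trans kn (mlt n).
  by rewrite h3 ?(ltnW kn')// adX// h4.
have Qn (l n : nat) x : Q (X (l + n)%N) (m (l + n)%N) x -> Q (X n) (m n) x.
  by elim: l => // l IH; rewrite addSn => /Qnest.
have [Pesc [r Pr] Po Pc] := hP.
have PE n : P (E n) by have [] := QE n.
have GE n : growing (E n) by have [] := QE n.
have [z hz] := cbolzano (fun n => Pr _ (PE n)).
have near k (d : R) N : 0 < d -> exists2 l, (N <= l)%N & nm (orb k (E l) - orb k z) < d.
  by move=> d0; have [d' d'0 H] := orb_cts a k z d0; have [l lN hl] := hz d' d'0 N; exists l => //; exact: H.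
have zJ : inJ a (T + 10) z.
  move=> k; rewrite leNgt; apply/negP => lt; have d0 : 0 < T + 10 - Rez (orb k z) by rewrite subr_gt0.
  have [l _ hl] := near k _ 0%N d0; have := growing_inJ (GE l) k.
  by have := Re_le (orb k (E l) - orb k z); rewrite ReB; lra.
have zT : inJ a T z by apply: inJ_le zJ; lra.
have adz n k : (k <= m n)%N -> addr (orb k z) = addr (orb k (X n)).
  move=> kn; have [l nl hl] := near k pi n (pi_gt0 R).
  have [_ _ h3] : Q (X n) (m n) (E l) by apply: (Qn (l - n)%N); rewrite subnK.
  rewrite -h3//; apply/esym/near_addr.
  - exact: addr_cexp_pos (growing_inJT (GE l)).
  - exact: addr_cexp_pos zT.
  - exact: le_lt_trans (Im_lip _ _) hl.
have gz : growing z.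
  by move=> k; rewrite (adz k k (mge k)); have [_ g h3] := QE k; rewrite -h3.
have ez : esc a z by apply: (@growing_esc _ a z 0%N) => k _; exact: leq_trans (leq_addr _ _) (gz k).
(* A point with the addresses of z that is behind E n at time m n stays behind until just before m
   (n + 1), by [persist]; but the address of z at that time requires it to be ahead of E n. *)
have claim N y n : inJ a T y -> (forall k, addr (orb k y) = addr (orb (N + k) z)) -> (N <= m n)%N ->
    Rez (orb (m n) (E n)) - 1 < Rez (orb (m n - N) y).
  move=> yJ ady Nm; rewrite ltNge; apply/negP => le.
  have EJ : inJ a T (orb N (E n)) by apply: inJ_orb; exact: growing_inJT (GE n).
  have [_ _ big] := rs n.
  have m1 : (0 < m n.+1)%N by exact: leq_ltn_trans (mlt n).
  have mm : (m n <= (m n.+1).-1)%N by rewrite -ltnS prednK.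
  have := @persist (m n - N) ((m n.+1).-1 - N) y (orb N (E n)) yJ EJ (leq_sub2r N mm).
  rewrite -!orbD !subnK ?(leq_trans Nm)// => pers.
  have : Rez (orb ((m n.+1).-1 - N) y) + 1 <= Rez (orb (m n.+1).-1 (E n)).
    apply: pers; last by lra.
    move=> k mk km; have kN : (k + N < m n.+1)%N.
      rewrite -[ltnRHS]prednK// ltnS -(subnK (leq_trans Nm mm)) leq_add2r//.
    rewrite -orbD; apply: addr_near20 => //; first exact: growing_inJT (GE n).
    by rewrite ady addnC (adz n.+1) ?(ltnW kN)// adX.
  have := big (orb ((m n.+1).-1 - N) y); rewrite -/(m n.+1) -/(X n.+1) -/(E n) => b1 b2.
  have e1' : addr (f (orb ((m n.+1).-1 - N) y)) = addr (orb (m n.+1) (X n.+1)).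
    rewrite -orbS -subSn ?(leq_trans Nm)// prednK// ady subnKC ?(adz n.+1)//.
    exact: leq_trans Nm (ltnW (mlt n)).
  have := b1 e1'; lra.
have Ez n : Rez (orb (m n) z) <= Rez (orb (m n) (E n)) + 2.
  have [l nl hl] := near (m n) 1 n ltr01.
  have : Rez (orb (m n) (E l)) <= Rez (orb (m n) (E n)) + 1.
    by apply: Qmax; apply: (Qn (l - n)%N); rewrite subnK.
  by have := Re_ge (orb (m n) (E l) - orb (m n) z); rewrite ReB; lra.
have nz : ~ on_hair a z.
  move=> /on_hair_fast[N HN]; have [zNJ v] := HN N (leqnn N).
  have N24 : - 1 / 2 <= - 1 / 4 :> R by lra.
  have v4 : valid a T (orb N z) (- 1 / 4) by exact (valid_le hT zNJ v N24).
  have n40 : - 1 / 4 <= 0 :> R by lra.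
  (* A slower point with the address of z. After 6 iterates its height exceeds the valid one at -1/2
     by 2^6 / 4 = 16, which covers the error 10 between [hair] and [hpt]. It falls behind z
     exponentially, whereas by [claim] it cannot fall behind E n, nor can z get ahead of E n by more
     than 2. *)
  pose y := orb 6 (hair a (orb N z) 0 (- 1 / 4)).
  have yE k : orb k y = hair a (orb N z) (k + 6) (- 1 / 4) by rewrite /y -orbD (hair_orb hT).
  have yJ : inJ a T y.
    move=> k; rewrite yE; have := Re_hair hT (k + 6) zNJ v4.
    have := hs_gap hT (k + 6) zNJ v N24; have := v (k + 6)%N.
    have : (2 ^+ 6 : R) <= 2 ^+ (k + 6) by rewrite ler_weXn2l ?ler1n// leq_addl.
    have -> : 2 ^+ 6 = 64 :> R by rewrite !exprS expr0; lra.
    lra.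
  have ady k : addr (orb k y) = addr (orb (N + 6 + k) z).
    have -> : (N + 6 + k)%N = (k + 6 + N)%N by lia.
    rewrite (orbD a (k + 6) N); apply: near_addr.
    - exact: addr_cexp_pos.
    - exact: addr_cexp_pos.
    - rewrite yE -(hair0 hT (k + 6) zNJ); apply: (hair_Im hT (k + 6) zNJ v4); exact (valid0 hT zNJ).
  have [N1 hN1] := pow2_ge (100 : R) (ltac:(lra) : 0 < 1 / 4 :> R).
  pose n := (N + 6 + N1)%N.
  have nm_ : (N + 6 + N1 <= m n)%N := mge n.
  have := claim (N + 6)%N y n yJ ady (leq_trans (leq_addr _ _) nm_).
  have := Ez n; rewrite yE.
  have g1 := Re_hair_gap hT (m n - (N + 6) + 6) zNJ v4 n40.
  rewrite (hair0 hT _ zNJ) -orbD in g1.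
  have ei : (m n - (N + 6) + 6 + N)%N = m n by rewrite -addnA [(6 + N)%N]addnC subnK// (leq_trans (leq_addr N1 _) nm_).
  rewrite ei in g1; have := hN1 (m n - (N + 6) + 6)%N (leq_trans (eq_leq (esym (addKn (N + 6) N1))) (leq_trans (leq_sub2r _ nm_) (leq_addr _ _))).
  move: g1; lra.
have Pz : P z by apply: Pc => // d d0; have [l _ hl] := hz d d0 0%N; exists (E l).
(* Approximate the hair point at height h by a member of P sharing the addresses up to time m n: it
   is then about 2^(m n) h ahead of z, hence of E n by [claim]. *)
have [d d0 H] := Po z Pz.
have d2 : 0 < d / 2 by rewrite divr_gt0.
have [h h0 hh] := hair_small zJ d2.
have [n hn] := pow2_ge (100 : R) h0.
have [J0 HJ] := special L zJ h0 d2.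
have [x [h1 h2 h3 h4 h5]] := HJ (maxn J0 (m n)) (leq_maxl _ _).
have Px : P x by apply: H => //; apply: le_lt_trans (nm_triB _ (hair a z 0 h) _) _; lra.
have gx : growing x.
  by move=> k; have [kj|jk] := ltnP k (maxn J0 (m n)).+1; [rewrite (h2 k kj).1; exact: gz|exact: h3].
have kin k : (k <= m n)%N -> (k < (maxn J0 (m n)).+1)%N by move=> kn; rewrite ltnS leq_max kn orbT.
have Qx : Q (X n) (m n) x by split => // k kn; rewrite (h2 k (kin k kn)).1 (adz n).
have := Qmax n x Qx; have := claim 0%N z n zT (fun k => erefl) (leq0n _); rewrite subn0.
have := Re_near (ltac:(rewrite nmB; exact: (h2 _ (kin _ (leqnn _))).2) : nm (hair a z (m n) h - orb (m n) x) <= 12).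
have := Re_near (h2 _ (kin _ (leqnn (m n)))).2.
have := Re_hair_gap hT10 (m n) zJ (valid0 hT10 zJ) (ltW h0); rewrite (hair0 hT10 _ zJ) subr0.
have := hn (m n) (mge n); lra.
Qed.

End Growing.

(** An image of P has a member far to the right, hence also a special point near it; after J0 + 1
    further iterates the addresses of this point grow from the start. *)
Theorem no_bounded_clopen P : bclopen P -> forall z, ~ P z.
Proof.
move=> hP z Pz; have [Pe _ _ _] := hP.
have [N HN] := esc_inJ (T + 10) (Pe z Pz).1.
have hP1 := bclopen_orb N hP.
set P1 := (fun X => _) in hP1.
pose e0 := orb N z; have Pe0 : P1 e0 by exists z.
have e0J : inJ a (T + 10) e0 := HN N (leqnn N).
pose L := (Num.truncn (expR (T + 10) + nm a)).+1.
have hL : expR (T + 10) + nm a <= L%:R by apply: ltW; exact: truncnS_gt.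
have [_ _ Po _] := hP1; have [d d0 H] := Po e0 Pe0.
have d2 : 0 < d / 2 by rewrite divr_gt0.
have [h h0 hh] := hair_small e0J d2.
have [J0 HJ] := special L e0J h0 d2.
have [x [h1 h2 h3 h4 h5]] := HJ J0 (leqnn _).
have Px : P1 x by apply: H => //; apply: le_lt_trans (nm_triB _ (hair a e0 0 h) _) _; lra.
apply: (@connected_growing L hL _ (orb J0.+1 x) (bclopen_orb J0.+1 hP1)); first by exists x.
move=> k; rewrite -orbD; apply: leq_trans (h3 _ (leq_addl _ _)).
by rewrite leq_add2r leq_addr.
Qed.

End Connected.

(** * Separation by a cut through the singular value *)

Section SmallAddress.
Variables (R : realType) (a : R[i]).
Implicit Types (z w x y u : R[i]) (h s t : R).
Notation f := (expmap a).
Notation orb := (orb a).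
Notation T := (T0 a).
Let hT : 100 * 20 + nm a <= T. Proof. exact: T0_ge. Qed.

Definition itexp (A0 : R) (n : nat) : R := iter n (@expR R) A0.

Lemma itexp_ge A0 n : A0 <= itexp A0 n.
Proof.
elim: n => //= n IH; apply: le_trans IH _; rewrite /itexp /=.
have := expR_ge1Dx (iter n (@expR R) A0); lra.
Qed.

Lemma itexp_le A0 m n : (m <= n)%N -> itexp A0 m <= itexp A0 n.
Proof. by move=> /subnK <-; rewrite /itexp iterD; exact: itexp_ge. Qed.

Lemma sqrt_sub_ge (x b : R) : 0 <= b -> b <= x -> x - b <= Num.sqrt (x ^+ 2 - b ^+ 2).
Proof.
move=> b0 bx; apply: le_trans (ler_norm _) _; rewrite -sqrtr_sqr ler_wsqrtr//.
by rewrite !expr2; nra.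
Qed.

Definition Cfast : R := T + 30 + 2 * nm a.

(** If the imaginary parts are at most iterated exponentials A of A0, real parts above 2 A + [Cfast]
    reproduce themselves: exp (2 A + C) is at least (1 + A + C) exp A, which dominates the next
    imaginary part and the next bound. *)
Lemma small_address_fast x A0 : inJ a T x -> 1 <= A0 -> (forall i, `|Imz (orb i x)| <= itexp A0 i + 25) ->
  2 * A0 + Cfast + 1 / 2 <= Rez x -> valid a T x (- 1 / 2).
Proof.
move=> xJ A1 hI hR; have n0 := nm_ge0 a.
suff S i : 2 * itexp A0 i + Cfast <= Rez (orb i x) + hs a x i (- 1 / 2).
  move=> i; apply: le_trans (S i); have := itexp_ge A0 i; rewrite /Cfast; lra.
elim: i => [|i IH].
  by rewrite orb0 (_ : itexp A0 0 = A0)// hs_start; lra.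
set r := _ + hs a x i _ in IH.
rewrite hsS -/r -(expmapB a) -orbS ReB ImB.
have Ai := itexp_ge A0 i; set A := itexp A0 i in IH Ai *.
have -> : itexp A0 i.+1 = expR A by [].
have b1 : `|Imz (orb i.+1 x) - Imz a| <= expR A + 25 + nm a.
  apply: le_trans (ler_normB _ _) _; have := hI i.+1; have := Im_nm a; rewrite /itexp /= -/(itexp A0 i) -/A; lra.
have eA := expR_ge1Dx A.
have e1 : expR A * (1 + (A + Cfast)) <= expR r.
  apply: le_trans (_ : expR (2 * A + Cfast) <= _); last by rewrite ler_expR.
  rewrite (_ : 2 * A + Cfast = A + (A + Cfast)); last by ring.
  by rewrite expRD ler_pM2l ?expR_gt0//; exact: expR_ge1Dx.
have C0 : 27 + 2 * nm a <= Cfast by have := hT; rewrite /Cfast; lra.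
have big : 2 * expR A + Cfast + nm a + (expR A + 25 + nm a) <= expR r.
  apply: le_trans e1; move: (expR A) C0 eA Ai A1; move: (Cfast) => C eE *; nra.
have := @sqrt_sub_ge (expR r) `|Imz (orb i.+1 x) - Imz a| (normr_ge0 _).
rewrite real_normK ?num_real// => sq.
have := sq (ltac:(have := expR_ge0 A; have := nm_ge0 a; move: b1 big; rewrite /Cfast; have := hT; lra)).
have := Re_le a; have := Re_ge a; move: b1 big; lra.
Qed.

Lemma escend_not_small x A0 : escend a x -> inJ a T x -> 1 <= A0 ->
  (forall i, `|Imz (orb i x)| <= itexp A0 i + 25) -> Rez x < 2 * A0 + Cfast + 1 / 2.
Proof.
move=> [_ nh] xJ A1 hI; rewrite ltNge; apply/negP => hR; apply: nh.
apply: (fast_on_hair xJ _ (small_address_fast xJ A1 hI hR)); lra.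
Qed.

End SmallAddress.

Section Separation.
Variables (R : realType) (a : R[i]).
Implicit Types (z w x y u : R[i]) (h s t : R).
Notation f := (expmap a).
Notation orb := (orb a).
Notation T := (T0 a).
Let hT : 100 * 20 + nm a <= T. Proof. exact: T0_ge. Qed.

Variables (C : R[i] -> Prop) (L : R[i] -> R[i]) (rho A0 : R).
Hypothesis LE : forall w, ~ C w -> cexp (L w) = w - a.
Hypothesis Lc : forall w, ~ C w -> forall e : R, 0 < e -> exists2 d : R, 0 < d &
  forall w', nm (w' - w) < d -> ~ C w' /\ nm (L w' - L w) < e.
Hypothesis fC : forall z, escend a z -> ~ C (f z).
Hypothesis LP : forall z, escend a z -> exists N, forall n, (N <= n)%N ->
  L (orb n z) - plog (orb n z - a) = 0 \/ L (orb n z) - plog (orb n z - a) = tpi 1.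
Hypothesis A1 : 1 <= A0.
Hypothesis small : forall u i, C u -> (forall i', (i' <= i)%N -> rho <= Rez (orb i' u)) ->
  `|Imz (orb i u)| <= itexp A0 i.

(** A multiple of 2 pi i, the address relative to L. Unlike [addr] it is locally constant on the
    escaping endpoints, whose images avoid the cut C. *)
Definition lab n x := orb n x - L (orb n.+1 x).

Lemma orbC n x : escend a x -> ~ C (orb n.+1 x).
Proof. by move=> ex; rewrite orbS; apply: fC; apply/escend_orb. Qed.

Lemma cexp_lab n x : escend a x -> cexp (lab n x) = 1.
Proof.
move=> ex; rewrite /lab cexpB LE; last exact: orbC.
by rewrite orbS expmapB divff// cexp_neq0.
Qed.

Lemma lab_loc n x : escend a x -> exists2 d : R, 0 < d & forall y, escend a y -> nm (y - x) < d -> lab n y = lab n x.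
Proof.
move=> ex; have [d1 p1 H1] := orb_cts a n x (ltr01 : 0 < 1 :> R).
have [d2 p2 H2] := Lc (orbC (n:=n) ex) (ltr01 : 0 < 1 :> R).
have [d3 p3 H3] := orb_cts a n.+1 x p2.
exists (Num.min d1 d3); first by rewrite lt_min p1.
move=> y ey; rewrite lt_min => /andP[/H1 h1 /H3/H2[_ h2]].
apply: cexp_inj; last by rewrite !cexp_lab.
rewrite -ImB; apply: le_lt_trans (Im_nm _) _; rewrite /lab (_ : _ - _ - _ = (orb n y - orb n x) - (L (orb n.+1 y) - L (orb n.+1 x))); last by ring.
by apply: le_lt_trans (nmBs _ _) _; have := pi_ge2 R; rewrite mulr2n; lra.
Qed.

(** Off C, L and [plog] are both continuous logarithms of g t - a, which stays in the right
    half-plane. *)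
Lemma path_delta (g : R -> R[i]) : pcont 0 1 g -> (forall t, 0 <= t <= 1 -> nm a < Rez (g t) /\ ~ C (g t)) ->
  L (g 1) - plog (g 1 - a) = L (g 0) - plog (g 0 - a).
Proof.
move=> gc gC.
have Lg : pcont 0 1 (fun t => L (g t)).
  move=> t it e e0; have [d d0 H] := Lc (gC t it).2 e0; have [d' d'0 H'] := gc t it d d0.
  by exists d' => // t' it' tt; exact: (H _ (H' t' it' tt)).2.
have E t : 0 <= t <= 1 -> cexp (L (g t)) = g t - a by move=> it; exact: LE (gC t it).2.
have i0 : 0 <= (0 : R) <= 1 by rewrite lexx ler01.
have i1 : 0 <= (1 : R) <= 1 by rewrite lexx ler01.
have sl t : 0 <= t <= 1 -> slit (cexp (L (g t))).
  by move=> it; left; rewrite E//; exact: Re_pos_subl (gC t it).1.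
have := slit_turn ler01 Lg sl; rewrite !E// => h.
by apply/eqP; rewrite -subr_eq0 -(subr_eq0 (_ - _)) in h *; apply/eqP; rewrite -[RHS](subrr (L (g 1) - L (g 0))) {2}h; ring.
Qed.

(** Equal labels keep the orbits close. If the addresses agree from some time on, expansion makes
    the orbits equal then, and equal labels pull this back to z = w. If they differ infinitely
    often, the orbits follow the cut, and z has too small addresses for an endpoint. *)
Lemma same_labels_eq z w : escend a z -> escend a w -> (forall n, lab n z = lab n w) -> z = w.
Proof.
move=> ez ew hl; have pi4 := pi_le4 R; have pi2 := pi_ge2 R.
have back n : orb n z = orb n w -> z = w.
  elim: n => // n IH e; apply: IH.
  by have := hl n; rewrite /lab e => /addIr.
have [Nz HNz] := LP ez; have [Nw HNw] := LP ew.
have [N1 HN1] := esc_inJ (T + 20 + `|rho| + (2 * A0 + Cfast a + 1)) ez.1.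
have [N2 HN2] := esc_inJ (T + 20 + `|rho|) ew.1.
pose N := maxn (maxn Nz Nw) (maxn N1 N2).
have NN n : (N <= n)%N -> [/\ (Nz <= n)%N, (Nw <= n)%N, (N1 <= n)%N & (N2 <= n)%N].
  by rewrite !geq_max => /andP[/andP[-> ->] /andP[-> ->]].
have bigz n : (N <= n)%N -> inJ a (T + 20 + `|rho| + (2 * A0 + Cfast a + 1)) (orb n z) by move=> /NN[_ _ h _]; exact: HN1.
have C0 : 0 <= Cfast a by rewrite /Cfast; have := hT; have := nm_ge0 a; lra.
have Jz n : (N <= n)%N -> inJ a T (orb n z).
  by move=> /bigz; apply: inJ_le; have := normr_ge0 rho; have := A1; lra.
have Jw n : (N <= n)%N -> inJ a T (orb n w).
  by move=> /NN[_ _ _ h]; apply: inJ_le (HN2 n h); have := normr_ge0 rho; lra.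
have posz n : (N <= n)%N -> nm a < Rez (orb n z).
  by move=> Nn; have := Jz n Nn 0%N; rewrite orb0; have := hT; have := nm_ge0 a; lra.
have posw n : (N <= n)%N -> nm a < Rez (orb n w).
  by move=> Nn; have := Jw n Nn 0%N; rewrite orb0; have := hT; have := nm_ge0 a; lra.
have dE n : orb n z - orb n w = L (orb n.+1 z) - L (orb n.+1 w).
  by have := hl n; rewrite /lab => /eqP; rewrite subr_eq => /eqP ->; ring.
(* At most 2 pi comes from L - [plog] at the two points and less than pi from the two arguments. *)
have near n : (N <= n)%N -> `|Imz (orb n z) - Imz (orb n w)| <= 12.
  move=> Nn; rewrite -ImB dE; have Nn1 : (N <= n.+1)%N := leqW Nn.
  have [n1 n2 _ _] := NN _ Nn1.
  have b1 := parg_lt (Re_pos_subl (posz _ Nn1)); have b2 := parg_lt (Re_pos_subl (posw _ Nn1)).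
  set lz := plog (orb n.+1 z - a) in b1; set lw := plog (orb n.+1 w - a) in b2.
  have -> : L (orb n.+1 z) - L (orb n.+1 w) = (L (orb n.+1 z) - lz) - (L (orb n.+1 w) - lw) + (lz - lw) by ring.
  rewrite ImD ImB (ImB lz lw).
  have iE0 : Imz (0 : R[i]) = 0 by [].
  have tE : Imz (tpi 1 : R[i]) = pi + pi by rewrite /tpi /= mulr1 mulr2n.
  have b3 : `|Imz (L (orb n.+1 z) - lz) - Imz (L (orb n.+1 w) - lw)| <= pi + pi.
    by case: (HNz _ n1) => ->; case: (HNw _ n2) => ->; rewrite ?tE ?iE0 ?subrr ?subr0 ?sub0r ?normrN ?normr0 ?ger0_norm//; lra.
  apply: le_trans (ler_normD _ _) _; have := ler_normB (Imz lz) (Imz lw); lra.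
have nI n : (N <= n)%N -> nearI a 20 (orb n z) (orb n w).
  move=> Nn k; rewrite -!orbD; have := near (k + n)%N (leq_trans Nn (leq_addl _ _)); lra.
(* A lead of 1 would put the faster of the two endpoints on a hair. *)
have Rb n : (N <= n)%N -> `|Rez (orb n z) - Rez (orb n w)| <= 1.
  move=> Nn; rewrite ler_norml; apply/andP; split; rewrite leNgt; apply/negP => lt.
    apply: (escend_not_faster ew (Jw n Nn) (Jz n Nn) (nearI_sym (nI n Nn))); exists 0%N; rewrite !orb0; lra.
  apply: (escend_not_faster ez (Jz n Nn) (Jw n Nn) (nI n Nn)); exists 0%N; rewrite !orb0; lra.
have dist n : (N <= n)%N -> nm (orb n z - orb n w) <= 13.
  by move=> Nn; apply: le_trans (nm_ReIm _) _; rewrite ReB ImB; have := near n Nn; have := Rb n Nn; lra.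
pose D n := addr (orb n z) <> addr (orb n w).
have [[N' hN']|inf] := pselect (exists N', forall n, (N' <= n)%N -> ~ D n).
  apply: (back (maxn N N')).
  have NNm : (N <= maxn N N')%N by exact: leq_maxl.
  apply: (@close_eq _ a T hT 1 _ _ (Jz _ NNm) (Jw _ NNm)) => n.
    rewrite -!orbD; apply: addr_near.
    - by rewrite orbD; exact: addr_cexp_pos (Jz _ NNm).
    - by rewrite orbD; exact: addr_cexp_pos (Jw _ NNm).
    - by apply: contrapT; apply: hN'; rewrite (leq_trans (leq_maxr N N'))// leq_addl.
  by rewrite -!orbD; apply: Rb; rewrite (leq_trans NNm)// leq_addl.
exfalso.
have [n1 n1N Dn1] : exists2 n1, (N <= n1)%N & D n1.
  apply: contrapT => no; apply: inf; exists N => n Nn Dn; apply: no; by exists n.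
have LamE x n : inJ a T (orb n x) -> Lam a (addr (orb n x)) (orb n.+1 x) = orb n x.
  move=> J; rewrite orbS Lam_addr// -orbS; have := J 1%N; rewrite orbS orb0 -orbS.
  by have := hT; have := nm_ge0 a; lra.
have cross n k : (N <= n)%N -> D n -> (n < k)%N -> (forall m, (n < m)%N -> (m < k)%N -> ~ D m) ->
    `|Imz (orb k z)| <= itexp A0 (k - n.+1) + 13.
  move=> Nn Dn nk nD.
  (* The segment between the two orbits at time k, pulled back i times along the common
     addresses. *)
  pose sg := fix sg (i : nat) (t : R) : R[i] := match i with
    | 0 => orb k z + t%:C * (orb k w - orb k z)
    | i'.+1 => Lam a (addr (orb (k - i'.+1) z)) (sg i' t) end.
  have sP i : (i <= k - n.+1)%N -> [/\ sg i 0 = orb (k - i) z, sg i 1 = orb (k - i) w &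
      forall t, 0 <= t <= 1 -> nm (sg i t - orb (k - i) z) <= 13].
    elim: i => [|i IH] ik.
      rewrite subn0 /= mul0r addr0 mul1r subrKC; split=> // t /andP[t0 t1].
      rewrite addrC addKr nmM nmR ger0_norm// nmB; have := dist k (leq_trans Nn (ltnW nk)).
      by have := nm_ge0 (orb k z - orb k w); nra.
    have [h0 h1 h2] := IH (ltnW ik); pose m := (k - i.+1)%N.
    have mS : (k - i = m.+1)%N by rewrite /m subnSK// (leq_trans ik (leq_subr _ _)).
    have nm_ : (n < m)%N by apply: leq_trans (leq_sub2l k ik); rewrite subKn.
    have mk : (m < k)%N by rewrite /m ltn_subrL (leq_ltn_trans _ nk).
    have Nm : (N <= m)%N := leq_trans Nn (ltnW nm_).
    rewrite mS in h0 h1 h2.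
    have Lz := LamE z m (Jz m Nm); have Lw := LamE w m (Jw m Nm).
    have ad : addr (orb m z) = addr (orb m w) by apply: contrapT; exact: nD.
    rewrite /= -/m h0 h1 {2}ad; split=> //.
    move=> t it; rewrite -{2}Lz; apply: le_trans (Lam_contract _ _ _) _.
    - have := Re_near (h2 t it); have := Jz m.+1 (leqW Nm) 0%N; rewrite orb0; have := hT; lra.
    - have := Jz m.+1 (leqW Nm) 0%N; rewrite orb0; have := hT; lra.
    - have := h2 t it; have := nm_ge0 (sg i t - orb m.+1 z); lra.
  have sR i t : (i <= k - n.+1)%N -> 0 <= t <= 1 -> T + `|rho| <= Rez (sg i t).
    move=> ik it; have [_ _ h] := sP i ik; have := Re_near (h t it).
    have Nk : (N <= k - i)%N by apply: leq_trans (leq_sub2l k ik); rewrite subKn// leqW.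
    by have := bigz _ Nk 0%N; rewrite orb0; have := A1; have := normr_ge0 rho; lra.
  have sa i t : (i <= k - n.+1)%N -> 0 <= t <= 1 -> nm a < Rez (sg i t).
    by move=> ik it; have := sR i t ik it; have := hT; have := nm_ge0 a; have := normr_ge0 rho; lra.
  have sc i : (i <= k - n.+1)%N -> pcont 0 1 (sg i).
    elim: i => [|i IH] ik.
      move=> t it e e0; exists (e / 14); first by rewrite divr_gt0.
      move=> t' it' tt; rewrite /= opprD addrACA subrr add0r -mulrBl -rmorphB nmM nmR nmB.
      have := dist k (leq_trans Nn (ltnW nk)); have := nm_ge0 (orb k z - orb k w).
      by have := normr_ge0 (t' - t); move: tt; rewrite ltr_pdivlMr//; nra.
    move=> t it e e0; have [d d0 H] := IH (ltnW ik) t it e e0; exists d => // t' it' tt.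
    have h := H t' it' tt; apply: le_lt_trans h => /=; apply: le_trans (Lam_contract _ _ _) _.
    - by have := sR i t' (ltnW ik) it'; have := hT; have := normr_ge0 rho; lra.
    - by have := sR i t (ltnW ik) it; have := hT; have := normr_ge0 rho; lra.
    - by have := nm_ge0 (sg i t' - sg i t); lra.
  pose i0 := (k - n.+1)%N.
  have ki0 : (k - i0 = n.+1)%N by rewrite /i0 subKn.
  (* If the segment pulled back to time n + 1 missed the cut, L - [plog] would agree at its ends,
     and equal labels would give equal addresses at time n. The orbit of the point found on C then
     bounds the imaginary part at time k. *)
  have [t [it Ct]] : exists t, 0 <= t <= 1 /\ C (sg i0 t).
    apply: contrapT => no.
    have := path_delta (sc i0 (leqnn _)) (fun t it => conj (sa i0 t (leqnn _) it) (fun Ct => no (ex_intro _ t (conj it Ct)))).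
    have [-> -> _] := sP i0 (leqnn _); rewrite ki0 => e.
    have := dE n; rewrite -(LamE z n (Jz n Nn)) -(LamE w n (Jw n Nn)) /Lam => e2.
    have e3 : tpi (addr (orb n z))%:~R = tpi (addr (orb n w))%:~R :> R[i].
      apply/eqP; rewrite -subr_eq0; apply/eqP.
      have -> : tpi (addr (orb n z))%:~R - tpi (addr (orb n w))%:~R =
        ((plog (orb n.+1 z - a) + tpi (addr (orb n z))%:~R) - (plog (orb n.+1 w - a) + tpi (addr (orb n w))%:~R))
        - (plog (orb n.+1 z - a) - plog (orb n.+1 w - a)) :> R[i] by ring.
      rewrite e2; have -> : L (orb n.+1 w) = (L (orb n.+1 w) - plog (orb n.+1 w - a)) + plog (orb n.+1 w - a) by ring.
      by rewrite e; ring.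
    apply: Dn; have := congr1 (@complex.Im R) e3; rewrite /tpi /= => /(mulfI (lt0r_neq0 (pi2_gt0 R))) /eqP.
    by rewrite eqr_int => /eqP.
  have so i : (i <= i0)%N -> orb i (sg i0 t) = sg (i0 - i)%N t.
    elim: i => [|i IH] ii; first by rewrite subn0.
    rewrite orbS IH ?(ltnW ii)//.
    have -> : (i0 - i = (i0 - i.+1).+1)%N by rewrite subnSK.
    by rewrite /= LamK//; apply: sa => //; rewrite leq_subr.
  have := small (i := i0) Ct; rewrite so// subnn => sm.
  have {sm} : `|Imz (sg 0%N t)| <= itexp A0 i0.
    apply: sm => i ii; rewrite so//; have := sR (i0 - i)%N t (leq_subr _ _) it.
    by have := ler_norm rho; have := hT; have := nm_ge0 a; lra.
  have [_ _ /(_ t it)] := sP 0%N (leq0n _); rewrite subn0 => h13.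
  have := Im_nm (sg 0%N t - orb k z); rewrite ImB distrC.
  have := ler_normD (Imz (orb k z) - Imz (sg 0%N t)) (Imz (sg 0%N t)); rewrite subrK; lra.
(* Apply [cross] with the last time before k at which the addresses differ. *)
have bound k : (n1 < k)%N -> `|Imz (orb k z)| <= itexp A0 (k - n1.+1) + 13.
  move=> n1k.
  pose p m := (n1 <= m < k)%N && `[< D m >].
  have ex : exists m, p m by exists n1; rewrite /p leqnn n1k; apply/asboolP.
  have ub m : p m -> (m <= k)%N by move=> /andP[/andP[_ h] _]; exact: ltnW.
  have [n /andP[/andP[n1n nk] /asboolP Dn] nmax] := ex_maxnP ex ub.
  apply: le_trans (cross n k (leq_trans n1N n1n) Dn nk _) _.
    move=> m nm_ mk Dm; have := nmax m; rewrite /p (leq_trans n1n (ltnW nm_)) mk /= => /(_ _).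
    by rewrite leqNgt nm_ => /(_ (introT (asboolP _) Dm)).
  by rewrite lerD2r itexp_le// leq_sub2l.
have N1' : (N <= n1.+1)%N := leqW n1N.
have : Rez (orb n1.+1 z) < 2 * A0 + Cfast a + 1 / 2.
  apply: (@escend_not_small _ a _ A0) => //.
  - exact/escend_orb.
  - exact: Jz.
  - move=> i; rewrite -orbD; have := bound (i + n1.+1)%N; rewrite addnK => b.
    by apply: le_trans (b _) _; [rewrite ltn_addl|lra].
have := bigz _ N1' 0%N; rewrite orb0; have := hT; have := nm_ge0 a; have := normr_ge0 rho; lra.
Qed.

Theorem escend_separated z w : escend a z -> escend a w -> z <> w ->
  exists U : R[i] -> Prop, [/\ U z, ~ U w & forall x, escend a x -> exists2 d : R, 0 < d &
    forall y, escend a y -> nm (y - x) < d -> (U y <-> U x)].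
Proof.
move=> ez ew zw.
have [n hn] : exists n, lab n z <> lab n w.
  by apply: contrapT => no; apply: zw; apply: same_labels_eq => // n; apply: contrapT => h; apply: no; exists n.
exists (fun x => lab n x = lab n z); split => //; first by move=> e; apply: hn.
by move=> x ex; have [d d0 H] := lab_loc n ex; exists d => // y ey /(H y ey) ->.
Qed.

End Separation.

(** * A branch of log (w - a) off a cut to infinity *)

Section HalfLine.
Variable R : realType.
Implicit Types (z w x y : R[i]) (h s t u v : R).

Lemma pcont_addc u v (g : R -> R[i]) c : pcont u v g -> pcont u v (fun t => g t + c).
Proof.
move=> gc t it e e0; have [d d0 H] := gc t it e e0; exists d => // t' it' tt.
by rewrite opprD addrACA subrr addr0; exact: H.
Qed.

Lemma pcont_csub u v (g : R -> R[i]) c : pcont u v g -> pcont u v (fun t => c - g t).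
Proof.
move=> gc t it e e0; have [d d0 H] := gc t it e e0; exists d => // t' it' tt.
rewrite (_ : c - g t' - (c - g t) = - (g t' - g t)); last by ring.
by rewrite nmN; exact: H.
Qed.

Lemma pcont_add u v (g g' : R -> R[i]) : pcont u v g -> pcont u v g' -> pcont u v (fun t => g t + g' t).
Proof.
move=> gc gc' t it e e0; have e2 : 0 < e / 2 by lra.
have [d d0 H] := gc t it _ e2; have [d' d'0 H'] := gc' t it _ e2.
exists (Num.min d d'); first by rewrite lt_min d0.
move=> t' it'; rewrite lt_min => /andP[/(H _ it') h1 /(H' _ it') h2].
by rewrite opprD addrACA; apply: le_lt_trans (nmD _ _) _; lra.
Qed.

Lemma log_unique_rev u v (L L' : R -> R[i]) : u <= v -> pcont u v L -> pcont u v L' ->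
  (forall t, u <= t <= v -> cexp (L t) = cexp (L' t)) -> L v = L' v -> L u = L' u.
Proof.
move=> uv c c' E e; rewrite -[u]opprK.
apply: (@log_unique R (- v) (- u) (fun t => L (- t)) (fun t => L' (- t))).
- by rewrite lerN2.
- exact: pcont_opp.
- exact: pcont_opp.
- by move=> t /andP[h1 h2]; apply: E; rewrite lerNr h2 lerNl.
- by rewrite !opprK.
Qed.

Lemma half_line_log (g : R -> R[i]) l : (forall v, pcont 0 v g) -> (forall t, 0 <= t -> g t != 0) ->
  cexp l = g 0 ->
  exists L : R -> R[i], [/\ forall v, pcont 0 v L, forall t, 0 <= t -> cexp (L t) = g t & L 0 = l].
Proof.
move=> gc g0 le.
have /choice[Ln HLn] : forall n : nat, exists Ln : R -> R[i], [/\ pcont 0 n%:R Ln,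
    forall t, 0 <= t <= n%:R -> cexp (Ln t) = g t & Ln 0 = l].
  by move=> n; apply: pcont_log_from => // t /andP[h _]; exact: g0.
have same (m n : nat) t : 0 <= t <= m%:R -> t <= n%:R -> Ln m t = Ln n t.
  move=> /andP[t0 tm] tn; have [c1 e1 l1] := HLn m; have [c2 e2 l2] := HLn n.
  apply: (@log_unique R 0 t) => //.
  - exact: (pcont_sub (lexx 0) tm c1).
  - exact: (pcont_sub (lexx 0) tn c2).
  - by move=> s /andP[s0 st]; rewrite e1 ?s0 ?(le_trans st)// e2// s0 (le_trans st).
  - by rewrite l1 l2.
have arch t : 0 <= t -> t <= (Num.truncn t).+1%:R by move=> t0; apply: ltW; exact: truncnS_gt.
pose L t := Ln (Num.truncn t).+1 t.
have LE (n : nat) t : 0 <= t <= n%:R -> L t = Ln n t.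
  by move=> /andP[t0 tn]; apply: same => //; rewrite t0 arch.
exists L; split.
- move=> v; have [v0|v0] := leP 0 v; last by move=> t /andP[h1 h2]; move: (le_lt_trans (le_trans h1 h2) v0); rewrite ltxx.
  have [c1 _ _] := HLn (Num.truncn v).+1.
  apply: (@pcont_eq _ 0 v (Ln (Num.truncn v).+1)); last exact: (pcont_sub (lexx 0) (arch v v0) c1).
  by move=> t /andP[t0 tv]; rewrite (LE (Num.truncn v).+1)// t0 (le_trans tv)// arch.
- by move=> t t0; have [_ e _] := HLn (Num.truncn t).+1; rewrite /L e// t0 arch.
- by have [_ _ e] := HLn (Num.truncn (0 : R)).+1.
Qed.

(** The turn along the edge s = 0 is computed along the three other edges, each of which is mapped
    into a half-plane. *)
Lemma turn_square (g1 g2 l : R -> R[i]) : pcont 0 1 g1 -> pcont 0 1 g2 -> pcont 0 1 l ->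
  (forall s t, 0 <= s <= 1 -> 0 <= t <= 1 -> g1 s <> g2 t) ->
  (forall t, 0 <= t <= 1 -> cexp (l t) = g1 0 - g2 t) ->
  (forall s, 0 <= s <= 1 -> 0 < Rez (g1 s - g2 0)) ->
  (forall t, 0 <= t <= 1 -> 0 <= Rez (g1 1 - g2 t)) ->
  (forall s, 0 <= s <= 1 -> Rez (g1 s - g2 1) <= 0) ->
  l 1 - l 0 = (plog (g1 1 - g2 1) - plog (- (g1 1 - g2 1))) + plog (- (g1 0 - g2 1)) - plog (g1 0 - g2 0).
Proof.
move=> c1 c2 cl ne hl hA hB hC.
have ne' s t : 0 <= s <= 1 -> 0 <= t <= 1 -> g1 s - g2 t != 0 by move=> h1 h2; rewrite subr_eq0; apply/eqP; exact: ne.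
have ne0 s t : 0 <= s <= 1 -> 0 <= t <= 1 -> g1 s - g2 t != 0 by exact: ne'.
have [L cL hL'] := @usq_log R g1 g2 0 c1 c2 ne'.
have hL s t : 0 <= s <= 1 -> 0 <= t <= 1 -> cexp (L (s +i* t)) = g1 s - g2 t by move=> h1 h2; rewrite hL'// subr0.
have i0 : 0 <= (0 : R) <= 1 by rewrite ?lexx ?ler01.
have i1 : 0 <= (1 : R) <= 1 by rewrite ?lexx ?ler01.
have M1 z : -1 * z = - z :> R[i] by rewrite mulN1r.
have e0 : 0 = 0 +i* 0 :> R[i] by []. have e1 : 1 = 1 +i* 0 :> R[i] by [].
have eci : ci R = 0 +i* 1 by [].
have e11 : 1 + ci R = 1 +i* 1 by apply: CP; rewrite !Cri /=; ring.
have e11' : ci R + 1 = 1 +i* 1 by apply: CP; rewrite !Cri /=; ring.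
have TA : L (0 + 1) - L 0 = plog (1 * cexp (L (0 + 1))) - plog (1 * cexp (L 0)).
  have eqt t : 0 + t%:C * 1 = t +i* 0 :> R[i] by apply: CP => /=; ring.
  apply: edge_turn cL _ _ _; first by rewrite oner_eq0.
    by move=> t t01; rewrite eqt; split => //=; rewrite lexx ler01.
  by move=> t t01; left; rewrite eqt mul1r hL//; exact: hA.
have TB : L (1 + ci R) - L 1 = plog (1 * cexp (L (1 + ci R))) - plog (1 * cexp (L 1)).
  have eqt t : 1 + t%:C * ci R = 1 +i* t by apply: CP => /=; ring.
  apply: edge_turn cL _ _ _; first by rewrite oner_eq0.
    by move=> t t01; rewrite eqt; split => //=; rewrite lexx ler01.
  by move=> t t01; rewrite eqt mul1r hL//; apply: Re0_slit; [exact: hB|exact: ne0].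
have TC : L (ci R + 1) - L (ci R) = plog (-1 * cexp (L (ci R + 1))) - plog (-1 * cexp (L (ci R))).
  have eqt t : ci R + t%:C * 1 = t +i* 1 by apply: CP => /=; ring.
  apply: edge_turn cL _ _ _; first by rewrite oppr_eq0 oner_eq0.
    by move=> t t01; rewrite eqt; split => //=; rewrite lexx ler01.
  move=> t t01; rewrite eqt M1 hL//; apply: Re0_slit; last by rewrite oppr_eq0 ne0.
  by rewrite ReN; have := hC t t01; lra.
rewrite !add0r !M1 !mul1r !e11' !e11 in TA TB TC.
have E00 : cexp (L 0) = g1 0 - g2 0 by rewrite {1}e0 hL.
have E10 : cexp (L 1) = g1 1 - g2 0 by rewrite {1}e1 hL.
have E01 : cexp (L (ci R)) = g1 0 - g2 1 by rewrite eci hL.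
rewrite ?E00 ?E10 ?E01 ?(hL 1 1 i1 i1) in TA TB TC.
have lE : l 1 = L (ci R) + (l 0 - L 0).
  rewrite eci (_ : L 0 = L (0 +i* 0))//; apply: (@log_unique R 0 1 l (fun t => L (0 +i* t) + (l 0 - L (0 +i* 0)))) => //.
  - apply: pcont_addc; apply: (@pcont_eq _ 0 1 (fun t => L (0 + t%:C * ci R))).
      by move=> t _; congr L; apply: CP => /=; ring.
    by apply: pcont_edge => // t t01; rewrite (_ : 0 + _ = 0 +i* t); [split => //=; rewrite lexx ler01|apply: CP => /=; ring].
  - by move=> t t01; rewrite cexpD cexpB hl// hl// !hL// divff ?mulr1// ne0.
  - by rewrite subrKC.
rewrite lE; move: TA TB TC.
move: (plog _) (plog (- (g1 1 - g2 1))) (plog (- (g1 0 - g2 1))) (plog (g1 0 - g2 0)) (plog (g1 1 - g2 0)) => p1 p2 p3 p4 p5.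
move: (L _) (L 0) (L 1) (L (1 +i* 1)) => q1 q2 q3 q4 TA TB TC.
have -> : q1 + (l 0 - q2) - l 0 = (q3 - q2) + (q4 - q3) - (q4 - q1) by ring.
by rewrite TA TB TC; ring.
Qed.

End HalfLine.

Section Cut.
Variables (R : realType) (a : R[i]).
Implicit Types (z w x y : R[i]) (h t u v : R).
Notation f := (expmap a).
Notation orb := (orb a).
Notation T := (T0 a).
Let hT : 100 * 20 + nm a <= T. Proof. exact: T0_ge. Qed.

Definition tail_to (s : R) (c : R -> R[i]) := forall X : R, exists2 t0 : R, 0 <= t0 &
  forall t, t0 <= t -> X <= s * Rez (c t).

(** While it stays right of rho, a point of the cut has imaginary parts bounded by iterated
    exponentials; by [escend_not_small] an escaping endpoint far to the right cannot have such a
    bound. *)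
Definition im_small (rho A0 : R) x := forall i, (forall i', (i' <= i)%N -> rho <= Rez (orb i' x)) ->
  `|Imz (orb i x)| <= itexp A0 i.

Variables (c : R -> R[i]) (s : R).
Hypothesis s1 : s = 1 \/ s = -1.
Hypothesis cc : forall v, pcont 0 v c.
Hypothesis ca : c 0 = a.
Hypothesis ct : tail_to s c.

Definition oncut w := exists2 t, 0 <= t & w = c t.

(* s is 1 or -1 according to whether Re (c t) tends to +oo or -oo; endlog is a
   logarithm of - s, which normalises the lifts of w - c at the far end of c. *)
Definition endlog : R[i] := 0 +i* (pi / 2 * (1 + s)).
Definition ecut : R[i] := (- s)%:C.

Lemma ecut_endlog : cexp endlog = ecut.
Proof.
apply: CP; rewrite ?Re_cexp ?Im_cexp /= expR0 mul1r; case: s1 => ->.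
- by rewrite (_ : _ * _ = pi) ?cospi//; field.
- by rewrite subrr mulr0 cos0 opprK.
- by rewrite (_ : _ * _ = pi) ?sinpi//; field.
- by rewrite subrr mulr0 sin0.
Qed.

Lemma ecut2 : ecut * ecut = 1.
Proof. by rewrite -rmorphM; case: s1 => -> ; rewrite ?mulrNN ?opprK mulr1. Qed.

Lemma ecut_neq0 : ecut != 0. Proof. by rewrite -ecut_endlog cexp_neq0. Qed.

Lemma Re_ecut z : Rez (ecut * z) = - s * Rez z. Proof. by rewrite ReM /=; ring. Qed.

(** A logarithm of w - c t along the cut, normalised at the far end, where w - c t lies in a
    half-plane. *)
Definition lifted w (l : R -> R[i]) := [/\ forall v, pcont 0 v l, forall t, 0 <= t -> cexp (l t) = w - c t &
  exists2 t0 : R, 0 <= t0 & forall t, t0 <= t ->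
    0 < Rez (ecut * (w - c t)) /\ l t = plog (ecut * (w - c t)) + endlog].

Lemma cut_side w : exists2 t0 : R, 0 <= t0 & forall t, t0 <= t -> 1 <= Rez (ecut * (w - c t)).
Proof.
have [t0 t00 H] := ct (s * Rez w + 1); exists t0 => // t /H; rewrite Re_ecut ReB; lra.
Qed.

Lemma off_cut w : ~ oncut w -> forall t, 0 <= t -> w - c t != 0.
Proof. by move=> wC t t0; rewrite subr_eq0; apply/eqP => e; apply: wC; exists t. Qed.

Lemma lift_ex w : ~ oncut w -> exists l, lifted w l.
Proof.
move=> /off_cut w0; have [t0 t00 H] := cut_side w.
have [l [lc lE l0]] := half_line_log (fun v => pcont_csub w (cc (v := v))) w0 (plogK (w0 0 (lexx 0))).
exists (fun t => l t + (plog (ecut * (w - c t0)) + endlog - l t0)); split.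
- by move=> v; apply: pcont_addc.
- move=> t tt; rewrite cexpD cexpB cexpD lE// lE// plogK; last by rewrite mulf_neq0 ?ecut_neq0 ?w0.
  rewrite ecut_endlog (_ : _ / _ = ecut * ecut * ((w - c t0) / (w - c t0))); last by ring.
  by rewrite ecut2 divff ?mulr1 ?w0.
- exists t0 => // t tt; have pos : 0 < Rez (ecut * (w - c t)) by have := H t tt; lra.
  split=> //; have t_0 := le_trans t00 tt.
  have := @slit_turn_rot R ecut t0 t l tt (pcont_sub t00 (lexx t) (lc t)) ecut_neq0.
  have h : forall t1, t0 <= t1 <= t -> slit (ecut * cexp (l t1)).
    move=> t1 /andP[h1 h2]; rewrite lE; last exact: le_trans h1.
    by left; have := H t1 h1; lra.
  move=> /(_ h); rewrite !lE// => E.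
  rewrite (_ : l t + _ = (l t - l t0) + plog (ecut * (w - c t0)) + endlog); last by ring.
  by rewrite E; ring.
Qed.

Lemma lift_uniq w l l' : lifted w l -> lifted w l' -> l 0 = l' 0.
Proof.
move=> [c1 e1 [t1 t10 h1]] [c2 e2 [t2 t20 h2]].
apply: (@log_unique_rev R 0 (Num.max t1 t2)); rewrite ?le_max ?t10//.
- by move=> t /andP[t0 _]; rewrite e1// e2.
- by rewrite (h1 _ _).2 ?le_max ?lexx// (h2 _ _).2// le_max lexx orbT.
Qed.

(** log (w - a) continued along the cut from its far end back to a. Since the continuation is in t
    and not in w, this works for a path that meets itself. *)
Definition cutlog w : R[i] := get [set x | exists2 l, lifted w l & x = l 0].

Lemma cutlogE w l : lifted w l -> cutlog w = l 0.
Proof.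
move=> hl; have : exists x, [set x | exists2 l, lifted w l & x = l 0] x by exists (l 0); exists l.
by move=> /getPex [l' hl' e]; rewrite /cutlog e; exact: lift_uniq hl' hl.
Qed.

Lemma cexp_cutlog w : ~ oncut w -> cexp (cutlog w) = w - a.
Proof. by move=> /lift_ex[l hl]; rewrite (cutlogE hl); have [_ -> //] := hl; rewrite ca. Qed.

Lemma cut_gap w : ~ oncut w -> exists2 m : R, 0 < m & forall t, 0 <= t -> m <= nm (w - c t).
Proof.
move=> wC; have w0 := off_cut wC; have [t0 t00 H] := cut_side w.
have [|m m0 Hm] := pcont_gap t00 (cc (v := t0)) (w := w).
  by move=> t /andP[tt _]; rewrite -subr_eq0 -oppr_eq0 opprB w0.
exists (Num.min m 1); first by rewrite lt_min m0 ltr01.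
move=> t tt; rewrite ge_min; have [h|h] := leP t t0; first by rewrite nmB Hm// tt.
apply/orP; right; apply: le_trans (H t (ltW h)) _; apply: le_trans (Re_le _) _.
by rewrite nmM -ecut_endlog nm_cexp /= expR0 mul1r.
Qed.

Lemma plog_half (r : R[i]) : nm (r - 1) <= 1 / 2 -> nm (plog r) <= 8 * nm (r - 1).
Proof. by move=> h; have := plog_lip h (w := 1); rewrite subrr nm0 plog1 subr0; apply; lra. Qed.

Lemma norm3_lt_2pi (y1 y2 y3 : R) : `|y1| < pi / 2 -> `|y2| < pi / 2 -> `|y3| < pi / 2 ->
  `|y2 + y3 - y1| < pi *+ 2.
Proof.
have := pi_gt0 R; have := ler_normB (y2 + y3) y1; have := ler_normD y2 y3; rewrite [pi *+ 2]mulr2n.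
by move: (pi : R) => p; lra.
Qed.

(** A lift for w gives one for w' by adding [plog] of the quotient (w' - c t) / (w - c t), which is
    uniformly near 1. *)
Lemma cutlog_cts w : ~ oncut w -> forall e : R, 0 < e -> exists2 d : R, 0 < d &
  forall w', nm (w' - w) < d -> ~ oncut w' /\ nm (cutlog w' - cutlog w) < e.
Proof.
move=> wC e e0; have w0 := off_cut wC; have [m m0 Hm] := cut_gap wC.
exists (Num.min (m / 2) (e * m / 8)); first by rewrite lt_min !divr_gt0 ?mulr_gt0.
move=> w'; rewrite lt_min => /andP[d1 d2].
have wC' : ~ oncut w'.
  by move=> [t t0 e']; have := Hm t t0; rewrite -e' nmB; lra.
split=> //; have [l hl] := lift_ex wC; have [lc lE [t1 t10 h1]] := hl.
pose r t := (w' - c t) / (w - c t).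
have rE t : 0 <= t -> r t - 1 = (w' - w) / (w - c t).
  by move=> t0; rewrite /r; field; rewrite w0.
have rb t : 0 <= t -> nm (r t - 1) <= nm (w' - w) / m.
  move=> t0; rewrite rE// nmM nmV ler_wpM2l ?nm_ge0// lef_pV2 ?posrE ?Hm//.
  exact: lt_le_trans m0 (Hm t t0).
have wm : nm (w' - w) / m <= 1 / 2 by rewrite ler_pdivrMr//; lra.
have rh t : 0 <= t -> nm (r t - 1) <= 1 / 2 by move=> t0; exact: le_trans (rb t t0) wm.
have r0 t : 0 <= t -> r t != 0.
  by move=> t0; rewrite mulf_neq0 ?invr_eq0 ?w0//; exact: off_cut.
have hl' : lifted w' (fun t => l t + plog (r t)).
  split.
  - move=> v; apply: pcont_add => // t it d d0.
    have [t0 _] := andP it.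
    have [d' d'0 H] := cc it (mulr_gt0 d0 (divr_gt0 m0 (ltr0n R 8))).
    exists d' => // t' it' tt; have [t'0 _] := andP it'.
    apply: le_lt_trans (plog_lip (rh _ t'0) (rh _ t0)) _.
    have -> : r t' - r t = (w' - w) / (w - c t') * ((c t' - c t) / (w - c t)).
      rewrite -(subrKA 1) -[1 - r t]opprB rE// rE//.
      by field; rewrite !w0.
    rewrite nmM -rE//; have := rh _ t'0; have := nm_ge0 (r t' - 1).
    rewrite nmM nmV; have : nm (c t' - c t) / nm (w - c t) < d / 8.
      rewrite ltr_pdivrMr; last exact: lt_le_trans m0 (Hm t t0).
      apply: lt_le_trans (H t' it' tt) _.
      by rewrite (_ : d * (m / 8) = d / 8 * m); [rewrite ler_pM2l ?divr_gt0// Hm|ring].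
    have := divr_ge0 (nm_ge0 (c t' - c t)) (nm_ge0 (w - c t)).
    move: (nm (r t' - 1)) (_ / nm _) => p q q0; rewrite ltr_pdivlMr// => q1 p0 p1.
    by apply: le_lt_trans q1; have := ler_wpM2r q0 p1; lra.
  - move=> t t0; rewrite cexpD lE// plogK ?r0// /r.
    by rewrite mulrCA divff ?mulr1 ?w0.
  - have [t2 t20 h2] := cut_side w'.
    exists (Num.max t1 t2); first by rewrite le_max t10.
    move=> t; rewrite ge_max => /andP[tt1 /h2 p2].
    have [p1 e1] := h1 t tt1; have t0 := le_trans t10 tt1.
    have p2' : 0 < Rez (ecut * (w' - c t)) by lra.
    split=> //; rewrite e1 addrAC; congr (_ + _).
    have pr : 0 < Rez (r t) by have := Re_near (rh t t0); rewrite /=; lra.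
    apply: cexp_inj; last first.
      rewrite cexpD !plogK ?r0 ?mulf_neq0 ?ecut_neq0 ?w0 ?off_cut//.
      by rewrite /r mulrA [_ * (w' - _)]mulrC -!mulrA [ecut * _]mulrC; field; rewrite w0.
    rewrite ImD; have := parg_lt pr; have := parg_lt p1; have := parg_lt p2'.
    by move=> y1 y2 y3; exact: norm3_lt_2pi.
rewrite (cutlogE hl) (cutlogE hl') addrC addKr.
apply: le_lt_trans (plog_half (rh 0 (lexx 0))) _.
apply: le_lt_trans (ler_wpM2l _ (rb 0 (lexx 0))) _ => //.
by rewrite mulrA ltr_pdivrMr//; lra.
Qed.

Lemma lifted_from w l t0 : lifted w l -> 0 <= t0 -> (forall t, t0 <= t -> 0 < Rez (ecut * (w - c t))) ->
  l t0 = plog (ecut * (w - c t0)) + endlog.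
Proof.
move=> [lc lE [t1 t10 h1]] t00 H.
pose t2 := Num.max t0 t1; have t02 : t0 <= t2 by rewrite le_max lexx.
have [_ e2] : _ /\ l t2 = _ := h1 t2 (ltac:(by rewrite le_max lexx orbT)).
have h : forall t, t0 <= t <= t2 -> slit (ecut * cexp (l t)).
  by move=> t /andP[h _]; rewrite lE ?(le_trans t00)//; left; exact: H.
have := slit_turn_rot t02 (pcont_sub t00 (lexx t2) (lc t2)) ecut_neq0 h.
rewrite !lE ?(le_trans t00)// e2 => E.
have -> : l t0 = (plog (ecut * (w - c t2)) + endlog) - (plog (ecut * (w - c t2)) + endlog - l t0) by ring.
by rewrite E; ring.
Qed.

Variables (rho A0 : R).
Hypothesis A1 : 1 <= A0.
Hypothesis small : forall t, 0 <= t -> im_small rho A0 (c t).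
Hypothesis ce : forall t, 0 <= t -> escend a (c t) -> c t = a.

Lemma f_off_cut z : escend a z -> ~ oncut (f z).
Proof.
move=> ez [t t0 e]; have := expmap_neq a z; rewrite e => /eqP; apply; apply: ce => //.
by rewrite -e; apply/(escend_orb a 1).
Qed.

Lemma plog_opp_im (P : R[i]) : Rez P = 0 -> P != 0 ->
  plog P - plog (- P) = 0 +i* pi \/ plog P - plog (- P) = 0 +i* (- pi).
Proof.
move=> r0 P0; have PE : P = 0 +i* Imz P by apply: CP.
have PN : - P = 0 +i* (- Imz P) by apply: CP; rewrite ?ReN ?ImN// r0 oppr0.
have y0 : Imz P != 0 by apply: contra P0 => /eqP y0; rewrite PE y0.
have rr : Rez (plog P - plog (- P)) = 0 by rewrite ReB !Re_plog nmN subrr.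
have [y|y|y] := ltgtP (Imz P) 0; last by rewrite y eqxx in y0.
- right; apply: CP => //; rewrite ImB PN plog_pos_im; last by rewrite oppr_gt0.
  by rewrite PE plog_neg_im//=; field.
- left; apply: CP => //; rewrite ImB PN plog_neg_im; last by rewrite oppr_lt0.
  by rewrite PE plog_pos_im//=; field.
Qed.

(** All points of the hair of z have its addresses. One of them on the cut would make these small,
    against [escend_not_small]. *)
Lemma hair_off_cut z : escend a z -> inJ a (T + 10 + `|rho| + (2 * A0 + Cfast a + 1)) z ->
  forall h, 0 <= h -> ~ oncut (hair a z 0 h).
Proof.
move=> ez zJ h h0 [t t0 e]; have n0 := nm_ge0 a; have r0 := normr_ge0 rho.
have C0 : 0 <= Cfast a by rewrite /Cfast; have := hT; lra.
have J : inJ a T z by apply: inJ_le zJ; have := A1; lra.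
have v : valid a T z h by exact (valid_ge0 hT J h0).
have v0 : valid a T z 0 by exact (valid0 hT J).
suff : Rez z < 2 * A0 + Cfast a + 1 / 2.
  by have := zJ 0%N; rewrite orb0; have := hT; lra.
apply: (escend_not_small ez J A1) => i.
have Im1 := hair_Im hT i J v v0; rewrite (hair0 hT) // in Im1.
have := @small t t0 i; rewrite -e (hair_orb hT)// => S.
have {}S : `|Imz (hair a z i h)| <= itexp A0 i.
  apply: S => i' _; rewrite (hair_orb hT)//; have := Re_hair_gap hT i' J v0 h0; rewrite (hair0 hT)//.
  have := zJ i'; have := ler_norm rho; have := A1; have := hT.
  have p2 : 0 <= 2 ^+ i' * (h - 0) by rewrite subr0 mulr_ge0// exprn_ge0.
  by lra.
have := ler_normD (Imz (orb i z) - Imz (hair a z i h)) (Imz (hair a z i h)); rewrite subrK.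
by rewrite distrC in Im1; have := pi_le4 R; lra.
Qed.

(** For a cut going to the left, late points of the orbit lie to the right of the whole cut. For a
    cut going to the right, follow the hair of w and the cut up to a common abscissa X; the value is
    0 or 2 pi i according to which of the two is above there. *)
Lemma cutlog_plog z : escend a z -> exists N, forall n, (N <= n)%N ->
  cutlog (orb n z) - plog (orb n z - a) = 0 \/ cutlog (orb n z) - plog (orb n z - a) = tpi 1.
Proof.
move=> ez.
have nC n : (0 < n)%N -> ~ oncut (orb n z).
  by case: n => // n _; rewrite orbS; apply: f_off_cut; apply/escend_orb.
have s_cases := s1; case: s_cases => sE; last first.
  have [t0 t00 Ht] := ct 0; have [B HB] := pcont_bounded t00 (cc (v := t0)).
  have [N HN] := ez.1 (`|B| + 1); exists N.+1 => n Nn.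
  have [l hl] := lift_ex (nC n (leq_trans (ltn0Sn N) Nn)); left.
  rewrite (cutlogE hl) (lifted_from hl (lexx 0)) ?ca.
    have -> : ecut = 1 by rewrite /ecut sE opprK.
    have -> : endlog = 0 by rewrite /endlog sE subrr mulr0.
    by rewrite mul1r addr0 subrr.
  move=> t tt; rewrite Re_ecut sE opprK mul1r ReB; have := HN n (ltnW Nn).
  have [h|h] := leP t t0.
    have := HB t; rewrite tt h => /(_ isT); have := Re_le (c t); have := ler_norm B; lra.
  have := Ht t (ltW h); rewrite sE; have := normr_ge0 B; lra.
have [N HN] := esc_inJ (T + 10 + `|rho| + (2 * A0 + Cfast a + 1)) ez.1.
exists N.+1 => n Nn; have wC := nC n (leq_trans (ltn0Sn N) Nn).
have ew : escend a (orb n z) by apply/escend_orb.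
have wJ' := HN n (ltnW Nn); move: wC ew wJ'; set w := orb n z => wC ew wJ'.
have offH := hair_off_cut ew wJ'.
have C0 : 0 <= Cfast a by rewrite /Cfast; have := hT; have := nm_ge0 a; lra.
have J : inJ a T w by apply: inJ_le wJ'; have := A1; have := normr_ge0 rho; lra.
have v0 : valid a T w 0 by exact (valid0 hT J).
have vh h : 0 <= h -> valid a T w h by move=> h0; exact (valid_ge0 hT J h0).
have hw0 : hair a w 0 0 = w by rewrite (hair0 hT).
have w_T : T <= Rez w by have := J 0%N; rewrite orb0.
have [t0 t00 Ht] := cut_side w; have [B HB] := pcont_bounded t00 (cc (v := t0)).
(* X is beyond w, a and the cut up to t0, so that the cut first reaches X after t0, where the lift
   is given by [lifted_from]. *)
pose X := Num.max (Rez w) (Num.max (Rez a) B) + 1.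
have [Xw [Xa XB]] : Rez w < X /\ Rez a < X /\ B < X.
  have h1 : Rez w <= Num.max (Rez w) (Num.max (Rez a) B) by rewrite le_max lexx.
  have h2 : Rez a <= Num.max (Rez w) (Num.max (Rez a) B) by rewrite !le_max lexx orbT.
  have h3 : B <= Num.max (Rez w) (Num.max (Rez a) B) by rewrite !le_max lexx !orbT.
  by rewrite /X; split; [|split]; lra.
have [h1 [/andP[h10 _] Xh Hh]] : exists h, [/\ 0 <= h <= X - Rez w + 20, Rez (hair a w 0 h) = X &
    forall h', 0 <= h' -> h' < h -> Rez (hair a w 0 h') < X].
  apply: pcont_first_hit; [by lra|exact (hair_pcont0 hT J v0)|exact: Re_lip|by rewrite hw0|].
  have h0 : 0 <= X - Rez w + 20 by lra.
  by have := Re_hair_gap hT 0 J v0 h0; rewrite hw0 expr0; lra.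
have [t2 t20 Ht2] := ct X.
have [t1 [/andP[t10 _] Xt Htt]] : exists t, [/\ 0 <= t <= t2, Rez (c t) = X &
    forall t', 0 <= t' -> t' < t -> Rez (c t') < X].
  apply: pcont_first_hit; [by []|exact: cc|exact: Re_lip|by rewrite ca|].
  by have := Ht2 t2 (lexx _); rewrite sE mul1r.
have t01 : t0 <= t1.
  rewrite leNgt; apply/negP => lt; have := HB t1; rewrite t10 (ltW lt) => /(_ isT).
  by have := Re_le (c t1); rewrite Xt; lra.
have [l hl] := lift_ex wC; rewrite (cutlogE hl).
have lt1 := lifted_from hl t10 (fun t tt => lt_le_trans ltr01 (Ht t (le_trans t01 tt))).
have [lc lE _] := hl.
have sub (x : R) : 0 <= x -> forall r, 0 <= r <= 1 -> 0 <= x * r <= x.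
  by move=> x0 r /andP[r0 r1]; rewrite mulr_ge0//= ler_piMr.
have i0 : 0 <= (0 : R) <= 1 by rewrite lexx ler01.
have i1 : 0 <= (1 : R) <= 1 by rewrite lexx ler01.
have rep (g : R -> R[i]) (x : R) : 0 <= x -> pcont 0 x g -> pcont 0 1 (fun r => g (x * r)).
  move=> x0 gc; apply: pcont_eq (pcont_reparam x0 gc) => r _; by rewrite add0r subr0.
have := @turn_square R (fun r => hair a w 0 (h1 * r)) (fun r => c (t1 * r)) (fun r => l (t1 * r))
  (rep _ _ h10 (hair_pcont0 hT J v0)) (rep _ _ t10 (cc (v := t1))) (rep _ _ t10 (lc t1)).
rewrite !mulr0 !mulr1 hw0 ca; set P := hair a w 0 h1 - c t1 => turn.
have {turn} turn : l t1 - l 0 = plog P - plog (- P) + plog (- (w - c t1)) - plog (w - a).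
  apply: turn.
  - move=> r r' /(sub _ h10)/andP[k1 _] /(sub _ t10)/andP[k2 _] e; apply: (offH _ k1); by exists (t1 * r').
  - by move=> r /(sub _ t10)/andP[k _]; rewrite lE.
  - move=> r /(sub _ h10)/andP[k _]; rewrite ReB.
    have k' := vh _ k; have := Re_hair_ge hT 0 J k'; have := Re_le a; have := hT; lra.
  - move=> r /(sub _ t10)/andP[k1 k2]; rewrite ReB Xh subr_ge0.
    by move: k2; rewrite le_eqVlt => /orP[/eqP ->|k2]; [rewrite Xt|exact/ltW/Htt].
  - move=> r /(sub _ h10)/andP[k1 k2]; rewrite ReB Xt subr_le0.
    by move: k2; rewrite le_eqVlt => /orP[/eqP ->|k2]; [rewrite Xh|exact/ltW/Hh].
have P0 : P != 0 by rewrite subr_eq0; apply/eqP => e; apply: (offH _ h10); exists t1.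
have PR : Rez P = 0 by rewrite /P ReB Xh Xt subrr.
have eN : ecut = -1 by rewrite /ecut sE rmorphN rmorph1.
have endE : endlog = 0 +i* pi by rewrite /endlog sE; congr (_ +i* _); field.
have -> : l 0 - plog (w - a) = endlog - (plog P - plog (- P)).
  have -> : l 0 = l t1 - (l t1 - l 0) by ring.
  by rewrite turn lt1 eN mulN1r; ring.
rewrite endE; have [->|->] := plog_opp_im PR P0; [left|right].
  by rewrite subrr.
by rewrite /tpi; apply: CP; rewrite !Cri /= ?subrr// mulr1 mulr2n opprK.
Qed.

Theorem cut_separates z w : escend a z -> escend a w -> z <> w ->
  exists U : R[i] -> Prop, [/\ U z, ~ U w & forall x, escend a x -> exists2 d : R, 0 < d &
    forall y, escend a y -> nm (y - x) < d -> (U y <-> U x)].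
Proof.
apply: (@escend_separated R a oncut cutlog rho A0) => //.
- exact: cexp_cutlog.
- exact: cutlog_cts.
- exact: f_off_cut.
- exact: cutlog_plog.
- by move=> u i [t t0 ->] H; exact: small.
Qed.

End Cut.

(** * Cuts made of hairs *)

Section TailPaths.
Variables (R : realType) (a : R[i]).
Implicit Types (z w x y : R[i]) (h t u v s : R) (q c : R -> R[i]).
Notation f := (expmap a).
Notation orb := (orb a).
Notation T := (T0 a).
Let hT : 100 * 20 + nm a <= T. Proof. exact: T0_ge. Qed.

Definition tail_path s q (rho A0 : R) := [/\ s = 1 \/ s = -1, forall v, pcont 0 v q, tail_to s q, 1 <= A0 &
  forall t, 0 <= t -> im_small a rho A0 (q t)].

Lemma itexp_mono (A B : R) n : A <= B -> itexp A n <= itexp B n.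
Proof. by move=> AB; elim: n => //= n IH; rewrite /itexp /= ler_expR. Qed.

Lemma half_turn_bound z w : 0 < Rez z -> 0 < Rez w -> `|Imz (plog z - plog w)| <= 4.
Proof.
move=> /parg_lt h1 /parg_lt h2; rewrite ImB; have := ler_normB (Imz (plog z)) (Imz (plog w)).
by have := pi_le4 R; lra.
Qed.

(** Far out, q stays in a half-plane, so its logarithm has bounded imaginary part and real part
    tending to +oo. The bound enters the new A0' to cover time 0; later times are those of q, one
    exponential earlier. *)
Lemma tail_lift s q (rho A0 : R) w : tail_path s q rho A0 -> q 0 = f w -> (forall t, 0 <= t -> q t <> a) ->
  exists q' A0', [/\ tail_path 1 q' rho A0', q' 0 = w & forall t, 0 <= t -> f (q' t) = q t].
Proof.
move=> [s1 qc qt A1 sm] q0 qa; have n0 := nm_ge0 a.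
have g0 t : 0 <= t -> q t - a != 0 by move=> /qa h; rewrite subr_eq0; apply/eqP.
have gc v : pcont 0 v (fun t => q t - a) by apply: pcont_addc.
have [|L [Lc LE L0]] := half_line_log gc g0 (l := w); first by rewrite q0 expmapB.
have fL t : 0 <= t -> f (L t) = q t by move=> t0; rewrite expmapE LE// subrK.
have sR z : Rez (s%:C * z) = s * Rez z by rewrite ReM /=; ring.
have sn : s%:C != 0 :> R[i].
  by case: s1 => ->; rewrite ?rmorphN rmorph1 ?oppr_eq0 oner_eq0.
have [B HB] : exists B, forall t, 0 <= t -> `|Imz (L t)| <= B.
  have [t0 t00 Ht] := qt (nm a + 1); have [B HB] := pcont_bounded t00 (Lc t0).
  have sl t : t0 <= t -> 0 < Rez (s%:C * (q t - a)).
    move=> /Ht; rewrite sR ReB mulrBr; have := Re_ge a; have := Re_le a.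
    by case: s1 => ->; lra.
  exists (B + 4) => t tt; have [h|h] := leP t t0.
    by apply: le_trans (Im_nm _) _; have := HB t; rewrite tt h => /(_ isT); lra.
  have hs : forall t1, t0 <= t1 <= t -> slit (s%:C * cexp (L t1)).
    by move=> t1 /andP[h1 _]; rewrite LE ?(le_trans t00)//; left; exact: sl.
  have E := slit_turn_rot (ltW h) (pcont_sub t00 (lexx t) (Lc t)) sn hs.
  have b1 : `|Imz (L t - L t0)| <= 4.
    by rewrite E !LE//; apply: half_turn_bound; apply: sl => //; exact: ltW.
  have b2 : `|Imz (L t0)| <= B by apply: le_trans (Im_nm _) (HB t0 _); rewrite t00 lexx.
  by have := ler_normD (Imz (L t - L t0)) (Imz (L t0)); rewrite -ImD subrK; lra.
exists L, (Num.max A0 B); split=> //; split.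
- by left.
- exact: Lc.
- move=> X; have [t0 t00 Ht] := qt (expR X + nm a); exists t0 => // t tt.
  rewrite mul1r -ler_expR -nm_cexp LE; last exact: le_trans tt.
  apply: le_trans (nm_subl _ _); have := Ht t tt; have := Re_le (q t); have := Re_ge (q t).
  by case: s1 => ->; lra.
- by rewrite le_max A1.
- move=> t t0 [|i] hi.
    by rewrite orb0; apply: le_trans (HB t t0) _; rewrite /itexp /= le_max lexx orbT.
  rewrite orbSr fL//; have S : `|Imz (orb i (q t))| <= itexp A0 i.
    by apply: sm => // i' ii; have := hi i'.+1 ii; rewrite orbSr fL.
  apply: le_trans S _; apply: le_trans (itexp_mono i _) (itexp_le _ (leqnSn i)).
  by rewrite le_max lexx.
Qed.

Lemma tail_shift s q (rho A0 t1 : R) : 0 <= t1 -> tail_path s q rho A0 -> tail_path s (fun t => q (t1 + t)) rho A0.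
Proof.
move=> t10 [s1 qc qt A1 sm]; split=> //.
- move=> v; have := pcont_shift (c := - t1) (pcont_sub t10 (lexx (t1 + v)) (qc _)).
  by rewrite subrr addrC addKr; apply: pcont_eq => t _; rewrite opprK addrC.
- by move=> X; have [t0 t00 Ht] := qt X; exists t0 => // t tt; apply: Ht; lra.
- by move=> t tt; apply: sm; lra.
Qed.

(** A path through a cannot be lifted, but its part after the passage through a already is a tail
    starting at a. *)
Lemma tail_pull (G : R[i] -> Prop) n s q (rho A0 : R) x : (forall w, G (f w) -> G w) ->
  tail_path s q rho A0 -> q 0 = orb n x -> (forall t, 0 <= t -> G (q t)) ->
  exists s' c A0', [/\ tail_path s' c rho A0', c 0 = a \/ c 0 = x & forall t, 0 <= t -> G (c t)].
Proof.
move=> fG; elim: n s q A0 => [|n IH] s q A0 tq q0 qG.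
  by exists s, q, A0; split=> //; right; rewrite q0 orb0.
have [[t1 t10 e]|no] := pselect (exists2 t1, 0 <= t1 & q t1 = a).
  exists s, (fun t => q (t1 + t)), A0; split; first exact: tail_shift.
    by left; rewrite addr0.
  by move=> t t0; apply: qG; rewrite addr_ge0.
have qa t : 0 <= t -> q t <> a by move=> t0 e; apply: no; exists t.
have [|q' [A0' [tq' q'0 fq']]] := tail_lift (w := orb n x) tq _ qa.
  by rewrite q0 orbS.
by apply: IH tq' q'0 _ => t t0; apply: fG; rewrite fq'//; exact: qG.
Qed.

Definition separated := forall z w, escend a z -> escend a w -> z <> w ->
  exists U : R[i] -> Prop, [/\ U z, ~ U w & forall x, escend a x -> exists2 d : R, 0 < d &
    forall y, escend a y -> nm (y - x) < d -> (U y <-> U x)].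

Lemma tail_separates s c (rho A0 : R) : tail_path s c rho A0 -> c 0 = a ->
  (forall t, 0 <= t -> escend a (c t) -> c t = a) -> separated.
Proof.
by move=> [s1 cc ct A1 sm] ca ce z w; exact: (cut_separates s1 cc ca ct A1 sm ce).
Qed.

(** Raising rho beyond the real parts of the compact piece makes its smallness condition vacuous. *)
Lemma tail_cat s q (rho A0 : R) (g : R -> R[i]) (v : R) : 0 <= v -> pcont 0 v g -> q 0 = g v ->
  tail_path s q rho A0 ->
  exists rho', tail_path s (fun t => if t <= v then g t else q (t - v)) rho' A0.
Proof.
move=> v0 gc e [s1 qc qt A1 sm]; have [B HB] := pcont_bounded v0 gc.
pose c t := if t <= v then g t else q (t - v); change (exists rho', tail_path s c rho' A0).
have cg t : t <= v -> c t = g t by rewrite /c => ->.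
have cq t : v <= t -> c t = q (t - v).
  by rewrite le_eqVlt => /orP[/eqP <-|lt]; rewrite /c ?lexx ?subrr ?e// leNgt lt.
have n0 := normr_ge0 rho; have := ler_norm rho; have := ler_norm B; have := normr_ge0 B => B0 BB rr.
exists (`|rho| + `|B| + 1); split=> //.
- move=> u; have [uv|uv] := leP u v.
    apply: (pcont_eq (g := g)); last exact: pcont_sub (lexx 0) uv gc.
    by move=> t /andP[_ tu]; rewrite cg// (le_trans tu).
  apply: (pcont_cat (m := v)).
    by apply: (pcont_eq (g := g)) => // t /andP[_ tv]; rewrite cg.
  apply: (pcont_eq (g := fun t => q (t - v))); first by move=> t /andP[tv _]; rewrite cq.
  by have := pcont_shift (c := v) (qc (u - v)); rewrite add0r subrK.
- move=> X; have [t0 t00 Ht] := qt X; exists (v + t0); first lra.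
  by move=> t tt; rewrite cq; [apply: Ht|]; lra.
- move=> t t0 i; have [tv|tv] := leP t v.
    move=> /(_ 0%N isT); rewrite orb0 cg// => h; exfalso.
    by have := HB t; rewrite t0 tv => /(_ isT); have := Re_le (g t); lra.
  rewrite (cq _ (ltW tv)) => h; apply: sm; first by lra.
  by move=> i' /h; lra.
Qed.

Lemma orb_Im_itexp x i : `|Imz (orb i x)| + (nm a + 5) <= itexp (nm x + nm a + 5) i.
Proof.
have n0 := nm_ge0 a.
suff : nm (orb i x) + nm a + 5 <= itexp (nm x + nm a + 5) i by have := Im_nm (orb i x); lra.
elim: i => [|i IH]; first by rewrite orb0.
rewrite orbS /itexp /= -/(itexp _ i); apply: le_trans (_ : expR (nm (orb i x) + (nm a + 5)) <= _).
  have e1 : nm (f (orb i x)) <= expR (nm (orb i x)) + nm a.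
    by rewrite expmapE; apply: le_trans (nmD _ _) _; rewrite nm_cexp lerD2r ler_expR Re_le.
  have := nm_ge0 (orb i x); rewrite -(ler_expR 0) expR0 expRD => e2.
  have e3 : nm a + nm a + 6 <= expR (nm a + 5).
    rewrite (_ : nm a + 5 = (nm a + 5) / 2 + (nm a + 5) / 2); last by field.
    by rewrite expRD; have := expR_ge1Dx ((nm a + 5) / 2); move: (expR _) => p hp; nra.
  by move: (expR (nm a + 5)) e3 (expR _) e1 e2 => p e3 q e1 e2; nra.
by rewrite ler_expR; lra.
Qed.

(** Along the hair the imaginary parts stay within pi of those of x, which [orb_Im_itexp] bounds; as
    t < 0 even the starting point x is on a hair. *)
Lemma hair_tail x t : inJ a T x -> valid a T x t -> t < 0 ->
  exists q A0, [/\ tail_path 1 q 0 A0, q 0 = x & forall h, 0 <= h -> on_hair a (q h)].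
Proof.
move=> xJ v t0; have v0 : valid a T x 0 by exact (valid0 hT xJ).
have vh h : 0 <= h -> valid a T x h by move=> h0; exact (valid_ge0 hT xJ h0).
exists (hair a x 0), (nm x + nm a + 5); split.
- split.
  + by left.
  + by move=> r; exact (hair_pcont0 hT xJ v0).
  + move=> X; exists (`|X - Rez x| + 20); first by have := normr_ge0 (X - Rez x); lra.
    move=> h hh; have h0 : 0 <= h by have := normr_ge0 (X - Rez x); lra.
    have := Re_hair_gap hT 0 xJ v0 h0; rewrite (hair0 hT)// orb0 expr0 mul1r.
    by have := ler_norm (X - Rez x); lra.
  + by have := nm_ge0 x; have := nm_ge0 a; lra.
  + move=> h h0 i _; have vh0 := vh h h0; rewrite (hair_orb hT)//.
    have := hair_Im hT i xJ vh0 v0; rewrite (hair0 hT)//.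
    have := orb_Im_itexp x i; have := nm_ge0 a; have := pi_le4 R.
    by have := ler_normD (Imz (hair a x i h) - Imz (orb i x)) (Imz (orb i x)); rewrite subrK; lra.
- by rewrite (hair0 hT).
- by move=> h h0; apply: hair_on_hair xJ v _; lra.
Qed.

(** The hair of an iterate of g v is a tail. Pulled back, it starts either at a or at g v, and in
    the second case g joins a to it. All points of this cut but a are on hairs, hence not
    endpoints. *)
Lemma hair_path_separates (g : R -> R[i]) (v : R) : 0 < v -> pcont 0 v g -> g 0 = a ->
  (forall t, 0 < t <= v -> on_hair a (g t)) -> separated.
Proof.
move=> v0 gc g0 gh.
have xh : on_hair a (g v) by apply: gh; rewrite v0 lexx.
have [N HN] := on_hair_fast xh; have [xJ xv] := HN N (leqnn N).
have t0 : - 1 / 2 < 0 :> R by lra.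
have [q [A0 [tq q0 qh]]] := hair_tail xJ xv t0.
have [s [c [A0' [tc c0 ch]]]] := tail_pull (@on_hair_pull R a) tq q0 qh.
case: c0 => c0; first by apply: tail_separates tc c0 _ => t t0' [_ /(_ (ch t t0'))].
have [rho' tc'] := tail_cat (ltW v0) gc c0 tc.
apply: tail_separates tc' _ _; first by rewrite (ltW v0) g0.
move=> t; rewrite le_eqVlt => /orP[/eqP <-|t0']; first by rewrite (ltW v0) g0.
case: leP => [tv|tv] [_ no]; exfalso; apply: no; first by apply: gh; rewrite t0' tv.
by apply: ch; lra.
Qed.

Lemma inner_on_hair (g : R -> R[i]) t d : 0 < d -> pcont (t - d) (t + d) g ->
  (forall r r', t - d <= r <= t + d -> t - d <= r' <= t + d -> g r = g r' -> r = r') ->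
  (forall r, t - d <= r <= t + d -> esc a (g r)) -> on_hair a (g t).
Proof.
move=> d0 gc gi ge; apply/on_hairE; exists (fun r => g (t + d * r)).
have sub r : - 1 <= r <= 1 -> t - d <= t + d * r <= t + d by move=> /andP[? ?]; apply/andP; split; nra.
split.
- have P : pcont (- d) d (fun r => g (t + r)).
    have := pcont_shift (c := - t) gc; have -> : t - d - t = - d by ring.
    have -> : t + d - t = d by ring.
    by apply: pcont_eq => r _; rewrite opprK addrC.
  by apply: (pcont_scale d0 _ P) => r /andP[? ?]; apply/andP; split; nra.
- move=> r r' /sub ir /sub ir' /(gi _ _ ir ir') /addrI; exact: (mulfI (lt0r_neq0 d0)).
- by move=> r /sub; exact: ge.
- by rewrite mulr0 addr0.
Qed.

Lemma on_hair_separates : on_hair a a -> separated.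
Proof.
move=> /on_hairE[g [gc gi ge g0]].
apply: (@hair_path_separates g (1 / 2)) => //; first by apply: pcont_sub gc; lra.
move=> t /andP[t0 t1]; have d0 : 0 < 1 / 2 :> R by lra.
have sub r : t - 1 / 2 <= r <= t + 1 / 2 -> -1 <= r <= 1 by move=> /andP[? ?]; apply/andP; split; lra.
apply: (inner_on_hair d0).
- by apply: pcont_sub gc; lra.
- by move=> r r' /sub ir /sub ir'; exact: gi.
- by move=> r /sub; exact: ge.
Qed.

Lemma endpoint_separates : endpoints a a -> separated.
Proof.
move=> [_ [g [/arcP[gc gi] g0 ge]]].
have ge' t : 0 < t <= 1 -> esc a (g t) by move=> it; apply/escP; apply: ge; rewrite in_itv.
apply: (@hair_path_separates g (1 / 2)) => //; first by apply: pcont_sub gc; lra.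
move=> t /andP[t0 t1]; have d0 : 0 < t / 2 by rewrite divr_gt0.
have sub r : t - t / 2 <= r <= t + t / 2 -> 0 < r <= 1 by move=> /andP[? ?]; apply/andP; split; lra.
have sub' r : t - t / 2 <= r <= t + t / 2 -> 0 <= r <= 1 by move=> /sub/andP[/ltW -> ->].
apply: (inner_on_hair d0).
- by apply: pcont_sub gc; lra.
- by move=> r r' /sub' ir /sub' ir'; exact: gi.
- by move=> r /sub; exact: ge'.
Qed.

End TailPaths.

(** * The singular value in the Fatou set *)

Section Fatou.
Variables (R : realType) (a : R[i]).
Implicit Types (z w x y : R[i]) (h t u v s : R).
Notation f := (expmap a).
Notation orb := (orb a).
Notation T := (T0 a).
Let hT : 100 * 20 + nm a <= T. Proof. exact: T0_ge. Qed.

(** X <= asin X because sin y <= y, and the square root in the denominator is at most (1 + |z|)(1 +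
    |w|). *)
Lemma spherical_small z w e : spherical_dist z w < e ->
  nm (z - w) <= e / 2 * ((1 + nm z) * (1 + nm w)).
Proof.
rewrite /spherical_dist; set S := Num.sqrt _; set X := nm (z - w) / S => h.
have z0 := nm_ge0 z; have w0 := nm_ge0 w; have d0 := nm_ge0 (z - w).
have r0 : 0 < (1 + nm z ^+ 2) * (1 + nm w ^+ 2) by rewrite mulr_gt0// ltr_wpDr ?sqr_ge0.
have S0 : 0 < S by rewrite sqrtr_gt0.
have S2 : S ^+ 2 = (1 + nm z ^+ 2) * (1 + nm w ^+ 2) by rewrite sqr_sqrtr// ltW.
have X0 : 0 <= X by rewrite divr_ge0// ltW.
have dS : nm (z - w) <= S.
  rewrite -ler_sqr ?nnegrE ?(ltW S0)// S2; have t := nmBs z w.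
  apply: le_trans (_ : (nm z + nm w) ^+ 2 <= _); first by rewrite ler_sqr ?nnegrE ?addr_ge0.
  rewrite -subr_ge0 (_ : _ - _ = (1 - nm z * nm w) ^+ 2); [exact: sqr_ge0|ring].
have X1 : -1 <= X <= 1 by rewrite ler_pdivrMr// mul1r dS andbT; lra.
have sX : sin (asin X) = X by apply: asinK; rewrite in_itv.
have lo := asin_geNpi2 X1.
have Xe : X <= e / 2.
  have [y0|y0] := leP 0 (asin X); first by rewrite -sX; apply: le_trans (sin_le_id y0) _; lra.
  have : 0 <= sin (- asin X) by apply: sin_ge0_pi; have := pi_gt0 R; lra.
  rewrite sinN sX => X0'; have XE : X = 0 by apply/eqP; rewrite eq_le X0 andbT; lra.
  move: y0; rewrite XE; have := sX; rewrite XE => s0 y0.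
  have : 0 < sin (- asin (0 : R)) by apply: sin_gt0_pi; rewrite XE in lo; have := pi_gt0 R; lra.
  by rewrite sinN s0 oppr0 ltxx.
have SS : S <= (1 + nm z) * (1 + nm w).
  rewrite -ler_sqr ?nnegrE ?(ltW S0) ?mulr_ge0 ?addr_ge0// S2 exprMn.
  by apply: ler_pM; rewrite ?addr_ge0 ?sqr_ge0// !expr2; nra.
have e0 : 0 <= e / 2 by apply: le_trans Xe.
have -> : nm (z - w) = X * S by rewrite /X divfK ?gt_eqF.
by apply: ler_pM => //; exact: ltW.
Qed.

(** Any displacement b of orb k y is realised by moving y very little; it will be pi i, hence the
    bound 4. *)
Lemma pull_back_point k y (b : R[i]) : inJ a (T + 30) y -> nm b <= 4 ->
  exists2 w, nm (w - y) <= 4 / 2 ^+ k & orb k w = orb k y + b.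
Proof.
move=> yJ b4; elim: k y yJ => [|k IH] y yJ.
  by exists (y + b); [rewrite addrC addKr expr0 divr1|rewrite !orb0].
have fJ : inJ a (T + 30) (f y) by have := inJ_orb 1 yJ; rewrite orbS orb0.
have [w1 h1 e1] := IH (f y) fJ.
have w4 : nm (w1 - f y) <= 4.
  by apply: le_trans h1 _; rewrite ler_pdivrMr ?exprn_gt0// ler_peMr// exprn_ege1// ler1n.
have fy := fJ 0%N; rewrite orb0 in fy; have n0 := nm_ge0 a.
have w1R := Re_near w4.
exists (Lst a y w1); last by rewrite orbSr LstK ?e1 -?orbSr//; have := hT; lra.
have -> : Lst a y w1 - y = Lst a y w1 - Lst a y (f y) by rewrite Lst_id.
apply: le_trans (Lst_contract _ _ _) _; [have := hT; lra|have := hT; lra|].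
rewrite exprS invfM mulrCA; have := nm_ge0 (w1 - f y).
by move: (_ / _ ^+ k) h1 => q; lra.
Qed.

Lemma Re_reflect y : Rez (f (y + 0 +i* pi)) = 2 * Rez a - Rez (f y).
Proof.
rewrite !expmapE !ReD !Re_cexp /= ReD ImD /= addr0.
by rewrite cosDpi; ring.
Qed.

(** Near an escaping point there are points whose orbit is displaced by pi i at a late time. The
    next iterate has a very negative real part by [Re_reflect], and the one after is close to a, at
    a definite spherical distance from the orbit of z. *)
Lemma equicontinuous_not_esc (U : R[i] -> Prop) z : (exists2 d : R, 0 < d & forall w, nm (w - z) < d -> U w) ->
  spherically_equicontinuous_on U (fun n => iter n f) -> ~ esc a z.
Proof.
move=> [d d0 dU] eq ez; have n0 := nm_ge0 a.
have Uz : U z by apply: dU; rewrite subrr nm0.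
pose B := 1 + nm a; pose e := 1 / (2 * (1 + B)).
have B0 : 0 < 2 * (1 + B) by rewrite /B; lra.
have e0 : 0 < e by rewrite divr_gt0.
have /nbhs_nmP[d1 d10 H1] := eq z Uz e e0.
have [N HN] := esc_inJ (T + 30) ez; pose y := orb N z.
have yJ : inJ a (T + 30) y := HN N (leqnn N).
have md : 0 < Num.min d d1 by rewrite lt_min d0.
have [d2 d20 H2] := orb_open a N z md.
have [K hK] := half_pow_lt 4 d20.
have [N2 HN2] := ez (4 + 4 * B + nm a *+ 2); pose k := (K + N2)%N.
have b4 : nm (0 +i* pi : R[i]) <= 4.
  by apply: le_trans (nm_ReIm _) _; rewrite /= normr0 add0r ger0_norm ?pi_ge0// pi_le4.
have [w hw ow] := pull_back_point k yJ b4.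
have kd : 4 / 2 ^+ k < d2.
  apply: le_lt_trans hK; rewrite ler_pM2l// lef_pV2 ?posrE ?exprn_gt0//.
  by apply: ler_weXn2l; rewrite ?ler1n// leq_addr.
have [w' h' ow'] := H2 w (le_lt_trans hw kd).
move: h'; rewrite lt_min => /andP[wd wd1].
have S := H1 w' wd1 (dU _ wd) (k.+2 + N)%N; have {S} := spherical_small S.
rewrite -[iter _ _ z]/(orb (k.+2 + N) z) -[iter _ _ w']/(orb (k.+2 + N) w').
rewrite !orbD ow' -/y; set Z := orb k.+2 y; set W := orb k.+2 w => S.
have kN : (N2 <= k)%N by rewrite /k leq_addl.
have WB : nm W <= B.
  rewrite /W orbS expmapE; apply: le_trans (nmD _ _) _; rewrite nm_cexp lerD2r.
  rewrite -expR0 ler_expR orbS ow Re_reflect -orbS.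
  have := HN2 (k.+1 + N)%N (leq_trans kN (leq_trans (leqnSn k) (leq_addr N k.+1))); rewrite orbD -/y mulr2n.
  by have := Re_le a; have := ltW B0; lra.
have ZB : 4 + 4 * B <= nm Z.
  apply: le_trans (Re_le _); have := HN2 (k.+2 + N)%N (leq_trans kN (leq_trans (leqW (leqnSn k)) (leq_addr N k.+2))).
  by rewrite orbD -/y -/Z mulr2n; lra.
have := nm_subl Z W; have := nm_ge0 W.
have eB : e / 2 * ((1 + nm Z) * (1 + nm W)) <= (1 + nm Z) / 4.
  apply: le_trans (_ : e / 2 * ((1 + nm Z) * (1 + B)) <= _).
    have nZ := nm_ge0 Z; apply: ler_wpM2l; first by apply: divr_ge0 => //; exact: ltW.
    by apply: ler_wpM2l; [apply: addr_ge0|rewrite lerD2l].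
  by rewrite /e le_eqVlt; apply/orP; left; apply/eqP; field; rewrite gt_eqF//; lra.
by move: S eB WB ZB; lra.
Qed.

Lemma fatou_ball : fatou_set a a -> exists2 r : R, 0 < r & forall w, nm (w - a) < r -> ~ esc a w.
Proof.
move=> [U /nbhs_nmP[r r0 rU] eq]; exists r => // w wr; apply: equicontinuous_not_esc eq.
exists (r - nm (w - a)); first by rewrite subr_gt0.
move=> x hx; apply: rU; have := nm_triB x w a; lra.
Qed.

(** Run p backwards from orb n.+1 a until it is within r of a, and lift it by f from orb n a. The
    lift is continued to the left and pulled back n times; nothing on the resulting cut escapes. *)
Lemma good_separates (r : R) n (p : R -> R[i]) : 0 < r -> (forall w, nm (w - a) < r -> ~ esc a w) ->
  pcont 0 1 p -> p 0 = a -> p 1 = orb n.+1 a -> (forall t, 0 <= t <= 1 -> ~ esc a (p t)) -> separated a.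
Proof.
move=> r0 rD pc p0 p1 pe.
have an0 : f (orb n a) - a != 0 by rewrite subr_eq0 expmap_neq.
have [v [L [v0 Lc L0 Le Lv]]] : exists v L, [/\ 0 <= v, pcont 0 v L, L 0 = orb n a,
    forall t, 0 <= t <= v -> ~ esc a (f (L t)) & nm (f (L v) - a) < r].
  have [near|far] := ltP (nm (f (orb n a) - a)) r.
    exists 0, (fun=> orb n a); split=> //.
      by move=> t _ e e0; exists 1 => // t' _ _; rewrite subrr nm0.
    by move=> t _; rewrite -orbS -p1; apply: pe; rewrite ler01 lexx.
  pose g t := p (1 - t); have gc : pcont 0 1 g := pcont_rev pc.
  have [|||t1 [/andP[t10 t11] gt1 Ht1]] := pcont_first_hit ler01 gc (phi := fun z => - nm (z - a)) (c := - (r / 2)).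
  - move=> z w; rewrite opprK addrC; rewrite ler_norml; apply/andP; split.
      by have := nm_triB z w a; lra.
    by have := nm_triB w z a; rewrite (nmB w z); lra.
  - by rewrite /g subr0 p1 orbS; lra.
  - by rewrite /g subrr p0 subrr nm0; lra.
  have gca : pcont 0 t1 (fun t => g t - a) by apply: pcont_addc; apply: pcont_sub gc; lra.
  have ne t : 0 <= t <= t1 -> g t - a != 0.
    move=> /andP[h1]; rewrite -nm_gt0 le_eqVlt => /orP[/eqP ->|h2]; first by lra.
    by have := Ht1 t h1 h2; lra.
  have [|L [Lc LE L0]] := pcont_log_from (l := orb n a) t10 gca ne.
    by rewrite /g subr0 p1 orbS expmapB.
  exists t1, L; have fL t : 0 <= t <= t1 -> f (L t) = g t by move=> it; rewrite expmapE LE// subrK.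
  split=> //.
    move=> t it; rewrite fL//; apply: pe; move: it => /andP[? ?]; apply/andP; split; lra.
  by rewrite fL ?t10 ?lexx//; lra.
(* To the left of L v, f has values within r of a, so the whole ray consists of points that do not
   escape. *)
pose q t := L v - t%:C.
have tq : tail_path a (-1) q (Rez (L v) + 1) 1.
  split=> //.
  - by right.
  - move=> u; apply: pcont_csub => t _ e e0; exists e => // t' _ h.
    by rewrite -rmorphB nmR.
  - move=> X; exists (`|X + Rez (L v)|) => // t h; rewrite /q ReB mulN1r /= opprB.
    by have := ler_norm (X + Rez (L v)); lra.
  - by move=> t t0 i /(_ 0%N isT); rewrite orb0 /q ReB /=; lra.
have q0 : q 0 = L v by rewrite /q subr0.
have [rho tc] := tail_cat v0 Lc q0 tq; set c := fun t => _ in tc.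
have c0 : c 0 = orb n a by rewrite /c v0 L0.
have ce t : 0 <= t -> ~ esc a (c t).
  move=> t0; rewrite /c; case: leP => tv; first by move=> /(esc_orb a 1); rewrite orbS orb0; apply: Le; rewrite t0.
  move=> /(esc_orb a 1); rewrite orbS orb0; apply: rD; apply: le_lt_trans Lv.
  rewrite !expmapB !nm_cexp ler_expR /q ReB /=; lra.
have fG w : ~ esc a (f w) -> ~ esc a w by move=> no /(esc_orb a 1); rewrite orbS orb0.
have [s [c' [A0' [tc' c'0 ce']]]] := tail_pull fG tc c0 ce.
apply: tail_separates tc' _ _; first by case: c'0.
by move=> t t0 [/(ce' t t0)].
Qed.

End Fatou.

(** * A distortion theorem *)

Section Jets.
Variable R : realType.
Implicit Types (z w x p h v : R[i]) (F E : R[i] -> R[i]).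

Lemma sin_sub_id (y : R) : `|y| <= 1 / 2 -> `|sin y - y| <= y ^+ 2 / 4.
Proof.
have pos (x : R) : 0 <= x -> x <= 1 / 2 -> `|sin x - x| <= x ^+ 2 / 4.
  move=> x0 x1.
  have [|c] := @MVT_segment R (@sin R) (@cos R) 0 x x0 (fun y _ => is_derive_sin y).
    by apply: continuous_subspaceT; exact: continuous_sin.
  rewrite in_itv /= => /andP[c0 cx]; rewrite sin0 !subr0 => ->.
  have := cos_ge_quad c; have := cos_le1 c; move: (cos c) => k k1 k2.
  have h : 0 <= x - k * x <= x ^+ 2 / 4.
    apply/andP; split; first by nra.
    have : 1 - k <= x ^+ 2 / 2 by rewrite !expr2 in k2 *; nra.
    rewrite expr2 => k3; have : (1 - k) * x <= x * x / 2 * (1 / 2) by apply: ler_pM; lra.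
    lra.
  by rewrite distrC ger0_norm; move: h => /andP[].
move=> y1; have [y0|y0] := leP 0 y; first by apply: pos => //; rewrite ger0_norm in y1.
have := pos (- y); rewrite sinN sqrrN -opprB opprK normrN addrC => -> //.
- by rewrite oppr_ge0 ltW.
- by rewrite ltr0_norm in y1.
Qed.

Lemma expR_taylor1 (x : R) : `|x| <= 1 / 2 -> 0 <= expR x - 1 - x <= 2 * x ^+ 2 /\ expR x <= 2 /\ `|expR x - 1| <= 2 * `|x|.
Proof.
rewrite ler_norml => /andP[x1 x2]; have h1 := expR_ge1Dx x; have h2 := expR_ge1Dx (- x).
have h3 : expR x * (1 - x) <= 1.
  apply: le_trans (_ : expR x * expR (- x) <= _); last by rewrite expRxMexpNx_1.
  by apply: ler_wpM2l; first exact: expR_ge0.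
have h0 := expR_gt0 x; move: (expR x) h1 h3 h0 => E h1 h3 h0.
have h4 : E - 1 - x <= 2 * x ^+ 2 by rewrite expr2; nra.
split; first by apply/andP; split => //; lra.
split; first by nra.
have [x0|x0] := leP 0 x.
  by rewrite (ger0_norm x0) ger0_norm; nra.
by rewrite (ltr0_norm x0) ler_norml; apply/andP; split; nra.
Qed.

Lemma cexp_taylor1 w : nm w <= 1 / 2 -> nm (cexp w - 1 - w) <= 3 * nm w ^+ 2.
Proof.
move=> w1; have hx := le_trans (Re_nm w) w1; have hy := le_trans (Im_nm w) w1.
have [/andP[e0 e1] [e2 e3]] := expR_taylor1 hx; have s1 := sin_sub_id hy.
have s2 := sin_norm_le (Imz w); have c1 := cos_ge_quad (Imz w); have c2 := cos_le1 (Imz w).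
apply: le_trans (nm_ReIm _) _; rewrite !Cri Re_cexp Im_cexp /= nm2 subr0.
move: (Rez w) (Imz w) hx hy e0 e1 e2 e3 s1 s2 c1 c2 => x y hx hy e0 e1 e2 e3 s1 s2 c1 c2.
have E0 := expR_gt0 x.
have r1 : `|expR x * cos y - 1 - x| <= 2 * x ^+ 2 + y ^+ 2.
  have -> : expR x * cos y - 1 - x = (expR x - 1 - x) - expR x * (1 - cos y) by ring.
  have h : 0 <= expR x * (1 - cos y) <= y ^+ 2.
    apply/andP; split; first by rewrite mulr_ge0// ?ltW//; lra.
    apply: le_trans (_ : 2 * (y ^+ 2 / 2) <= _); last by lra.
    by apply: ler_pM; lra.
  by move: h => /andP[? ?]; rewrite ler_norml; apply/andP; split; have := sqr_ge0 x; lra.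
have r2 : `|expR x * sin y - y| <= x ^+ 2 + y ^+ 2 + y ^+ 2 / 4.
  have -> : expR x * sin y - y = (expR x - 1) * sin y + (sin y - y) by ring.
  apply: le_trans (ler_normD _ _) _; rewrite normrM lerD//.
  apply: le_trans (_ : (2 * `|x|) * `|y| <= _); first by apply: ler_pM.
  rewrite -(real_normK (num_real x)) -(real_normK (num_real y)).
  have := sqr_ge0 (`|x| - `|y|); rewrite !expr2; lra.
have := sqr_ge0 x; have := sqr_ge0 y; lra.
Qed.

Lemma nm_2 : nm (2%:R : R[i]) = 2.
Proof.
have -> : (2%:R : R[i]) = 2 +i* 0 by apply: CP; rewrite mulr2n ?ReD ?ImD /=; ring.
by rewrite nmR ger0_norm.
Qed.

Definition rem2 w := cexp w - 1 - w - w * w / 2%:R.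

(** Through exp v = (exp (v / 2))^2 the remainder at v is twice that at v / 2 plus a cubic error;
    each halving halves the quadratic excess of the crude bound. *)
Lemma cexp_taylor2 v : nm v <= 1 / 2 -> nm (rem2 v) <= 2 * nm v ^+ 3.
Proof.
move=> v1; suff S n : nm (rem2 v) <= 2 * nm v ^+ 3 + 4 * nm v ^+ 2 / 2 ^+ n.
  have : nm (rem2 v) - 2 * nm v ^+ 3 <= 0; last by lra.
  by apply: (@le0_half_pow _ (4 * nm v ^+ 2)) => n; have := S n; lra.
elim: n v v1 => [|n IH] v v1.
  have -> : rem2 v = (cexp v - 1 - v) - v * v / 2%:R by [].
  apply: le_trans (nmBs _ _) _; rewrite !nmM nmV.
  rewrite nm_2.
  have := cexp_taylor1 v1; have := nm_ge0 v; rewrite expr0 expr2 exprS expr2.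
  move: (nm v) => k k0; have k3 : 0 <= k * (k * k) by rewrite !mulr_ge0.
  by have := mulr_ge0 k0 k0; lra.
pose w := v / 2%:R.
have n2 := nm_2.
have nw : nm w = nm v / 2 by rewrite /w nmM nmV n2.
have vw : v = w + w by rewrite /w; field.
have E : rem2 v = 2%:R * rem2 w + (cexp w - 1 - w) * ((cexp w - 1 - w) + 2%:R * w).
  by rewrite /rem2 vw cexpD; field.
have w1 : nm w <= 1 / 2 by rewrite nw; have := nm_ge0 v; lra.
have t1 := cexp_taylor1 w1; have t2 := IH w w1.
rewrite E; apply: le_trans (nmD _ _) _; rewrite !nmM n2.
have t3 : nm (cexp w - 1 - w + 2%:R * w) <= 4 * nm w.
  apply: le_trans (nmD _ _) _; rewrite nmM n2; move: t1; rewrite expr2; have := nm_ge0 w; nra.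
have t4 : nm (cexp w - 1 - w) * nm (cexp w - 1 - w + 2%:R * w) <= (3 * nm w ^+ 2) * (4 * nm w).
  by apply: ler_pM; rewrite ?nm_ge0.
apply: le_trans (_ : 2 * (2 * nm w ^+ 3 + 4 * nm w ^+ 2 / 2 ^+ n) + 3 * nm w ^+ 2 * (4 * nm w) <= _); first by lra.
rewrite le_eqVlt; apply/orP; left; apply/eqP; rewrite nw [2 ^+ n.+1]exprS; field.
by rewrite expf_neq0.
Qed.

Lemma plog_taylor2 : exists2 K : R, 0 < K & forall w, nm w <= 1 / 32 ->
  nm (plog (1 + w) - (w - w * w / 2%:R)) <= K * nm w ^+ 3.
Proof.
exists (2 * 512 + 600); first by lra.
move=> u u1; set v := plog (1 + u).
have n2 := nm_2.
have u2 : nm (1 + u - 1) = nm u by rewrite addrC addKr.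
have v8 : nm v <= 8 * nm u.
  have := @plog_lip R (1 + u) 1; rewrite subrr nm0 plog1 subr0 u2; apply; lra.
have u0 : 1 + u != 0.
  rewrite -nm_gt0; have := nm_subl 1 (- u); rewrite opprK nm1 nmN; lra.
have uE : u = v + v * v / 2%:R + rem2 v by rewrite /rem2 /v plogK//; ring.
have v1 : nm v <= 1 / 2 by lra.
have r := cexp_taylor2 v1; have v0 := nm_ge0 v; have un := nm_ge0 u.
have r' : nm (rem2 v) <= nm v ^+ 2.
  by apply: le_trans r _; rewrite exprS mulrA ler_piMl ?sqr_ge0//; lra.
have d1 : nm (u - v) <= 2 * nm v ^+ 2.
  rewrite {1}uE (_ : _ - v = v * v / 2%:R + rem2 v); last by ring.
  apply: le_trans (nmD _ _) _; rewrite !nmM nmV n2; rewrite expr2 in r' *; have : 0 <= nm v * nm v by rewrite mulr_ge0.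
  lra.
have d2 : nm (u + v) <= 9 * nm u by apply: le_trans (nmD _ _) _; lra.
have -> : v - (u - u * u / 2%:R) = (u - v) * (u + v) / 2%:R - rem2 v by rewrite {1}uE; field.
apply: le_trans (nmBs _ _) _; rewrite !nmM nmV n2.
have p1 : nm (u - v) * nm (u + v) <= (2 * nm v ^+ 2) * (9 * nm u) by apply: ler_pM; rewrite ?nm_ge0.
have p2 : nm v ^+ 2 <= 64 * nm u ^+ 2.
  by rewrite (_ : 64 * _ = (8 * nm u) ^+ 2); [rewrite ler_sqr ?nnegrE//; lra|ring].
have p3 : nm v ^+ 3 <= 512 * nm u ^+ 3.
  by rewrite (_ : 512 * _ = (8 * nm u) ^+ 3); [apply: lerXn2r; rewrite ?nnegrE//; lra|ring].
have p4 : (2 * nm v ^+ 2) * (9 * nm u) <= 2 * (64 * nm u ^+ 2) * (9 * nm u).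
  by apply: ler_wpM2r; lra.
have -> : (2 * 512 + 600) * nm u ^+ 3 = 2 * 512 * nm u ^+ 3 + 600 * (nm u * nm u ^+ 2) by rewrite exprS; ring.
have p5 : 0 <= nm u * nm u ^+ 2 by rewrite mulr_ge0// sqr_ge0.
lra.
Qed.

(* Second order expansions at each point are all that the maximum principle for
   ln |F| requires of a holomorphic F. *)
Definition cjet F p := exists A B : R[i], forall e : R, 0 < e -> exists2 d : R, 0 < d &
  forall h, nm h < d -> nm (F (p + h) - F p - (A * h + B * (h * h))) <= e * nm h ^+ 2.

Definition cts_at F p := forall e : R, 0 < e -> exists2 d : R, 0 < d &
  forall x, nm (x - p) < d -> nm (F x - F p) < e.

Lemma cjet_lip F p : cjet F p -> exists C, exists2 d : R, 0 < d & 0 < C /\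
  forall h, nm h < d -> nm (F (p + h) - F p) <= C * nm h.
Proof.
move=> [A [B H]]; have [d d0 Hd] := H 1 ltr01.
exists (nm A + nm B + 1), (Num.min d 1); first by rewrite lt_min d0 ltr01.
split; first by have := nm_ge0 A; have := nm_ge0 B; lra.
move=> h; rewrite lt_min => /andP[hd h1].
have -> : F (p + h) - F p = (F (p + h) - F p - (A * h + B * (h * h))) + (A * h + B * (h * h)) by ring.
apply: le_trans (nmD _ _) _; apply: le_trans (lerD (Hd h hd) (nmD _ _)) _; rewrite !nmM mul1r expr2.
have := nm_ge0 A; have := nm_ge0 B; have := nm_ge0 h; move: (nm h) h1 (nm A) (nm B) => k k1 p1 p2 k0 p20 p10.
have q1 : k * k <= k by rewrite ler_piMl// ltW.
by have := ler_wpM2l p20 q1; lra.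
Qed.

Lemma cjet_cts F p : cjet F p -> cts_at F p.
Proof.
move=> /cjet_lip[C [d d0 [C0 H]]] e e0; exists (Num.min d (e / C)); first by rewrite lt_min d0 divr_gt0.
move=> x; rewrite lt_min ltr_pdivlMr// => /andP[xd xe].
by have := H _ xd; rewrite subrKC mulrC => h; apply: le_lt_trans h xe.
Qed.

Lemma cjet_affine F p (k : R[i]) : cjet (fun x => x + k) p.
Proof.
exists 1, 0 => e e0; exists 1 => // h _.
rewrite (_ : _ - _ = 0) ?nm0; last by ring.
by rewrite mulr_ge0 ?sqr_ge0// ltW.
Qed.

Lemma cjet_subc F p c : cjet F p -> cjet (fun x => F x - c) p.
Proof.
move=> [A [B H]]; exists A, B => e /H[d d0 Hd]; exists d => // h /Hd.
by rewrite (_ : F (p + h) - c - (F p - c) = F (p + h) - F p)//; ring.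
Qed.

Lemma cjet_scale F p c : cjet F p -> cjet (fun x => F x / c) p.
Proof.
move=> [A [B H]]; exists (A / c), (B / c) => e e0.
have k0 : 0 < nm c^-1 + 1 by have := nm_ge0 c^-1; lra.
have [d d0 Hd] := H _ (divr_gt0 e0 k0); exists d => // h /Hd hh.
rewrite (_ : _ - _ = (F (p + h) - F p - (A * h + B * (h * h))) * c^-1); last by ring.
rewrite nmM; apply: le_trans (_ : e / (nm c^-1 + 1) * nm h ^+ 2 * (nm c^-1 + 1) <= _).
  by apply: ler_pM; rewrite ?nm_ge0//; lra.
by rewrite mulrAC divfK// gt_eqF.
Qed.

Lemma cjet_plog F p : cjet F p -> F p = 1 -> cjet (fun x => plog (F x)) p.
Proof.
move=> [A [B H]] F1; have [K K0 HK] := plog_taylor2.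
exists A, (B - A * A / 2%:R) => e e0.
have e2 : 0 < Num.min 1 (e / 2) by rewrite lt_min ltr01 divr_gt0.
have [d1 d10 H1] := H _ e2.
pose C := nm A + nm B + 1; have C1 : 1 <= C by rewrite /C; have := nm_ge0 A; have := nm_ge0 B; lra.
have CE : C = nm A + nm B + 1 by []. clearbody C.
pose Q := C * C + K * C ^+ 3; have Q0 : 0 < Q by rewrite addr_gt0 ?mulr_gt0 ?exprn_gt0//; lra.
have QE k : Q * k * k ^+ 2 = K * (C * k) ^+ 3 + (C * k ^+ 2) * (2 * (C * k)) / 2 by rewrite /Q; field.
clearbody Q.
pose d := Num.min (Num.min d1 1) (Num.min (1 / (32 * C)) (e / (2 * Q))).
exists d; first by rewrite !lt_min d10 ltr01 !divr_gt0 ?mulr_gt0//; lra.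
move=> h; rewrite !lt_min => /andP[/andP[hd1 h1] /andP[h2 h3]].
clear d; have {}H1 := H1 h hd1; set u := F (p + h) - 1.
have FE : F (p + h) = 1 + u by rewrite /u; ring.
rewrite F1 plog1 subr0 FE; rewrite F1 -/u in H1.
have n2 := nm_2.
have h0 := nm_ge0 h; set k := nm h in h0 h1 h2 h3 H1 *.
have m1 : Num.min 1 (e / 2) <= 1 by rewrite ge_min lexx.
have m2 : Num.min 1 (e / 2) <= e / 2 by rewrite ge_min lexx orbT.
set w := u - A * h.
have wE : nm w <= C * k ^+ 2.
  rewrite (_ : w = (u - (A * h + B * (h * h))) + B * (h * h)); last by rewrite /w; ring.
  apply: le_trans (nmD _ _) _; rewrite !nmM -/k -[k * k]expr2.
  have := sqr_ge0 k; have := nm_ge0 A; rewrite CE; move: (k ^+ 2) H1 => kk H1 a0 kk0.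
  have := ler_wpM2r kk0 m1; have := mulr_ge0 a0 kk0; lra.
have kk : k ^+ 2 <= k by rewrite expr2 ler_piMl// ltW.
have uE : nm u <= C * k.
  rewrite (_ : u = w + A * h); last by rewrite /w; ring.
  rewrite (_ : w = (u - (A * h + B * (h * h))) + B * (h * h)); last by rewrite /w; ring.
  apply: le_trans (nmD _ _) _; apply: le_trans (lerD (nmD _ _) (lexx _)) _; rewrite !nmM -/k -[k * k]expr2.
  have := nm_ge0 B; have := sqr_ge0 k; rewrite CE; move: (k ^+ 2) H1 kk => kk H1 kk1 kk0 b0.
  have := ler_wpM2r kk0 m1; have := ler_wpM2l b0 kk1; lra.
have u32 : nm u <= 1 / 32.
  apply: le_trans uE _; rewrite mulrC -ler_pdivlMr; last by lra.
  by move: h2; rewrite -mulrA -invfM; lra.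
have T := HK u u32.
have -> : plog (1 + u) - (A * h + (B - A * A / 2%:R) * (h * h)) =
  (plog (1 + u) - (u - u * u / 2%:R)) + (u - (A * h + B * (h * h))) - w * (u + A * h) / 2%:R.
  by rewrite /w; field.
apply: le_trans (nmBs _ _) _; apply: le_trans (lerD (nmD _ _) (lexx _)) _; rewrite !nmM nmV n2.
have uA : nm (u + A * h) <= 2 * (C * k).
  apply: le_trans (nmD _ _) _; rewrite nmM -/k; have b0 := nm_ge0 B.
  have : nm A * k <= C * k by apply: ler_wpM2r => //; rewrite CE; lra.
  lra.
have wu : nm w * nm (u + A * h) <= (C * k ^+ 2) * (2 * (C * k)) by apply: ler_pM; rewrite ?nm_ge0.
have u3 : K * nm u ^+ 3 <= K * (C * k) ^+ 3.
  by apply: ler_wpM2l; [exact: ltW|apply: lerXn2r; rewrite ?nnegrE ?nm_ge0// (le_trans (nm_ge0 u))].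
have kQ : Q * k <= e / 2.
  by move: h3; rewrite ltr_pdivlMr; [rewrite ltNge; lra|rewrite mulr_gt0].
have k2 := sqr_ge0 k.
have kQ2 : Q * k * k ^+ 2 <= e / 2 * k ^+ 2 by apply: ler_wpM2r.
have H1' : nm (u - (A * h + B * (h * h))) <= e / 2 * k ^+ 2 by apply: le_trans H1 _; apply: ler_wpM2r.
by move: (QE k) T wu; lra.
Qed.

(** Near p the continuous logarithm E differs by a constant from [plog] of (F x - c) / (F p - c),
    and so inherits its expansion. *)
Lemma cjet_lift F E p c : cjet F p -> F p != c -> cts_at E p ->
  (exists2 d : R, 0 < d & forall x, nm (x - p) < d -> cexp (E x) = F x - c) -> cjet E p.
Proof.
move=> jF Fc cE [d d0 HE].
have Fc0 : F p - c != 0 by rewrite subr_eq0.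
have jq : cjet (fun x => plog ((F x - c) / (F p - c))) p.
  by apply: cjet_plog; [exact/cjet_scale/cjet_subc|rewrite divff].
have q1 : plog ((F p - c) / (F p - c)) = 0 by rewrite divff// plog1.
have cq := cjet_cts jq.
have [d1 d10 H1] := cE 1 ltr01; have [d2 d20 H2] := cq 1 ltr01.
have jF' : cts_at (fun x => F x - c) p by exact/cjet_cts/cjet_subc.
have n0 : 0 < nm (F p - c) by rewrite nm_gt0.
have [d3 d30 H3] := jF' _ n0.
have EE x : nm (x - p) < Num.min (Num.min d d1) (Num.min d2 d3) -> E x - E p = plog ((F x - c) / (F p - c)).
  rewrite !lt_min => /andP[/andP[k0 k1] /andP[k2 k3]].
  have {}H1 := H1 x k1; have := H2 x k2; rewrite q1 subr0 => {}H2.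
  have Fx0 : F x - c != 0.
    rewrite -nm_gt0; have := H3 x k3; have := nm_subl (F p - c) (F p - c - (F x - c)).
    by rewrite subKr (nmB (F x - c)); lra.
  apply: cexp_inj.
    have := Im_nm (E x - E p); have := Im_nm (plog ((F x - c) / (F p - c))); have := pi_ge2 R.
    have := ler_normB (Imz (E x - E p)) (Imz (plog ((F x - c) / (F p - c)))); rewrite mulr2n; lra.
  rewrite cexpB !HE// ?plogK// ?mulf_neq0 ?invr_eq0//.
  by rewrite subrr nm0.
have [A [B H]] := jq; exists A, B => e /H[d4 d40 H4].
exists (Num.min d4 (Num.min (Num.min d d1) (Num.min d2 d3))); first by rewrite !lt_min d40 d0 d10 d20 d30.
move=> h; rewrite lt_min => /andP[h4 hh]; have := H4 h h4; rewrite q1 subr0 EE//.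
by rewrite addrC addKr.
Qed.

Definition ln_nm F x := ln (nm (F x)).

Lemma ln_nm_plog F p x : F p != 0 -> F x != 0 -> ln_nm F x - ln_nm F p = Rez (plog (F x / F p)).
Proof.
move=> p0 x0; rewrite Re_plog nmM nmV /ln_nm lnM ?lnV ?posrE ?invr_gt0 ?nm_gt0//.
Qed.

Lemma cts_neq0 F p : cts_at F p -> F p != 0 -> exists2 d : R, 0 < d & forall x, nm (x - p) < d -> F x != 0.
Proof.
move=> cF; rewrite -nm_gt0 => n0; have [d d0 H] := cF _ n0; exists d => // x /H.
by rewrite -nm_gt0; have := nm_subl (F p) (F p - F x); rewrite subKr (nmB (F x)); lra.
Qed.

Lemma ln_nm_cts F p : cts_at F p -> F p != 0 -> forall e : R, 0 < e -> exists2 d : R, 0 < d &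
  forall x, nm (x - p) < d -> `|ln_nm F x - ln_nm F p| < e.
Proof.
move=> cF p0 e e0; have [d1 d10 H1] := cts_neq0 cF p0.
have n0 : 0 < nm (F p) by rewrite nm_gt0.
have m0 : 0 < nm (F p) * Num.min (1 / 2) (e / 8) by rewrite mulr_gt0// lt_min !divr_gt0.
have [d2 d20 H2] := cF _ m0; exists (Num.min d1 d2); first by rewrite lt_min d10.
move=> x; rewrite lt_min => /andP[/H1 x0 /H2 hx]; rewrite ln_nm_plog//.
have hx' : nm (F x / F p - 1) < Num.min (1 / 2) (e / 8).
  by rewrite (_ : _ - 1 = (F x - F p) / F p); [rewrite nmM nmV ltr_pdivrMr// mulrC|field].
move: hx'; rewrite lt_min => /andP[h1 h2].
apply: le_lt_trans (Re_nm _) _; have := @plog_lip R _ 1 (ltW h1); rewrite subrr nm0 plog1 subr0.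
by move=> /(_ (ltac:(lra))); lra.
Qed.

(** The five-point Laplacian of u at p is o(r^2), a pointwise form of harmonicity. *)
Definition flat (u : R[i] -> R) p := forall e : R, 0 < e -> exists2 d : R, 0 < d & forall r : R, 0 < r -> r < d ->
  `|u (p + r%:C) + u (p - r%:C) + u (p + r%:C * ci R) + u (p - r%:C * ci R) - 4 * u p| <= e * r ^+ 2.

(** In the sum over r, - r, i r and - i r the linear terms of the expansion cancel in pairs and the
    quadratic ones because i^2 = -1. *)
Lemma flat_ln F p : cjet F p -> F p != 0 -> flat (ln_nm F) p.
Proof.
move=> jF p0 e e0; have [d1 d10 H1] := cts_neq0 (cjet_cts jF) p0.
have jq : cjet (fun x => plog (F x / F p)) p by apply: cjet_plog; [exact: cjet_scale|rewrite divff].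
have [A [B H]] := jq; have e4 : 0 < e / 4 by lra.
have [d2 d20 H2] := H _ e4; exists (Num.min d1 d2); first by rewrite lt_min d10.
move=> r r0; rewrite lt_min => /andP[r1 r2].
have step h : nm h = r -> `|ln_nm F (p + h) - ln_nm F p - Rez (A * h + B * (h * h))| <= e / 4 * r ^+ 2.
  move=> hr; rewrite ln_nm_plog//; last by apply: H1; rewrite addrC addKr hr.
  have := H2 h; rewrite hr divff// plog1 subr0 => /(_ r2) hh.
  by rewrite -ReB; apply: le_trans (Re_nm _) hh.
have nr : nm (r%:C : R[i]) = r by rewrite nmR gtr0_norm.
have ni : nm (r%:C * ci R) = r by rewrite nmM nr nmE /= expr0n expr1n add0r sqrtr1 mulr1.
have s1 := step _ nr; have s2 := step (- r%:C) (etrans (nmN _) nr).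
have s3 := step _ ni; have s4 := step (- (r%:C * ci R)) (etrans (nmN _) ni).
have c2 : ci R * ci R = -1 by apply: CP; rewrite ?ReM ?ImM /=; ring.
have Z : Rez (A * r%:C + B * (r%:C * r%:C)) + Rez (A * - r%:C + B * (- r%:C * - r%:C)) +
  Rez (A * (r%:C * ci R) + B * (r%:C * ci R * (r%:C * ci R))) +
  Rez (A * - (r%:C * ci R) + B * (- (r%:C * ci R) * - (r%:C * ci R))) = 0.
  rewrite -!ReD; move: (r%:C) (ci R) c2 => X Y c2.
  suff -> : A * X + B * (X * X) + (A * - X + B * (- X * - X)) + (A * (X * Y) + B * (X * Y * (X * Y))) +
    (A * - (X * Y) + B * (- (X * Y) * - (X * Y))) = B * X * X * (2%:R + 2%:R * (Y * Y)).
    by rewrite c2 mulrN1 subrr mulr0.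
  by ring.
move: s1 s2 s3 s4 Z.
move: (Rez _) (Rez (A * - r%:C + _)) (Rez (A * (r%:C * ci R) + _)) (Rez (A * - (r%:C * ci R) + _)) => q1 q2 q3 q4.
move: (ln_nm F (p + r%:C)) (ln_nm F (p - r%:C)) (ln_nm F (p + r%:C * ci R)) (ln_nm F (p - r%:C * ci R)) (ln_nm F p) => u1 u2 u3 u4 u0.
rewrite !ler_norml => /andP[? ?] /andP[? ?] /andP[? ?] /andP[? ?] ?; apply/andP; split; lra.
Qed.

End Jets.

(** * Maximum principle and Schwarz lemma *)

Section Koebe.
Variable R : realType.
Implicit Types (z w x p h v : R[i]) (F E : R[i] -> R[i]).

Lemma annulus_max z (s0 s : R) (V : R[i] -> R) x1 : s0 < nm (x1 - z) -> nm (x1 - z) < s ->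
  (forall x, s0 <= nm (x - z) <= s -> forall e : R, 0 < e -> exists2 d : R, 0 < d &
     forall y, nm (y - x) < d -> `|V y - V x| < e) ->
  (forall x, nm (x - z) = s0 \/ nm (x - z) = s -> V x < V x1) ->
  (forall p, s0 < nm (p - z) -> nm (p - z) < s -> forall d : R, 0 < d -> exists2 y, nm (y - p) < d & V p < V y) ->
  False.
Proof.
move=> x10 x1s cV bV up; pose A := [set x : R[i] | s0 <= nm (x - z) <= s].
have cA : compact A.
  apply: (subclosed_compact _ (@compact_cball R (s + nm z))).
    have -> : A = (fun x => nm (x - z)) @^-1` [set r : R | s0 <= r <= s] by [].
    apply: closed_comp; first by move=> x _; exact: nm_cst_continuous.
    rewrite (_ : [set r : R | s0 <= r <= s] = `[s0, s]%classic); first exact: interval_closed.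
    by apply/seteqP; split => r /=; rewrite in_itv.
  by move=> x /andP[_ hx] /=; have := nm_subl x z; lra.
have A1 : A x1 by rewrite /A /=; apply/andP; split; exact: ltW.
have [|p] := @compact_EVT_max _ R V A (ex_intro _ x1 A1) cA.
  apply: continuous_in_subspaceT => x /set_mem xA U /nbhs_ballP[e /= e0 eU].
  have [d d0 H] := cV x xA e e0; apply/nbhs_nmP; exists d => // y /H h.
  by apply: eU; rewrite /ball /= distrC.
move=> /set_mem /andP[p0 ps] Hp.
have Vp : V x1 <= V p by apply: Hp; exact/mem_set.
have p0' : s0 < nm (p - z).
  by rewrite lt_neqAle p0 andbT; apply/eqP => e; have := bV p (or_introl (esym e)); lra.
have ps' : nm (p - z) < s.
  by rewrite lt_neqAle ps andbT; apply/eqP => e; have := bV p (or_intror e); lra.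
have md : 0 < Num.min (nm (p - z) - s0) (s - nm (p - z)) by rewrite lt_min !subr_gt0 p0'.
have [y] := up p p0' ps' _ md; rewrite lt_min => /andP[y1 y2] Vy.
have : V y <= V p.
  apply: Hp; apply/mem_set; rewrite /A /=; apply/andP; split.
    by have := nm_triB p y z; rewrite (nmB p y); lra.
  by have := nm_triB y p z; lra.
lra.
Qed.

(** The term c |x - z|^2 has a positive Laplacian and excludes interior maxima; e > 0 makes the
    potential tend to -oo at z when N vanishes there. *)
Definition potential N D z (e c : R) x :=
  ln_nm N x - ln_nm D x - (1 - e) * ln_nm (fun x => x - z) x + c * nm (x - z) ^+ 2.

Lemma dist_lip z x y : `|nm (y - z) - nm (x - z)| <= nm (y - x).
Proof.
have a1 := nm_triB y x z; have a2 := nm_triB x y z; rewrite (nmB x y) in a2.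
by rewrite ler_norml; apply/andP; split; lra.
Qed.

Lemma sqdist_cts z x (c : R) : 0 < c -> forall d : R, 0 < d -> exists2 k : R, 0 < k &
  forall y, nm (y - x) < k -> `|c * nm (y - z) ^+ 2 - c * nm (x - z) ^+ 2| < d.
Proof.
move=> c0 d d0; have n0 := nm_ge0 (x - z); have p0 : 0 < c * (2 * nm (x - z) + 1) by rewrite mulr_gt0//; lra.
exists (Num.min 1 (d / (c * (2 * nm (x - z) + 1)))); first by rewrite lt_min ltr01 divr_gt0.
move=> y; rewrite lt_min => /andP[y1]; rewrite ltr_pdivlMr// => yd.
rewrite -mulrBr normrM gtr0_norm// subr_sqr normrM.
apply: le_lt_trans yd; rewrite [leRHS]mulrCA ler_pM2l//; apply: ler_pM => //; first exact: dist_lip.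
by rewrite ger0_norm ?addr_ge0 ?nm_ge0//; have := nm_triB y x z; lra.
Qed.

Lemma norm4_lt (n1 n2 n3 n4 n5 n6 n7 n8 t d : R) : 0 <= t -> t <= 1 ->
  `|n1 - n2| < d / 4 -> `|n3 - n4| < d / 4 -> `|n5 - n6| < d / 4 -> `|n7 - n8| < d / 4 ->
  `|n1 - n3 - t * n5 + n7 - (n2 - n4 - t * n6 + n8)| < d.
Proof.
move=> t0 t1 h1 h2 h3 h4; have h5 : `|t * (n5 - n6)| < d / 4.
  by apply: le_lt_trans h3; rewrite normrM (ger0_norm t0) ler_piMl.
rewrite (_ : _ - _ = (n1 - n2) - (n3 - n4) - t * (n5 - n6) + (n7 - n8)); last by ring.
have := ler_normD (n1 - n2 - (n3 - n4) - t * (n5 - n6)) (n7 - n8).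
have := ler_normB (n1 - n2 - (n3 - n4)) (t * (n5 - n6)); have := ler_normB (n1 - n2) (n3 - n4).
lra.
Qed.

Lemma potential_cts N D z (e c : R) x : 0 < e -> e <= 1 -> 0 < c -> cts_at N x -> N x != 0 ->
  cts_at D x -> D x != 0 -> x != z -> forall d : R, 0 < d -> exists2 k : R, 0 < k &
  forall y, nm (y - x) < k -> `|potential N D z e c y - potential N D z e c x| < d.
Proof.
move=> e0 e1 c0 cN Nx cD Dx xz d d0; have d4 : 0 < d / 4 by lra.
have [k1 k10 H1] := ln_nm_cts cN Nx d4; have [k2 k20 H2] := ln_nm_cts cD Dx d4.
have cid : cts_at (fun x => x - z) x by exact/cjet_cts/(@cjet_affine R id x (- z)).
have [|k3 k30 H3] := ln_nm_cts cid _ d4; first by rewrite subr_eq0.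
have [k4 k40 H4] := sqdist_cts z x c0 d4.
exists (Num.min (Num.min k1 k2) (Num.min k3 k4)); first by rewrite !lt_min k10 k20 k30 k40.
move=> y; rewrite !lt_min => /andP[/andP[/H1 h1 /H2 h2] /andP[/H3 h3 /H4 h4]].
by apply: norm4_lt => //; lra.
Qed.

Lemma sum4_gt (S1 S2 S3 t c q : R) : 0 <= t -> t <= 1 -> 0 < c * q ->
  `|S1| <= c * q -> `|S2| <= c * q -> `|S3| <= c * q -> 0 < S1 - S2 - t * S3 + c * (4 * q).
Proof.
move=> t0 t1 p h1 h2 h3; have : `|t * S3| <= c * q by apply: le_trans h3; rewrite normrM (ger0_norm t0) ler_piMl.
move: h1 h2; rewrite !ler_norml => /andP[? ?] /andP[? ?] /andP[? ?]; lra.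
Qed.

Lemma sqdist4 p z (r : R) : nm (p + r%:C - z) ^+ 2 + nm (p - r%:C - z) ^+ 2 + nm (p + r%:C * ci R - z) ^+ 2 +
  nm (p - r%:C * ci R - z) ^+ 2 - 4 * nm (p - z) ^+ 2 = 4 * r ^+ 2.
Proof. by rewrite !nm2 !Cri !ReM !ImM /=; ring. Qed.

Lemma potential_up N D z (e c : R) p : 0 < e -> e <= 1 -> 0 < c -> cjet N p -> N p != 0 ->
  cjet D p -> D p != 0 -> p != z -> forall d : R, 0 < d ->
  exists2 y, nm (y - p) < d & potential N D z e c p < potential N D z e c y.
Proof.
move=> e0 e1 c0 jN Np jD Dp pz d d0; set V := potential N D z e c.
have [k1 k10 H1] := flat_ln jN Np c0; have [k2 k20 H2] := flat_ln jD Dp c0.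
have [|k3 k30 H3] := flat_ln (@cjet_affine R id p (- z)) _ c0; first by rewrite subr_eq0.
have [r [r_0 r1 r2 r3 rd]] : exists r, [/\ 0 < r, r < k1, r < k2, r < k3 & r < d].
  pose m := Num.min (Num.min k1 k2) (Num.min k3 d).
  have m0 : 0 < m by rewrite !lt_min k10 k20 k30.
  exists (m / 2); have rm : m / 2 < m by lra.
  by move: (rm); rewrite divr_gt0// !lt_min => /andP[/andP[-> ->] /andP[-> ->]].
have {}H1 := H1 r r_0 r1; have {}H2 := H2 r r_0 r2; have {}H3 := H3 r r_0 r3.
have nr : nm (r%:C : R[i]) = r by rewrite nmR gtr0_norm.
have ni : nm (r%:C * ci R) = r by rewrite nmM nr nmE /= expr0n expr1n add0r sqrtr1 mulr1.
apply: contrapT => no.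
have le y : nm (y - p) = r -> V y <= V p.
  by move=> yr; rewrite leNgt; apply/negP => lt'; apply: no; exists y => //; rewrite yr.
have v1 := le (p + r%:C) (ltac:(by rewrite addrC addKr)).
have v2 := le (p - r%:C) (ltac:(by rewrite addrC addKr nmN)).
have v3 := le (p + r%:C * ci R) (ltac:(by rewrite addrC addKr)).
have v4 := le (p - r%:C * ci R) (ltac:(by rewrite addrC addKr nmN)).
have t0 : 0 <= 1 - e by rewrite subr_ge0.
have t1 : 1 - e <= 1 by rewrite lerBlDr lerDl ltW.
have := sum4_gt t0 t1 (mulr_gt0 c0 (exprn_gt0 2 r_0)) H1 H2 H3.
rewrite -(sqdist4 p z) => S.
have : 0 < V (p + r%:C) + V (p - r%:C) + V (p + r%:C * ci R) + V (p - r%:C * ci R) - 4 * V p.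
  by apply: lt_le_trans S _; rewrite le_eqVlt; apply/orP; left; apply/eqP; rewrite /V /potential; ring.
move: v1 v2 v3 v4; move: (V _) (V (p - r%:C)) (V (p + r%:C * ci R)) (V (p - r%:C * ci R)) (V p) => w1 w2 w3 w4 w0.
lra.
Qed.

Lemma half_lt (x y : R) : 0 < x -> y <= x / 2 -> y < x.
Proof. lra. Qed.

Lemma nm_half_near (u v : R[i]) : nm (v - u) < nm u / 2 -> nm u / 2 <= nm v.
Proof. by have := nm_subl u (u - v); rewrite subKr (nmB v); lra. Qed.

Lemma schwarz_inner (n d r f c C h g v : R) :
  n <= C + r -> h <= d -> f <= v - (C - h + g) - 1 -> c <= g -> n - d - r + f + c < v.
Proof. lra. Qed.

(* Schwarz's lemma for N / D: the maximum principle applied to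
   ln|N| - ln|D| - (1 - e) ln|x - z| + c |x - z|^2 on an annulus around z. *)
Lemma schwarz N D z (s M : R) : 0 < s -> 0 < M ->
  (forall x, nm (x - z) <= s -> cjet N x /\ cjet D x /\ D x != 0) ->
  (forall x, nm (x - z) <= s -> x != z -> N x != 0) -> N z = 0 ->
  (forall x, nm (x - z) = s -> nm (N x) <= M * nm (D x)) ->
  forall x, nm (x - z) <= s -> nm (N x) * s <= M * nm (D x) * nm (x - z).
Proof.
move=> s0 M0 hj hN Nz hM x1 x1s; rewrite leNgt; apply/negP => lt.
have x1z : x1 != z by apply: contraTneq lt => ->; rewrite Nz nm0 mul0r subrr nm0 mulr0 ltxx.
have r0 : 0 < nm (x1 - z) by rewrite nm_gt0 subr_eq0.
have rs : nm (x1 - z) < s.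
  rewrite lt_neqAle x1s andbT; apply/eqP => e; move: lt; rewrite e ltr_pM2r// ltNge.
  by rewrite hM.
pose id_z := fun x : R[i] => x - z.
pose Phi x := ln_nm N x - ln_nm D x - ln_nm id_z x.
have D0 x : nm (x - z) <= s -> 0 < nm (D x) by move=> /hj[_ [_]]; rewrite nm_gt0.
have N0 x : nm (x - z) <= s -> x != z -> 0 < nm (N x) by move=> xs xz; rewrite nm_gt0 hN.
have Phi_s x : nm (x - z) = s -> Phi x <= ln M - ln s.
  move=> xs; have xs' : nm (x - z) <= s by rewrite xs.
  have xz : x != z by apply: contraTneq s0 => e; rewrite -xs e subrr nm0 ltxx.
  rewrite /Phi /ln_nm /id_z xs lerB// lerBlDr -lnM ?posrE ?D0//.
  by rewrite ler_ln ?posrE ?mulr_gt0 ?N0 ?D0// hM.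
have gap : 0 < Phi x1 - (ln M - ln s).
  rewrite /Phi /ln_nm /id_z; have := lt; rewrite -ltr_ln ?posrE ?mulr_gt0 ?D0 ?N0//.
  by rewrite !lnM ?posrE ?mulr_gt0 ?D0 ?N0//; lra.
have [g gE] : exists g, g = Phi x1 - (ln M - ln s) by eexists.
rewrite -gE in gap.
(* The gap g between x1 and the outer circle is spent in thirds: one for c, one for e. *)
have [c [c0 cs]] : exists c, 0 < c /\ c * s ^+ 2 = g / 3.
  exists (g / (3 * s ^+ 2)); rewrite divr_gt0 ?mulr_gt0 ?exprn_gt0//; split=> //.
  by field; rewrite gt_eqF.
have [e [e0 e1 el]] : exists e, [/\ 0 < e, e <= 1 & e * (ln s - ln (nm (x1 - z))) <= g / 3].
  have l0 : 0 < ln s - ln (nm (x1 - z)) by rewrite subr_gt0 ltr_ln ?posrE.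
  set l := ln s - _ in l0 *; exists (Num.min 1 (g / (3 * l))); split.
  - by rewrite lt_min ltr01 divr_gt0// mulr_gt0.
  - by rewrite ge_min lexx.
  - apply: le_trans (_ : g / (3 * l) * l <= _); first by rewrite ler_pM2r// ge_min lexx orbT.
    by rewrite le_eqVlt; apply/orP; left; apply/eqP; field; rewrite gt_eqF.
pose V := potential N D z e c.
have VE x : V x = Phi x + e * ln_nm id_z x + c * nm (x - z) ^+ 2 by rewrite /V /potential /Phi /id_z; ring.
have zs : nm (z - z) <= s by rewrite subrr nm0 ltW.
have [jN [jD Dz]] := hj z zs.
have [C [d1 d10 [C0 HC]]] := cjet_lip jN.
have [d2 d20 HD] := cjet_cts jD (divr_gt0 (D0 z zs) (ltr0n R 2)).
have [q qE] : exists q, q = ln C - ln (nm (D z) / 2) + g / 3 by eexists.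
(* On the inner circle e ln s1 pushes the potential below its value at x1. *)
have [s1 [s10 [sd1 [sd2 [sx sq]]]]] : exists s1, 0 < s1 /\ s1 <= d1 / 2 /\ s1 <= d2 / 2 /\
    s1 <= nm (x1 - z) / 2 /\ s1 <= expR ((V x1 - q - 1) / e).
  exists (Num.min (Num.min (d1 / 2) (d2 / 2)) (Num.min (nm (x1 - z) / 2) (expR ((V x1 - q - 1) / e)))).
  by rewrite !lt_min !divr_gt0 ?expR_gt0// !ge_min !lexx !orbT.
have sx1 := half_lt r0 sx; have sd1' := half_lt d10 sd1; have sd2' := half_lt d20 sd2.
have offz x (r : R) : 0 < r -> r <= nm (x - z) -> x != z.
  by move=> r'; apply: contraTneq => ->; rewrite subrr nm0 -ltNge.
apply: (@annulus_max z s1 s V x1) => //.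
- move=> x /andP[x0 xs]; have [jNx [jDx Dx]] := hj x xs; have xz := offz x s1 s10 x0.
  exact: potential_cts e0 e1 c0 (cjet_cts jNx) (hN x xs xz) (cjet_cts jDx) Dx xz.
- move=> x [xs|xs].
    have xs' : nm (x - z) <= s by rewrite xs ltW// (lt_trans sx1).
    have xz : x != z by apply: offz s10 _; rewrite xs.
    have h1 : nm (N x) <= C * s1.
      by have := HC (x - z); rewrite xs subrKC Nz subr0; apply.
    have h2 : nm (D z) / 2 <= nm (D x).
      by apply: nm_half_near; apply: HD; rewrite xs.
    have h3 : ln (nm (N x)) <= ln C + ln s1 by rewrite -lnM ?posrE// ler_ln ?posrE ?mulr_gt0// N0.
    have h4 : ln (nm (D z) / 2) <= ln (nm (D x)) by rewrite ler_ln ?posrE ?divr_gt0 ?D0.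
    have h5 : e * ln s1 <= V x1 - q - 1.
      rewrite mulrC -ler_pdivlMr//; apply: le_trans (_ : ln (expR ((V x1 - q - 1) / e)) <= _); last by rewrite expRK.
      by rewrite ler_ln ?posrE ?expR_gt0.
    have h6 : c * s1 ^+ 2 <= g / 3.
      rewrite -cs ler_pM2l// ler_sqr ?nnegrE ?(ltW s10) ?(ltW s0)//; exact: ltW (lt_trans sx1 rs).
    rewrite VE /Phi /ln_nm /id_z xs; rewrite qE in h5; exact: schwarz_inner h3 h4 h5 h6.
  have h1 := Phi_s x xs; rewrite VE (VE x1) xs cs /ln_nm /id_z xs.
  have h2 : 0 <= c * nm (x1 - z) ^+ 2 by rewrite mulr_ge0 ?sqr_ge0 ?(ltW c0).
  have h3 : e * ln s - e * ln (nm (x1 - z)) <= g / 3 by rewrite -mulrBr.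
  by rewrite gE in h3 gap cs *; lra.
- move=> p p0 ps; have [jNp [jDp Dp]] := hj p (ltW ps); have pz := offz p s1 s10 (ltW p0).
  exact: potential_up e0 e1 c0 jNp (hN p (ltW ps) pz) jDp Dp pz.
Qed.

End Koebe.

Section Distortion.
Variable R : realType.
Implicit Types (z w x y p h v : R[i]) (g F : R[i] -> R[i]).

Lemma inf_approach (S : set R) (d : R) : S !=set0 -> 0 < d -> (forall t, S t -> d <= t) ->
  exists t0, [/\ 0 < t0, forall t, S t -> t0 <= t & forall e : R, 0 < e -> exists2 t, S t & t < t0 + e].
Proof.
move=> S0 d0 Sd; have hi : has_inf S by split => //; exists d => t; exact: Sd.
have d1 : d <= inf S by apply: lb_le_inf => // t; exact: Sd.
have i0 : 0 < inf S by lra.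
exists (inf S); split=> //; first by move=> t St; apply: ge_inf => //; case: hi.
by move=> e e0; have [t St tl] := inf_adherent e0 hi; exists t.
Qed.

Lemma cclosed_ball (r : R) : cclosed (fun h : R[i] => nm h <= r).
Proof.
move=> h H; rewrite leNgt; apply/negP => lt; have [|w wr] := H (nm h - r); first by rewrite subr_gt0.
by have := nm_subl h w; rewrite (nmB h); lra.
Qed.

Lemma nm_cexpB1 v : nm v <= 1 / 4 -> nm (cexp v - 1) < 1 / 2.
Proof.
move=> v1; have v2 : nm v <= 1 / 2 by lra.
have := cexp_taylor1 v2; have := nmD (cexp v - 1 - v) v; rewrite subrK expr2; have := nm_ge0 v.
by move: (nm v) v1 => k; nra.
Qed.

Section Koebe.
Variables (g F : R[i] -> R[i]) (z : R[i]) (s : R).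
Hypothesis s0 : 0 < s.
Hypothesis jg : forall x, nm (x - z) <= s -> cjet g x.
Hypothesis gK : forall x, nm (x - z) <= s -> F (g x) = x.
Hypothesis cF : forall y, cts_at F y.
Let half x : nm (x - z) <= s / 2 -> nm (x - z) <= s. Proof. by have := s0; lra. Qed.

(* As g is injective, a continuous logarithm l of (g - w0) / (g z - w0) vanishing
   at z omits a disc around 2 pi i; apply Schwarz's lemma to l / (l - 2 pi i). *)
Lemma koebe_aux w0 x : (forall x, nm (x - z) <= s / 2 -> g x != w0) ->
  (forall y, nm (y - g z) <= nm (w0 - g z) / 2 -> exists2 x, nm (x - z) <= s / 2 & g x = y) ->
  nm (x - z) <= s / 4400 -> nm (g x - g z) <= nm (w0 - g z).
Proof.
move=> om cov; have s_0 := s0.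
have zz r : 0 <= r -> nm (z - z) <= r by rewrite subrr nm0.
pose c := g z - w0; have c0 : c != 0 by rewrite subr_eq0; apply: om; apply: zz; lra.
have [L Lc LE] : exists2 L : R[i] -> R[i], ccont (fun h => nm h <= s / 2) L &
    forall h, nm h <= s / 2 -> cexp (L h) = (g (z + h) - w0) / c.
  have sh h : nm h <= s / 2 -> nm (z + h - z) <= s / 2 by rewrite addrC addKr.
  apply: (@starlog R (fun h => nm h <= s / 2) (s / 2)) => //.
  - exact: cclosed_ball.
  - by rewrite nm0; lra.
  - move=> h t hs /andP[t0 t1]; rewrite nmM nmR ger0_norm//; apply: le_trans hs.
    by rewrite ler_piMl ?nm_ge0.
  - move=> h hs e e0.
    have [d d0 H] := cjet_cts (cjet_scale c (cjet_subc w0 (jg (half (sh h hs))))) e0.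
    by exists d => // q _ qh; apply: H; rewrite opprD addrACA subrr add0r.
  - by move=> h hs; rewrite mulf_neq0 ?invr_eq0// subr_eq0; apply: om; exact: sh.
pose l y := L (y - z) - L 0.
have l0 : l z = 0 by rewrite /l subrr subrr.
have cL0 : cexp (L 0) = 1 by rewrite LE ?nm0 ?addr0 ?divff//; lra.
have lE y : nm (y - z) <= s / 2 -> cexp (l y) = (g y - w0) / c.
  by move=> ys; rewrite /l cexpB cL0 divr1 LE// subrKC.
have lcts y : nm (y - z) < s / 2 -> cts_at l y.
  move=> ys e e0; have [d d0 H] := Lc _ (ltW ys) e e0.
  have ms : 0 < s / 2 - nm (y - z) by lra.
  exists (Num.min d (s / 2 - nm (y - z))); first by rewrite lt_min d0.
  move=> y'; rewrite lt_min => /andP[h1 h2].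
  rewrite /l opprD addrACA opprK [- _ + _]addrC subrr addr0; apply: H.
    by have := nm_triB y' y z; lra.
  by rewrite opprB addrA subrK.
have jl y : nm (y - z) < s / 2 -> cjet l y.
  move=> ys; have ys' := ltW ys.
  apply: (cjet_lift (cjet_scale c (jg (half ys'))) (c := w0 / c)); last 2 first.
  - exact: lcts.
  - exists (s / 2 - nm (y - z)); first by rewrite subr_gt0.
    by move=> y' h; rewrite lE ?mulrBl//; have := nm_triB y' y z; lra.
  - by rewrite -subr_eq0 -mulrBl mulf_neq0 ?invr_eq0// subr_eq0 om.
have t1E : Imz (tpi 1 : R[i]) = pi + pi by rewrite /tpi /= mulr1 mulr2n.
have t1n : nm (tpi 1 : R[i]) <= 8.
  apply: le_trans (nm_ReIm _) _; rewrite t1E /= normr0 add0r ger0_norm; have := pi_le4 R; have := pi_ge0 R; lra.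
(* If l y were near 2 pi i, put v = l y - 2 pi i. The values exp (t v) give a path Y from g z to g y
   inside the disc covered by g. Along F (Y t), l equals t v by uniqueness, so at t = 1 it would be
   v, not l y. *)
have far y : nm (y - z) <= s / 2 -> 1 / 4 < nm (l y - tpi 1).
  move=> ys; rewrite ltNge; apply/negP => near; set v := l y - tpi 1 in near.
  have ev : cexp v = (g y - w0) / c by rewrite /v cexpB lE// (cexp_tpi R 1) divr1.
  pose Y (t : R) := w0 + cexp (t%:C * v) * c.
  have nmt t : 0 <= t <= 1 -> nm (t%:C * v) <= 1 / 4.
    by move=> /andP[t0 t1]; rewrite nmM nmR ger0_norm//; apply: le_trans near; rewrite ler_piMl ?nm_ge0.
  have covt t : 0 <= t <= 1 -> nm (F (Y t) - z) <= s / 2 /\ g (F (Y t)) = Y t.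
    move=> it; have [|x' xs' gx'] := cov (Y t).
      rewrite (_ : Y t - g z = (cexp (t%:C * v) - 1) * c); last by rewrite /Y /c; ring.
      rewrite nmM (nmB w0) -/c mulrC; have := nm_cexpB1 (nmt t it); have := nm_ge0 c.
      by move: (nm _) (nm c) => p q q0 p1; rewrite ler_wpM2l//; lra.
    by rewrite -gx' gK ?half.
  have Yc : pcont 0 1 Y.
    move=> t it e e0; have c1 : 0 < nm c by rewrite nm_gt0.
    have [d d0 H] := cexp_cts (t%:C * v) (divr_gt0 e0 c1).
    exists d => // t' it' tt; rewrite /Y opprD addrACA subrr add0r -mulrBl nmM -ltr_pdivlMr//.
    apply: H; rewrite -mulrBl -rmorphB nmM nmR; apply: le_lt_trans tt.
    by rewrite ler_piMr//; lra.
  have lY : pcont 0 1 (fun t => l (F (Y t))).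
    move=> t it e e0; have [h1 _] := covt t it.
    have [d d0 H] := Lc _ h1 e e0; have [d1 d10 H1] := cF (Y t) d0.
    have [d2 d20 H2] := Yc t it d1 d10; exists d2 => // t' it' tt.
    rewrite /l opprD addrACA opprK [- _ + _]addrC subrr addr0; apply: H; first exact: (covt t' it').1.
    by rewrite opprB addrA subrK; apply: H1; exact: H2.
  have vc : pcont 0 1 (fun t => t%:C * v).
    move=> t it e e0; exists e => // t' it' tt; rewrite -mulrBl -rmorphB nmM nmR.
    by apply: le_lt_trans tt; rewrite ler_piMr//; lra.
  have i0 : 0 <= (0 : R) <= 1 by rewrite lexx ler01.
  have i1 : 0 <= (1 : R) <= 1 by rewrite lexx ler01.
  have : l (F (Y 1)) = 1%:C * v.
    apply: (log_unique ler01 lY vc).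
      move=> t it; have [h1 h2] := covt t it; rewrite lE// h2 /Y addrC addKr mulfK//.
    rewrite mul0r; have -> : Y 0 = g z by rewrite /Y mul0r cexp0 mul1r /c subrKC.
    by rewrite gK ?l0//; apply: zz; exact: ltW.
  rewrite mul1r; have -> : Y 1 = g y by rewrite /Y mul1r ev divfK// subrKC.
  rewrite gK ?half// /v => e.
  have : tpi 1 = 0 :> R[i] by rewrite -[LHS](subKr (l y)) -e subrr.
  by move=> /(congr1 (@complex.Im R)); rewrite t1E; have := pi_gt0 R; rewrite /=; lra.
have lz y : nm (y - z) <= s / 2 -> y != z -> l y != 0.
  move=> ys yz; apply: contra yz => /eqP ly0.
  have := lE y ys; rewrite ly0 cexp0 => /esym/divr1_eq; rewrite /c => /addIr gyz.
  by rewrite -(gK (half ys)) gyz gK//; apply: zz; exact: ltW.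
have S : nm (x - z) <= s / 4 -> nm (l x) * (s / 4) <= 33 * nm (l x - tpi 1) * nm (x - z).
  move=> xs; apply: (@schwarz R l (fun y => l y - tpi 1) z (s / 4) 33) => //.
  - lra.
  - move=> y ys; have ys' : nm (y - z) < s / 2 by lra.
    split; first exact: jl. split; first by apply: cjet_subc; exact: jl.
    by rewrite -nm_gt0; have := far y (ltW ys'); lra.
  - by move=> y ys; apply: lz; lra.
  - move=> y ys; have ys' : nm (y - z) <= s / 2 by lra.
    by have := far y ys'; have := nmD (l y - tpi 1) (tpi 1); rewrite subrK; lra.
(* 33 = 1 + 8 * 4 comes from |l| <= |l - 2 pi i| + 8 with |l - 2 pi i| > 1/4; the radius s / 4400 is
   small enough to turn Schwarz's bound into 1/4. *)
move=> xs; have lx : nm (l x) <= 1 / 4.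
  have h1 := nmBs (l x) (tpi 1); have h0 := nm_ge0 (l x).
  have h2 : nm (l x) * (s / 4) <= 33 * (nm (l x) + 8) * (s / 4400).
    apply: le_trans (S _) _; first by lra.
    apply: ler_pM; rewrite ?mulr_ge0 ?nm_ge0//.
    by rewrite ler_pM2l//; apply: le_trans h1 _; rewrite lerD2l.
  rewrite -(ler_pM2r s_0); have h3 := mulr_ge0 h0 (ltW s_0).
  by move: (nm (l x)) h0 h2 h3 => k h0 h2 h3; lra.
have xs2 : nm (x - z) <= s / 2 by lra.
have gx : g x - g z = (cexp (l x) - 1) * c by rewrite lE// mulrBl divfK// /c; ring.
rewrite gx nmM (nmB w0) -/c ler_piMl ?nm_ge0//; apply: le_trans (ltW (nm_cexpB1 lx)) _; lra.
Qed.

(** Apply [koebe_aux] to an omitted value w0 that is within a factor 2 of the distance from g z to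
    the omitted values; everything closer than half of |w0 - g z| is then covered. *)
Theorem koebe w x : (exists2 d : R, 0 < d & forall y, nm (y - g z) < d -> exists2 x, nm (x - z) <= s / 2 & g x = y) ->
  (forall x, nm (x - z) <= s -> g x != w) -> nm (x - z) <= s / 4400 ->
  nm (g x - g z) <= 2 * nm (w - g z).
Proof.
move=> [d d0 gd] om xs.
pose S := [set t : R | exists2 w', forall x, nm (x - z) <= s / 2 -> g x != w' & t = nm (w' - g z)].
have Sw : S (nm (w - g z)) by exists w => // y /half; exact: om.
have [||t0 [t00 tS tA]] := @inf_approach S d _ d0.
- by exists (nm (w - g z)).
- move=> t [w' om' ->]; rewrite leNgt; apply/negP => /gd[y ys e].
  by have := om' y ys; rewrite e eqxx.
have [_ [w0 om0 ->] lt] := tA _ t00.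
have h : nm (w0 - g z) <= 2 * nm (w - g z) by have := tS _ Sw; lra.
apply: le_trans h; apply: koebe_aux xs => // y yl.
apply: contrapT => no; have : t0 <= nm (y - g z).
  by apply: tS; exists y => // x' xs'; apply/eqP => e; apply: no; exists x'.
lra.
Qed.

End Koebe.
End Distortion.

(** * Inverse branches along the singular orbit *)

Section InverseBranch.
Variables (R : realType) (a : R[i]).
Implicit Types (z w x y h v e : R[i]).
Notation f := (expmap a).
Notation orb := (orb a).
Notation T := (T0 a).
Let hT : 100 * 20 + nm a <= T. Proof. exact: T0_ge. Qed.

Lemma expmap_inj_near x y : nm (x - y) < pi -> f x = f y -> x = y.
Proof.
move=> d; rewrite !expmapE => /addIr; apply: cexp_inj; rewrite -ImB.
by apply: le_lt_trans (Im_nm _) _; have := pi_gt0 R; rewrite mulr2n; lra.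
Qed.

Lemma orb_inj_near n z : exists2 d : R, 0 < d & forall x y, nm (x - z) < d -> nm (y - z) < d ->
  orb n x = orb n y -> x = y.
Proof.
elim: n => [|n [d d0 IH]]; first by exists 1 => // x y _ _; rewrite !orb0.
have p2 : 0 < pi / 2 :> R by rewrite divr_gt0 ?pi_gt0.
have [d1 d10 H1] := orb_cts a n z p2.
exists (Num.min d d1); first by rewrite lt_min d0.
move=> x y; rewrite !lt_min => /andP[xd /H1 x1] /andP[yd /H1 y1].
rewrite !orbS => e; apply: (IH x y xd yd); apply: expmap_inj_near e.
by have := nm_triB (orb n x) (orb n z) (orb n y); rewrite (nmB (orb n z)); lra.
Qed.

(** The closed k-neighbourhood of the segment from 0 to v. The coordinate h is relative to orb n a,
    so the set joins discs around orb n a and around the escaping point e. *)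
Definition stad v (k : R) h := exists2 t : R, 0 <= t <= 1 & nm (h - t%:C * v) <= k.
Definition inner (D : R[i] -> Prop) h := exists2 d : R, 0 < d & forall h', nm (h' - h) < d -> D h'.

Lemma stad_bound v k h : stad v k h -> nm h <= nm v + k.
Proof.
move=> [t /andP[t0 t1] hk]; have := nm_subl h (t%:C * v); rewrite nmM nmR ger0_norm//.
by have := nm_ge0 v; nra.
Qed.

Lemma stad_closed v k : cclosed (stad v k).
Proof.
move=> h H.
have /choice[tn Htn] : forall n : nat, exists t : R, 0 <= t <= 1 /\ nm (h - t%:C * v) <= k + n.+1%:R^-1.
  move=> n; have [|w [t it wk] wh] := H n.+1%:R^-1; first by rewrite invr_gt0.
  exists t; split => //; apply: le_trans (nm_triB h w _) _.
  by rewrite (nmB h w) addrC; apply: lerD => //; exact: ltW.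
have b n : nm ((tn n)%:C : R[i]) <= 1.
  by rewrite nmR; have [/andP[t0 t1] _] := Htn n; rewrite ger0_norm.
have [t Ht] := cbolzano b.
have i0 : Imz t = 0.
  apply/eqP; rewrite -normr_eq0 eq_le normr_ge0 andbT leNgt; apply/negP => p.
  have [n _ hn] := Ht _ p 0%N; have := Im_nm ((tn n)%:C - t); rewrite ImB /= sub0r normrN; lra.
have tE : t = (Rez t)%:C by apply: CP.
have close (e : R) : 0 < e -> forall N, exists2 n, (N <= n)%N & `|tn n - Rez t| < e.
  move=> e0 N; have [n Nn hn] := Ht e e0 N; exists n => //.
  by apply: le_lt_trans hn; have := Re_nm ((tn n)%:C - t); rewrite ReB.
exists (Rez t).
  apply/andP; split; rewrite leNgt; apply/negP => lt.
    have [|n _ hn] := close (- Rez t) _ 0%N; first by lra.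
    have [/andP[t0 _] _] := Htn n; have := ler_norm (tn n - Rez t); lra.
  have [|n _ hn] := close (Rez t - 1) _ 0%N; first by lra.
  have [/andP[_ t1] _] := Htn n; move: hn; rewrite distrC; have := ler_norm (Rez t - tn n); lra.
rewrite leNgt; apply/negP => lt; set g := nm _ in lt.
have g0 : 0 < (g - k) / 2 by lra.
have v1 : 0 < nm v + 1 by have := nm_ge0 v; lra.
have [N hN] : exists N : nat, N.+1%:R^-1 < (g - k) / 2.
  exists (Num.truncn ((g - k) / 2)^-1); rewrite invf_plt ?posrE ?ltr0n//; exact: truncnS_gt.
have [n Nn hn] := close ((g - k) / 2 / (nm v + 1)) (divr_gt0 g0 v1) N.
have [_ h1] := Htn n.
have h2 : n.+1%:R^-1 <= N.+1%:R^-1 :> R by rewrite lef_pV2 ?posrE ?ltr0n// ler_nat.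
have h3 : nm ((tn n)%:C * v - (Rez t)%:C * v) <= (g - k) / 2.
  rewrite -mulrBl -rmorphB nmM nmR; move: hn; rewrite ltr_pdivlMr// => hn.
  by apply: le_trans (ltW hn); rewrite ler_wpM2l//; lra.
have := nm_triB h ((tn n)%:C * v) ((Rez t)%:C * v); rewrite -/g.
by move: (n.+1%:R^-1) (N.+1%:R^-1) h1 h2 hN => q1 q2 h1 h2 hN; lra.
Qed.

Lemma stad0 v k : 0 <= k -> stad v k 0.
Proof. by move=> k0; exists 0; rewrite ?lexx ?ler01// mul0r subrr nm0. Qed.

Lemma stad_star v k h s : stad v k h -> 0 <= s <= 1 -> stad v k (s%:C * h).
Proof.
move=> [t /andP[t0 t1] hk] /andP[s0 s1]; exists (s * t).
  by rewrite mulr_ge0//= mulr_ile1.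
rewrite rmorphM -mulrA -mulrBr nmM nmR ger0_norm//; apply: le_trans hk.
by rewrite ler_piMl ?nm_ge0.
Qed.

Variables (n : nat) (rho mu : R) (e : R[i]).
Hypothesis n0 : (0 < n)%N.
Hypothesis mu0 : 0 < mu.
Hypothesis murho : mu <= rho.
Hypothesis rho_free : forall w, nm (w - orb n a) < rho -> ~ esc a w.
Hypothesis mu_far : forall j, (j <= n)%N -> mu <= nm (e - orb j a).
Hypothesis e_near : nm (e - orb n a) < rho + mu / 100.
Hypothesis bad : forall k p, pcont 0 1 p -> p 0 = a -> p 1 = orb k.+1 a ->
  ~ (forall t, 0 <= t <= 1 -> ~ esc a (p t)).

Let v := e - orb n a.
Notation D := (stad v (mu / 3)).

(** If (1 - t)|v| >= 2 mu / 3 then t |v| < rho + mu / 100 - 2 mu / 3, and the radius mu / 3 still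
    leaves |h| < rho. *)
Lemma stad_cases h : D h -> nm (orb n a + h - e) < mu \/ nm h < rho.
Proof.
move=> [t /andP[t0 t1] hk]; have := mu0; have := murho; have := e_near; rewrite -/v => en mr m0.
have [c|c] := ltP (nm ((1 - t)%:C * v)) (2 * mu / 3).
  left; have -> : orb n a + h - e = (h - t%:C * v) - (1 - t)%:C * v by rewrite rmorphB rmorph1 /v; ring.
  by have := nmBs (h - t%:C * v) ((1 - t)%:C * v); lra.
right; rewrite nmM nmR ger0_norm in c; last by lra.
have := nm_subl h (t%:C * v); rewrite nmM nmR ger0_norm//; lra.
Qed.

(* If some pullback hits a at h, either an iterate of a is too close to e, or the
   segment from 0 to h pulls back to a path from a to an iterate of a. *)
Lemma branch j : (j <= n)%N -> exists g, [/\ ccont D g, g 0 = orb (n - j) a,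
  forall h, D h -> orb j (g h) = orb n a + h & forall h, inner D h -> cjet g h].
Proof.
have k0 : 0 <= mu / 3 by have := mu0; lra.
elim: j => [|j IH] jn.
  exists (fun h => h + orb n a); split.
  - by move=> p _ d d0; exists d => // q _ qp; rewrite opprD addrACA subrr addr0.
  - by rewrite add0r subn0.
  - by move=> h _; rewrite orb0 addrC.
  - by move=> h _; exact: (@cjet_affine R id).
have [g [gc g0 gE gj]] := IH (ltnW jn).
have njS : (n - j = (n - j.+1).+1)%N by rewrite subnSK.
have ga h : D h -> g h - a != 0.
  move=> hD; rewrite subr_eq0; apply/eqP => gh.
  have aj : orb j a = orb n a + h by rewrite -gE// gh.
  have [near|near] := stad_cases hD.
    by have := mu_far (ltnW jn); rewrite nmB aj; lra.
  apply: (@bad (n - j.+1)%N (fun t => g ((1 - t)%:C * h))).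
  - move=> t it d d0; have sub (r : R) : 0 <= r <= 1 -> 0 <= 1 - r <= 1 by move=> /andP[? ?]; apply/andP; split; lra.
    have [d1 d10 H] := gc _ (stad_star hD (sub _ it)) d d0.
    have h1 : 0 < nm h + 1 by have := nm_ge0 h; lra.
    exists (d1 / (nm h + 1)); first by rewrite divr_gt0.
    move=> t' it' tt; apply: H; first exact: stad_star hD (sub _ it').
    rewrite -mulrBl -rmorphB nmM nmR (_ : 1 - t' - (1 - t) = t - t'); last by ring.
    rewrite distrC; move: tt; rewrite ltr_pdivlMr// => tt; apply: le_lt_trans tt.
    by rewrite ler_wpM2l//; lra.
  - by rewrite subr0 mul1r.
  - by rewrite subrr mul0r g0 njS.
  - move=> t /andP[t0 t1] et; have it : 0 <= 1 - t <= 1 by apply/andP; split; lra.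
    have E : orb j (g ((1 - t)%:C * h)) - orb n a = (1 - t)%:C * h.
      by rewrite gE ?[_ + _ - _]addrAC ?subrr ?add0r//; exact: stad_star hD it.
    apply: (@rho_free (orb j (g ((1 - t)%:C * h)))); last by apply/esc_orb.
    rewrite E nmM nmR ger0_norm; last by lra.
    by apply: le_lt_trans near; rewrite ler_piMl ?nm_ge0//; lra.
have D0 : D 0 := stad0 v k0.
have [L Lc LE] : exists2 L, ccont D L & forall h, D h -> cexp (L h) = g h - a.
  apply: (@starlog R D (nm v + mu / 3)) => //.
  - by move=> h; exact: stad_bound.
  - exact: stad_closed.
  - by move=> h s; exact: stad_star.
  - move=> p Dp d d0; have [d1 d10 H] := gc p Dp d d0; exists d1 => // q Dq qp.
    by rewrite opprD addrACA opprK [- a + a]addrC subrr addr0; exact: H.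
exists (fun h => L h + (orb (n - j.+1) a - L 0)).
have c1 : cexp (orb (n - j.+1) a - L 0) = 1.
  by rewrite cexpB LE// g0 njS orbS expmapB divff// cexp_neq0.
have LE' h : D h -> cexp (L h + (orb (n - j.+1) a - L 0)) = g h - a.
  by move=> hD; rewrite cexpD c1 mulr1 LE.
have Lc' : ccont D (fun h => L h + (orb (n - j.+1) a - L 0)).
  move=> p Dp d d0; have [d1 d10 H] := Lc p Dp d d0; exists d1 => // q Dq qp.
  by rewrite opprD addrACA subrr addr0; exact: H.
split.
- exact: Lc'.
- by rewrite subrKC.
- by move=> h hD; rewrite orbSr expmapE LE'// subrK gE.
- move=> h hi; have [d d0 dD] := hi; have hD : D h by apply: dD; rewrite subrr nm0.
  apply: (cjet_lift (gj h hi) (c := a)).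
  + by rewrite -subr_eq0; exact: ga.
  + move=> d' d'0; have [d1 d10 H] := Lc' h hD d' d'0.
    exists (Num.min d d1); first by rewrite lt_min d0.
    by move=> x; rewrite lt_min => /andP[/dD xD xd]; exact: H.
  + by exists d => // x /dD; exact: LE'.
Qed.

Variables (r : R) (m : nat).
Hypothesis r0 : 0 < r.
Hypothesis r_free : forall w, nm (w - a) < r -> ~ esc a w.
Hypothesis e_esc : esc a e.
Hypothesis m_big : nm v * (6 * 4400) <= mu * m.+1%:R.

Lemma scale_div (x y k M : R) : 0 < k -> x * (6 * k) <= y * M -> x <= y / 6 / k * M.
Proof.
move=> k0 h; rewrite -(ler_pM2r (mulr_gt0 (ltr0n R 6) k0)); apply: le_trans h _.
by rewrite le_eqVlt; apply/orP; left; apply/eqP; field; rewrite gt_eqF.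
Qed.

(** Go from 0 to v in m + 1 steps short enough for [koebe]. The preimage y of e is then at bounded
    distance from a, and the branch covers a disc of fixed radius around it, which orb n maps into
    the bounded stadium. *)
Lemma wide_branch : exists y, [/\ esc a y, nm (y - a) <= 16 * m.+1%:R &
  forall w w', nm (w - y) < r / 3 ^+ m.+1 -> nm (w' - y) < r / 3 ^+ m.+1 ->
    nm (orb n w - orb n w') <= 2 * (nm v + mu)].
Proof.
have [g [gc g0 gE gj]] := branch (leqnn n); have m0 := mu0; have r_0 := r0.
rewrite subnn orb0 in g0.
pose F w := orb n w - orb n a.
have gK h : D h -> F (g h) = h by move=> hD; rewrite /F gE// addrC addKr.
have cF w : cts_at F w.
  move=> d d0; have [d1 d10 H] := orb_cts a n w d0; exists d1 => // x /H.
  by rewrite /F opprD addrACA opprK [- orb n a + _]addrC subrr addr0.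
pose s := mu / 6; have s0 : 0 < s by rewrite /s; lra.
have ball t h : 0 <= t <= 1 -> nm (h - t%:C * v) <= s -> inner D h.
  move=> it hs; exists s => // h' hh; exists t => //.
  by have := nm_triB h' h (t%:C * v); rewrite /s in hs hh *; lra.
have inD h : inner D h -> D h by move=> [d d0]; apply; rewrite subrr nm0.
have cpt t : 0 <= t <= 1 -> D (t%:C * v).
  by move=> it; apply/inD/(ball t) => //; rewrite subrr nm0 ltW.
have op t : 0 <= t <= 1 -> exists2 d : R, 0 < d & forall y, nm (y - g (t%:C * v)) < d ->
    exists2 x, nm (x - t%:C * v) <= s / 2 & g x = y.
  move=> it; have s2 : 0 < s / 2 by lra.
  have [d1 d10 inj] := orb_inj_near n (g (t%:C * v)).
  have [d2 d20 H2] := gc _ (cpt t it) d1 d10.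
  have sd : 0 < Num.min (s / 2) d2 by rewrite lt_min s2.
  have [d3 d30 H3] := cF (g (t%:C * v)) _ sd.
  exists (Num.min d1 d3); first by rewrite lt_min d10.
  move=> y; rewrite lt_min => /andP[y1 /H3].
  rewrite (gK _ (cpt t it)) lt_min => /andP[y2 y3].
  have yD : D (F y) by apply: inD; apply: (ball t) => //; rewrite /s in y2 *; lra.
  exists (F y); first exact: ltW.
  by apply: inj => //; [exact: H2|rewrite gE// /F subrKC].
have two t t' w : 0 <= t <= 1 -> 0 <= t' <= 1 -> `|t' - t| * m.+1%:R <= 1 ->
    (forall h, D h -> g h != w) -> nm (g (t'%:C * v) - g (t%:C * v)) <= 2 * nm (w - g (t%:C * v)).
  move=> it it' tt om.
  apply: (@koebe R g F (t%:C * v) s s0 _ _ cF) => //.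
  - by move=> x xs; apply: gj; exact: (ball t).
  - by move=> x xs; apply/gK/inD; exact: (ball t).
  - exact: op.
  - by move=> x xs; apply/om/inD; exact: (ball t).
  - rewrite -mulrBl -rmorphB nmM nmR; have mp : 0 < m.+1%:R :> R by rewrite ltr0n.
    rewrite -(ler_pM2r mp); apply: le_trans (_ : nm v <= _).
      by rewrite mulrAC ler_piMl// nm_ge0.
    exact: (scale_div (ltr0n R 4400)).
have mp : 0 < m.+1%:R :> R by rewrite ltr0n.
pose z (i : nat) := g ((i%:R / m.+1%:R)%:C * v).
have it (i : nat) : (i <= m.+1)%N -> 0 <= (i%:R / m.+1%:R : R) <= 1.
  by move=> im; rewrite divr_ge0//= ler_pdivrMr// mul1r ler_nat.
have step i w : (i <= m)%N -> (forall h, D h -> g h != w) -> nm (z i - z i.+1) <= 2 * nm (w - z i.+1).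
  move=> im om; apply: two => //; [exact: it|exact/it/leqW|].
  have -> : i%:R / m.+1%:R - i.+1%:R / m.+1%:R = - m.+1%:R^-1 :> R by rewrite -[i.+1]addn1 natrD; ring.
  by rewrite normrN gtr0_norm ?invr_gt0// mulVf// gt_eqF.
have zm : z m.+1 = g v by rewrite /z divff ?gt_eqF// mul1r.
have z0 : z 0%N = a by rewrite /z mul0r mul0r.
have vD : D v by have := cpt 1; rewrite mul1r ler01 lexx; exact.
have oy : orb n (g v) = e by rewrite gE// /v subrKC.
have y_esc : esc a (g v) by apply/(esc_orb a n); rewrite oy.
have rad : r <= nm (g v - a) by rewrite leNgt; apply/negP => /r_free.
exists (g v); split=> //.
- suff S i : (i <= m.+1)%N -> nm (z i - a) <= 16 * i%:R by rewrite -zm; exact: S.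
  elim: i => [|i IH] im; first by rewrite z0 subrr nm0 mulr0.
  (* As n > 0, orb n has period 2 pi i, so the injective branch g omits the translate of its own
     value, at distance at most 8; [koebe] doubles this to 16. *)
  have om h : D h -> g h != z i.+1 + tpi 1.
    move=> hD; apply/eqP => gh.
    have t1 := cpt _ (it _ im).
    have E : orb n (z i.+1 + tpi 1) = orb n (z i.+1).
      by have := n0; case: (n) => // k _; rewrite !orbSr (expmap_tpi a _ 1).
    have hE : h = (i.+1%:R / m.+1%:R)%:C * v by rewrite -(gK _ hD) gh /F E -/(F _) (gK _ t1).
    move: gh; rewrite hE -/(z i.+1) -[X in X = _ -> _]addr0 => /addrI/esym/(congr1 (@complex.Im R)).
    by rewrite /tpi /= mulr1 mulr2n; have := pi_gt0 R; lra.
  have st := step i _ im om; rewrite [z i.+1 + _]addrC addrK in st.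
  have t8 : nm (tpi 1 : R[i]) <= 8.
    by apply: le_trans (nm_ReIm _) _; rewrite /tpi /= normr0 add0r mulr1 mulr2n ger0_norm; have := pi_le4 R; have := pi_ge0 R; lra.
  have nE : i.+1%:R = i%:R + 1 :> R by rewrite -[i.+1]addn1 natrD.
  have := IH (ltnW im); have := nm_triB (z i.+1) (z i) a; rewrite (nmB (z i.+1) (z i)) nE; lra.
(* If w were omitted, its distance to z i would at most triple at each step back from v to 0, and g
   v would be within r of a although it escapes. *)
have cov w : nm (w - g v) < r / 3 ^+ m.+1 -> exists2 h, D h & g h = w.
  move=> wy; apply: contrapT => no; have om h : D h -> g h != w.
    by move=> hD; apply/eqP => gh; apply: no; exists h.
  have S i : (i <= m.+1)%N -> nm (w - z (m.+1 - i)%N) <= 3 ^+ i * nm (w - g v) /\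
      nm (z (m.+1 - i)%N - g v) <= (3 ^+ i - 1) * nm (w - g v).
    elim: i => [|i IH] im; first by rewrite subn0 zm expr0 mul1r subrr nm0 subrr mul0r.
    have [h1 h2] := IH (ltnW im); have E : (m.+1 - i = (m.+1 - i.+1).+1)%N by rewrite subnSK.
    have im' : (m.+1 - i.+1 <= m)%N by rewrite subSS leq_subr.
    rewrite E in h1 h2; have st := step _ w im' om.
    move: (m.+1 - i.+1)%N h1 h2 st => j h1 h2 st.
    have t1 := nm_triB w (z j.+1) (z j); rewrite (nmB (z j.+1)) in t1.
    have t2 := nm_triB (z j) (z j.+1) (g v).
    by rewrite exprS; move: (3 ^+ i) h1 h2 => p h1 h2; split; lra.
  have [_] := S m.+1 (leqnn _); rewrite subnn z0 nmB => h.
  have p0 : 0 < 3 ^+ m.+1 :> R by rewrite exprn_gt0.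
  move: wy; rewrite ltr_pdivlMr// => wy; have := nm_ge0 (w - g v).
  by move: (nm (w - g v)) (3 ^+ m.+1) p0 h wy => k p p0 h wy k0; lra.
move=> w w' /cov[h hD <-] /cov[h' hD' <-]; rewrite !gE// opprD addrACA subrr add0r.
have := nmBs h h'; have := stad_bound hD; have := stad_bound hD'; lra.
Qed.

End InverseBranch.

(** * A path from a to one of its iterates must exist *)

Section NoWanderingValue.
Variables (R : realType) (a : R[i]) (r : R) (x0 : R[i]).
Implicit Types (z w x y h v e : R[i]).
Notation f := (expmap a).
Notation orb := (orb a).
Notation T := (T0 a).
Let hT : 100 * 20 + nm a <= T. Proof. exact: T0_ge. Qed.
Let hT10 : 100 * 20 + nm a <= T + 10. Proof. by have := hT; lra. Qed.
Hypothesis r0 : 0 < r.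
Hypothesis r_free : forall w, nm (w - a) < r -> ~ esc a w.
Hypothesis x0_esc : esc a x0.
Hypothesis bad : forall k p, pcont 0 1 p -> p 0 = a -> p 1 = orb k.+1 a ->
  ~ (forall t, 0 <= t <= 1 -> ~ esc a (p t)).

Lemma orb_free n : exists2 d : R, 0 < d & forall w, nm (w - orb n a) < d -> ~ esc a w.
Proof.
have [d d0 H] := orb_open a n a r0; exists d => // w /H[w' h <-] /(esc_orb a n); exact: r_free.
Qed.

Lemma esc_dist n : exists rho : R, [/\ 0 < rho, forall x, esc a x -> rho <= nm (x - orb n a) &
  forall e : R, 0 < e -> exists2 x, esc a x & nm (x - orb n a) < rho + e].
Proof.
have [d d0 H] := orb_free n.
pose S := [set t : R | exists2 x, esc a x & t = nm (x - orb n a)].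
have S0 : S !=set0 by exists (nm (x0 - orb n a)); exists x0.
have Sd t : S t -> d <= t by move=> [x ex ->]; rewrite leNgt; apply/negP => /H.
have [rho [h1 h2 h3]] := inf_approach S0 d0 Sd; exists rho; split=> //.
- by move=> x ex; apply: h2; exists x.
- by move=> e /h3[_ [x ex ->] lt]; exists x.
Qed.

(** One hair reaches all large abscissas, and its translates by 2 pi i consist of escaping points as
    well. *)
Lemma esc_net (B : R) : exists Q : R, forall w, B <= Rez w -> exists2 x, esc a x & nm (x - w) <= Q.
Proof.
have [N /(_ N (leqnn N)) xJ] := esc_inJ T x0_esc; set x := orb N x0 in xJ.
have ex : esc a x by apply/esc_orb.
have v0 : valid a T x 0 by exact (valid0 hT xJ).
exists (`|Rez x| + `|B| + 8) => w Bw.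
have [h h0 [hx hR]] : exists2 h : R, 0 <= h & esc a (hair a x 0 h) /\
    `|Rez (hair a x 0 h) - Rez w| <= `|Rez x| + `|B|.
  have hx0 : hair a x 0 0 = x by rewrite (hair0 hT).
  have [c|c] := ltP (Rez x) (Rez w).
    have [h h0 [hR _]] := hair_first_hit hT xJ (k := 0%N) (c : Rez (orb 0 x) < Rez w).
    exists h => //; split; last by rewrite hR subrr normr0 addr_ge0.
    move: h0; rewrite le_eqVlt => /orP[/eqP <-|h0]; first by rewrite hx0.
    exact: (hair_esc hT xJ v0 h0).
  exists 0 => //; rewrite hx0; split=> //; rewrite ger0_norm ?subr_ge0//.
  by have := ler_norm (Rez x); have := ler_norm (- B); rewrite normrN; lra.
set y := hair a x 0 h in hx hR.
pose k := Num.floor ((Imz w - Imz y) / (pi *+ 2)).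
exists (y + tpi k%:~R).
  by apply/(esc_orb a 1); rewrite orbS orb0 (expmap_tpi a); have /(esc_orb a 1) := hx; rewrite orbS orb0.
have p2 := pi2_gt0 R; have := floor_le ((Imz w - Imz y) / (pi *+ 2)); have := lt_succ_floor ((Imz w - Imz y) / (pi *+ 2)).
rewrite -/k; rewrite ltr_pdivrMr// ler_pdivlMr// => k2 k1.
apply: le_trans (nm_ReIm _) _; rewrite !Cri /tpi /= addr0; apply: lerD => //.
have pi4 := pi_le4 R; rewrite intrD mulrDl mul1r in k2; rewrite [pi *+ 2 * _]mulrC ler_norml.
by move: (_ * _) k1 k2 => q; rewrite mulr2n => k1 k2; apply/andP; split; lra.
Qed.

(** Otherwise orb n.+1 a is within r of a, and the straight segment between them is a path without
    escaping points. *)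
Lemma Re_orb_ge n : ln r <= Rez (orb n a).
Proof.
rewrite -ler_expR lnK ?posrE// -nm_cexp -(expmapB a) -orbS leNgt; apply/negP => near.
apply: (@bad n (fun t => a + t%:C * (orb n.+1 a - a))).
- move=> t it d d0; have p0 : 0 < nm (orb n.+1 a - a) + 1 by have := nm_ge0 (orb n.+1 a - a); lra.
  exists (d / (nm (orb n.+1 a - a) + 1)); first by rewrite divr_gt0.
  move=> t' it'; rewrite ltr_pdivlMr// => tt; rewrite opprD addrACA subrr add0r -mulrBl -rmorphB nmM nmR.
  by apply: le_lt_trans tt; rewrite ler_wpM2l//; lra.
- by rewrite mul0r addr0.
- by rewrite mul1r subrKC.
- move=> t /andP[t0 t1]; apply: r_free; rewrite addrC addKr nmM nmR ger0_norm//.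
  by apply: le_lt_trans near; rewrite ler_piMl ?nm_ge0.
Qed.

(** If rho is bounded below by m, every time qualifies with K = Q / m or 1; otherwise take K = 1 and
    the first time at which rho falls below all its values up to N. *)
Lemma record_times (rho : nat -> R) (Q : R) : (forall n, 0 < rho n) -> (forall n, rho n <= Q) ->
  exists2 K : R, 1 <= K & forall N, exists2 n, (N < n)%N & forall j, (j <= n)%N -> rho n <= K * rho j.
Proof.
move=> rp rQ; have [[m m0 hm]|no] := pselect (exists2 m : R, 0 < m & forall n, m <= rho n).
  exists (Num.max 1 (Q / m)); first by rewrite le_max lexx.
  move=> N; exists N.+1 => // j _; apply: le_trans (rQ _) _.
  have QE : Q = Q / m * m by rewrite divfK ?lt0r_neq0.
  rewrite {1}QE; have h : Q / m <= Num.max 1 (Q / m) by rewrite le_max lexx orbT.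
  apply: le_trans (ler_wpM2r (ltW m0) h) _; apply: ler_wpM2l => //.
  by apply: le_trans ler01 _; rewrite le_max lexx.
exists 1 => // N.
have [m0 mp Hm] : exists2 m0 : R, 0 < m0 & forall j, (j <= N)%N -> m0 <= rho j.
  elim: N => [|N [m0 mp Hm]]; first by exists (rho 0%N) => // j; rewrite leqn0 => /eqP ->.
  exists (Num.min m0 (rho N.+1)); first by rewrite lt_min mp rp.
  move=> j; rewrite leq_eqVlt => /orP[/eqP ->|jN]; rewrite ge_min ?lexx ?orbT// Hm//.
have ex : exists n, `[< rho n < m0 >].
  apply: contrapT => no'; apply: no; exists m0 => // n; rewrite leNgt; apply/negP => lt.
  by apply: no'; exists n; apply/asboolP.
have [n /asboolP rn nmin] := ex_minnP ex; exists n.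
  by rewrite ltnNge; apply/negP => /Hm; lra.
move=> j jn; rewrite mul1r; have [lt|ge] := ltP (rho j) m0; last by lra.
have := nmin j (introT (asboolP _) lt) => nj.
by have -> : j = n by apply/eqP; rewrite eqn_leq jn nj.
Qed.

Lemma scale_bound (x mu K M m : R) : x <= 2 * (mu * K) -> 0 <= M -> 0 < mu -> 2 * K * M <= m -> x * M <= mu * m.
Proof.
move=> h1 M0 mu0 h2; apply: le_trans (ler_wpM2r M0 h1) _.
have -> : 2 * (mu * K) * M = mu * (2 * K * M) by ring.
by rewrite ler_pM2l.
Qed.

Lemma diam_bound (x mu rho Q : R) : x < rho + mu / 100 -> mu <= rho -> rho <= Q -> 0 < mu ->
  2 * (x + mu) <= 6 * Q.
Proof. by lra. Qed.

(** At a record time the distance rho n from orb n a to the escaping points is comparable to the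
    smallest one up to n, so the number m of steps in [wide_branch] does not depend on n. *)
Lemma wide_returns : exists c B D : R, 0 < c /\ forall N, exists n y, [/\ (N < n)%N, esc a y, nm (y - a) <= B &
  forall w w', nm (w - y) < c -> nm (w' - y) < c -> nm (orb n w - orb n w') <= D].
Proof.
have /choice[rho Hrho] := esc_dist.
have [Q HQ] := esc_net (ln r).
have rp n : 0 < rho n by have [] := Hrho n.
have rQ n : rho n <= Q.
  by have [x ex xQ] := HQ _ (Re_orb_ge n); have [_ h _] := Hrho n; apply: le_trans (h x ex) xQ.
have [K K1 HK] := record_times rp rQ.
pose m := Num.truncn (2 * K * (6 * 4400)).
exists (r / 3 ^+ m.+1), (16 * m.+1%:R), (6 * Q); split; first by rewrite divr_gt0// exprn_gt0.
move=> N; have [n Nn hn] := HK N; exists n.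
have n0 : (0 < n)%N := leq_trans (ltn0Sn N) Nn.
have K0 : 0 < K by lra.
pose mu := rho n / K; have mu0 : 0 < mu by rewrite divr_gt0.
have muE : mu * K = rho n by rewrite divfK// gt_eqF.
have murho : mu <= rho n by rewrite ler_pdivrMr// ler_peMr// ltW.
have [_ rl ra] := Hrho n.
have [|e ee en] := ra (mu / 100); first by rewrite divr_gt0.
have rho_free w : nm (w - orb n a) < rho n -> ~ esc a w by move=> h /rl; lra.
have mu_far j : (j <= n)%N -> mu <= nm (e - orb j a).
  move=> jn; have [_ h _] := Hrho j; apply: le_trans (h e ee).
  by rewrite ler_pdivrMr// mulrC; exact: hn.
have mb : nm (e - orb n a) * (6 * 4400) <= mu * m.+1%:R.
  have h1 : nm (e - orb n a) <= 2 * (mu * K) by rewrite muE; lra.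
  have h2 : 2 * K * (6 * 4400) <= m.+1%:R :> R by apply: ltW; exact: truncnS_gt.
  exact: scale_bound h1 (mulr_ge0 (ler0n R 6) (ler0n R 4400)) mu0 h2.
have [y [ey yB yD]] := wide_branch n0 mu0 murho rho_free mu_far en bad r0 r_free ee mb.
exists y; split=> // w w' h h'; apply: le_trans (yD w w' h h') _.
exact: diam_bound en murho (rQ n) mu0.
Qed.

(** The points y accumulate at some z. Fix one of them, y, near z, and y' near y with an iterate on
    the hair of an iterate of y: the two real parts separate like 2^k h, although both points lie in
    later discs on which orb n varies by at most D. *)
Theorem bad_false : False.
Proof.
have [c [B [D [c0 H]]]] := wide_returns.
have /choice[ny Hny] : forall N, exists ny : nat * R[i], [/\ (N < ny.1)%N, esc a ny.2, nm (ny.2 - a) <= B &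
  forall w w', nm (w - ny.2) < c -> nm (w' - ny.2) < c -> nm (orb ny.1 w - orb ny.1 w') <= D].
  by move=> N; have [n [y h]] := H N; exists (n, y).
have bd N : nm (ny N).2 <= B + nm a.
  by have [_ _ h _] := Hny N; have := nm_subl (ny N).2 a; lra.
have [z Hz] := cbolzano bd; have c2 : 0 < c / 4 by lra.
have [N0 _ hN0] := Hz _ c2 0%N; set y := (ny N0).2 in hN0.
have ey : esc a y by have [_ h _ _] := Hny N0.
have [N1 /(_ N1 (leqnn N1)) qJ] := esc_inJ (T + 10) ey; set q := orb N1 y in qJ.
have qJT : inJ a T q by apply: inJ_le qJ; lra.
have [d d0 Hd] := orb_open a N1 y c2.
have [h h0 hd] := hair_small qJ d0.
have [y' yy' oy'] := Hd _ hd.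
have v0 : valid a T q 0 by exact (valid0 hT qJT).
have vh : valid a T q h by exact (valid_ge0 hT qJT (ltW h0)).
have [N2 HN2] := pow2_ge (D + 21) h0.
have [N3 N3b hN3] := Hz _ c2 (N1 + N2)%N.
have [N3n _ _ dia] := Hny N3; set n := (ny N3).1 in N3n dia; set yn := (ny N3).2 in dia hN3.
have nE : exists2 k, (N2 <= k)%N & n = (k + N1)%N.
  have le : (N1 + N2 <= n)%N := leq_trans N3b (ltnW N3n).
  exists (n - N1)%N; first by rewrite leq_subRL// (leq_trans (leq_addr _ _) le).
  by rewrite subnK// (leq_trans (leq_addr _ _) le).
have [k kN kE] := nE.
have t1 : nm (y - yn) < c by have := nm_triB y z yn; rewrite (nmB z); lra.
have t2 : nm (y' - yn) < c by have := nm_triB y' y yn; have := nm_triB y z yn; rewrite (nmB z); lra.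
have := dia _ _ t2 t1; rewrite kE !orbD -/q oy' (hair_orb hT) //.
have := Re_hair_gap hT k qJT v0 (ltW h0); rewrite (hair0 hT)// subr0.
have := HN2 k kN; have := Re_le (hair a q k h - orb k q); rewrite ReB; lra.
Qed.

End NoWanderingValue.

Theorem fatou_separates (R : realType) (a : R[i]) : fatou_set a a -> separated a.
Proof.
move=> /fatou_ball[r r0 free].
have [[k [p [pc [p0 [p1 pe]]]]]|no] := pselect (exists k (p : R -> R[i]),
    pcont 0 1 p /\ p 0 = a /\ p 1 = orb a k.+1 a /\ forall t, 0 <= t <= 1 -> ~ esc a (p t)).
  exact: good_separates r0 free pc p0 p1 pe.
move=> z w [ez _]; exfalso; apply: (@bad_false R a r z r0 free ez) => k p pc p0 p1 pe.
by apply: no; exists k, p.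
Qed.

(** * Conclusion *)

Section Explosion.
Variables (R : realType) (a : R[i]).
Implicit Types (z w x y : R[i]).

Lemma set_type_open (A : set R[i]) (U : R[i] -> Prop) :
  (forall x, A x -> U x -> exists2 d : R, 0 < d & forall y, A y -> nm (y - x) < d -> U y) ->
  open [set p : set_type A | U (set_val p)].
Proof.
move=> H; rewrite openE => p /= Up; have Ap : A (set_val p) := set_valP p.
have [d d0 Hd] := H _ Ap Up.
have nb : nbhs (set_val p) [set y : R[i] | nm (y - set_val p) < d] by apply/nbhs_nmP; exists d.
have c : {for p, continuous (set_val : set_type A -> R[i])} by exact: initial_continuous.
have := c _ nb; rewrite nbhs_simpl /=; apply: filterS => q /= hq; apply: Hd => //; exact: set_valP.
Qed.

Lemma separated_totally : separated a -> totally_separated (set_type [set z | escend a z]).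
Proof.
move=> sep p q pq.
have vpq : set_val p <> set_val q by move=> e; apply: pq; exact: val_inj.
have [U [Up Uq loc]] := sep _ _ (set_valP p) (set_valP q) vpq.
exists [set p : set_type [set z | escend a z] | U (set_val p)]; split=> //; split.
  apply: set_type_open => x Ax Ux; have [d d0 H] := loc x Ax; exists d => // y Ay h.
  by apply/(H y Ay h).
rewrite -openC; apply: (@set_type_open _ (fun x => ~ U x)) => x Ax Ux.
have [d d0 H] := loc x Ax; exists d => // y Ay h Uy; apply: Ux.
by apply/(H y Ay h).
Qed.

(** Of a relatively clopen set and its complement, the one without infinity lies in a compact part
    of the plane, so it is a [bclopen] set and hence empty. *)
Lemma connected_at_infinity : connected ((@to_sphere R @` [set z | escend a z]) `|` [set infinity]).
Proof.
set S := _ `|` _.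
have nbhsE (z : R[i]) (V : set (riemann_sphere R)) : open V -> V (to_sphere z) ->
    exists2 d : R, 0 < d & forall w, nm (w - z) < d -> V (to_sphere w).
  move=> oV Vz; have := open_nbhs_nbhs (conj oV Vz).
  by move=> /nbhs_nmP.
have key (B C1 C2 : set (riemann_sphere R)) : open C1 -> closed C2 -> B = S `&` C1 -> B = S `&` C2 ->
    ~ B infinity -> forall p, ~ B p.
  move=> o1 c2 E1 E2 Bi.
  have S_some z : S (to_sphere z) <-> escend a z.
    by split=> [[[w ew [<-]]|]|ez] //; left; exists z.
  have B1 z : escend a z -> (B (to_sphere z) <-> C1 (to_sphere z)).
    by move=> ez; rewrite E1; split=> [[]|h] //; split => //; apply/S_some.
  have B2 z : escend a z -> (B (to_sphere z) <-> C2 (to_sphere z)).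
    by move=> ez; rewrite E2; split=> [[]|h] //; split => //; apply/S_some.
  have o2 : open (~` C2) by rewrite openC.
  have n2 : (~` C2) infinity by move=> h; apply: Bi; rewrite E2; split=> //; right.
  have [K [cK _] KU] : nbhs (infinity : riemann_sphere R) (~` C2) := open_nbhs_nbhs (conj o2 n2).
  have [r Kr] := compact_nm_bounded cK.
  have bc : bclopen a (fun z => escend a z /\ B (to_sphere z)).
    split.
    - by move=> z [].
    - exists r => z [ez Bz]; apply: Kr; apply: contrapT => nK.
      by have := KU (to_sphere z) (or_introl (ex_intro2 _ _ z nK erefl)); apply; apply/B2.
    - move=> z [ez /B1-/(_ ez)/(nbhsE _ _ o1)[d d0 H]]; exists d => // w ew /H.
      by move=> /B1-/(_ ew).
    - move=> z ez H; split=> //; apply/B2 => //; apply: contrapT => nz.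
      have [d d0 Hd] := nbhsE _ _ o2 nz; have [w [ew Bw] wd] := H d d0.
      by apply: (Hd w wd); apply/B2.
  move=> [z|] // Bz; have Sz : S (to_sphere z) by move: Bz; rewrite E1 => -[].
  by apply: (no_bounded_clopen bc (z := z)); split=> //; apply/S_some.
move=> B [b Bb] [C1 o1 E1] [C2 c2 E2].
have [Bi|Bi] := pselect (B infinity); last by exfalso; exact: key o1 c2 E1 E2 Bi b Bb.
apply/seteqP; split; first by rewrite E1 => x [].
move=> x Sx; apply: contrapT => Bx.
apply: (key (S `\` B) (~` C2) (~` C1) _ _ _ _ _ x) => //.
- by rewrite openC.
- by rewrite closedC.
- rewrite E2; apply/seteqP; split=> y [Sy h]; split=> //; first by move=> h2; apply: h.
  by move=> [_]; exact: h.
- rewrite E1; apply/seteqP; split=> y [Sy h]; split=> //; first by move=> h2; apply: h.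
  by move=> [_]; exact: h.
- by move=> [].
Qed.

End Explosion.

Theorem theorem1p3 (R : realType) (a : R[i])
  (ha : fatou_set a a \/ on_hair a a \/ endpoints a a) :
  infinity_explosion_point (escaping_endpoints a).
Proof.
rewrite escaping_endpointsE; split; first exact: connected_at_infinity.
apply: separated_totally; case: ha => [|[|]].
- exact: fatou_separates.
- exact: on_hair_separates.
- exact: endpoint_separates.
Qed.
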